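(* Let $A\in(1,2]$, let $R_0:=A-\sqrt{A^2-1}$, and let $R_2$ be the least value of $r\in(0,R_0)$ satisfying $\xi(r)=0$, where $$\xi(r):=\sin^{-1}\left(\frac{r}{R_0}\right)+2A\sin^{-1}(r)-\frac{\pi}{2}.$$ Then the radius of convexity of the class $Co(A)\ast\mathcal{S}t(1/2)=\{f\ast\phi : f\in Co(A),\ \phi\in\mathcal{S}t(1/2)\}$ is at least $R_2$.
   Context: Let $\mathbb{D}=\{z\in\mathbb{C}:|z|<1\}$ and $\mathbb{D}_r=\{z\in\mathbb{C}:|z|<r\}$. $\mathcal{A}$ is the class of analytic functions $f$ in $\mathbb{D}$ with $f(0)=0=f'(0)-1$, and $\mathcal{S}$ is the class of univalent (injective) functions in $\mathcal{A}$. $\mathcal{S}t(1/2)=\{f\in\mathcal{A}: \mathrm{Re}\,(zf'(z)/f(z))>1/2,\ z\in\mathbb{D}\}$ (starlike functions of order $1/2$; the quotient takes the value $1$ at $z=0$). For $A\in(1,2]$, $Co(A)$ (concave univalent functions with opening angle $\pi A$ at infinity) is the class of functions $f$ such that: (i) $f\in\mathcal{S}$ with $f(1)=\infty$; (ii) $\mathbb{C}\setminus f(\mathbb{D})$ is convex; (iii) the opening angle of $f(\mathbb{D})$ at $\infty$ is less than or equal to $\pi A$. By a known characterization (Avkhadiev–Wirths), an analytic $f$ in $\mathbb{D}$ with $f(0)=0=f'(0)-1$ belongs to $Co(A)$ if and only if $\mathrm{Re}\,T_f(z)>0$ for all $z\in\mathbb{D}$, where $$T_f(z)=\frac{2}{A-1}\left[\frac{A+1}{2}\left(\frac{1+z}{1-z}\right)-1-z\frac{f''(z)}{f'(z)}\right].$$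 The convolution (Hadamard product) of $f(z)=\sum_{n\ge0}a_nz^n$ and $g(z)=\sum_{n\ge0}b_nz^n$ is $(f\ast g)(z)=\sum_{n\ge0}a_nb_nz^n$. The radius of convexity of a subclass $\mathcal{A}_1\subseteq\mathcal{A}$ is the largest $r\in(0,1]$ such that every $f\in\mathcal{A}_1$ is convex in $\mathbb{D}_r$, i.e. $f$ maps $\mathbb{D}_r$ conformally onto a convex domain; equivalently, $\mathrm{Re}\,(1+zf''(z)/f'(z))>0$ for all $z\in\mathbb{D}_r$ (with $f'\neq0$ there). *)

(* Defs.v *)
(* Vanilla Stdlib reals with Coquelicot's complex numbers.

   Functions on the unit disk are total functions C -> C; every notion below
   depends only on their values on the disk in question. *)
From Stdlib Require Import Reals.
From Coquelicot Require Import Coquelicot.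
Open Scope R_scope.

Definition disk (r : R) (z : C) : Prop := Cmod z < r.

Definition image_of (f : C -> C) (D : C -> Prop) (w : C) : Prop :=
  exists z, D z /\ f z = w.

Definition injective_on (D : C -> Prop) (f : C -> C) : Prop :=
  forall z1 z2, D z1 -> D z2 -> f z1 = f z2 -> z1 = z2.

Definition convex_set (E : C -> Prop) : Prop :=
  forall (w1 w2 : C) (t : R), E w1 -> E w2 -> 0 <= t <= 1 ->
    E ((1 - t)%R * w1 + t * w2)%C.

(* Complex differentiability, i.e. analyticity when [D] is open. *)
Definition analytic_on (D : C -> Prop) (f : C -> C) : Prop :=
  forall z, D z -> ex_derive (K := C_AbsRing) (V := C_NormedModule) f z.

Definition class_A (f : C -> C) : Prop :=
  analytic_on (disk 1) f /\ f 0%C = 0%C /\ C_derive f 0%C = 1%C.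

Definition class_S (f : C -> C) : Prop :=
  class_A f /\ injective_on (disk 1) f.

(* A zero of [f] at some [z <> 0] is a pole of z f'(z) / f(z), so it is ruled
   out explicitly instead of relying on the value of a division by zero.
   At [z = 0] the quotient is 1 and there is nothing to require. *)
Definition starlike_half (f : C -> C) : Prop :=
  class_A f /\
  forall z, disk 1 z -> z <> 0%C ->
    f z <> 0%C /\ 1 / 2 < Re (z * C_derive f z / f z)%C.

(* The ray of argument [theta] eventually stays in [Omega]. *)
Definition reaches_infinity (Omega : C -> Prop) (theta : R) : Prop :=
  exists T : R, forall t : R, T <= t -> Omega (t * (cos theta, sin theta))%C.

(* Length of the largest open arc of directions (at most a full turn) along
   which [Omega] extends to infinity.  When the complement of [Omega] is convex
   these directions form, up to endpoints, a single arc, and starting the rays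
   from another point than 0 changes at most its endpoints.  Thus a half-plane
   has opening angle PI and the plane slit along a ray has 2 * PI. *)
Definition opening_angle_at_infinity (Omega : C -> Prop) : Rbar :=
  Lub_Rbar (fun l : R =>
    0 <= l <= 2 * PI /\
    exists theta0 : R, forall theta : R,
      theta0 < theta < theta0 + l -> reaches_infinity Omega theta).

(* f(1) = infinity: f(z) tends to infinity as z tends to 1 within the disk. *)
Definition infinite_at_one (f : C -> C) : Prop :=
  filterlim (fun z : C => Cmod (f z))
    (within (disk 1) (locally (RtoC 1))) (Rbar_locally p_infty).

Definition concave_class (A : R) (f : C -> C) : Prop :=
  class_S f /\
  infinite_at_one f /\
  convex_set (fun w => ~ image_of f (disk 1) w) /\
  Rbar_le (opening_angle_at_infinity (image_of f (disk 1))) (PI * A).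

Definition power_series_on_disk (a : nat -> C) (f : C -> C) : Prop :=
  forall z, disk 1 z -> is_pseries (K := C_AbsRing) (V := C_NormedModule) a z (f z).

(* [h] is f * g on the unit disk. *)
Definition is_convolution (f g h : C -> C) : Prop :=
  exists a b : nat -> C,
    power_series_on_disk a f /\
    power_series_on_disk b g /\
    power_series_on_disk (fun n => a n * b n)%C h.

Definition convolution_class (F G : (C -> C) -> Prop) (h : C -> C) : Prop :=
  exists f g, F f /\ G g /\ is_convolution f g h.

(* [f] maps the disk of radius [r] conformally onto a convex domain; the image
   is automatically open, by the open mapping theorem. *)
Definition convex_in_disk (r : R) (f : C -> C) : Prop :=
  analytic_on (disk r) f /\
  injective_on (disk r) f /\
  convex_set (image_of f (disk r)).

Definition convexity_holds_at (F : (C -> C) -> Prop) (r : R) : Prop :=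
  0 < r <= 1 /\ forall f, F f -> convex_in_disk r f.

Definition is_radius_of_convexity (F : (C -> C) -> Prop) (rho : R) : Prop :=
  convexity_holds_at F rho /\
  forall r, convexity_holds_at F r -> r <= rho.

Definition rad0 (A : R) : R := A - sqrt (A ^ 2 - 1).

Definition xi (A r : R) : R := asin (r / rad0 A) + 2 * A * asin r - PI / 2.

(* Main.v *)
Require Import Defs.
From Stdlib Require Import Reals Lra Lia Psatz Arith Classical ClassicalEpsilon.
From Coquelicot Require Import Coquelicot.
Open Scope R_scope.

(** Let [f] be concave with opening angle at most [PI A], let [phi] be starlike of order one half, and let
    [h] be their convolution.  The proof shows that [1 + z h'' / h'] has positive real part for
    [|z| < R2], which makes [h] convex there, and has three ingredients.

    A differential inequality for [f].  The complement of the image of [f] is a closed, unbounded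
    convex set.  A direction that is not one of its recession directions reaches infinity inside
    the image, so the bound on the opening angle provides two recession directions [v1], [v2] at
    angle [(2 - A) PI] ([recession_sector]).  The image absorbs translations by [- v1] and [- v2];
    these lift through [f] to a commuting family of self-maps of the disc.  Julia's lemma gives
    them a common boundary fixed point [tau], and letting the length of the translations tend to
    zero shows that [- conj tau v / (f' (1 - conj tau z)^2)] has nonnegative real part for both
    directions [v] ([boundary_fixed_point]).  Hence a logarithm of [f' (1 - conj tau z)^2] maps the
    disc into a strip of width [(A - 1) PI], and the Schwarz-Pick inequality yields
    [|(1 - |z|^2) f'' / f' - 2 conj z| <= 2 A] ([concave_pre_schwarzian]).  Consequently
    [1 + z f'' / f'] lies in an explicit disc and the argument of [f'] is at most
    [2 A artanh |z|].

    A convolution theorem.  If [p] and [q] are zero-free with [Re (z p' / p) > - 1/2] and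
    [Re (z q' / q) > - 1/2] on a disc larger than the unit disc, and [F] has positive real part on
    the unit circle, then for [0 < rho < 1] the convolution of [p] and [q F (rho z)], taken
    at [1], does not vanish ([convolve_nonzero]): divided by the convolution of [p] and [q], it is an average of the values of [F] on the circle.
    The nonnegativity of the averaging weight comes from [two_point]: on the circle
    the argument of [p (e^{it}) e^{it/2}] increases, by [PI] in one turn.

    Their combination.  Put [p = phi / z] and [q = sqrt f'], so that [f' = q q] and
    [z q' / q = z f'' / (2 f')].  The convolution of [p] and [q q] is [h'], and for real [tau] that
    of [p] and [q q (1 + z f'' / f' + i tau)] is [(1 + i tau) h' + z h''].  Up to constant
    factors both weights [q] and [q (1 + z f'' / f' + i tau)] have positive real part as soon as
    [2 A r / (1 + r^2) < cos (A artanh r)], an inequality that the equation defining [R2] implies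
    for [r <= R2] ([radius_inequality]).  So [1 + z h'' / h'] omits the imaginary axis; being [1]
    at the centre, it stays in the right half-plane ([hadamard_curvature]).  That this implies
    convexity is proved from the monotone turning of the tangents to the images of circles
    ([convex_injective], [convex_image]). *)

(** * Limits and continuity of complex-valued maps *)

Lemma C_ext (a b : C) : Re a = Re b -> Im a = Im b -> a = b.
Proof. destruct a, b; simpl; intros; congruence. Qed.

Ltac ceq := apply C_ext; unfold Re, Im, Cminus, Cplus, Copp, Cmult, Cconj, RtoC, Ci; simpl; ring.

Lemma im_le_Cmod (c : C) : Rabs (Im c) <= Cmod c.
Proof.
  rewrite <- (Cmod_opp c), <- (Rabs_Ropp (Im c)).
  replace (- Im c) with (Re (c * Ci)%C) by (destruct c; simpl; ring).
  eapply Rle_trans; [apply re_le_Cmod|].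
  rewrite Cmod_mult, Cmod_Ci, Cmod_opp; lra.
Qed.

Lemma re_le (c : C) : Re c <= Cmod c.
Proof. pose proof (re_le_Cmod c); pose proof (Rle_abs (Re c)); lra. Qed.

Lemma Cmod_le_re_im (c : C) : Cmod c <= Rabs (Re c) + Rabs (Im c).
Proof.
  destruct c as [x y]; simpl.
  replace (x, y) with (RtoC x + RtoC y * Ci)%C by ceq.
  eapply Rle_trans; [apply Cmod_triangle|].
  rewrite Cmod_mult, Cmod_Ci, !Cmod_R; lra.
Qed.

Lemma Cmod_sub_sym (a b : C) : Cmod (a - b) = Cmod (b - a).
Proof. rewrite <- (Cmod_opp (a - b)). f_equal; ring. Qed.

Lemma Cmod_rev_triangle (a b : C) : Cmod a - Cmod b <= Cmod (a - b).
Proof.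
  pose proof (Cmod_triangle (a - b) b).
  replace (a - b + b)%C with a in H by ring; lra.
Qed.

Lemma Cmod_plus_ge (a b : C) : Cmod a - Cmod b <= Cmod (a + b).
Proof.
  pose proof (Cmod_rev_triangle a (- b)). rewrite Cmod_opp in H.
  replace (a - - b)%C with (a + b)%C in H by ring; lra.
Qed.

Lemma Cmod_tri3 (a b c : C) : Cmod (a - c) <= Cmod (a - b) + Cmod (b - c).
Proof. replace (a - c)%C with ((a - b) + (b - c))%C by ring. apply Cmod_triangle. Qed.

Lemma Cmod_0_eq (a b : C) : Cmod (a - b) = 0 -> a = b.
Proof.
  intros H. apply Cmod_eq_0 in H. replace a with (a - b + b)%C by ring.
  rewrite H; ring.
Qed.

Lemma C_eq_of_small (a b : C) : (forall eps, 0 < eps -> Cmod (a - b) < eps) -> a = b.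
Proof.
  intros H. apply Cmod_0_eq.
  destruct (Rle_lt_or_eq_dec 0 (Cmod (a - b)) (Cmod_ge_0 _)) as [K|K]; auto.
  specialize (H _ K); lra.
Qed.

Lemma Cneq_mod (a : C) : 0 < Cmod a -> a <> 0%C.
Proof. intros H. now apply Cmod_gt_0. Qed.

Lemma Cconj_mult_self (a : C) : (a * Cconj a)%C = RtoC (Cmod a ^ 2).
Proof. rewrite Cmod2_alt. ceq. Qed.

Lemma half_pos e : 0 < e -> 0 < e / 2. Proof. lra. Qed.
Lemma quarter_pos e : 0 < e -> 0 < e / 4. Proof. lra. Qed.

(** Neighbourhoods are measured by the modulus so that estimates with [Cmod] apply directly. *)
Definition nearC (z : C) : (C -> Prop) -> Prop :=
  fun P => exists d, 0 < d /\ forall w, Cmod (w - z) < d -> P w.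

#[global] Instance nearC_filter z : Filter (nearC z).
Proof.
  constructor.
  - exists 1; split; [lra|auto].
  - intros P Q [d [Hd HP]] [e [He HQ]].
    exists (Rmin d e); split; [now apply Rmin_glb_lt|].
    intros w Hw; split; [apply HP|apply HQ];
      eapply Rlt_le_trans; eauto; [apply Rmin_l|apply Rmin_r].
  - intros P Q HPQ [d [Hd HP]]; exists d; auto.
Qed.

Definition clim {T} (F : (T -> Prop) -> Prop) (g : T -> C) (l : C) :=
  forall eps, 0 < eps -> F (fun x => Cmod (g x - l) < eps).

Section Clim.
Context {T : Type} (F : (T -> Prop) -> Prop) {FF : Filter F}.

Lemma clim_const c : clim F (fun _ => c) c.
Proof.
  intros e He. apply filter_forall. intros _.
  replace (c - c)%C with (RtoC 0) by ring. rewrite Cmod_0; auto.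
Qed.

Lemma clim_plus f g a b :
  clim F f a -> clim F g b -> clim F (fun x => f x + g x)%C (a + b)%C.
Proof.
  intros Hf Hg e He.
  generalize (filter_and _ _ (Hf _ (half_pos _ He)) (Hg _ (half_pos _ He))).
  apply filter_imp. intros x [H1 H2].
  replace (f x + g x - (a + b))%C with ((f x - a) + (g x - b))%C by ring.
  eapply Rle_lt_trans; [apply Cmod_triangle|lra].
Qed.

Lemma clim_opp f a : clim F f a -> clim F (fun x => - f x)%C (- a)%C.
Proof.
  intros Hf e He. generalize (Hf e He). apply filter_imp. intros x H1.
  rewrite <- Cmod_opp. replace (- (- f x - - a))%C with (f x - a)%C by ring; auto.
Qed.

Lemma clim_minus f g a b :
  clim F f a -> clim F g b -> clim F (fun x => f x - g x)%C (a - b)%C.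
Proof. intros. apply clim_plus; auto. now apply clim_opp. Qed.

Lemma clim_mult f g a b :
  clim F f a -> clim F g b -> clim F (fun x => f x * g x)%C (a * b)%C.
Proof.
  intros Hf Hg e He.
  pose proof (Cmod_ge_0 a) as Ha. pose proof (Cmod_ge_0 b) as Hb.
  set (d := Rmin 1 (e / (2 + Cmod a + Cmod b))).
  assert (Hd : 0 < d) by (apply Rmin_glb_lt; [lra|apply Rdiv_lt_0_compat; lra]).
  generalize (filter_and _ _ (Hf d Hd) (Hg d Hd)).
  apply filter_imp. intros x [H1 H2].
  replace (f x * g x - a * b)%C with ((f x - a) * (g x - b) + ((f x - a) * b + a * (g x - b)))%C by ring.
  eapply Rle_lt_trans; [apply Cmod_triangle|].
  eapply Rle_lt_trans; [apply Rplus_le_compat_l, Cmod_triangle|].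
  rewrite !Cmod_mult.
  assert (D1 : d <= 1) by apply Rmin_l.
  assert (D2 : d * (2 + Cmod a + Cmod b) <= e).
  { apply (Rmult_le_reg_r (/ (2 + Cmod a + Cmod b))).
    - apply Rinv_0_lt_compat; lra.
    - rewrite Rmult_assoc, Rinv_r, Rmult_1_r by lra. apply Rmin_r. }
  pose proof (Cmod_ge_0 (f x - a)). pose proof (Cmod_ge_0 (g x - b)). nra.
Qed.

Lemma clim_inv f (a : C) : a <> 0%C -> clim F f a -> clim F (fun x => / f x)%C (/ a)%C.
Proof.
  intros Ha Hf e He.
  assert (A : 0 < Cmod a) by now apply Cmod_gt_0.
  set (d := Rmin (Cmod a / 2) (e * (Cmod a / 2) * Cmod a)).
  assert (Hd : 0 < d).
  { apply Rmin_glb_lt; [lra|]. apply Rmult_lt_0_compat; [apply Rmult_lt_0_compat; lra|lra]. }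
  generalize (Hf d Hd). apply filter_imp. intros x H1.
  assert (D1 : d <= Cmod a / 2) by apply Rmin_l.
  assert (D2 : d <= e * (Cmod a / 2) * Cmod a) by apply Rmin_r.
  assert (X : Cmod a / 2 < Cmod (f x)).
  { pose proof (Cmod_rev_triangle a (f x)). rewrite Cmod_sub_sym in H. lra. }
  assert (X0 : f x <> 0%C) by (apply Cneq_mod; lra).
  replace (/ f x - / a)%C with (- ((f x - a) * / (f x * a)))%C by (field; auto).
  rewrite Cmod_opp, Cmod_mult, Cmod_inv by (apply Cmult_neq_0; auto).
  rewrite Cmod_mult.
  apply (Rmult_lt_reg_r (Cmod (f x) * Cmod a)); [nra|].
  rewrite Rmult_assoc, Rinv_l by nra.
  assert (e * (Cmod a / 2) * Cmod a < e * (Cmod (f x) * Cmod a)); [|lra].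
  clear - X A He. rewrite Rmult_assoc. apply Rmult_lt_compat_l; [exact He|]. apply Rmult_lt_compat_r; [exact A|exact X].
Qed.

Lemma clim_div f g (a b : C) :
  b <> 0%C -> clim F f a -> clim F g b -> clim F (fun x => f x / g x)%C (a / b)%C.
Proof. intros. apply clim_mult; auto. now apply clim_inv. Qed.

Lemma clim_conj f a : clim F f a -> clim F (fun x => Cconj (f x)) (Cconj a).
Proof.
  intros Hf e He. generalize (Hf e He). apply filter_imp. intros x H1.
  now rewrite <- Cminus_conj, Cmod_conj.
Qed.

Lemma clim_ext f g a : (forall x, f x = g x) -> clim F f a -> clim F g a.
Proof. intros H Hf e He. generalize (Hf e He). apply filter_imp. intros x; now rewrite H. Qed.

Lemma clim_ext_loc f g a : F (fun x => f x = g x) -> clim F f a -> clim F g a.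
Proof.
  intros H Hf e He. generalize (filter_and _ _ H (Hf e He)). apply filter_imp.
  intros x [H1 H2]. now rewrite <- H1.
Qed.

Lemma clim_comp (f : T -> C) (g : C -> C) a b :
  clim F f a -> clim (nearC a) g b -> clim F (fun x => g (f x)) b.
Proof.
  intros Hf Hg e He. destruct (Hg e He) as [d [Hd H]].
  generalize (Hf d Hd). apply filter_imp; auto.
Qed.

Lemma clim_re f a : clim F f a -> filterlim (fun x => Re (f x)) F (locally (Re a)).
Proof.
  intros Hf. apply filterlim_locally. intros e.
  generalize (Hf e (cond_pos e)). apply filter_imp. intros x H.
  change (Rabs (Re (f x) - Re a) < e).
  replace (Re (f x) - Re a) with (Re (f x - a)%C) by (destruct (f x), a; simpl; ring).
  eapply Rle_lt_trans; [apply re_le_Cmod|auto].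
Qed.

Lemma clim_im f a : clim F f a -> filterlim (fun x => Im (f x)) F (locally (Im a)).
Proof.
  intros Hf. apply filterlim_locally. intros e.
  generalize (Hf e (cond_pos e)). apply filter_imp. intros x H.
  change (Rabs (Im (f x) - Im a) < e).
  replace (Im (f x) - Im a) with (Im (f x - a)%C) by (destruct (f x), a; simpl; ring).
  eapply Rle_lt_trans; [apply im_le_Cmod|auto].
Qed.

Lemma clim_pair f (a b : R) :
  filterlim (fun x => Re (f x)) F (locally a) ->
  filterlim (fun x => Im (f x)) F (locally b) -> clim F f (a, b).
Proof.
  intros H1 H2 e He.
  assert (E : 0 < e / 2) by lra.
  apply filterlim_locally with (eps := mkposreal _ E) in H1.
  apply filterlim_locally with (eps := mkposreal _ E) in H2.
  generalize (filter_and _ _ H1 H2). apply filter_imp. intros x [K1 K2].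
  change (Rabs (Re (f x) - a) < e / 2) in K1. change (Rabs (Im (f x) - b) < e / 2) in K2.
  eapply Rle_lt_trans; [apply Cmod_le_re_im|].
  replace (Re (f x - (a, b))%C) with (Re (f x) - a) by (destruct (f x); simpl; ring).
  replace (Im (f x - (a, b))%C) with (Im (f x) - b) by (destruct (f x); simpl; ring).
  lra.
Qed.

Lemma clim_cmod f a : clim F f a -> filterlim (fun x => Cmod (f x)) F (locally (Cmod a)).
Proof.
  intros Hf. apply filterlim_locally. intros e.
  generalize (Hf e (cond_pos e)). apply filter_imp. intros x H.
  change (Rabs (Cmod (f x) - Cmod a) < e).
  pose proof (Cmod_rev_triangle (f x) a). pose proof (Cmod_rev_triangle a (f x)).
  rewrite (Cmod_sub_sym a) in H1. apply Rabs_def1; lra.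
Qed.
End Clim.

Lemma clim_nearC_id z : clim (nearC z) (fun w => w) z.
Proof. intros e He; exists e; auto. Qed.

Definition ccont (f : C -> C) (z : C) := clim (nearC z) f (f z).
Definition rcont (c : R -> C) := forall t, clim (locally t) c (c t).

Lemma clim_comp_cont {T} (F : (T -> Prop) -> Prop) {FF : Filter F} (f : T -> C) (g : C -> C) a :
  clim F f a -> ccont g a -> clim F (fun x => g (f x)) (g a).
Proof. intros; eapply clim_comp; eauto. Qed.

(** Discharges continuity goals by following the syntax of the map. *)
Ltac clim_tac :=
  match goal with
  | |- clim _ (fun x => (_ + _)%C) _ => apply clim_plus; [typeclasses eauto| |]; clim_tac
  | |- clim _ (fun x => (_ - _)%C) _ => apply clim_minus; [typeclasses eauto| |]; clim_tac
  | |- clim _ (fun x => (- _)%C) _ => apply clim_opp; [typeclasses eauto|]; clim_tac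
  | |- clim _ (fun x => (_ * _)%C) _ => apply clim_mult; [typeclasses eauto| |]; clim_tac
  | |- clim _ (fun x => (_ / _)%C) _ => apply clim_div; [typeclasses eauto| | |]; [|clim_tac|clim_tac]
  | |- clim _ (fun x => (/ _)%C) _ => apply clim_inv; [typeclasses eauto| |]; [|clim_tac]
  | |- clim _ (fun x => Cconj _) _ => apply clim_conj; [typeclasses eauto|]; clim_tac
  | |- clim _ (fun x => ?c) _ => apply clim_const; typeclasses eauto
  | |- clim (nearC _) (fun x => x) _ => apply clim_nearC_id
  | H : ccont ?f _ |- clim (nearC _) ?f _ => apply H
  | H : rcont ?f |- clim (locally _) ?f _ => apply H
  | H : rcont ?f |- clim (locally _) (fun x => ?f x) _ => apply H
  | _ => idtac
  end.

Lemma rcont_re c : rcont c -> forall t, continuous (fun s => Re (c s)) t.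
Proof. intros H t. apply clim_re; [typeclasses eauto|apply H]. Qed.
Lemma rcont_im c : rcont c -> forall t, continuous (fun s => Im (c s)) t.
Proof. intros H t. apply clim_im; [typeclasses eauto|apply H]. Qed.
Lemma rcont_cmod c : rcont c -> forall t, continuous (fun s => Cmod (c s)) t.
Proof. intros H t. apply clim_cmod; [typeclasses eauto|apply H]. Qed.
Lemma rcont_const c : rcont (fun _ => c).
Proof. intros t. apply clim_const. typeclasses eauto. Qed.
Lemma rcont_plus f g : rcont f -> rcont g -> rcont (fun t => f t + g t)%C.
Proof. intros ? ? t; clim_tac. Qed.
Lemma rcont_minus f g : rcont f -> rcont g -> rcont (fun t => f t - g t)%C.
Proof. intros ? ? t; clim_tac. Qed.
Lemma rcont_mult f g : rcont f -> rcont g -> rcont (fun t => f t * g t)%C.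
Proof. intros ? ? t; clim_tac. Qed.
Lemma rcont_opp f : rcont f -> rcont (fun t => - f t)%C.
Proof. intros ? t; clim_tac. Qed.
Lemma rcont_conj f : rcont f -> rcont (fun t => Cconj (f t))%C.
Proof. intros ? t; clim_tac. Qed.
Lemma rcont_inv (f : R -> C) : (forall t, f t <> 0%C) -> rcont f -> rcont (fun t => / f t)%C.
Proof. intros ? ? t; clim_tac; auto. Qed.
Lemma rcont_div (f g : R -> C) : (forall t, g t <> 0%C) -> rcont f -> rcont g -> rcont (fun t => f t / g t)%C.
Proof. intros ? ? ? t; clim_tac; auto. Qed.
Lemma rcont_comp g f : (forall t, ccont g (f t)) -> rcont f -> rcont (fun t => g (f t)).
Proof. intros Hg Hf t. apply (clim_comp_cont (locally t) f g (f t)); auto. Qed.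
Lemma rcont_ext f g : (forall t, f t = g t) -> rcont f -> rcont g.
Proof. intros H Hf t. rewrite <- H. eapply clim_ext; [typeclasses eauto|apply H|apply Hf]. Qed.

(** * Complex derivatives *)

Definition cder (f : C -> C) (z l : C) :=
  forall eps, 0 < eps -> nearC z (fun w => Cmod (f w - f z - l * (w - z)) <= eps * Cmod (w - z)).

Lemma cder_ccont f z l : cder f z l -> ccont f z.
Proof.
  intros H e He. destruct (H 1 Rlt_0_1) as [d [Hd K]].
  pose proof (Cmod_ge_0 l) as Hl.
  exists (Rmin d (e / (2 + Cmod l))). split.
  { apply Rmin_glb_lt; auto. apply Rdiv_lt_0_compat; lra. }
  intros w Hw.
  assert (W1 : Cmod (w - z) < d) by (eapply Rlt_le_trans; [apply Hw|apply Rmin_l]).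
  assert (W2 : Cmod (w - z) < e / (2 + Cmod l)) by (eapply Rlt_le_trans; [apply Hw|apply Rmin_r]).
  specialize (K w W1).
  replace (f w - f z)%C with ((f w - f z - l * (w - z)) + l * (w - z))%C by ring.
  eapply Rle_lt_trans; [apply Cmod_triangle|]. rewrite Cmod_mult.
  apply (Rmult_lt_compat_r (2 + Cmod l)) in W2; [|lra].
  unfold Rdiv in W2. rewrite Rmult_assoc, Rinv_l, Rmult_1_r in W2 by lra.
  pose proof (Cmod_ge_0 (w - z)). nra.
Qed.

Lemma cder_eq f z a b : cder f z a -> a = b -> cder f z b.
Proof. now intros ? <-. Qed.

Lemma cder_const c z : cder (fun _ => c) z 0.
Proof.
  intros e He. exists 1; split; [lra|]. intros w _.
  replace (c - c - 0 * (w - z))%C with (RtoC 0) by ring. rewrite Cmod_0.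
  pose proof (Cmod_ge_0 (w - z)). nra.
Qed.

Lemma cder_id z : cder (fun w => w) z 1.
Proof.
  intros e He. exists 1; split; [lra|]. intros w _.
  replace (w - z - 1 * (w - z))%C with (RtoC 0) by ring. rewrite Cmod_0.
  pose proof (Cmod_ge_0 (w - z)). nra.
Qed.

Lemma cder_ext_loc f g z l : nearC z (fun w => f w = g w) -> cder f z l -> cder g z l.
Proof.
  intros [d [Hd H]] Hf e He.
  assert (Z : f z = g z).
  { apply H. replace (z - z)%C with (RtoC 0) by ring. now rewrite Cmod_0. }
  generalize (filter_and _ _ (Hf e He) (ex_intro _ d (conj Hd H) : nearC z _)).
  apply filter_imp. intros w [H1 H2]. now rewrite <- H2, <- Z.
Qed.

Lemma cder_ext f g z l : (forall w, f w = g w) -> cder f z l -> cder g z l.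
Proof. intros H. apply cder_ext_loc. exists 1; split; [lra|auto]. Qed.

Lemma cder_plus f g z a b : cder f z a -> cder g z b -> cder (fun w => f w + g w)%C z (a + b)%C.
Proof.
  intros Hf Hg e He.
  generalize (filter_and _ _ (Hf _ (half_pos _ He)) (Hg _ (half_pos _ He))).
  apply filter_imp. intros w [H1 H2].
  replace (f w + g w - (f z + g z) - (a + b) * (w - z))%C
    with ((f w - f z - a * (w - z)) + (g w - g z - b * (w - z)))%C by ring.
  eapply Rle_trans; [apply Cmod_triangle|lra].
Qed.

Lemma cder_opp f z a : cder f z a -> cder (fun w => - f w)%C z (- a)%C.
Proof.
  intros Hf e He. generalize (Hf e He). apply filter_imp. intros w H.
  rewrite <- Cmod_opp.
  replace (- (- f w - - f z - - a * (w - z)))%C with (f w - f z - a * (w - z))%C by ring. auto.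
Qed.

Lemma cder_minus f g z a b : cder f z a -> cder g z b -> cder (fun w => f w - g w)%C z (a - b)%C.
Proof. intros. apply cder_plus; auto. now apply cder_opp. Qed.

(** A derivative is a limit of difference quotients; this form makes the product and
    chain rules consequences of the rules for limits: [f] is differentiable at [z]
    iff [f w - f z = k w * (w - z)] with [k] continuous at [z]. *)
Lemma cder_slope f z l :
  cder f z l <->
  exists k, ccont k z /\ k z = l /\ forall w, (f w - f z = k w * (w - z))%C.
Proof.
  split.
  - intros H.
    exists (fun w => if excluded_middle_informative (w = z) then l else ((f w - f z) / (w - z))%C).
    split; [|split].
    + intros e He. destruct (H _ (half_pos _ He)) as [d [Hd K]].
      exists d; split; auto. intros w Hw. cbv beta.
      destruct (excluded_middle_informative (z = z)) as [_|N]; [|congruence].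
      destruct (excluded_middle_informative (w = z)) as [_|N].
      * replace (l - l)%C with (RtoC 0) by ring. now rewrite Cmod_0.
      * assert (N' : (w - z)%C <> 0%C).
        { intro. apply N. replace w with (w - z + z)%C by ring. rewrite H0; ring. }
        replace ((f w - f z) / (w - z) - l)%C with ((f w - f z - l * (w - z)) / (w - z))%C by (field; auto).
        rewrite Cmod_div by auto. specialize (K w Hw).
        assert (0 < Cmod (w - z)) by now apply Cmod_gt_0.
        apply Rle_lt_trans with (e / 2); [|lra].
        apply (Rmult_le_reg_r (Cmod (w - z))); auto.
        unfold Rdiv. rewrite Rmult_assoc, Rinv_l by lra. lra.
    + destruct (excluded_middle_informative (z = z)) as [_|N]; [auto|congruence].
    + intros w. destruct (excluded_middle_informative (w = z)) as [->|N]; [ring|].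
      assert (N' : (w - z)%C <> 0%C).
      { intro. apply N. replace w with (w - z + z)%C by ring. rewrite H0; ring. }
      field; auto.
  - intros [k [Hk [<- H]]] e He. generalize (Hk e He). apply filter_imp.
    intros w K. rewrite H. replace (k w * (w - z) - k z * (w - z))%C with ((k w - k z) * (w - z))%C by ring.
    rewrite Cmod_mult. pose proof (Cmod_ge_0 (w - z)). nra.
Qed.

Lemma cder_mult f g z a b :
  cder f z a -> cder g z b -> cder (fun w => f w * g w)%C z (a * g z + f z * b)%C.
Proof.
  intros Hf Hg. pose proof (cder_ccont _ _ _ Hg) as Cg.
  apply cder_slope in Hf as [k [Ck [<- K]]]. apply cder_slope in Hg as [m [Cm [<- M]]].
  apply cder_slope. exists (fun w => k w * g w + f z * m w)%C. split; [|split]; auto.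
  - unfold ccont; clim_tac.
  - intros w. replace (f w * g w - f z * g z)%C with ((f w - f z) * g w + f z * (g w - g z))%C by ring.
    rewrite K, M. ring.
Qed.

Lemma cder_comp f g z a b :
  cder g z b -> cder f (g z) a -> cder (fun w => f (g w)) z (a * b)%C.
Proof.
  intros Hg Hf. pose proof (cder_ccont _ _ _ Hg) as Cg.
  apply cder_slope in Hf as [k [Ck [<- K]]]. apply cder_slope in Hg as [m [Cm [<- M]]].
  apply cder_slope. exists (fun w => k (g w) * m w)%C. split; [|split]; auto.
  - unfold ccont. apply clim_mult; [typeclasses eauto| |apply Cm].
    apply (clim_comp_cont (nearC z) g k (g z)); auto.
  - intros w. rewrite K, M. ring.
Qed.

Lemma cder_inv_id (z : C) : z <> 0%C -> cder (fun w => / w)%C z (- / (z * z))%C.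
Proof.
  intros Hz. apply cder_ext_loc with (f := fun w : C => if excluded_middle_informative (w = RtoC 0) then RtoC 0 else (/ w)%C).
  { exists (Cmod z); split; [now apply Cmod_gt_0|]. intros w Hw.
    destruct (excluded_middle_informative (w = RtoC 0)) as [->|]; auto.
    exfalso. replace (0 - z)%C with (- z)%C in Hw by ring. rewrite Cmod_opp in Hw. lra. }
  apply cder_slope.
  exists (fun w : C => if excluded_middle_informative (w = RtoC 0) then (/ (z * z))%C else (- / (w * z))%C).
  assert (NZ : nearC z (fun w => w <> 0%C)).
  { exists (Cmod z); split; [now apply Cmod_gt_0|]. intros w Hw ->.
    replace (0 - z)%C with (- z)%C in Hw by ring. rewrite Cmod_opp in Hw. lra. }
  split; [|split].
  - unfold ccont. eapply clim_ext_loc; [typeclasses eauto| |].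
    2:{ destruct (excluded_middle_informative (z = RtoC 0)); [easy|].
        apply (clim_opp (nearC z) (fun w => / (w * z))%C).
        apply (clim_inv (nearC z) (fun w => (w * z))%C). { now apply Cmult_neq_0. } clim_tac. }
    revert NZ; apply filter_imp. intros w Hw.
    destruct (excluded_middle_informative (w = RtoC 0)); easy.
  - destruct (excluded_middle_informative (z = RtoC 0)); easy.
  - intros w. destruct (excluded_middle_informative (z = RtoC 0)); [easy|].
    destruct (excluded_middle_informative (w = RtoC 0)) as [->|]; field; auto.
Qed.

Lemma cder_inv (f : C -> C) (z a : C) : f z <> 0%C -> cder f z a -> cder (fun w => / f w)%C z (- (a / (f z * f z)))%C.
Proof.
  intros Hz Hf. replace (- (a / (f z * f z)))%C with (- / (f z * f z) * a)%C by (field; auto).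
  apply (cder_comp (fun w => / w)%C f); auto. now apply cder_inv_id.
Qed.

Lemma cder_unique f z a b : cder f z a -> cder f z b -> a = b.
Proof.
  intros Ha Hb. apply C_eq_of_small. intros e He.
  destruct (filter_and _ _ (Ha _ (quarter_pos _ He)) (Hb _ (quarter_pos _ He))) as [d [Hd H]].
  destruct (H (z + RtoC (d/2))%C) as [H1 H2].
  { replace (z + RtoC (d/2) - z)%C with (RtoC (d/2)) by ring. rewrite Cmod_R, Rabs_pos_eq; lra. }
  replace (z + RtoC (d/2) - z)%C with (RtoC (d/2)) in * by ring.
  set (w := (z + RtoC (d/2))%C) in *.
  assert (K : Cmod ((a - b) * RtoC (d/2)) <= e / 2 * (d / 2)).
  { replace ((a - b) * RtoC (d/2))%C with ((f w - f z - b * RtoC (d/2)) - (f w - f z - a * RtoC (d/2)))%C by ring.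
    eapply Rle_trans; [apply Cmod_triangle|]. rewrite Cmod_opp.
    rewrite Cmod_R, Rabs_pos_eq in H1, H2 by lra. lra. }
  rewrite Cmod_mult, Cmod_R, Rabs_pos_eq in K by lra.
  assert (0 < d / 2) by lra. nra.
Qed.

(** The balls of the normed field [C] are those of the modulus, so both notions of
    derivative express the same estimate. *)
Lemma is_derive_cder (f : C -> C) (z l : C) :
  is_derive (K := C_AbsRing) (V := C_NormedModule) f z l <-> cder f z l.
Proof.
  assert (L : forall P : C -> Prop,
    @locally (AbsRing_UniformSpace C_AbsRing) z P <-> nearC z P).
  { intros P; split.
    - intros [d H]. exists d; split; [apply cond_pos|]. intros w Hw. apply H. exact Hw.
    - intros [d [Hd H]]. exists (mkposreal d Hd). intros w Hw. apply H. exact Hw. }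
  split.
  - intros [_ H] e He.
    assert (FL : is_filter_lim (locally (T := AbsRing_UniformSpace C_AbsRing) z) z) by (intros P HP; exact HP).
    specialize (H z FL (mkposreal e He)). apply L.
    eapply filter_imp; [|exact H]. intros w Hw. simpl in Hw.
    change (Cmod ((f w - f z) - ((w - z) * l)) <= e * Cmod (w - z)) in Hw.
    now rewrite (Cmult_comm l).
  - intros H. split; [apply is_linear_scal_l|].
    intros y Hy. apply (is_filter_lim_locally_unique (V := AbsRing_NormedModule C_AbsRing)) in Hy. subst y.
    intros e. specialize (H e (cond_pos e)). apply L in H.
    eapply filter_imp; [|exact H]. intros w Hw.
    change (Cmod ((f w - f z) - ((w - z) * l)) <= e * Cmod (w - z)).
    now rewrite (Cmult_comm _ l).
Qed.

Lemma C_derive_cder (f : C -> C) (z l : C) : cder f z l -> C_derive f z = l.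
Proof. intros H. apply is_C_derive_unique. now apply is_derive_cder. Qed.

(** ** Curves *)

Definition rder (c : R -> C) (t : R) (l : C) :=
  is_derive (fun s => Re (c s)) t (Re l) /\ is_derive (fun s => Im (c s)) t (Im l).

Lemma rder_eq c t a b : rder c t a -> a = b -> rder c t b.
Proof. now intros ? <-. Qed.

Lemma is_derive_eps (f : R -> R) (t l : R) :
  is_derive f t l <->
  forall eps, 0 < eps -> locally t (fun s => Rabs (f s - f t - l * (s - t)) <= eps * Rabs (s - t)).
Proof.
  split.
  - intros [_ H] e He. specialize (H t (fun P HP => HP) (mkposreal e He)).
    eapply filter_imp; [|exact H]. intros w Hw.
    change (Rabs ((f w - f t) - ((w - t) * l)) <= e * Rabs (w - t)) in Hw.
    now rewrite (Rmult_comm l).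
  - intros H. split; [apply is_linear_scal_l|].
    intros y Hy. apply (is_filter_lim_locally_unique (V := AbsRing_NormedModule R_AbsRing)) in Hy. subst y.
    intros e. specialize (H e (cond_pos e)).
    eapply filter_imp; [|exact H]. intros w Hw.
    change (Rabs ((f w - f t) - ((w - t) * l)) <= e * Rabs (w - t)).
    now rewrite (Rmult_comm _ l).
Qed.

Lemma rder_eps c t l :
  rder c t l <->
  forall eps, 0 < eps ->
    locally t (fun s => Cmod (c s - c t - l * RtoC (s - t)) <= eps * Rabs (s - t)).
Proof.
  assert (RE : forall s, Re (c s - c t - l * RtoC (s - t))%C = Re (c s) - Re (c t) - Re l * (s - t))
    by (intros; unfold Re; simpl; ring).
  assert (IE : forall s, Im (c s - c t - l * RtoC (s - t))%C = Im (c s) - Im (c t) - Im l * (s - t))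
    by (intros; unfold Im; simpl; ring).
  split.
  - intros [H1 H2] e He. apply is_derive_eps with (eps := e / 2) in H1; [|lra].
    apply is_derive_eps with (eps := e / 2) in H2; [|lra].
    generalize (filter_and _ _ H1 H2). apply filter_imp. intros s [K1 K2].
    eapply Rle_trans; [apply Cmod_le_re_im|]. rewrite RE, IE. lra.
  - intros H. split; apply is_derive_eps; intros e He;
      generalize (H e He); apply filter_imp; intros s K.
    + rewrite <- RE. eapply Rle_trans; [apply re_le_Cmod|auto].
    + rewrite <- IE. eapply Rle_trans; [apply im_le_Cmod|auto].
Qed.

Lemma rder_rcont_at c t l : rder c t l -> clim (locally t) c (c t).
Proof.
  intros [H1 H2].
  assert (E : c t = (Re (c t), Im (c t))) by (destruct (c t); auto). rewrite E.
  apply clim_pair; [typeclasses eauto| |].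
  - apply (ex_derive_continuous (V := R_NormedModule) (fun s => Re (c s))). now exists (Re l).
  - apply (ex_derive_continuous (V := R_NormedModule) (fun s => Im (c s))). now exists (Im l).
Qed.

Lemma rder_const a t : rder (fun _ => a) t 0.
Proof. split; simpl; apply @is_derive_const. Qed.

Lemma rder_comp f c t a b : cder f (c t) a -> rder c t b -> rder (fun s => f (c s)) t (a * b)%C.
Proof.
  intros Hf Hc. pose proof (rder_rcont_at _ _ _ Hc) as Cc.
  apply rder_eps. intros e He.
  set (m := Cmod b + Cmod a + 2).
  pose proof (Cmod_ge_0 a). pose proof (Cmod_ge_0 b).
  assert (M : 0 < m) by (unfold m; lra).
  assert (E1 : 0 < e / m) by (apply Rdiv_lt_0_compat; lra).
  set (d := Rmin 1 (e / m)).
  assert (D : 0 < d) by (apply Rmin_glb_lt; lra).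
  destruct (Hf d D) as [r [Hr K]].
  pose proof (proj1 (rder_eps _ _ _) Hc d D) as Hc'.
  generalize (filter_and _ _ Hc' (Cc r Hr)). apply filter_imp. intros s [K1 K2].
  specialize (K _ K2).
  replace (f (c s) - f (c t) - a * b * RtoC (s - t))%C
    with ((f (c s) - f (c t) - a * (c s - c t)) + a * (c s - c t - b * RtoC (s - t)))%C by ring.
  eapply Rle_trans; [apply Cmod_triangle|]. rewrite Cmod_mult.
  assert (K3 : Cmod (c s - c t) <= (Cmod b + 1) * Rabs (s - t)).
  { replace (c s - c t)%C with ((c s - c t - b * RtoC (s - t)) + b * RtoC (s - t))%C by ring.
    eapply Rle_trans; [apply Cmod_triangle|]. rewrite (Cmod_mult b), Cmod_R.
    assert (d <= 1) by apply Rmin_l. pose proof (Rabs_pos (s - t)). nra. }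
  assert (D2 : d * m <= e).
  { apply (Rmult_le_reg_r (/ m)); [now apply Rinv_0_lt_compat|].
    rewrite Rmult_assoc, Rinv_r, Rmult_1_r by lra. apply Rmin_r. }
  pose proof (Rabs_pos (s - t)).
  assert (Cmod a * Cmod (c s - c t - b * RtoC (s - t)) <= Cmod a * (d * Rabs (s - t)))
    by (apply Rmult_le_compat_l; auto).
  assert (d * Cmod (c s - c t) <= d * ((Cmod b + 1) * Rabs (s - t)))
    by (apply Rmult_le_compat_l; lra).
  apply Rle_trans with (d * m * Rabs (s - t)); [unfold m; nra|].
  apply Rmult_le_compat_r; auto.
Qed.

Lemma rder_plus c d t a b : rder c t a -> rder d t b -> rder (fun s => c s + d s)%C t (a + b)%C.
Proof. intros [H1 H2] [K1 K2]. split; simpl; apply @is_derive_plus; auto. Qed.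

Lemma rder_mult c d t a b :
  rder c t a -> rder d t b -> rder (fun s => c s * d s)%C t (a * d t + c t * b)%C.
Proof.
  intros [H1 H2] [K1 K2]. split.
  - evar_last.
    + apply (is_derive_minus (V := R_NormedModule)); apply Derive.is_derive_mult; eauto.
    + unfold minus, plus, opp, Re, Im; simpl; unfold Re, Im; ring.
  - evar_last.
    + apply (is_derive_plus (V := R_NormedModule)); apply Derive.is_derive_mult; eauto.
    + unfold minus, plus, opp, Re, Im; simpl; unfold Re, Im; ring.
Qed.

Lemma rder_RtoC (f : R -> R) t l : is_derive f t l -> rder (fun s => RtoC (f s)) t (RtoC l).
Proof. intros H. split; simpl; auto. apply @is_derive_const. Qed.

(** * The complex exponential *)

Definition cexp (z : C) : C := (exp (Re z) * cos (Im z), exp (Re z) * sin (Im z)).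
Definition cis (t : R) : C := (cos t, sin t).

Lemma cexp_plus a b : cexp (a + b) = (cexp a * cexp b)%C.
Proof.
  unfold cexp. rewrite re_plus. replace (Im (a + b)%C) with (Im a + Im b) by (destruct a, b; auto).
  rewrite exp_plus, cos_plus, sin_plus. ceq.
Qed.

Lemma cexp_0 : cexp 0 = 1%C.
Proof. unfold cexp; simpl. rewrite exp_0, cos_0, sin_0. ceq. Qed.

Lemma cexp_opp_r a : (cexp a * cexp (- a) = 1)%C.
Proof. rewrite <- cexp_plus. replace (a + - a)%C with (RtoC 0) by ring. apply cexp_0. Qed.

Lemma cexp_neq_0 a : cexp a <> 0%C.
Proof.
  intros H. pose proof (cexp_opp_r a). rewrite H, Cmult_0_l in H0.
  assert (1 = 0); [|lra]. now apply RtoC_inj.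
Qed.

Lemma Cmod_cexp a : Cmod (cexp a) = exp (Re a).
Proof.
  apply (Rsqr_inj _ _ (Cmod_ge_0 _) (Rlt_le _ _ (exp_pos _))).
  rewrite !Rsqr_pow2, Cmod2_alt. unfold cexp; simpl.
  pose proof (sin2_cos2 (Im a)). unfold Rsqr in H. nra.
Qed.

Lemma Re_cexp z : Re (cexp z) = exp (Re z) * cos (Im z).
Proof. reflexivity. Qed.
Lemma cis_cexp t : cis t = cexp (Ci * RtoC t).
Proof.
  unfold cis, cexp. replace (Re (Ci * RtoC t)%C) with 0 by (unfold Re; simpl; ring).
  replace (Im (Ci * RtoC t)%C) with t by (unfold Im; simpl; ring).
  rewrite exp_0. ceq.
Qed.

Lemma Cmod_cis t : Cmod (cis t) = 1.
Proof.
  rewrite cis_cexp, Cmod_cexp. replace (Re (Ci * RtoC t)%C) with 0 by (unfold Re; simpl; ring). apply exp_0.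
Qed.

Lemma cis_neq_0 t : cis t <> 0%C.
Proof. apply Cneq_mod. rewrite Cmod_cis; lra. Qed.

Lemma cis_plus s t : cis (s + t) = (cis s * cis t)%C.
Proof. unfold cis. rewrite cos_plus, sin_plus. ceq. Qed.

Lemma cis_conj t : Cconj (cis t) = (/ cis t)%C.
Proof.
  pose proof (cis_neq_0 t) as N.
  assert (E : (cis t * Cconj (cis t))%C = 1%C) by (rewrite Cconj_mult_self, Cmod_cis; ceq).
  replace (Cconj (cis t)) with (/ cis t * (cis t * Cconj (cis t)))%C by (field; auto).
  rewrite E; ring.
Qed.

Lemma cis_conj' t : Cconj (cis t) = cis (- t).
Proof. unfold cis. rewrite cos_neg, sin_neg. reflexivity. Qed.

Lemma cis_0 : cis 0 = 1%C.
Proof. unfold cis. now rewrite cos_0, sin_0. Qed.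

Lemma cis_2PI : cis (2 * PI) = 1%C.
Proof. unfold cis. now rewrite cos_2PI, sin_2PI. Qed.

Lemma cexp_polar z : cexp z = (RtoC (exp (Re z)) * cis (Im z))%C.
Proof. unfold cexp, cis. ceq. Qed.

Lemma rder_cis t : rder cis t (Ci * cis t)%C.
Proof.
  split; simpl; unfold Re, Im; simpl.
  - replace (0 * cos t - 1 * sin t) with (- sin t) by ring. apply is_derive_cos.
  - replace (0 * sin t + 1 * cos t) with (cos t) by ring. apply is_derive_sin.
Qed.

Lemma rcont_cis : rcont cis.
Proof. intros t. eapply rder_rcont_at, rder_cis. Qed.

(** The real derivatives of [exp], [cos] and [sin] at [0] suffice; the functional equation
    carries the result to every other point. *)
Lemma cexp_near_0 : cder cexp 0 1.
Proof.
  intros e He. set (d := Rmin 1 (e / 16)).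
  assert (D : 0 < d) by (apply Rmin_glb_lt; lra).
  assert (D1 : d <= 1) by apply Rmin_l. assert (D2 : d <= e / 16) by apply Rmin_r.
  pose proof (proj1 (is_derive_eps _ _ _) (is_derive_exp 0) d D) as [r1 H1].
  pose proof (proj1 (is_derive_eps _ _ _) (is_derive_cos 0) d D) as [r2 H2].
  pose proof (proj1 (is_derive_eps _ _ _) (is_derive_sin 0) d D) as [r3 H3].
  rewrite exp_0 in H1. rewrite sin_0, cos_0 in *.
  exists (Rmin d (Rmin r1 (Rmin r2 r3))). split.
  { apply Rmin_glb_lt; [exact D|]. repeat (apply Rmin_glb_lt; [apply cond_pos|]). apply cond_pos. }
  intros w Hw. replace (w - 0)%C with w in * by ring.
  assert (W0 : Cmod w < d) by (eapply Rlt_le_trans; [exact Hw|apply Rmin_l]).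
  assert (W : Cmod w < Rmin r1 (Rmin r2 r3)) by (eapply Rlt_le_trans; [exact Hw|apply Rmin_r]).
  assert (W1 : Cmod w < r1) by (eapply Rlt_le_trans; [exact W|apply Rmin_l]).
  assert (W' : Cmod w < Rmin r2 r3) by (eapply Rlt_le_trans; [exact W|apply Rmin_r]).
  assert (W2 : Cmod w < r2) by (eapply Rlt_le_trans; [exact W'|apply Rmin_l]).
  assert (W3 : Cmod w < r3) by (eapply Rlt_le_trans; [exact W'|apply Rmin_r]).
  pose proof (re_le_Cmod w) as Rw. pose proof (im_le_Cmod w) as Iw.
  assert (B1 : ball 0 r1 (Re w)).
  { change (Rabs (Re w - 0) < r1). rewrite Rminus_0_r. lra. }
  assert (B2 : ball 0 r2 (Im w)).
  { change (Rabs (Im w - 0) < r2). rewrite Rminus_0_r. lra. }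
  assert (B3 : ball 0 r3 (Im w)).
  { change (Rabs (Im w - 0) < r3). rewrite Rminus_0_r. lra. }
  specialize (H1 _ B1). specialize (H2 _ B2). specialize (H3 _ B3). simpl in H1, H2, H3.
  rewrite cexp_0.
  eapply Rle_trans; [apply Cmod_le_re_im|].
  destruct w as [x y]. unfold cexp, Re, Im in *; simpl in *. rewrite Rminus_0_r in *.
  set (ex := exp x) in *. set (cy := cos y) in *. set (sy := sin y) in *.
  set (m := Cmod (x, y)) in *.
  assert (Rabs x <= m) by auto. assert (Rabs y <= m) by auto.
  assert (E1 : Rabs (ex - 1 - x) <= d * m).
  { replace (ex - 1 - x) with (ex - 1 - 1 * x) by ring. apply Rle_trans with (1 := H1). apply Rmult_le_compat_l; lra. }
  assert (E2 : Rabs (cy - 1) <= d * m).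
  { replace (cy - 1) with (cy - 1 - - 0 * y) by ring. apply Rle_trans with (1 := H2). apply Rmult_le_compat_l; lra. }
  assert (E3 : Rabs (sy - y) <= d * m).
  { replace (sy - y) with (sy - 1 * (y - 0)) by ring. rewrite Rminus_0_r in *. apply Rle_trans with (1 := H3). apply Rmult_le_compat_l; lra. }
  apply Rabs_le_between in E1, E2, E3.
  assert (Xb : - m <= x <= m) by now apply Rabs_le_between.
  assert (Yb : - m <= y <= m) by now apply Rabs_le_between.
  assert (M0 : 0 <= m) by apply Cmod_ge_0.
  assert (dm : d * m <= m) by nra.
  assert (EX : 0 < ex) by apply exp_pos. assert (EX3 : ex <= 3) by lra.
  assert (P1 : Rabs (ex * cy + - (1) + - (1 * x - 0 * y)) <= 4 * (d * m)).
  { replace (ex * cy + - (1) + - (1 * x - 0 * y))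
      with (ex * (cy - 1) + (ex - 1 - x)) by ring.
    apply Rabs_le; nra. }
  assert (P2 : Rabs (ex * sy + - 0 + - (1 * y + 0 * x)) <= 5 * (d * m)).
  { replace (ex * sy + - 0 + - (1 * y + 0 * x))
      with ((ex - 1) * (sy - y) + (sy - y) + (ex - 1 - x) * y + x * y) by ring.
    assert (md : m <= d) by lra.
    assert (T1 : Rabs (x * y) <= d * m).
    { rewrite Rabs_mult. pose proof (Rabs_pos x). pose proof (Rabs_pos y). nra. }
    assert (T2 : Rabs ((ex - 1 - x) * y) <= d * m).
    { rewrite Rabs_mult. apply Rle_trans with (d * m * 1); [|lra].
      apply Rmult_le_compat; try apply Rabs_pos; [apply Rabs_le; lra|lra]. }
    assert (T3 : Rabs ((ex - 1) * (sy - y)) <= 2 * (d * m)).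
    { rewrite Rabs_mult. apply Rmult_le_compat; try apply Rabs_pos; apply Rabs_le; lra. }
    apply Rabs_le_between in T1, T2, T3. apply Rabs_le.
    change (x * y) with (x * y) in *. lra. }
  apply Rle_trans with (9 * (d * m)). { lra. }
  assert (9 * d <= e) by lra. nra.
Qed.

Lemma cder_cexp z : cder cexp z (cexp z).
Proof.
  apply cder_ext with (f := fun w => (cexp z * cexp (w - z))%C).
  { intros w. rewrite <- cexp_plus. f_equal; ring. }
  apply cder_eq with (0 * cexp (z - z) + cexp z * (1 * (1 - 0)))%C; [|ring].
  apply (cder_mult (fun _ => cexp z) (fun w => cexp (w - z))%C); [apply cder_const|].
  apply (cder_comp cexp (fun w => w - z)%C).
  - apply (cder_minus (fun w => w) (fun _ => z)); [apply cder_id|apply cder_const].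
  - replace (z - z)%C with (RtoC 0) by ring. apply cexp_near_0.
Qed.

Lemma ccont_cexp z : ccont cexp z.
Proof. eapply cder_ccont, cder_cexp. Qed.

(** * Holomorphic functions on discs centred at the origin *)

(** [holD r f df]: [f] is continuously differentiable, with derivative [df], on the disc
    of radius [r].  Continuity of the derivative is what makes differentiation under the
    integral sign available, and with it a short proof of the integral formula. *)
Definition holD (r : R) (f df : C -> C) :=
  forall z, Cmod z < r -> cder f z (df z) /\ ccont df z.

Definition hol (r : R) (f : C -> C) := exists df, holD r f df.

Lemma disk_open r z : Cmod z < r -> nearC z (fun w => Cmod w < r).
Proof.
  intros H. exists (r - Cmod z); split; [lra|]. intros w Hw.
  pose proof (Cmod_rev_triangle w z). lra.
Qed.

Lemma ccont_ext_loc f g z : nearC z (fun w => f w = g w) -> ccont f z -> ccont g z.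
Proof.
  intros H Hf. assert (E : f z = g z).
  { destruct H as [d [Hd H]]. apply H. replace (z - z)%C with (RtoC 0) by ring. now rewrite Cmod_0. }
  unfold ccont. rewrite <- E. eapply clim_ext_loc; eauto; typeclasses eauto.
Qed.

Lemma holD_ext r f g df dg :
  (forall z, Cmod z < r -> f z = g z) -> (forall z, Cmod z < r -> df z = dg z) ->
  holD r f df -> holD r g dg.
Proof.
  intros Hf Hd H z Hz. destruct (H z Hz) as [H1 H2]. pose proof (disk_open r z Hz) as N.
  split.
  - rewrite <- Hd by auto. apply cder_ext_loc with f; auto. revert N; apply filter_imp; auto.
  - apply ccont_ext_loc with df; auto. revert N; apply filter_imp; auto.
Qed.

Lemma hol_ext r f g : (forall z, Cmod z < r -> f z = g z) -> hol r f -> hol r g.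
Proof. intros H [df Hf]. exists df. eapply holD_ext; eauto. Qed.

Lemma holD_sub r r' f df : r' <= r -> holD r f df -> holD r' f df.
Proof. intros H Hf z Hz. apply Hf. lra. Qed.
Lemma hol_sub r r' f : r' <= r -> hol r f -> hol r' f.
Proof. intros H [df Hf]. exists df. eapply holD_sub; eauto. Qed.

Lemma holD_cont r f df z : holD r f df -> Cmod z < r -> ccont f z.
Proof. intros H Hz. eapply cder_ccont. now apply H. Qed.
Lemma hol_cont r f z : hol r f -> Cmod z < r -> ccont f z.
Proof. intros [df H]. eapply holD_cont; eauto. Qed.

Lemma holD_const r c : holD r (fun _ => c) (fun _ => 0%C).
Proof. intros z _; split; [apply cder_const|]. unfold ccont; clim_tac. Qed.
Lemma holD_id r : holD r (fun z => z) (fun _ => 1%C).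
Proof. intros z _; split; [apply cder_id|]. unfold ccont; clim_tac. Qed.

Lemma holD_plus r f g df dg :
  holD r f df -> holD r g dg -> holD r (fun z => f z + g z)%C (fun z => df z + dg z)%C.
Proof.
  intros Hf Hg z Hz. destruct (Hf z Hz), (Hg z Hz). split; [now apply cder_plus|].
  unfold ccont; clim_tac.
Qed.

Lemma holD_opp r f df : holD r f df -> holD r (fun z => - f z)%C (fun z => - df z)%C.
Proof.
  intros Hf z Hz. destruct (Hf z Hz). split; [now apply cder_opp|]. unfold ccont; clim_tac.
Qed.

Lemma holD_minus r f g df dg :
  holD r f df -> holD r g dg -> holD r (fun z => f z - g z)%C (fun z => df z - dg z)%C.
Proof. intros. apply holD_plus; auto. now apply holD_opp. Qed.

Lemma holD_mult r f g df dg :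
  holD r f df -> holD r g dg ->
  holD r (fun z => f z * g z)%C (fun z => df z * g z + f z * dg z)%C.
Proof.
  intros Hf Hg z Hz. destruct (Hf z Hz) as [A B], (Hg z Hz) as [A' B'].
  pose proof (cder_ccont _ _ _ A). pose proof (cder_ccont _ _ _ A').
  split; [now apply cder_mult|]. unfold ccont; clim_tac.
Qed.

Lemma holD_inv r (f df : C -> C) :
  (forall z, Cmod z < r -> f z <> 0%C) -> holD r f df ->
  holD r (fun z => / f z)%C (fun z => - (df z / (f z * f z)))%C.
Proof.
  intros N Hf z Hz. destruct (Hf z Hz) as [A B]. pose proof (cder_ccont _ _ _ A).
  split; [apply cder_inv; auto|]. unfold ccont; clim_tac.
  apply Cmult_neq_0; auto.
Qed.

Lemma holD_comp r s f g df dg :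
  (forall z, Cmod z < r -> Cmod (g z) < s) -> holD s f df -> holD r g dg ->
  holD r (fun z => f (g z)) (fun z => df (g z) * dg z)%C.
Proof.
  intros N Hf Hg z Hz. destruct (Hg z Hz) as [A B]. destruct (Hf (g z) (N z Hz)) as [A' B'].
  split; [now apply cder_comp|]. unfold ccont.
  apply clim_mult; [typeclasses eauto| |auto].
  apply (clim_comp_cont (nearC z) g df (g z)); auto. now apply (cder_ccont _ _ _ A).
Qed.

Lemma holD_cexp r f df : holD r f df -> holD r (fun z => cexp (f z)) (fun z => cexp (f z) * df z)%C.
Proof.
  intros Hf z Hz. destruct (Hf z Hz) as [A B].
  split; [apply (cder_comp cexp f); auto; apply cder_cexp|]. unfold ccont.
  apply clim_mult; [typeclasses eauto| |auto].
  apply (clim_comp_cont (nearC z) f cexp (f z)); auto; [now apply (cder_ccont _ _ _ A)|apply ccont_cexp].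
Qed.

Lemma hol_const r c : hol r (fun _ => c).
Proof. eexists; apply holD_const. Qed.
Lemma hol_id r : hol r (fun z => z).
Proof. eexists; apply holD_id. Qed.
Lemma hol_plus r f g : hol r f -> hol r g -> hol r (fun z => f z + g z)%C.
Proof. intros [] []; eexists; eapply holD_plus; eauto. Qed.
Lemma hol_opp r f : hol r f -> hol r (fun z => - f z)%C.
Proof. intros []; eexists; eapply holD_opp; eauto. Qed.
Lemma hol_minus r f g : hol r f -> hol r g -> hol r (fun z => f z - g z)%C.
Proof. intros [] []; eexists; eapply holD_minus; eauto. Qed.
Lemma hol_mult r f g : hol r f -> hol r g -> hol r (fun z => f z * g z)%C.
Proof. intros [] []; eexists; eapply holD_mult; eauto. Qed.
Lemma hol_inv r (f : C -> C) : (forall z, Cmod z < r -> f z <> 0%C) -> hol r f -> hol r (fun z => / f z)%C.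
Proof. intros ? []; eexists; eapply holD_inv; eauto. Qed.
Lemma hol_div r (f g : C -> C) :
  (forall z, Cmod z < r -> g z <> 0%C) -> hol r f -> hol r g -> hol r (fun z => f z / g z)%C.
Proof. intros. apply hol_mult; auto. now apply hol_inv. Qed.
Lemma hol_comp r s f g :
  (forall z, Cmod z < r -> Cmod (g z) < s) -> hol s f -> hol r g -> hol r (fun z => f (g z)).
Proof. intros ? [] []; eexists; eapply holD_comp; eauto. Qed.
Lemma hol_cexp r f : hol r f -> hol r (fun z => cexp (f z)).
Proof. intros []; eexists; eapply holD_cexp; eauto. Qed.
Lemma hol_pow r f n : hol r f -> hol r (fun z => f z ^ n)%C.
Proof.
  intros Hf. induction n; [exact (hol_const r (RtoC 1))|].
  apply hol_ext with (fun z => f z * f z ^ n)%C; [reflexivity|]. now apply hol_mult.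
Qed.

Ltac hol_tac :=
  match goal with
  | H : hol ?r ?f |- hol ?r ?f => exact H
  | H : hol ?r ?f |- hol ?r (fun z => ?f z) => exact H
  | |- hol ?r (Cmult ?y) => apply (hol_mult r (fun _ => y) (fun z => z)); [apply hol_const|apply hol_id]
  | |- hol ?r (Cplus ?y) => apply (hol_plus r (fun _ => y) (fun z => z)); [apply hol_const|apply hol_id]
  | |- hol _ (fun z => (_ + _)%C) => apply hol_plus; hol_tac
  | |- hol _ (fun z => (_ - _)%C) => apply hol_minus; hol_tac
  | |- hol _ (fun z => (- _)%C) => apply hol_opp; hol_tac
  | |- hol _ (fun z => (_ * _)%C) => apply hol_mult; hol_tac
  | |- hol _ (fun z => (_ / _)%C) => apply hol_div; [|hol_tac|hol_tac]
  | |- hol _ (fun z => (/ _)%C) => apply hol_inv; [|hol_tac]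
  | |- hol _ (fun z => (_ ^ _)%C) => apply hol_pow; hol_tac
  | |- hol _ (fun z => cexp _) => apply hol_cexp; hol_tac
  | |- hol _ (fun z => z) => apply hol_id
  | |- hol _ (fun z => ?c) => apply hol_const
  | _ => idtac
  end.

(** * Means over a circle *)

Definition rmean (u : R -> R) : R := RInt u 0 (2 * PI) / (2 * PI).
Definition cmean (c : R -> C) : C := (rmean (fun t => Re (c t)), rmean (fun t => Im (c t))).

Lemma twoPI_pos : 0 < 2 * PI.
Proof. pose proof PI_RGT_0; lra. Qed.

Lemma cont_ex_RInt (u : R -> R) a b : (forall t, continuous u t) -> ex_RInt u a b.
Proof. intros H. apply (ex_RInt_continuous (V := R_CompleteNormedModule)). auto. Qed.

Lemma rmean_ext u v : (forall t, u t = v t) -> rmean u = rmean v.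
Proof. intros H. unfold rmean. f_equal. apply (RInt_ext (V := R_CompleteNormedModule)). auto. Qed.

Lemma rmean_plus u v : (forall t, continuous u t) -> (forall t, continuous v t) ->
  rmean (fun t => u t + v t) = rmean u + rmean v.
Proof.
  intros Hu Hv. unfold rmean.
  rewrite (RInt_plus (V := R_CompleteNormedModule) u v) by now apply cont_ex_RInt.
  unfold plus; simpl. pose proof twoPI_pos. field; lra.
Qed.

Lemma rmean_scal k u : (forall t, continuous u t) -> rmean (fun t => k * u t) = k * rmean u.
Proof.
  intros Hu. unfold rmean.
  rewrite (RInt_scal (V := R_CompleteNormedModule) u) by now apply cont_ex_RInt.
  unfold scal; simpl; unfold mult; simpl. pose proof twoPI_pos. field; lra.
Qed.

Lemma rmean_const k : rmean (fun _ => k) = k.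
Proof.
  unfold rmean. rewrite RInt_const. unfold scal; simpl; unfold mult; simpl.
  pose proof PI_RGT_0. field; lra.
Qed.

Lemma rmean_le u v : (forall t, continuous u t) -> (forall t, continuous v t) ->
  (forall t, 0 <= t <= 2 * PI -> u t <= v t) -> rmean u <= rmean v.
Proof.
  intros Hu Hv H. unfold rmean. pose proof twoPI_pos.
  apply Rmult_le_compat_r; [apply Rlt_le, Rinv_0_lt_compat; lra|].
  apply RInt_le; try apply cont_ex_RInt; auto; [lra|]. intros; apply H; lra.
Qed.

Lemma rmean_gt_0 u t0 : (forall t, continuous u t) -> (forall t, 0 <= u t) ->
  0 < t0 < 2 * PI -> 0 < u t0 -> 0 < rmean u.
Proof.
  intros Hu H Ht Hp.
  pose proof (proj1 (filterlim_locally _ _) (Hu t0) (mkposreal _ Hp)) as [d Hd].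
  set (a := Rmax 0 (t0 - d / 2)). set (b := Rmin (2 * PI) (t0 + d / 2)).
  assert (D := cond_pos d).
  assert (A : 0 <= a < t0) by (split; [apply Rmax_l|apply Rmax_lub_lt; lra]).
  assert (A' : t0 - d / 2 <= a) by apply Rmax_r.
  assert (B : t0 < b <= 2 * PI) by (split; [apply Rmin_glb_lt; lra|apply Rmin_l]).
  assert (B' : b <= t0 + d / 2) by apply Rmin_r.
  assert (I1 : 0 <= RInt u 0 a) by (apply RInt_ge_0; auto; try lra; now apply cont_ex_RInt).
  assert (I3 : 0 <= RInt u b (2 * PI)) by (apply RInt_ge_0; auto; try lra; now apply cont_ex_RInt).
  assert (I2 : 0 < RInt u a b).
  { apply RInt_gt_0; auto; [lra|]. intros x Hx.
    assert (K : Rabs (u x - u t0) < u t0).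
    { apply Hd. change (Rabs (x - t0) < d). apply Rabs_def1; lra. }
    apply Rabs_def2 in K. lra. }
  assert (E : RInt u 0 (2 * PI) = RInt u 0 a + (RInt u a b + RInt u b (2 * PI))).
  { rewrite <- (RInt_Chasles (V := R_CompleteNormedModule) u 0 a (2 * PI)) by now apply cont_ex_RInt.
    rewrite <- (RInt_Chasles (V := R_CompleteNormedModule) u a b (2 * PI)) by now apply cont_ex_RInt.
    reflexivity. }
  unfold rmean. apply Rdiv_lt_0_compat; [lra|apply twoPI_pos].
Qed.

Lemma Re_cmean c : Re (cmean c) = rmean (fun t => Re (c t)).
Proof. reflexivity. Qed.

Lemma cmean_ext c d : (forall t, c t = d t) -> cmean c = cmean d.
Proof. intros H. unfold cmean. f_equal; apply rmean_ext; intros; now rewrite H. Qed.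

Lemma cmean_plus c d : rcont c -> rcont d -> cmean (fun t => c t + d t)%C = (cmean c + cmean d)%C.
Proof.
  intros Hc Hd. unfold cmean, Cplus. f_equal; simpl.
  - rewrite <- rmean_plus; [|now apply rcont_re|now apply rcont_re]. apply rmean_ext; reflexivity.
  - rewrite <- rmean_plus; [|now apply rcont_im|now apply rcont_im]. apply rmean_ext; reflexivity.
Qed.

Lemma rmean_lin a b u v : (forall t, continuous u t) -> (forall t, continuous v t) ->
  rmean (fun t => a * u t + b * v t) = a * rmean u + b * rmean v.
Proof.
  intros Hu Hv. rewrite (rmean_plus (fun t => a * u t) (fun t => b * v t)), !rmean_scal; auto.
  all: intros; apply (continuous_scal_r (V := R_NormedModule)); auto.
Qed.

Lemma cmean_scal k c : rcont c -> cmean (fun t => k * c t)%C = (k * cmean c)%C.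
Proof.
  intros Hc. pose proof (rcont_re c Hc). pose proof (rcont_im c Hc).
  apply C_ext; unfold cmean at 1; unfold Re at 1, Im at 1; simpl.
  - transitivity (rmean (fun t => Re k * Re (c t) + - Im k * Im (c t))).
    + apply rmean_ext; intros; unfold Re, Im; ring.
    + rewrite rmean_lin; auto. unfold cmean, Re, Im; simpl; ring.
  - transitivity (rmean (fun t => Re k * Im (c t) + Im k * Re (c t))).
    + apply rmean_ext; intros; unfold Re, Im; ring.
    + rewrite rmean_lin; auto.
Qed.

Lemma cmean_scal_r k c : rcont c -> cmean (fun t => c t * k)%C = (cmean c * k)%C.
Proof.
  intros Hc. rewrite Cmult_comm, <- cmean_scal by auto. apply cmean_ext; intros; ring.
Qed.

Lemma cmean_opp c : rcont c -> cmean (fun t => - c t)%C = (- cmean c)%C.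
Proof.
  intros Hc. replace (- cmean c)%C with (- (1) * cmean c)%C by ring.
  rewrite <- cmean_scal by auto. apply cmean_ext; intros; ring.
Qed.

Lemma cmean_minus c d : rcont c -> rcont d -> cmean (fun t => c t - d t)%C = (cmean c - cmean d)%C.
Proof.
  intros. unfold Cminus at 2. rewrite <- cmean_opp by auto.
  rewrite <- cmean_plus; auto. now apply rcont_opp.
Qed.

Lemma cmean_const k : cmean (fun _ => k) = k.
Proof. unfold cmean. rewrite !rmean_const. now destruct k. Qed.

Lemma cmean_conj c : rcont c -> cmean (fun t => Cconj (c t)) = Cconj (cmean c).
Proof.
  intros Hc. unfold cmean, Cconj; simpl. f_equal.
  replace (- rmean (fun t => Im (c t))) with (-1 * rmean (fun t => Im (c t))) by ring.
  rewrite <- rmean_scal by now apply rcont_im. apply rmean_ext; intros; unfold Im; simpl; ring.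
Qed.

Lemma Cmod_cmean_le c M : rcont c -> (forall t, 0 <= t <= 2 * PI -> Cmod (c t) <= M) -> Cmod (cmean c) <= M.
Proof.
  intros Hc H. pose proof (Cmod_ge_0 (cmean c)) as P.
  destruct (Rle_lt_or_eq_dec _ _ P) as [Q|Q].
  2:{ rewrite <- Q. eapply Rle_trans; [apply Cmod_ge_0|apply (H 0); pose proof twoPI_pos; lra]. }
  set (k := (Cconj (cmean c) * RtoC (/ Cmod (cmean c)))%C).
  assert (K : Cmod k = 1).
  { unfold k. rewrite Cmod_mult, Cmod_conj, Cmod_R, Rabs_pos_eq; [field; lra|].
    apply Rlt_le, Rinv_0_lt_compat; auto. }
  assert (E : Re (k * cmean c) = Cmod (cmean c)).
  { unfold k. replace (Cconj (cmean c) * RtoC (/ Cmod (cmean c)) * cmean c)%C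
      with (RtoC (/ Cmod (cmean c)) * (cmean c * Cconj (cmean c)))%C by ring.
    rewrite Cconj_mult_self, re_scal_l, re_RtoC. field; lra. }
  rewrite <- E, <- cmean_scal, Re_cmean by auto.
  rewrite <- (rmean_const M). apply rmean_le.
  - apply rcont_re. apply rcont_mult; auto. apply rcont_const.
  - intros; apply continuous_const.
  - intros t Ht. eapply Rle_trans; [apply re_le|]. rewrite Cmod_mult, K. specialize (H t Ht). lra.
Qed.

Lemma cmean_uniform_limit (cn : nat -> R -> C) c :
  (forall n, rcont (cn n)) -> rcont c ->
  (forall eps, 0 < eps -> exists N, forall n, (N <= n)%nat -> forall t, 0 <= t <= 2 * PI -> Cmod (cn n t - c t) <= eps) ->
  forall eps, 0 < eps -> exists N, forall n, (N <= n)%nat -> Cmod (cmean (cn n) - cmean c) <= eps.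
Proof.
  intros Hn Hc H e He. destruct (H e He) as [N HN]. exists N. intros n Hn'.
  rewrite <- cmean_minus by auto. apply Cmod_cmean_le; auto. now apply rcont_minus.
Qed.

Lemma cmean_derive_periodic c c' :
  (forall t, rder c t (c' t)) -> rcont c' -> c (2 * PI) = c 0 -> cmean c' = 0%C.
Proof.
  intros Hd Hc Hp. unfold cmean, rmean.
  assert (A : RInt (fun t => Re (c' t)) 0 (2 * PI) = 0).
  { rewrite (is_RInt_unique (V := R_CompleteNormedModule) _ 0 (2 * PI) (minus (Re (c (2 * PI))) (Re (c 0)))).
    - rewrite Hp. unfold minus, plus, opp; simpl; ring.
    - apply (is_RInt_derive (V := R_CompleteNormedModule) (fun t => Re (c t))).
      + intros; apply Hd. + intros; now apply rcont_re. }
  assert (B : RInt (fun t => Im (c' t)) 0 (2 * PI) = 0).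
  { rewrite (is_RInt_unique (V := R_CompleteNormedModule) _ 0 (2 * PI) (minus (Im (c (2 * PI))) (Im (c 0)))).
    - rewrite Hp. unfold minus, plus, opp; simpl; ring.
    - apply (is_RInt_derive (V := R_CompleteNormedModule) (fun t => Im (c t))).
      + intros; apply Hd. + intros; now apply rcont_im. }
  rewrite A, B. pose proof twoPI_pos. apply C_ext; simpl; field; lra.
Qed.

Lemma clim_fst a b : clim (locally ((a, b) : R * R)) (fun p => RtoC (fst p)) (RtoC a).
Proof.
  intros e He. exists (mkposreal e He). intros [x y] [Hx _]. simpl in *.
  rewrite <- RtoC_minus, Cmod_R. exact Hx.
Qed.

Lemma clim_snd c a b : rcont c -> clim (locally ((a, b) : R * R)) (fun p => c (snd p)) (c b).
Proof.
  intros Hc e He. destruct (Hc b e He) as [d H]. exists d. intros [x y] [_ Hy]. simpl in *.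
  apply H. exact Hy.
Qed.

Lemma rmean_param_derive (g g' : R -> R -> R) (a b l : R) :
  a < l < b ->
  (forall x, a < x < b -> forall t, is_derive (fun y => g y t) x (g' x t)) ->
  (forall x, a < x < b -> forall t, continuous (g x) t) ->
  (forall t, continuity_2d_pt g' l t) ->
  is_derive (fun x => rmean (g x)) l (rmean (g' l)).
Proof.
  intros Hl Hd Hc H2.
  assert (N : locally l (fun x => a < x < b)).
  { assert (D : 0 < Rmin (l - a) (b - l)) by (apply Rmin_glb_lt; lra).
    exists (mkposreal _ D). intros x Hx. change (Rabs (x - l) < Rmin (l - a) (b - l)) in Hx.
    pose proof (Rmin_l (l - a) (b - l)). pose proof (Rmin_r (l - a) (b - l)).
    apply Rabs_def2 in Hx. lra. }
  assert (E : forall t, Derive (fun y => g y t) l = g' l t)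
    by (intros; apply is_derive_unique; now apply Hd).
  unfold rmean.
  apply is_derive_ext with (fun x => / (2 * PI) * RInt (g x) 0 (2 * PI)).
  { intros x. unfold Rdiv. apply Rmult_comm. }
  replace (RInt (g' l) 0 (2 * PI) / (2 * PI))
    with (/ (2 * PI) * RInt (fun t => Derive (fun y => g y t) l) 0 (2 * PI)).
  2:{ unfold Rdiv. rewrite Rmult_comm. f_equal. apply (RInt_ext (V := R_CompleteNormedModule)). auto. }
  apply is_derive_scal.
  apply (is_derive_RInt_param g).
  - revert N. apply filter_imp. intros x Hx t _. eexists; now apply Hd.
  - intros t _. apply continuity_2d_pt_ext_loc with g'; auto.
    destruct N as [d N]. exists d. intros u v Hu _. symmetry. apply is_derive_unique. apply Hd.
    apply N. exact Hu.
  - revert N. apply filter_imp. intros x Hx. apply cont_ex_RInt. intros; now apply Hc.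
Qed.

(** Differentiation under the mean: if the derivative in the parameter has mean zero
    throughout, the mean does not move. *)
Lemma cmean_param_const (G G' : R -> R -> C) (d : R) :
  0 < d ->
  (forall x, - d < x < 1 + d -> forall t, rder (fun y => G y t) x (G' x t)) ->
  (forall x, - d < x < 1 + d -> rcont (G x)) ->
  (forall x t, - d < x < 1 + d ->
     clim (locally ((x, t) : R * R)) (fun p => G' (fst p) (snd p)) (G' x t)) ->
  (forall x, 0 <= x <= 1 -> cmean (G' x) = 0%C) ->
  cmean (G 1) = cmean (G 0).
Proof.
  intros Hd Hder Hc H2 Hz.
  assert (KR : forall x, 0 <= x <= 1 -> is_derive (fun x => Re (cmean (G x))) x 0).
  { intros x Hx. replace 0 with (Re (cmean (G' x))) by (rewrite Hz by auto; reflexivity).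
    apply (rmean_param_derive (fun x t => Re (G x t)) (fun x t => Re (G' x t)) (- d) (1 + d)); [lra| | |].
    - intros y Hy t. apply Hder; auto.
    - intros y Hy. apply rcont_re. auto.
    - intros t. apply continuity_2d_pt_filterlim.
      apply (clim_re _ (fun p => G' (fst p) (snd p))). apply H2; lra. }
  assert (KI : forall x, 0 <= x <= 1 -> is_derive (fun x => Im (cmean (G x))) x 0).
  { intros x Hx. replace 0 with (Im (cmean (G' x))) by (rewrite Hz by auto; reflexivity).
    apply (rmean_param_derive (fun x t => Im (G x t)) (fun x t => Im (G' x t)) (- d) (1 + d)); [lra| | |].
    - intros y Hy t. apply Hder; auto.
    - intros y Hy. apply rcont_im. auto.
    - intros t. apply continuity_2d_pt_filterlim.
      apply (clim_im _ (fun p => G' (fst p) (snd p))). apply H2; lra. }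
  apply C_ext; symmetry.
  - apply (eq_is_derive (V := R_NormedModule) (fun x => Re (cmean (G x))) 0 1); [exact KR|lra].
  - apply (eq_is_derive (V := R_NormedModule) (fun x => Im (cmean (G x))) 0 1); [exact KI|lra].
Qed.

Definition circ (r t : R) : C := (RtoC r * cis t)%C.

Lemma rcont_circ r : rcont (circ r).
Proof. apply rcont_mult; [apply rcont_const|apply rcont_cis]. Qed.

Lemma Cmod_circ r t : 0 <= r -> Cmod (circ r t) = r.
Proof. intros. unfold circ. rewrite Cmod_mult, Cmod_cis, Cmod_R, Rabs_pos_eq; lra. Qed.

Lemma rder_circ r t : rder (circ r) t (Ci * circ r t)%C.
Proof.
  unfold circ. replace (Ci * (RtoC r * cis t))%C with (0 * cis t + RtoC r * (Ci * cis t))%C by ring.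
  apply (rder_mult (fun _ => RtoC r) cis); [apply rder_const|apply rder_cis].
Qed.

Lemma circ_period r : circ r (2 * PI) = circ r 0.
Proof. unfold circ. now rewrite cis_2PI, cis_0. Qed.

Lemma circ_neq r t z : 0 <= r -> Cmod z < r -> (circ r t - z)%C <> 0%C.
Proof.
  intros Hr Hz H. assert (circ r t = z). { replace z with (circ r t - (circ r t - z))%C by ring. rewrite H; ring. }
  rewrite <- H0, Cmod_circ in Hz; lra.
Qed.

Lemma circ_neq_0 r t : 0 < r -> circ r t <> 0%C.
Proof. intros H. apply Cneq_mod. rewrite Cmod_circ; lra. Qed.

Lemma cmean_cis : cmean cis = 0%C.
Proof.
  rewrite (cmean_ext _ (fun t => - Ci * (Ci * cis t))%C).
  2:{ intros t. replace (- Ci * (Ci * cis t))%C with (- (Ci * Ci) * cis t)%C by ring.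
      replace (Ci * Ci)%C with (- (1))%C by ceq. ring. }
  assert (RC : rcont (fun t => Ci * cis t)%C) by (apply rcont_mult; [apply rcont_const|apply rcont_cis]).
  rewrite cmean_scal by auto.
  rewrite (cmean_derive_periodic cis); auto; [ring|apply rder_cis|now rewrite cis_2PI, cis_0].
Qed.

(** The same deformation, applied to [1 / (zeta - x z)], normalises the Cauchy kernel. *)
Lemma cauchy_kernel_mean r z : Cmod z < r -> cmean (fun t => circ r t / (circ r t - z))%C = 1%C.
Proof.
  intros Hz. pose proof (Cmod_ge_0 z) as Pz.
  assert (Hd : 0 < (r - Cmod z) / (2 * r)) by (apply Rdiv_lt_0_compat; lra).
  set (d := (r - Cmod z) / (2 * r)) in *.
  assert (D : forall x, - d < x < 1 + d -> Cmod (RtoC x * z) < r).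
  { intros x Hx. rewrite Cmod_mult, Cmod_R.
    assert (d * (2 * r) = r - Cmod z) by (unfold d; field; lra).
    assert (d <= 1/2) by nra.
    assert (Rabs x <= 1 + d) by (apply Rabs_le; lra). nra. }
  assert (NZ : forall x t, - d < x < 1 + d -> (circ r t - RtoC x * z)%C <> 0%C)
    by (intros; apply circ_neq; auto; lra).
  pose proof (rcont_circ r) as RC.
  pose proof (cmean_param_const
    (fun x t => circ r t / (circ r t - RtoC x * z))%C
    (fun x t => z * (circ r t / ((circ r t - RtoC x * z) * (circ r t - RtoC x * z))))%C d Hd) as K.
  assert (K' : cmean (fun t => circ r t / (circ r t - RtoC 1 * z))%C
             = cmean (fun t => circ r t / (circ r t - RtoC 0 * z))%C).
  { apply K; clear K.
    - intros x Hx t. specialize (NZ x t Hx).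
      assert (HD : cder (fun w => circ r t * / (circ r t - w * z))%C (RtoC x)
        (0 * / (circ r t - RtoC x * z) + circ r t * - ((0 - (1 * z + RtoC x * 0)) / ((circ r t - RtoC x * z) * (circ r t - RtoC x * z))))%C).
      { apply (cder_mult (fun _ => circ r t) (fun w => / (circ r t - w * z))%C); [apply cder_const|].
        apply (cder_inv (fun w => circ r t - w * z)%C); auto.
        apply (cder_minus (fun _ => circ r t) (fun w => w * z)%C); [apply cder_const|].
        apply (cder_mult (fun w => w) (fun _ => z)); [apply cder_id|apply cder_const]. }
      pose proof (rder_comp _ (fun y => RtoC y) x _ 1%C HD (rder_RtoC (fun y => y) x 1 (is_derive_id x))) as R1.
      match type of R1 with rder _ _ ?l =>
        replace (z * (circ r t / ((circ r t - RtoC x * z) * (circ r t - RtoC x * z))))%C with l by (field; auto) end.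
      exact R1.
    - intros x Hx. apply rcont_div; auto. apply rcont_minus; auto. apply rcont_const.
    - intros x t Hx. specialize (NZ x t Hx).
      pose proof (clim_snd _ x t RC) as C2. pose proof (clim_fst x t) as C1.
      apply clim_mult; [typeclasses eauto|apply clim_const; typeclasses eauto|].
      apply clim_div; [typeclasses eauto|now apply Cmult_neq_0|auto|].
      apply clim_mult; [typeclasses eauto| |];
        (apply clim_minus; [typeclasses eauto|auto|]; apply clim_mult; auto;
         [typeclasses eauto|apply clim_const; typeclasses eauto]).
    - intros x Hx.
      assert (Hx' : - d < x < 1 + d) by lra.
      assert (RD : rcont (fun t => circ r t - RtoC x * z)%C) by (apply rcont_minus; auto; apply rcont_const).
      assert (RE : rcont (fun t => circ r t / ((circ r t - RtoC x * z) * (circ r t - RtoC x * z)))%C).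
      { apply rcont_div; auto. { intros t; apply Cmult_neq_0; auto. } now apply rcont_mult. }
      rewrite cmean_scal by auto.
      rewrite (cmean_ext _ (fun t => Ci * (- Ci * (circ r t / ((circ r t - RtoC x * z) * (circ r t - RtoC x * z)))))%C).
      2:{ intros t. rewrite Cmult_assoc. replace (Ci * - Ci)%C with (RtoC 1) by ceq. ring. }
      rewrite cmean_scal by (apply rcont_mult; auto; apply rcont_const).
      rewrite (cmean_derive_periodic (fun t => / (circ r t - RtoC x * z))%C); [ring| | |].
      + intros t. specialize (NZ x t Hx').
        pose proof (rder_comp (fun w => / (w - RtoC x * z))%C (circ r) t _ _
          (cder_inv (fun w => w - RtoC x * z)%C (circ r t) _ NZ
            (cder_minus (fun w => w) (fun _ => RtoC x * z)%C _ _ _ (cder_id _) (cder_const _ _))) (rder_circ r t)) as R1.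
        match type of R1 with rder _ _ ?l =>
          replace (- Ci * (circ r t / ((circ r t - RtoC x * z) * (circ r t - RtoC x * z))))%C with l by (field; auto) end.
        exact R1.
      + apply rcont_mult; auto. apply rcont_const.
      + now rewrite circ_period. }
  rewrite (cmean_ext _ (fun t => circ r t / (circ r t - RtoC 1 * z))%C) by (intros; now rewrite Cmult_1_l).
  rewrite K', (cmean_ext _ (fun _ => 1%C)); [apply cmean_const|].
  intros t. assert (circ r t <> 0%C) by (apply circ_neq_0; lra). field.
  replace (circ r t - 0 * z)%C with (circ r t) by ring. auto.
Qed.

(** Cauchy's formula, by shrinking the circle to the point [z]. *)
Theorem cauchy_formula r0 r f z :
  hol r0 f -> r < r0 -> Cmod z < r ->
  f z = cmean (fun t => f (circ r t) * circ r t / (circ r t - z))%C.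
Proof.
  intros [df Hf] Hr Hz. pose proof (Cmod_ge_0 z) as Pz.
  assert (Hd : 0 < (r0 - r) / (4 * r)) by (apply Rdiv_lt_0_compat; lra).
  set (d := (r0 - r) / (4 * r)) in *.
  set (P := fun x t => (z + RtoC x * (circ r t - z))%C).
  assert (D : forall x t, - d < x < 1 + d -> Cmod (P x t) < r0).
  { intros x t Hx. unfold P.
    replace (z + RtoC x * (circ r t - z))%C with (RtoC (1 - x) * z + RtoC x * circ r t)%C
      by (rewrite RtoC_minus; ring).
    eapply Rle_lt_trans; [apply Cmod_triangle|].
    rewrite !Cmod_mult, !Cmod_R, Cmod_circ by lra.
    assert (E : d * (4 * r) = r0 - r) by (unfold d; field; lra).
    assert (Rabs (1 - x) * Cmod z <= Rabs (1 - x) * r) by (apply Rmult_le_compat_l; [apply Rabs_pos|lra]).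
    assert (Rabs (1 - x) + Rabs x <= 1 + 2 * d).
    { unfold Rabs; destruct (Rcase_abs (1 - x)), (Rcase_abs x); lra. }
    nra. }
  pose proof (rcont_circ r) as RC.
  assert (RP : forall x, rcont (P x)).
  { intros x. unfold P. apply rcont_plus; [apply rcont_const|]. apply rcont_mult; [apply rcont_const|].
    apply rcont_minus; auto. apply rcont_const. }
  assert (NZ : forall t, (circ r t - z)%C <> 0%C) by (intros; apply circ_neq; lra).
  assert (RK : rcont (fun t => circ r t / (circ r t - z))%C).
  { apply rcont_div; auto. apply rcont_minus; auto; apply rcont_const. }
  pose proof (cmean_param_const
    (fun x t => f (P x t) * (circ r t / (circ r t - z)))%C
    (fun x t => df (P x t) * circ r t)%C d Hd) as K.
  assert (K' : cmean (fun t => f (P 1 t) * (circ r t / (circ r t - z)))%C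
             = cmean (fun t => f (P 0 t) * (circ r t / (circ r t - z)))%C).
  { apply K; clear K.
    - intros x Hx t.
      assert (R0 : rder (fun y => P y t) x (0 + (1 * (circ r t - z) + RtoC x * 0))%C).
      { unfold P. apply (rder_plus (fun _ => z)); [apply rder_const|].
        apply (rder_mult (fun y => RtoC y) (fun _ => circ r t - z)%C); [|apply rder_const].
        apply (rder_RtoC (fun y => y)). apply @is_derive_id. }
      pose proof (rder_mult _ (fun _ => circ r t / (circ r t - z))%C x _ _
        (rder_comp f _ x _ _ (proj1 (Hf (P x t) (D x t Hx))) R0) (rder_const _ x)) as R1.
      match type of R1 with rder _ _ ?l =>
        replace (df (P x t) * circ r t)%C with l by (field; auto) end.
      exact R1.
    - intros x Hx. apply rcont_mult; auto. apply rcont_comp; auto.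
      intros t. eapply holD_cont; eauto.
    - intros x t Hx.
      apply clim_mult; [typeclasses eauto| |apply (clim_snd (circ r)); auto].
      apply (clim_comp_cont (locally ((x, t) : R * R)) (fun p => P (fst p) (snd p)) df (P x t));
        [|now apply Hf, D].
      unfold P. apply clim_plus; [typeclasses eauto|apply clim_const; typeclasses eauto|].
      apply clim_mult; [typeclasses eauto|apply clim_fst|].
      apply clim_minus; [typeclasses eauto|now apply (clim_snd (circ r))|apply clim_const; typeclasses eauto].
    - intros x Hx. destruct (Req_dec x 0) as [->|Nx].
      + rewrite (cmean_ext _ (fun t => (df z * RtoC r) * cis t)%C).
        2:{ intros t. unfold P. replace (z + 0 * (circ r t - z))%C with z by ring. unfold circ. ring. }
        rewrite cmean_scal by apply rcont_cis. rewrite cmean_cis. ring.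
      + assert (Hx' : - d < x < 1 + d) by lra.
        assert (NX : RtoC x <> 0%C) by (intro H; apply RtoC_inj in H; auto).
        assert (RD : rcont (fun t => df (P x t) * circ r t)%C).
        { apply rcont_mult; auto. apply rcont_comp; auto. intros t. now apply Hf, D. }
        assert (NI : Ci <> 0%C) by (apply Cneq_mod; rewrite Cmod_Ci; lra).
        rewrite (cmean_ext _ (fun t => / (RtoC x * Ci) * ((RtoC x * Ci) * (df (P x t) * circ r t)))%C).
        2:{ intros t. field. split; auto. }
        rewrite cmean_scal by (apply rcont_mult; auto; apply rcont_const).
        rewrite (cmean_derive_periodic (fun t => f (P x t))%C); [ring| | |].
        * intros t.
          assert (R0 : rder (P x) t (0 + (0 * (circ r t - z) + RtoC x * (Ci * circ r t + - 0)))%C).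
          { unfold P. apply (rder_plus (fun _ => z)); [apply rder_const|].
            apply (rder_mult (fun y => RtoC x) (fun s => circ r s - z)%C); [apply rder_const|].
            apply (rder_plus (circ r) (fun _ => - z)%C); [apply rder_circ|].
            replace (- 0)%C with (RtoC 0) by ring. apply rder_const. }
          pose proof (rder_comp f _ t _ _ (proj1 (Hf (P x t) (D x t Hx'))) R0) as R1.
          match type of R1 with rder _ _ ?l =>
            replace (RtoC x * Ci * (df (P x t) * circ r t))%C with l by ring end.
          exact R1.
        * apply rcont_mult; auto. apply rcont_const.
        * unfold P. now rewrite circ_period. }
  transitivity (f z * cmean (fun t => circ r t / (circ r t - z)))%C.
  { rewrite cauchy_kernel_mean by auto. ring. }
  rewrite <- cmean_scal by auto.
  transitivity (cmean (fun t => f (P 0 t) * (circ r t / (circ r t - z)))%C).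
  { apply cmean_ext. intros t. unfold P. replace (z + 0 * (circ r t - z))%C with z by ring. auto. }
  rewrite <- K'. apply cmean_ext. intros t. unfold P.
  replace (z + 1 * (circ r t - z))%C with (circ r t) by ring. field; auto.
Qed.

Lemma rcont_bounded c : rcont c -> exists M, 0 < M /\ forall t, 0 <= t <= 2 * PI -> Cmod (c t) <= M.
Proof.
  intros H. pose proof twoPI_pos.
  destruct (continuity_ab_maj (fun t => Cmod (c t)) 0 (2 * PI)) as [x [Hx _]]; [lra| |].
  - intros t _. apply continuity_pt_filterlim. apply (rcont_cmod c H t).
  - exists (Cmod (c x) + 1). split; [pose proof (Cmod_ge_0 (c x)); lra|].
    intros t Ht. specialize (Hx t Ht). simpl in Hx. lra.
Qed.

(** * The Cauchy transform *)

Definition cauchyK (n : nat) (r : R) (c : R -> C) (z : C) : C :=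
  cmean (fun t => c t * circ r t * (/ (circ r t - z)) ^ n)%C.

Lemma rcont_pow f n : rcont f -> rcont (fun t => f t ^ n)%C.
Proof.
  intros H. induction n; [apply (rcont_const (RtoC 1))|].
  apply rcont_ext with (fun t => f t * f t ^ n)%C; [reflexivity|]. now apply rcont_mult.
Qed.

Lemma rcont_kernel r z : Cmod z < r -> rcont (fun t => / (circ r t - z))%C.
Proof.
  intros H. pose proof (Cmod_ge_0 z). apply rcont_inv.
  - intros t; apply circ_neq; lra.
  - apply rcont_minus; [apply rcont_circ|apply rcont_const].
Qed.

Lemma rcont_cauchyK n r c z : rcont c -> Cmod z < r ->
  rcont (fun t => c t * circ r t * (/ (circ r t - z)) ^ n)%C.
Proof.
  intros. apply rcont_mult; [apply rcont_mult; auto; apply rcont_circ|].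
  now apply rcont_pow, rcont_kernel.
Qed.

Lemma circ_dist r t z : 0 <= r -> r - Cmod z <= Cmod (circ r t - z).
Proof. intros H. pose proof (Cmod_rev_triangle (circ r t) z). rewrite Cmod_circ in H0; lra. Qed.

Lemma kernel_bound r t z d : 0 < r -> 0 < d -> Cmod z <= r - d -> Cmod (/ (circ r t - z)) <= / d.
Proof.
  intros Hr Hd Hz. rewrite Cmod_inv by (apply circ_neq; lra).
  apply Rinv_le_contravar; auto. pose proof (circ_dist r t z). lra.
Qed.

Section CauchyTransform.
Variables (r : R) (c : R -> C).
Hypothesis Hc : rcont c.

(** With [x = 1/(zeta - w)], [y = 1/(zeta - z)] and [h = w - z] one has [x - y = h x y],
    which turns each remainder of a difference quotient into [h^2] times a bounded factor. *)
Lemma cauchyK_remainder (n : nat) (a : C -> C -> C) (l : C -> C) z B d :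
  Cmod z < r -> 0 < d -> d <= (r - Cmod z) / 2 -> 0 <= B ->
  (forall w, Cmod (w - z) < d -> exists k, rcont k /\
     (forall t, 0 <= t <= 2 * PI -> Cmod (k t) <= B * Cmod (w - z) * Cmod (w - z)) /\
     (cauchyK n r c w - cauchyK n r c z - l z * (w - z) = cmean k)%C) ->
  cder (cauchyK n r c) z (l z).
Proof.
  intros Hz Hd Hd' HB H e He.
  exists (Rmin d (e / (B + 1))). split; [apply Rmin_glb_lt; auto; apply Rdiv_lt_0_compat; lra|].
  intros w Hw.
  assert (W1 : Cmod (w - z) < d) by (eapply Rlt_le_trans; [exact Hw|apply Rmin_l]).
  assert (W2 : Cmod (w - z) < e / (B + 1)) by (eapply Rlt_le_trans; [exact Hw|apply Rmin_r]).
  destruct (H w W1) as [k [Hk [Bk ->]]].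
  eapply Rle_trans; [apply Cmod_cmean_le; eauto|].
  apply Rmult_le_compat_r; [apply Cmod_ge_0|].
  apply (Rmult_lt_compat_r (B + 1)) in W2; [|lra].
  unfold Rdiv in W2. rewrite Rmult_assoc, Rinv_l, Rmult_1_r in W2 by lra.
  pose proof (Cmod_ge_0 (w - z)). nra.
Qed.

Lemma kernel_half z w t :
  Cmod z < r -> Cmod (w - z) < (r - Cmod z) / 2 ->
  Cmod w < r /\ Cmod (/ (circ r t - w)) <= 2 / (r - Cmod z) /\
  Cmod (/ (circ r t - z)) <= 2 / (r - Cmod z).
Proof.
  intros Hz Hw. pose proof (Cmod_ge_0 z). pose proof (Cmod_rev_triangle w z).
  assert (E : 2 / (r - Cmod z) = / ((r - Cmod z) / 2)) by (field; lra).
  rewrite E. split; [lra|]. split; apply kernel_bound; lra.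
Qed.

Lemma cauchyK_der1 z : Cmod z < r -> cder (cauchyK 1 r c) z (cauchyK 2 r c z).
Proof.
  intros Hz. pose proof (Cmod_ge_0 z) as Pz.
  destruct (rcont_bounded c Hc) as [M [HM BM]].
  set (b := 2 / (r - Cmod z)). assert (Hb : 0 < b) by (apply Rdiv_lt_0_compat; lra).
  apply (cauchyK_remainder 1 (fun _ _ => 0%C) (cauchyK 2 r c) z (M * r * (b * b * b)) ((r - Cmod z) / 2)); auto; try lra.
  { apply Rmult_le_pos; [nra|]. apply Rmult_le_pos; nra. }
  intros w Hw.
  exists (fun t => c t * circ r t * ((w - z) * (w - z) * (/ (circ r t - w) * (/ (circ r t - z) * / (circ r t - z)))))%C.
  destruct (kernel_half z w 0 Hz Hw) as [Hw' _].
  assert (K : forall t, (circ r t - w)%C <> 0%C /\ (circ r t - z)%C <> 0%C)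
    by (intros; split; apply circ_neq; lra).
  split; [|split].
  - apply rcont_mult; [apply rcont_mult; auto; apply rcont_circ|].
    apply rcont_mult; [apply rcont_const|].
    apply rcont_mult; [now apply rcont_kernel|]. now apply rcont_mult; apply rcont_kernel.
  - intros t Ht. destruct (kernel_half z w t Hz Hw) as [_ [K1 K2]]. fold b in K1, K2.
    rewrite !Cmod_mult, Cmod_circ by lra.
    pose proof (Cmod_ge_0 (w - z)). pose proof (Cmod_ge_0 (c t)).
    pose proof (Cmod_ge_0 (/ (circ r t - w))). pose proof (Cmod_ge_0 (/ (circ r t - z))).
    replace (M * r * (b * b * b) * Cmod (w - z) * Cmod (w - z))
      with (M * r * (Cmod (w - z) * Cmod (w - z) * (b * (b * b)))) by ring.
    apply Rmult_le_compat; [nra| |apply Rmult_le_compat_r; auto; lra|].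
    { apply Rmult_le_pos; [nra|]. apply Rmult_le_pos; auto. nra. }
    apply Rmult_le_compat_l; [nra|]. apply Rmult_le_compat; auto; [nra|]. apply Rmult_le_compat; auto.
  - unfold cauchyK. rewrite <- cmean_scal_r by now apply rcont_cauchyK.
    rewrite <- !cmean_minus; try (now apply rcont_cauchyK).
    2:{ apply rcont_minus; now apply rcont_cauchyK. }
    2:{ apply rcont_mult; [now apply rcont_cauchyK|apply rcont_const]. }
    apply cmean_ext. intros t. destruct (K t). simpl. field. auto.
Qed.

Lemma cauchyK_der2 z : Cmod z < r -> cder (cauchyK 2 r c) z (2 * cauchyK 3 r c z)%C.
Proof.
  intros Hz. pose proof (Cmod_ge_0 z) as Pz.
  destruct (rcont_bounded c Hc) as [M [HM BM]].
  set (b := 2 / (r - Cmod z)). assert (Hb : 0 < b) by (apply Rdiv_lt_0_compat; lra).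
  apply (cauchyK_remainder 2 (fun _ _ => 0%C) (fun z => 2 * cauchyK 3 r c z)%C z (M * r * (b * (b * b) * (3 * b))) ((r - Cmod z) / 2)); auto; try lra.
  { apply Rmult_le_pos; [nra|]. apply Rmult_le_pos; [apply Rmult_le_pos|]; nra. }
  intros w Hw.
  exists (fun t => c t * circ r t * ((w - z) * (w - z) * (/ (circ r t - w) * (/ (circ r t - z) * / (circ r t - z))
     * (/ (circ r t - w) + 2 * / (circ r t - z)))))%C.
  destruct (kernel_half z w 0 Hz Hw) as [Hw' _].
  assert (K : forall t, (circ r t - w)%C <> 0%C /\ (circ r t - z)%C <> 0%C)
    by (intros; split; apply circ_neq; lra).
  split; [|split].
  - apply rcont_mult; [apply rcont_mult; auto; apply rcont_circ|].
    apply rcont_mult; [apply rcont_const|].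
    apply rcont_mult; [apply rcont_mult; [now apply rcont_kernel|]; now apply rcont_mult; apply rcont_kernel|].
    apply rcont_plus; [now apply rcont_kernel|]. apply rcont_mult; [apply rcont_const|now apply rcont_kernel].
  - intros t Ht. destruct (kernel_half z w t Hz Hw) as [_ [K1 K2]]. fold b in K1, K2.
    rewrite (Cmod_mult (c t * circ r t)), (Cmod_mult (c t)), Cmod_circ by lra.
    rewrite (Cmod_mult ((w - z) * (w - z))), (Cmod_mult (w - z)).
    rewrite (Cmod_mult (/ (circ r t - w) * _)), (Cmod_mult (/ (circ r t - w))), (Cmod_mult (/ (circ r t - z))).
    assert (K3 : Cmod (/ (circ r t - w) + 2 * / (circ r t - z)) <= 3 * b).
    { eapply Rle_trans; [apply Cmod_triangle|]. rewrite Cmod_mult, Cmod_R, Rabs_pos_eq; lra. }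
    pose proof (Cmod_ge_0 (w - z)). pose proof (Cmod_ge_0 (c t)).
    pose proof (Cmod_ge_0 (/ (circ r t - w))). pose proof (Cmod_ge_0 (/ (circ r t - z))).
    pose proof (Cmod_ge_0 (/ (circ r t - w) + 2 * / (circ r t - z))).
    replace (M * r * (b * (b * b) * (3 * b)) * Cmod (w - z) * Cmod (w - z))
      with (M * r * (Cmod (w - z) * Cmod (w - z) * (b * (b * b) * (3 * b)))) by ring.
    apply Rmult_le_compat; [nra| |apply Rmult_le_compat_r; auto; lra|].
    { apply Rmult_le_pos; [nra|]. repeat apply Rmult_le_pos; auto. }
    apply Rmult_le_compat_l; [nra|].
    apply Rmult_le_compat; auto; [apply Rmult_le_pos; nra|].
    apply Rmult_le_compat; auto; [nra|]. apply Rmult_le_compat; auto.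
  - unfold cauchyK. rewrite <- cmean_scal by now apply rcont_cauchyK.
    rewrite <- cmean_scal_r by (apply rcont_mult; [apply rcont_const|now apply rcont_cauchyK]).
    rewrite <- !cmean_minus; try (now apply rcont_cauchyK).
    2:{ apply rcont_minus; now apply rcont_cauchyK. }
    2:{ apply rcont_mult; [apply rcont_mult; [apply rcont_const|now apply rcont_cauchyK]|apply rcont_const]. }
    apply cmean_ext. intros t. destruct (K t). simpl. field. auto.
Qed.

Lemma cauchyK_cont3 z : Cmod z < r -> ccont (cauchyK 3 r c) z.
Proof.
  intros Hz e He. pose proof (Cmod_ge_0 z) as Pz.
  destruct (rcont_bounded c Hc) as [M [HM BM]].
  set (b := 2 / (r - Cmod z)). assert (Hb : 0 < b) by (apply Rdiv_lt_0_compat; lra).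
  set (B := M * r * (b * b * (3 * (b * b)))).
  assert (HB : 0 <= B) by (unfold B; apply Rmult_le_pos; [nra|]; apply Rmult_le_pos; nra).
  exists (Rmin ((r - Cmod z) / 2) (e / (B + 1))). split.
  { apply Rmin_glb_lt; [lra|]. apply Rdiv_lt_0_compat; lra. }
  intros w Hw.
  assert (W1 : Cmod (w - z) < (r - Cmod z) / 2) by (eapply Rlt_le_trans; [exact Hw|apply Rmin_l]).
  assert (W2 : Cmod (w - z) < e / (B + 1)) by (eapply Rlt_le_trans; [exact Hw|apply Rmin_r]).
  destruct (kernel_half z w 0 Hz W1) as [Hw' _].
  unfold cauchyK. rewrite <- cmean_minus by (now apply rcont_cauchyK).
  apply Rle_lt_trans with (B * Cmod (w - z)).
  - apply Cmod_cmean_le. { apply rcont_minus; now apply rcont_cauchyK. }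
    intros t Ht. destruct (kernel_half z w t Hz W1) as [_ [K1 K2]]. fold b in K1, K2.
    assert (N1 : (circ r t - w)%C <> 0%C) by (apply circ_neq; lra).
    assert (N2 : (circ r t - z)%C <> 0%C) by (apply circ_neq; lra).
    set (x := (/ (circ r t - w))%C) in *. set (y := (/ (circ r t - z))%C) in *.
    replace (c t * circ r t * x ^ 3 - c t * circ r t * y ^ 3)%C
      with (c t * circ r t * (x * y * (x * x + (x * y + y * y)) * (w - z)))%C.
    2:{ assert (E : (x - y = x * y * (w - z))%C) by (unfold x, y; field; auto).
        transitivity (c t * circ r t * ((x - y) * (x * x + (x * y + y * y))))%C; [rewrite E; ring|ring]. }
    rewrite (Cmod_mult (c t * circ r t)), (Cmod_mult (c t)), Cmod_circ by lra.
    rewrite (Cmod_mult _ (w - z)), (Cmod_mult (x * y)), (Cmod_mult x y).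
    pose proof (Cmod_ge_0 x). pose proof (Cmod_ge_0 y). pose proof (Cmod_ge_0 (c t)).
    pose proof (Cmod_ge_0 (w - z)). pose proof (Cmod_ge_0 (x * x + (x * y + y * y))).
    assert (K3 : Cmod (x * x + (x * y + y * y)) <= 3 * (b * b)).
    { eapply Rle_trans; [apply Cmod_triangle|].
      eapply Rle_trans; [apply Rplus_le_compat_l, Cmod_triangle|]. rewrite !Cmod_mult.
      assert (Cmod x * Cmod x <= b * b) by (apply Rmult_le_compat; auto).
      assert (Cmod x * Cmod y <= b * b) by (apply Rmult_le_compat; auto).
      assert (Cmod y * Cmod y <= b * b) by (apply Rmult_le_compat; auto). lra. }
    unfold B. rewrite (Rmult_assoc (M * r)).
    apply Rmult_le_compat; [nra| |apply Rmult_le_compat_r; auto; lra|].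
    { repeat apply Rmult_le_pos; auto. }
    apply Rmult_le_compat_r; auto. apply Rmult_le_compat; auto; [nra|]. apply Rmult_le_compat; auto.
  - apply (Rmult_lt_compat_r (B + 1)) in W2; [|lra].
    unfold Rdiv in W2. rewrite Rmult_assoc, Rinv_l, Rmult_1_r in W2 by lra.
    pose proof (Cmod_ge_0 (w - z)). nra.
Qed.

Lemma cauchyK_hol1 : holD r (cauchyK 1 r c) (cauchyK 2 r c).
Proof.
  intros z Hz. split; [now apply cauchyK_der1|]. eapply cder_ccont. now apply cauchyK_der2.
Qed.

Lemma cauchyK_hol2 : holD r (cauchyK 2 r c) (fun z => 2 * cauchyK 3 r c z)%C.
Proof.
  intros z Hz. split; [now apply cauchyK_der2|]. pose proof (cauchyK_cont3 z Hz) as H.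
  unfold ccont; clim_tac.
Qed.
End CauchyTransform.

Lemma hol_rcont_circ r0 r f : hol r0 f -> 0 <= r < r0 -> rcont (fun t => f (circ r t)).
Proof.
  intros H Hr. apply rcont_comp; [|apply rcont_circ]. intros t. eapply hol_cont; eauto.
  rewrite Cmod_circ; lra.
Qed.

Lemma cauchyK_formula r0 r f z : hol r0 f -> r < r0 -> Cmod z < r ->
  f z = cauchyK 1 r (fun t => f (circ r t)) z.
Proof.
  intros Hf Hr Hz. rewrite (cauchy_formula r0 r f z) by auto.
  apply cmean_ext. intros t. unfold Cdiv. ring.
Qed.

Lemma cauchyK_formula_der r0 r f df z : holD r0 f df -> r < r0 -> Cmod z < r ->
  df z = cauchyK 2 r (fun t => f (circ r t)) z.
Proof.
  intros Hf Hr Hz. pose proof (Cmod_ge_0 z).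
  apply (cder_unique f z); [apply Hf; lra|].
  apply cder_ext_loc with (cauchyK 1 r (fun t => f (circ r t))).
  - generalize (disk_open r z Hz). apply filter_imp. intros w Hw. symmetry.
    eapply cauchyK_formula; eauto. exists df; eassumption.
  - apply cauchyK_der1; auto. eapply hol_rcont_circ; [exists df; eassumption|lra].
Qed.

Lemma hol_glue r0 f : (forall r, r < r0 -> hol r f) -> hol r0 f.
Proof.
  intros H. exists (C_derive f). intros z Hz.
  destruct (H ((Cmod z + r0) / 2)) as [df Hf]; [lra|].
  assert (Hz' : Cmod z < (Cmod z + r0) / 2) by lra.
  assert (E : forall w, Cmod w < (Cmod z + r0) / 2 -> df w = C_derive f w).
  { intros w Hw. symmetry. apply C_derive_cder. now apply Hf. }
  split; [rewrite <- E by auto; now apply Hf|].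
  apply ccont_ext_loc with df; [|now apply Hf].
  generalize (disk_open _ z Hz'). apply filter_imp. auto.
Qed.

(** By the integral formula the derivative is itself a Cauchy transform, and Cauchy transforms
    can be differentiated under the mean. *)
Theorem hol_derivative r0 f df : holD r0 f df -> hol r0 df.
Proof.
  intros Hf. apply hol_glue. intros r Hr.
  destruct (Rle_or_lt r 0) as [Z|P].
  { exists (fun _ => 0%C). intros z Hz. pose proof (Cmod_ge_0 z). lra. }
  apply hol_ext with (cauchyK 2 r (fun t => f (circ r t))).
  - intros z Hz. symmetry. eapply cauchyK_formula_der; eauto.
  - eexists. apply cauchyK_hol2. eapply hol_rcont_circ; [exists df; eassumption|lra].
Qed.

Lemma mean_value r0 r f : hol r0 f -> 0 < r < r0 -> cmean (fun t => f (circ r t)) = f 0%C.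
Proof.
  intros Hf Hr. rewrite (cauchy_formula r0 r f 0%C); auto; [|lra|rewrite Cmod_0; lra].
  apply cmean_ext. intros t. assert (circ r t <> 0%C) by (apply circ_neq_0; lra). field.
  replace (circ r t - 0)%C with (circ r t) by ring. auto.
Qed.

(** * The maximum principle *)

(** The integral formula bounds [|f z|] by [k * max |f|] on the circle; applied to the powers
    of [f] it gives the bound with constant [1]. *)
Theorem max_modulus r0 r f M :
  hol r0 f -> r < r0 -> (forall z, Cmod z = r -> Cmod (f z) <= M) ->
  forall z, Cmod z < r -> Cmod (f z) <= M.
Proof.
  intros Hf Hr HM z Hz. pose proof (Cmod_ge_0 z) as Pz.
  assert (M0 : 0 <= M).
  { eapply Rle_trans; [|apply (HM (circ r 0))]; [apply Cmod_ge_0|apply Cmod_circ; lra]. }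
  destruct (Rle_or_lt (Cmod (f z)) M) as [|N]; auto. exfalso.
  assert (B : forall n, Cmod (f z) ^ n <= M ^ n * (r / (r - Cmod z))).
  { intros n. rewrite <- Cmod_pow.
    rewrite (cauchyK_formula r0 r (fun w => f w ^ n)%C z); auto; [|now apply hol_pow].
    apply Cmod_cmean_le.
    - apply rcont_cauchyK; auto. apply rcont_pow. eapply hol_rcont_circ; eauto; lra.
    - intros t _. rewrite !Cmod_mult, !Cmod_pow, Cmod_circ by lra. rewrite pow_1.
      unfold Rdiv. rewrite Rmult_assoc. apply Rmult_le_compat.
      + apply pow_le, Cmod_ge_0.
      + apply Rmult_le_pos; [lra|apply Cmod_ge_0].
      + apply pow_incr. split; [apply Cmod_ge_0|]. apply HM. apply Cmod_circ; lra.
      + apply Rmult_le_compat_l; [lra|]. apply kernel_bound; lra. }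
  set (q := Cmod (f z)) in *. set (k := r / (r - Cmod z)) in *.
  destruct (Rle_lt_or_eq_dec _ _ M0) as [P|<-].
  - assert (Q : 1 < q / M) by (apply Rmult_lt_reg_r with M; auto; unfold Rdiv; rewrite Rmult_assoc, Rinv_l; lra).
    destruct (Pow_x_infinity (q / M)) with (b := k + 1) as [n Hn]; [rewrite Rabs_pos_eq; lra|].
    specialize (Hn n (Nat.le_refl _)). specialize (B n).
    rewrite Rabs_pos_eq in Hn by (apply pow_le; lra).
    assert (E : q ^ n = (q / M) ^ n * M ^ n).
    { rewrite <- Rpow_mult_distr. f_equal. field; lra. }
    rewrite E in B. assert (0 < M ^ n) by (apply pow_lt; auto). nra.
  - specialize (B 1%nat). rewrite !pow_1 in B. lra.
Qed.

(** The maximum principle for [exp (- f)]. *)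
Corollary min_real_part r0 r f m :
  hol r0 f -> r < r0 -> (forall z, Cmod z = r -> m <= Re (f z)) ->
  forall z, Cmod z < r -> m <= Re (f z).
Proof.
  intros Hf Hr HM z Hz.
  assert (K : Cmod (cexp (- f z)) <= exp (- m)).
  { apply (max_modulus r0 r (fun w => cexp (- f w))); auto; [hol_tac|].
    intros w Hw. rewrite Cmod_cexp, re_opp. specialize (HM w Hw).
    destruct (Rle_lt_or_eq_dec _ _ HM) as [L|<-]; [|lra]. left. apply exp_increasing; lra. }
  rewrite Cmod_cexp, re_opp in K. destruct (Rle_or_lt m (Re (f z))); auto.
  pose proof (exp_increasing (- m) (- Re (f z))). lra.
Qed.

(** * Power series *)

Fixpoint psum (a : nat -> C) (n : nat) (z : C) : C :=
  match n with O => 0%C | S m => (psum a m z + a m * z ^ m)%C end.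

(** Convergence is required locally uniformly so that limits pass through means over circles;
    [plim_useries] recovers it from pointwise convergence. *)
Definition useries (r : R) (a : nat -> C) (f : C -> C) :=
  forall s, s < r -> forall eps, 0 < eps ->
  exists N, forall n, (N <= n)%nat -> forall z, Cmod z <= s -> Cmod (psum a n z - f z) <= eps.

Definition pder (a : nat -> C) (k : nat) : C := (RtoC (INR (S k)) * a (S k))%C.

Lemma cder_pow n z : cder (fun w => w ^ S n)%C z (RtoC (INR (S n)) * z ^ n)%C.
Proof.
  induction n.
  - apply cder_ext with (fun w => w); [intros; simpl; ring|].
    apply cder_eq with (RtoC 1); [apply cder_id|]. simpl. ring.
  - apply cder_ext with (fun w => w * w ^ S n)%C; [reflexivity|].
    apply cder_eq with (1 * z ^ S n + z * (RtoC (INR (S n)) * z ^ n))%C.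
    + apply (cder_mult (fun w => w) (fun w => w ^ S n)%C); auto. apply cder_id.
    + rewrite (S_INR (S n)), RtoC_plus. simpl (z ^ S n)%C. ring.
Qed.

Lemma holD_psum r a n : holD r (psum a (S n)) (psum (pder a) n).
Proof.
  induction n.
  - apply holD_ext with (fun _ => a O) (fun _ => 0%C); [| |apply holD_const].
    + intros; simpl; ring. + reflexivity.
  - apply holD_ext with (fun z => psum a (S n) z + a (S n) * z ^ S n)%C
      (fun z => psum (pder a) n z + (0 * z ^ S n + a (S n) * (RtoC (INR (S n)) * z ^ n)))%C.
    + reflexivity.
    + intros z _. simpl psum. unfold pder. ring.
    + apply holD_plus; auto. apply (holD_mult r (fun _ => a (S n))); [apply holD_const|].
      intros z Hz. split; [apply cder_pow|].
      eapply hol_cont with (r := r); auto. apply hol_mult; [apply hol_const|]. apply hol_pow, hol_id.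
Qed.

Lemma hol_psum r a n : hol r (psum a n).
Proof.
  destruct n; [apply (hol_const r (RtoC 0))|]. eexists; apply holD_psum.
Qed.

Lemma psum_tail a M q z m : 0 <= M -> 0 <= q < 1 -> (forall k, Cmod (a k * z ^ k) <= M * q ^ k) ->
  forall n, Cmod (psum a (m + n) z - psum a n z) <= M * q ^ n / (1 - q) * (1 - q ^ m).
Proof.
  intros HM Hq H n. induction m.
  - simpl. replace (psum a n z - psum a n z)%C with (RtoC 0) by ring. rewrite Cmod_0. lra.
  - simpl psum. replace (psum a (m + n) z + a (m + n)%nat * z ^ (m + n) - psum a n z)%C
      with ((psum a (m + n) z - psum a n z) + a (m + n)%nat * z ^ (m + n))%C by ring.
    eapply Rle_trans; [apply Cmod_triangle|].
    specialize (H (m + n)%nat). rewrite pow_add in H.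
    replace (M * q ^ n / (1 - q) * (1 - q ^ S m))
      with (M * q ^ n / (1 - q) * (1 - q ^ m) + M * (q ^ m * q ^ n)) by (simpl; field; lra).
    lra.
Qed.

Lemma geom_small M q : 0 <= M -> 0 <= q < 1 -> forall eps, 0 < eps ->
  exists N, forall n, (N <= n)%nat -> M * q ^ n / (1 - q) <= eps.
Proof.
  intros HM Hq e He.
  destruct (pow_lt_1_zero q) with (y := e * (1 - q) / (M + 1)) as [N HN].
  - rewrite Rabs_pos_eq; lra.
  - apply Rdiv_lt_0_compat; [|lra]. apply Rmult_lt_0_compat; lra.
  - exists N. intros n Hn. specialize (HN n Hn). rewrite Rabs_pos_eq in HN by (apply pow_le; lra).
    apply (Rmult_lt_compat_r (M + 1)) in HN; [|lra].
    unfold Rdiv in HN. rewrite Rmult_assoc, Rinv_l, Rmult_1_r in HN by lra.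
    assert (0 <= q ^ n) by (apply pow_le; lra).
    apply Rmult_le_reg_r with (1 - q); [lra|]. unfold Rdiv. rewrite Rmult_assoc, Rinv_l by lra. nra.
Qed.

Definition plim (a : nat -> C) (z l : C) :=
  forall eps, 0 < eps -> exists N, forall n, (N <= n)%nat -> Cmod (psum a n z - l) <= eps.

Lemma plim_coef_bounded a z l : plim a z l -> exists M, 0 <= M /\ forall k, Cmod (a k * z ^ k) <= M.
Proof.
  intros H. destruct (H 1 Rlt_0_1) as [N HN].
  assert (F : exists M, 0 <= M /\ forall k, (k < N)%nat -> Cmod (a k * z ^ k) <= M).
  { clear HN. induction N.
    - exists 0. split; [lra|]. intros; lia.
    - destruct IHN as [M [M0 HM]]. exists (M + Cmod (a N * z ^ N)).
      pose proof (Cmod_ge_0 (a N * z ^ N)). split; [lra|]. intros k Hk.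
      destruct (Nat.eq_dec k N) as [->|]; [lra|]. specialize (HM k ltac:(lia)). lra. }
  destruct F as [M [M0 HM]]. exists (M + 2). split; [lra|]. intros k.
  destruct (le_lt_dec N k) as [L|L]; [|specialize (HM k L); lra].
  pose proof (HN k L) as H1. pose proof (HN (S k) ltac:(lia)) as H2.
  replace (a k * z ^ k)%C with ((psum a (S k) z - l) - (psum a k z - l))%C by (simpl; ring).
  eapply Rle_trans; [apply Cmod_triangle|]. rewrite Cmod_opp. lra.
Qed.

(** Convergence at a point of larger modulus bounds the terms there, so on smaller discs the
    series is dominated by a geometric one. *)
Lemma plim_useries r a f : (forall z, Cmod z < r -> plim a z (f z)) -> useries r a f.
Proof.
  intros H s Hs e He.
  destruct (Rlt_le_dec s 0) as [Neg|Pos].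
  { exists O. intros n _ z Hz. pose proof (Cmod_ge_0 z). lra. }
  set (p := (s + r) / 2). assert (Hp : s < p < r) by (unfold p; lra).
  destruct (plim_coef_bounded a (RtoC p) (f (RtoC p))) as [M [M0 HM]].
  { apply H. rewrite Cmod_R, Rabs_pos_eq; lra. }
  set (q := s / p). assert (Hq : 0 <= q < 1).
  { unfold q; split; [apply Rdiv_le_0_compat; lra|]. apply Rmult_lt_reg_r with p; [lra|].
    unfold Rdiv. rewrite Rmult_assoc, Rinv_l; lra. }
  destruct (geom_small M q M0 Hq e He) as [N HN]. exists N. intros n Hn z Hz.
  specialize (HN n Hn).
  assert (T : forall k, Cmod (a k * z ^ k) <= M * q ^ k).
  { intros k. specialize (HM k). rewrite Cmod_mult, Cmod_pow in *. rewrite Cmod_R, Rabs_pos_eq in HM by lra.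
    apply Rle_trans with (Cmod (a k) * s ^ k).
    - apply Rmult_le_compat_l; [apply Cmod_ge_0|]. apply pow_incr. split; auto; apply Cmod_ge_0.
    - replace (s ^ k) with (p ^ k * q ^ k) by (rewrite <- Rpow_mult_distr; f_equal; unfold q; field; lra).
      rewrite <- Rmult_assoc. apply Rmult_le_compat_r; auto. apply pow_le; lra. }
  apply le_epsilon. intros d Hd.
  destruct (H z ltac:(lra) d Hd) as [N' HN'].
  specialize (HN' (N' + n)%nat ltac:(lia)).
  pose proof (psum_tail a M q z N' M0 Hq T n) as K.
  replace (psum a n z - f z)%C with ((psum a (N' + n) z - f z) - (psum a (N' + n) z - psum a n z))%C by ring.
  eapply Rle_trans; [apply Cmod_triangle|]. rewrite Cmod_opp.
  assert (0 <= q ^ N') by (apply pow_le; lra).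
  assert (0 <= M * q ^ n / (1 - q)).
  { apply Rdiv_le_0_compat; [|lra]. apply Rmult_le_pos; auto. apply pow_le; lra. }
  nra.
Qed.

Lemma useries_plim r a f z : useries r a f -> Cmod z < r -> plim a z (f z).
Proof. intros H Hz e He. destruct (H (Cmod z) Hz e He) as [N HN]. exists N. intros n Hn. apply HN; auto; lra. Qed.

Lemma plim_unique a z l l' : plim a z l -> plim a z l' -> l = l'.
Proof.
  intros H H'. apply C_eq_of_small. intros e He.
  destruct (H (e/4) ltac:(lra)) as [N HN]. destruct (H' (e/4) ltac:(lra)) as [N' HN'].
  specialize (HN (N + N')%nat ltac:(lia)). specialize (HN' (N + N')%nat ltac:(lia)).
  replace (l - l')%C with ((psum a (N + N') z - l') - (psum a (N + N') z - l))%C by ring.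
  eapply Rle_lt_trans; [apply Cmod_triangle|]. rewrite Cmod_opp. lra.
Qed.

Lemma useries_ccont r a f z : useries r a f -> Cmod z < r -> ccont f z.
Proof.
  intros H Hz e He. destruct (H ((Cmod z + r) / 2) ltac:(lra) (e / 4) ltac:(lra)) as [N HN].
  specialize (HN N (Nat.le_refl _)).
  pose proof (hol_cont r (psum a N) z (hol_psum r a N) Hz (e / 4) ltac:(lra)) as C1.
  generalize (filter_and _ _ C1 (disk_open ((Cmod z + r) / 2) z ltac:(lra))).
  apply filter_imp. intros w [W1 W2].
  pose proof (HN w ltac:(lra)). pose proof (HN z ltac:(lra)).
  replace (f w - f z)%C with (- (psum a N w - f w) + ((psum a N w - psum a N z) + (psum a N z - f z)))%C by ring.
  eapply Rle_lt_trans; [apply Cmod_triangle|]. rewrite Cmod_opp.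
  eapply Rle_lt_trans; [apply Rplus_le_compat_l, Cmod_triangle|]. lra.
Qed.

Lemma cauchyK_diff_bound n r c c' z e : rcont c -> rcont c' -> Cmod z < r -> 0 <= e ->
  (forall t, 0 <= t <= 2 * PI -> Cmod (c t - c' t) <= e) ->
  Cmod (cauchyK n r c z - cauchyK n r c' z) <= e * (r * (/ (r - Cmod z)) ^ n).
Proof.
  intros Hc Hc' Hz He H. pose proof (Cmod_ge_0 z).
  unfold cauchyK. rewrite <- cmean_minus by now apply rcont_cauchyK.
  apply Cmod_cmean_le; [apply rcont_minus; now apply rcont_cauchyK|].
  intros t Ht.
  replace (c t * circ r t * (/ (circ r t - z)) ^ n - c' t * circ r t * (/ (circ r t - z)) ^ n)%C
    with ((c t - c' t) * (circ r t * (/ (circ r t - z)) ^ n))%C by ring.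
  rewrite !Cmod_mult, Cmod_pow, Cmod_circ by lra.
  apply Rmult_le_compat; auto; [apply Cmod_ge_0| |].
  - apply Rmult_le_pos; [lra|]. apply pow_le, Cmod_ge_0.
  - apply Rmult_le_compat_l; [lra|]. apply pow_incr. split; [apply Cmod_ge_0|]. apply kernel_bound; lra.
Qed.

Lemma useries_rcont r s a f : useries r a f -> 0 <= s < r -> rcont (fun t => f (circ s t)).
Proof.
  intros H Hs. apply rcont_comp; [|apply rcont_circ]. intros t. eapply useries_ccont; eauto.
  rewrite Cmod_circ; lra.
Qed.

(** Limits pass through the integral formula. *)
Lemma useries_cauchyK r s a f n : useries r a f -> 0 < s < r -> forall z, Cmod z < s ->
  forall eps, 0 < eps -> exists N, forall k, (N <= k)%nat ->
  Cmod (cauchyK n s (fun t => psum a k (circ s t)) z - cauchyK n s (fun t => f (circ s t)) z) <= eps.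
Proof.
  intros H Hs z Hz e He. set (k0 := s * (/ (s - Cmod z)) ^ n).
  assert (K0 : 0 < k0) by (apply Rmult_lt_0_compat; [lra|]; apply pow_lt, Rinv_0_lt_compat; lra).
  destruct (H s ltac:(lra) (e / k0)) as [N HN]; [now apply Rdiv_lt_0_compat|].
  exists N. intros k Hk.
  replace e with (e / k0 * k0) by (field; lra).
  apply cauchyK_diff_bound; auto.
  - eapply hol_rcont_circ; [apply (hol_psum r)|lra].
  - eapply useries_rcont; eauto; lra.
  - apply Rlt_le, Rdiv_lt_0_compat; auto.
  - intros t _. apply HN; auto. rewrite Cmod_circ; lra.
Qed.

Lemma useries_formula r s a f z : useries r a f -> 0 < s < r -> Cmod z < s ->
  f z = cauchyK 1 s (fun t => f (circ s t)) z.
Proof.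
  intros H Hs Hz. apply (plim_unique a z); [eapply useries_plim; eauto; lra|].
  intros e He. destruct (useries_cauchyK r s a f 1 H Hs z Hz e He) as [N HN].
  exists N. intros n Hn. rewrite (cauchyK_formula r s (psum a n) z) by (try lra; apply hol_psum). auto.
Qed.

Theorem useries_hol r a f : useries r a f -> hol r f.
Proof.
  intros H. apply hol_glue. intros s Hs.
  destruct (Rle_or_lt s 0) as [Z|P].
  { exists (fun _ => 0%C). intros z Hz. pose proof (Cmod_ge_0 z). lra. }
  apply hol_ext with (cauchyK 1 s (fun t => f (circ s t))).
  - intros z Hz. symmetry. eapply useries_formula; eauto.
  - eexists. apply cauchyK_hol1. eapply useries_rcont; eauto; lra.
Qed.

Theorem useries_derivative r a f df : useries r a f -> holD r f df -> useries r (pder a) df.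
Proof.
  intros H Hf. apply plim_useries. intros z Hz e He. pose proof (Cmod_ge_0 z) as Pz.
  set (s := (Cmod z + r) / 2). assert (Hs : Cmod z < s < r) by (unfold s; lra).
  destruct (useries_cauchyK r s a f 2 H ltac:(lra) z ltac:(lra) e He) as [N HN].
  exists N. intros n Hn. specialize (HN (S n) ltac:(lia)).
  rewrite (cauchyK_formula_der r s (psum a (S n)) (psum (pder a) n) z) by (try lra; apply holD_psum).
  rewrite (cauchyK_formula_der r s f df z) by (auto; lra). exact HN.
Qed.

Lemma cmean_cis_pow n : cmean (fun t => cis t ^ S n)%C = 0%C.
Proof.
  assert (H := mean_value 2 1 (fun z => z ^ S n)%C (hol_pow 2 _ _ (hol_id 2)) ltac:(lra)).
  simpl in H. rewrite Cmult_0_l in H. rewrite <- H. apply cmean_ext. intros t. simpl.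
  unfold circ. rewrite !Cmult_1_l. reflexivity.
Qed.

Lemma rcont_psum_mult a n s k : 0 <= s ->
  rcont (fun t => psum a n (circ s t) * (Cconj (cis t)) ^ k)%C.
Proof.
  intros Hs. apply rcont_mult.
  - eapply hol_rcont_circ with (r0 := s + 1); [apply hol_psum|lra].
  - apply rcont_pow, rcont_conj, rcont_cis.
Qed.

Lemma cis_conj_mul t : (cis t * Cconj (cis t))%C = 1%C.
Proof. rewrite Cconj_mult_self, Cmod_cis. ceq. Qed.

Lemma cmean_cis_orth j k : j <> k -> cmean (fun t => cis t ^ j * Cconj (cis t) ^ k)%C = 0%C.
Proof.
  intros H.
  destruct (le_lt_dec k j) as [L|L].
  - rewrite (cmean_ext _ (fun t => cis t ^ S (j - k - 1))%C); [apply cmean_cis_pow|].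
    intros t. replace j with (S (j - k - 1) + k)%nat at 1 by lia.
    rewrite Cpow_add_r, <- Cmult_assoc, <- Cpow_mult_l, cis_conj_mul, Cpow_1_l. ring.
  - rewrite (cmean_ext _ (fun t => Cconj (cis t ^ S (k - j - 1)))%C).
    + rewrite cmean_conj, cmean_cis_pow; [ceq|]. apply rcont_pow, rcont_cis.
    + intros t. rewrite Cpow_conj. replace k with (j + S (k - j - 1))%nat at 1 by lia.
      rewrite Cpow_add_r, Cmult_assoc, <- Cpow_mult_l, cis_conj_mul, Cpow_1_l. ring.
Qed.

Lemma cmean_psum_coef a s k n : 0 <= s -> (k < n)%nat ->
  cmean (fun t => psum a n (circ s t) * Cconj (cis t) ^ k)%C = (a k * RtoC s ^ k)%C.
Proof.
  intros Hs.
  assert (T : forall j, rcont (fun t => cis t ^ j * Cconj (cis t) ^ k)%C).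
  { intros j. apply rcont_mult; apply rcont_pow; [apply rcont_cis|apply rcont_conj, rcont_cis]. }
  assert (Z : forall n, (n <= k)%nat -> cmean (fun t => psum a n (circ s t) * Cconj (cis t) ^ k)%C = 0%C).
  { induction n0; intros L.
    - rewrite (cmean_ext _ (fun _ => 0%C)); [apply cmean_const|]. intros; simpl; ring.
    - rewrite (cmean_ext _ (fun t => psum a n0 (circ s t) * Cconj (cis t) ^ k
        + (a n0 * RtoC s ^ n0) * (cis t ^ n0 * Cconj (cis t) ^ k))%C).
      + rewrite cmean_plus, IHn0, cmean_scal, cmean_cis_orth; auto; try lia; try ring.
        * now apply rcont_psum_mult.
        * apply rcont_mult; auto. apply rcont_const.
      + intros t. simpl. unfold circ. rewrite Cpow_mult_l. ring. }
  intros Hk. induction n; [lia|].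
  rewrite (cmean_ext _ (fun t => psum a n (circ s t) * Cconj (cis t) ^ k
        + (a n * RtoC s ^ n) * (cis t ^ n * Cconj (cis t) ^ k))%C).
  2:{ intros t. simpl. unfold circ. rewrite Cpow_mult_l. ring. }
  rewrite cmean_plus, cmean_scal; auto; [|now apply rcont_psum_mult|apply rcont_mult; auto; apply rcont_const].
  destruct (Nat.eq_dec k n) as [->|Hn].
  - rewrite Z by lia. rewrite (cmean_ext _ (fun _ => 1%C)).
    + rewrite cmean_const; ring.
    + intros t. now rewrite <- Cpow_mult_l, cis_conj_mul, Cpow_1_l.
  - rewrite IHn by lia. rewrite cmean_cis_orth by auto. ring.
Qed.

(** Only the term of index [k] survives the mean, by orthogonality of the powers of [cis t]. *)
Theorem useries_coef r s a f k : useries r a f -> 0 <= s < r ->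
  cmean (fun t => f (circ s t) * Cconj (cis t) ^ k)%C = (a k * RtoC s ^ k)%C.
Proof.
  intros H Hs. apply C_eq_of_small. intros e He.
  destruct (H s ltac:(lra) (e/2) ltac:(lra)) as [N HN].
  specialize (HN (N + S k)%nat ltac:(lia)).
  rewrite <- (cmean_psum_coef a s k (N + S k)) by (try lra; lia).
  assert (RF : rcont (fun t => f (circ s t) * Cconj (cis t) ^ k)%C).
  { apply rcont_mult; [eapply useries_rcont; eauto|]. apply rcont_pow, rcont_conj, rcont_cis. }
  rewrite <- cmean_minus; auto; [|apply rcont_psum_mult; lra].
  apply Rle_lt_trans with (e / 2); [|lra].
  apply Cmod_cmean_le; [apply rcont_minus; auto; apply rcont_psum_mult; lra|].
  intros t _. rewrite <- Cmod_opp.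
  replace (- (f (circ s t) * Cconj (cis t) ^ k - psum a (N + S k) (circ s t) * Cconj (cis t) ^ k))%C
    with ((psum a (N + S k) (circ s t) - f (circ s t)) * Cconj (cis t) ^ k)%C by ring.
  rewrite Cmod_mult, Cmod_pow, Cmod_conj, Cmod_cis, pow1, Rmult_1_r.
  apply HN. rewrite Cmod_circ; lra.
Qed.

Lemma taylor_on_circle r0 r f : hol r0 f -> 0 < r < r0 -> exists a, useries r a f.
Proof.
  intros Hf Hr.
  set (g := fun t => f (circ r t)).
  assert (Rg : rcont g) by (eapply hol_rcont_circ; eauto; lra).
  assert (RI : rcont (fun t => / circ r t)%C).
  { apply rcont_inv; [intros; apply circ_neq_0; lra|apply rcont_circ]. }
  set (a := fun k => cmean (fun t => g t * (/ circ r t) ^ k)%C).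
  assert (RA : forall k, rcont (fun t => g t * (/ circ r t) ^ k)%C)
    by (intros; apply rcont_mult; auto; now apply rcont_pow).
  destruct (rcont_bounded g Rg) as [M [HM BM]].
  assert (RE : forall n z, Cmod z < r -> rcont (fun t => (g t * (z * / circ r t) ^ n) * (circ r t * / (circ r t - z)))%C).
  { intros n z Hz. apply rcont_mult.
    - apply rcont_mult; auto. apply rcont_pow, rcont_mult; auto. apply rcont_const.
    - apply rcont_mult; [apply rcont_circ|now apply rcont_kernel]. }
  assert (E : forall n z, Cmod z < r ->
    (f z - psum a n z = cmean (fun t => (g t * (z * / circ r t) ^ n) * (circ r t * / (circ r t - z))))%C).
  { induction n; intros z Hz.
    - simpl. replace (f z - 0)%C with (f z) by ring. rewrite (cauchyK_formula r0 r f z) by (auto; lra).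
      apply cmean_ext. intros t. unfold g. simpl. ring.
    - simpl psum. replace (f z - (psum a n z + a n * z ^ n))%C with ((f z - psum a n z) - a n * z ^ n)%C by ring.
      rewrite IHn by auto. unfold a. rewrite <- cmean_scal_r by auto.
      rewrite <- cmean_minus; auto; [|apply rcont_mult; auto; apply rcont_const].
      apply cmean_ext. intros t.
      assert (N1 : circ r t <> 0%C) by (apply circ_neq_0; lra).
      assert (N2 : (circ r t - z)%C <> 0%C) by (apply circ_neq; lra).
      simpl Cpow. rewrite !Cpow_mult_l. field. auto. }
  exists a. intros s Hs e He.
  destruct (Rlt_le_dec s 0) as [Neg|Pos].
  { exists O. intros n _ z Hz. pose proof (Cmod_ge_0 z). lra. }
  set (q := s / r). assert (Hq : 0 <= q < 1).
  { unfold q; split; [apply Rdiv_le_0_compat; lra|]. apply Rmult_lt_reg_r with r; [lra|].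
    unfold Rdiv. rewrite Rmult_assoc, Rinv_l; lra. }
  destruct (geom_small M q ltac:(lra) Hq e He) as [N HN]. exists N. intros n Hn z Hz.
  specialize (HN n Hn). rewrite Cmod_sub_sym, E by lra.
  eapply Rle_trans; [|exact HN]. pose proof (Cmod_ge_0 z) as Pz.
  apply Cmod_cmean_le; [apply RE; lra|]. intros t Ht.
  rewrite !Cmod_mult, Cmod_pow, Cmod_mult, Cmod_circ by lra.
  rewrite Cmod_inv by (apply circ_neq_0; lra). rewrite Cmod_circ by lra.
  unfold Rdiv at 1. apply Rmult_le_compat.
  - apply Rmult_le_pos; [apply Cmod_ge_0|]. apply pow_le. apply Rmult_le_pos; auto.
    apply Rlt_le, Rinv_0_lt_compat; lra.
  - apply Rmult_le_pos; [lra|apply Cmod_ge_0].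
  - apply Rmult_le_compat; [apply Cmod_ge_0| |now apply BM|].
    + apply pow_le. apply Rmult_le_pos; auto. apply Rlt_le, Rinv_0_lt_compat; lra.
    + apply pow_incr. split. { apply Rmult_le_pos; auto. apply Rlt_le, Rinv_0_lt_compat; lra. }
      apply Rmult_le_compat_r; auto. apply Rlt_le, Rinv_0_lt_compat; lra.
  - replace (/ (1 - q)) with (r * / (r - s)) by (unfold q; field; lra).
    apply Rmult_le_compat_l; [lra|]. apply kernel_bound; lra.
Qed.

Theorem taylor r0 f : 0 < r0 -> hol r0 f -> exists a, useries r0 a f.
Proof.
  intros P Hf.
  destruct (taylor_on_circle r0 (r0 / 2) f Hf ltac:(lra)) as [a Ha].
  exists a. intros s Hs.
  destruct (taylor_on_circle r0 ((Rmax s (r0 / 2) + r0) / 2) f Hf) as [b Hb].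
  { pose proof (Rmax_r s (r0 / 2)). assert (Rmax s (r0 / 2) < r0) by (apply Rmax_lub_lt; lra). lra. }
  assert (M1 : s < (Rmax s (r0 / 2) + r0) / 2).
  { pose proof (Rmax_l s (r0 / 2)). lra. }
  assert (M2 : r0 / 2 < (Rmax s (r0 / 2) + r0) / 2).
  { pose proof (Rmax_r s (r0 / 2)). lra. }
  assert (E : forall k, a k = b k).
  { intros k. pose proof (useries_coef _ (r0 / 4) a f k Ha ltac:(lra)) as H1.
    pose proof (useries_coef _ (r0 / 4) b f k Hb ltac:(lra)) as H2. rewrite H1 in H2.
    assert (N : (RtoC (r0 / 4) ^ k)%C <> 0%C) by (apply Cpow_nz; intro K; apply RtoC_inj in K; lra).
    replace (a k) with (a k * RtoC (r0 / 4) ^ k / RtoC (r0 / 4) ^ k)%C by (field; auto).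
    rewrite H2. field; auto. }
  assert (E' : forall n z, psum a n z = psum b n z).
  { induction n; intros; simpl; auto. now rewrite IHn, E. }
  intros e He. destruct (Hb s M1 e He) as [N HN]. exists N. intros. rewrite E'. auto.
Qed.

(** * Difference quotients, primitives and logarithms *)

(** The quotient is the Cauchy transform of [f zeta / (zeta - y)], which is holomorphic at [y] too. *)
Theorem difference_quotient r0 f df y : holD r0 f df -> Cmod y < r0 ->
  exists D, hol r0 D /\ D y = df y /\ forall a, Cmod a < r0 -> (f a - f y = (a - y) * D a)%C.
Proof.
  intros Hf Hy. pose proof (Cmod_ge_0 y) as Py.
  set (D := fun a => if excluded_middle_informative (a = y) then df y else ((f a - f y) / (a - y))%C).
  exists D. split; [|split].
  - apply hol_glue. intros r' Hr'.
    set (r := (Rmax r' (Cmod y) + r0) / 2).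
    assert (Hr : r' <= r < r0 /\ Cmod y < r).
    { unfold r. pose proof (Rmax_l r' (Cmod y)). pose proof (Rmax_r r' (Cmod y)).
      assert (Rmax r' (Cmod y) < r0) by (apply Rmax_lub_lt; lra). lra. }
    apply hol_sub with r; [lra|].
    assert (RF : rcont (fun t => f (circ r t))) by (eapply hol_rcont_circ; [exists df; eassumption|lra]).
    assert (RK : forall z, Cmod z < r -> rcont (fun t => / (circ r t - z))%C) by (intros; now apply rcont_kernel).
    apply hol_ext with (cauchyK 1 r (fun t => f (circ r t) * / (circ r t - y))%C).
    2:{ eexists. apply cauchyK_hol1. apply rcont_mult; auto. apply RK; lra. }
    intros z Hz. unfold D. destruct (excluded_middle_informative (z = y)) as [->|N].
    + rewrite (cauchyK_formula_der r0 r f df y) by (auto; lra).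
      apply cmean_ext. intros t. simpl. ring.
    + assert (N' : (z - y)%C <> 0%C).
      { intro H. apply N. replace z with (z - y + y)%C by ring. rewrite H; ring. }
      rewrite (cauchyK_formula r0 r f z), (cauchyK_formula r0 r f y); try lra; try (exists df; eassumption).
      unfold cauchyK. rewrite <- cmean_minus by (apply rcont_cauchyK; auto; lra).
      unfold Cdiv. rewrite <- cmean_scal_r by (apply rcont_minus; apply rcont_cauchyK; auto; lra).
      apply cmean_ext. intros t.
      assert ((circ r t - z)%C <> 0%C) by (apply circ_neq; lra).
      assert ((circ r t - y)%C <> 0%C) by (apply circ_neq; lra).
      simpl. field. auto.
  - unfold D. destruct (excluded_middle_informative (y = y)); congruence.
  - intros a Ha. unfold D. destruct (excluded_middle_informative (a = y)) as [->|N]; [ring|].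
    assert (N' : (a - y)%C <> 0%C).
    { intro H. apply N. replace a with (a - y + y)%C by ring. rewrite H; ring. }
    field; auto.
Qed.

Lemma rder_ray f df r z s : holD r f df -> Cmod (RtoC s * z) < r ->
  rder (fun x => f (RtoC x * z)%C) s (df (RtoC s * z) * z)%C.
Proof.
  intros Hf Hs. apply (rder_comp f (fun x => RtoC x * z)%C); [now apply Hf|].
  eapply rder_eq; [apply (rder_mult (fun x => RtoC x) (fun _ => z) s 1%C 0%C);
    [exact (rder_RtoC (fun y => y) s 1 (is_derive_id s))|apply rder_const]|cbv beta; ring].
Qed.

Lemma ray_in_disk r z s : 0 <= s <= 1 -> Cmod z < r -> Cmod (RtoC s * z) < r.
Proof.
  intros Hs Hz. rewrite Cmod_mult, Cmod_R, Rabs_pos_eq by lra. pose proof (Cmod_ge_0 z). nra.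
Qed.

Lemma hol_constant r f : holD r f (fun _ => 0%C) -> forall z, Cmod z < r -> f z = f 0%C.
Proof.
  intros Hf z Hz.
  assert (H : forall s, 0 <= s <= 1 -> rder (fun x => f (RtoC x * z)%C) s 0).
  { intros s Hs. replace (RtoC 0) with (0 * z)%C by ring.
    apply (rder_ray f (fun _ => 0%C) r); auto. now apply ray_in_disk. }
  assert (E1 : f z = f (RtoC 1 * z)%C) by (f_equal; ring).
  assert (E0 : f 0%C = f (RtoC 0 * z)%C) by (f_equal; ring).
  rewrite E1, E0. apply C_ext; symmetry.
  - apply (eq_is_derive (V := R_NormedModule) (fun x => Re (f (RtoC x * z)%C)) 0 1); [|lra].
    intros s Hs. apply (H s Hs).
  - apply (eq_is_derive (V := R_NormedModule) (fun x => Im (f (RtoC x * z)%C)) 0 1); [|lra].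
    intros s Hs. apply (H s Hs).
Qed.

Lemma plim_exists a M q z : 0 <= M -> 0 <= q < 1 -> (forall k, Cmod (a k * z ^ k) <= M * q ^ k) ->
  exists l, plim a z l.
Proof.
  intros HM Hq H.
  assert (CS : forall eps, 0 < eps -> exists N, forall n m : nat, (N <= n)%nat -> (N <= m)%nat ->
    Cmod (psum a n z - psum a m z) <= eps).
  { intros e He. destruct (geom_small M q HM Hq (e / 2) ltac:(lra)) as [N HN].
    assert (K : forall n, (N <= n)%nat -> Cmod (psum a n z - psum a N z) <= e / 2).
    { intros n Hn. replace n with ((n - N) + N)%nat by lia.
      eapply Rle_trans; [apply (psum_tail a M q z (n - N) HM Hq H N)|].
      specialize (HN N (Nat.le_refl _)). assert (0 <= q ^ (n - N)) by (apply pow_le; lra).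
      assert (0 <= M * q ^ N / (1 - q)).
      { apply Rdiv_le_0_compat; [|lra]. apply Rmult_le_pos; auto. apply pow_le; lra. }
      nra. }
    exists N. intros n m Hn Hm. pose proof (K n Hn). pose proof (K m Hm).
    eapply Rle_trans; [apply (Cmod_tri3 _ (psum a N z))|]. rewrite (Cmod_sub_sym (psum a N z)). lra. }
  destruct (Rcomplete.R_complete (fun n => Re (psum a n z))) as [x Hx].
  { intros e He. destruct (CS (e / 2) ltac:(lra)) as [N HN]. exists N. intros n m Hn Hm.
    unfold Rdist. replace (Re (psum a n z) - Re (psum a m z)) with (Re (psum a n z - psum a m z)%C)
      by (unfold Re; simpl; ring).
    eapply Rle_lt_trans; [apply re_le_Cmod|]. specialize (HN n m Hn Hm). lra. }
  destruct (Rcomplete.R_complete (fun n => Im (psum a n z))) as [y Hy].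
  { intros e He. destruct (CS (e / 2) ltac:(lra)) as [N HN]. exists N. intros n m Hn Hm.
    unfold Rdist. replace (Im (psum a n z) - Im (psum a m z)) with (Im (psum a n z - psum a m z)%C)
      by (unfold Im; simpl; ring).
    eapply Rle_lt_trans; [apply im_le_Cmod|]. specialize (HN n m Hn Hm). lra. }
  exists (x, y). intros e He.
  destruct (Hx (e / 2) ltac:(lra)) as [N1 H1]. destruct (Hy (e / 2) ltac:(lra)) as [N2 H2].
  exists (N1 + N2)%nat. intros n Hn. specialize (H1 n ltac:(lia)). specialize (H2 n ltac:(lia)).
  unfold Rdist in *. eapply Rle_trans; [apply Cmod_le_re_im|].
  replace (Re (psum a n z - (x, y))%C) with (Re (psum a n z) - x) by (unfold Re; simpl; ring).
  replace (Im (psum a n z - (x, y))%C) with (Im (psum a n z) - y) by (unfold Im; simpl; ring).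
  lra.
Qed.

Theorem primitive r0 u : 0 < r0 -> hol r0 u -> exists U, holD r0 U u.
Proof.
  intros P Hu. destruct (taylor r0 u P Hu) as [a Ha].
  set (b := fun k => match k with O => RtoC 0 | S k => (a k / RtoC (INR (S k)))%C end).
  assert (NI : forall k, RtoC (INR (S k)) <> 0%C).
  { intros k H. apply RtoC_inj in H. pose proof (lt_0_INR (S k) ltac:(lia)). lra. }
  assert (EX : forall z, Cmod z < r0 -> exists l, plim b z l).
  { intros z Hz. pose proof (Cmod_ge_0 z) as Pz.
    set (p := (Cmod z + r0) / 2). assert (Hp : Cmod z < p < r0) by (unfold p; lra).
    destruct (plim_coef_bounded a (RtoC p) (u (RtoC p))) as [M [M0 HM]].
    { eapply useries_plim; eauto. rewrite Cmod_R, Rabs_pos_eq; lra. }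
    apply (plim_exists b (M * p) (Cmod z / p)).
    - apply Rmult_le_pos; lra.
    - split; [apply Rdiv_le_0_compat; lra|]. apply Rmult_lt_reg_r with p; [lra|].
      unfold Rdiv. rewrite Rmult_assoc, Rinv_l; lra.
    - intros [|k].
      + simpl. replace (0 * 1)%C with (RtoC 0) by ring. rewrite Cmod_0. nra.
      + unfold b. rewrite Cmod_mult, Cmod_pow, Cmod_div by auto.
        specialize (HM k). rewrite Cmod_mult, Cmod_pow, Cmod_R, Rabs_pos_eq in HM by lra.
        rewrite Cmod_R, Rabs_pos_eq by (apply pos_INR).
        assert (I : 1 <= INR (S k)) by (rewrite S_INR; pose proof (pos_INR k); lra).
        replace (M * p * (Cmod z / p) ^ S k) with (M * (Cmod z ^ S k / p ^ k)).
        2:{ unfold Rdiv. rewrite Rpow_mult_distr, pow_inv. simpl. field. split; [apply pow_nonzero|]; lra. }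
        assert (0 < p ^ k) by (apply pow_lt; lra).
        assert (0 <= Cmod z ^ S k) by (apply pow_le; lra).
        assert (Cmod (a k) / INR (S k) <= Cmod (a k)).
        { pose proof (Cmod_ge_0 (a k)). apply Rmult_le_reg_r with (INR (S k)); [lra|].
          unfold Rdiv. rewrite Rmult_assoc, Rinv_l by lra. nra. }
        apply Rle_trans with (Cmod (a k) * Cmod z ^ S k); [apply Rmult_le_compat_r; auto|].
        replace (Cmod (a k) * Cmod z ^ S k) with ((Cmod (a k) * p ^ k) * (Cmod z ^ S k / p ^ k)) by (field; lra).
        apply Rmult_le_compat_r; auto. apply Rdiv_le_0_compat; lra. }
  set (U := fun z => epsilon (inhabits (0%C : C)) (fun l => plim b z l)).
  assert (HU : useries r0 b U).
  { apply plim_useries. intros z Hz. apply epsilon_spec. now apply EX. }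
  destruct (useries_hol r0 b U HU) as [dU HdU].
  pose proof (useries_derivative r0 b U dU HU HdU) as HD.
  exists U. apply holD_ext with U dU; auto. intros z Hz.
  apply (plim_unique a z); [|eapply useries_plim; eauto].
  intros e He. destruct (useries_plim _ _ _ z HD Hz e He) as [N HN]. exists N. intros n Hn.
  replace (psum a n z) with (psum (pder b) n z); [auto|].
  clear. assert (E : forall k, pder b k = a k).
  { intros k. unfold pder, b. field. intros H. apply RtoC_inj in H. pose proof (lt_0_INR (S k) ltac:(lia)). lra. }
  induction n; simpl; auto. now rewrite IHn, E.
Qed.

(** A primitive [l] of [p' / p] makes [p exp (- l)] constant. *)
Theorem logarithm r0 (p dp : C -> C) l0 :
  0 < r0 -> holD r0 p dp -> (forall z, Cmod z < r0 -> p z <> 0%C) -> cexp l0 = p 0%C ->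
  exists l, holD r0 l (fun z => dp z / p z)%C /\ l 0%C = l0 /\
    forall z, Cmod z < r0 -> cexp (l z) = p z.
Proof.
  intros P Hp Nz H0.
  assert (Hp' : hol r0 p) by (exists dp; auto).
  assert (Hdp : hol r0 dp) by (eapply hol_derivative; eauto).
  destruct (primitive r0 (fun z => dp z / p z)%C P) as [U HU]; [hol_tac; auto|].
  exists (fun z => U z - (U 0 - l0))%C.
  assert (HL : holD r0 (fun z => U z - (U 0 - l0))%C (fun z => dp z / p z)%C).
  { apply holD_ext with (fun z => U z - (U 0 - l0))%C (fun z => dp z / p z - 0)%C; auto.
    - intros; ring.
    - apply (holD_minus r0 U (fun _ => U 0 - l0)%C); auto. apply holD_const. }
  split; [auto|split; [ring|]].
  assert (HK : holD r0 (fun z => p z * cexp (- (U z - (U 0 - l0))))%C (fun _ => 0%C)).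
  { eapply holD_ext; [reflexivity| |eapply holD_mult; [exact Hp|apply holD_cexp, holD_opp, HL]].
    intros z Hz. simpl. field. auto. }
  intros z Hz. pose proof (hol_constant _ _ HK z Hz) as E. simpl in E.
  replace (U 0 - (U 0 - l0))%C with l0 in E by ring.
  rewrite <- H0, cexp_opp_r in E.
  pose proof (cexp_opp_r (U z - (U 0 - l0))) as E'.
  set (L := (U z - (U 0 - l0))%C) in *.
  transitivity (cexp L * (p z * cexp (- L)))%C; [rewrite E; ring|].
  transitivity (p z * (cexp L * cexp (- L)))%C; [ring|]. rewrite E'. ring.
Qed.

(** * The Schwarz lemma and its invariant forms *)

Lemma le_of_scaled x y : (forall r, 0 < r < 1 -> r * x <= y) -> x <= y.
Proof.
  intros H. destruct (Rle_or_lt x y) as [|N]; auto.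
  destruct (Rle_or_lt x 0) as [Z|P].
  - specialize (H (1/2) ltac:(lra)). lra.
  - pose proof (H (1/2) ltac:(lra)).
    assert (0 < (x + y) / (2 * x) < 1).
    { split; [apply Rdiv_lt_0_compat; lra|]. apply Rmult_lt_reg_r with (2 * x); [lra|].
      unfold Rdiv; rewrite Rmult_assoc, Rinv_l; lra. }
    specialize (H _ H1). replace ((x + y) / (2 * x) * x) with ((x + y) / 2) in H by (field; lra). lra.
Qed.

Theorem schwarz f df : holD 1 f df -> f 0%C = 0%C -> (forall z, Cmod z < 1 -> Cmod (f z) <= 1) ->
  (forall z, Cmod z < 1 -> Cmod (f z) <= Cmod z) /\ Cmod (df 0%C) <= 1.
Proof.
  intros Hf H0 Hb.
  destruct (difference_quotient 1 f df 0%C Hf) as [D [HD [D0 DE]]]; [rewrite Cmod_0; lra|].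
  assert (K : forall z, Cmod z < 1 -> Cmod (D z) <= 1).
  { intros z Hz. pose proof (Cmod_ge_0 z) as Pz. apply le_of_scaled. intros r Hr.
    set (s := Rmax r ((1 + Cmod z) / 2)).
    assert (Hs : r <= s < 1 /\ Cmod z < s).
    { unfold s. pose proof (Rmax_l r ((1 + Cmod z) / 2)). pose proof (Rmax_r r ((1 + Cmod z) / 2)).
      assert (Rmax r ((1 + Cmod z) / 2) < 1) by (apply Rmax_lub_lt; lra). lra. }
    assert (Cmod (D z) <= / s).
    { apply (max_modulus 1 s D); auto; try lra. intros w Hw.
      specialize (Hb w ltac:(lra)). specialize (DE w ltac:(lra)). rewrite H0 in DE.
      replace (f w) with (w * D w)%C in Hb.
      2:{ replace (f w) with (f w - 0)%C by ring. rewrite DE. ring. }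
      rewrite Cmod_mult, Hw in Hb. apply Rmult_le_reg_l with s; [lra|]. rewrite Rinv_r; lra. }
    pose proof (Cmod_ge_0 (D z)).
    apply Rle_trans with (s * Cmod (D z)); [nra|].
    apply Rle_trans with (s * / s); [apply Rmult_le_compat_l; lra|]. rewrite Rinv_r; lra. }
  split.
  - intros z Hz. specialize (DE z Hz). rewrite H0 in DE.
    replace (f z) with (z * D z)%C.
    2:{ replace (f z) with (f z - 0)%C by ring. rewrite DE. ring. }
    rewrite Cmod_mult. specialize (K z Hz). pose proof (Cmod_ge_0 z). nra.
  - rewrite <- D0. apply K. rewrite Cmod_0; lra.
Qed.

Lemma blaschke_identity a z :
  Cmod (1 - Cconj a * z) ^ 2 - Cmod (z - a) ^ 2 = (1 - Cmod a ^ 2) * (1 - Cmod z ^ 2).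
Proof. rewrite !Cmod2_alt. destruct a, z; unfold Re, Im; simpl; ring. Qed.

Lemma blaschke_denom a z : Cmod a < 1 -> Cmod z <= 1 -> (1 - Cconj a * z)%C <> 0%C.
Proof.
  intros Ha Hz. apply Cneq_mod.
  pose proof (Cmod_rev_triangle 1 (Cconj a * z)). rewrite Cmod_mult, Cmod_conj, Cmod_1 in H.
  pose proof (Cmod_ge_0 a). pose proof (Cmod_ge_0 z). nra.
Qed.

Lemma sq_lt_reg x y : 0 <= y -> x ^ 2 < y ^ 2 -> x < y.
Proof. intros. nra. Qed.
Lemma sq_le_reg x y : 0 <= y -> x ^ 2 <= y ^ 2 -> x <= y.
Proof. intros. nra. Qed.

Lemma blaschke_lt a z : Cmod a < 1 -> Cmod z < 1 -> Cmod (z - a) < Cmod (1 - Cconj a * z).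
Proof.
  intros Ha Hz. apply sq_lt_reg; [apply Cmod_ge_0|].
  pose proof (blaschke_identity a z). pose proof (Cmod_ge_0 a). pose proof (Cmod_ge_0 z).
  assert (0 < (1 - Cmod a ^ 2) * (1 - Cmod z ^ 2)) by (apply Rmult_lt_0_compat; nra). lra.
Qed.

Definition moebius (a z : C) : C := ((z + a) / (1 + Cconj a * z))%C.

Lemma moebius_denom a z : Cmod a < 1 -> Cmod z < 1 -> (1 + Cconj a * z)%C <> 0%C.
Proof.
  intros Ha Hz. replace (1 + Cconj a * z)%C with (1 - Cconj (- a) * z)%C by (rewrite Copp_conj; ring).
  apply blaschke_denom; [now rewrite Cmod_opp|lra].
Qed.

Lemma moebius_disk a z : Cmod a < 1 -> Cmod z < 1 -> Cmod (moebius a z) < 1.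
Proof.
  intros Ha Hz. pose proof (moebius_denom a z Ha Hz) as N. unfold moebius. rewrite Cmod_div by auto.
  assert (P : 0 < Cmod (1 + Cconj a * z)) by now apply Cmod_gt_0.
  apply Rmult_lt_reg_r with (Cmod (1 + Cconj a * z)); auto.
  unfold Rdiv. rewrite Rmult_assoc, Rinv_l by lra.
  pose proof (blaschke_lt (- a) z) as B. rewrite Cmod_opp in B. specialize (B Ha Hz).
  replace (z - - a)%C with (z + a)%C in B by ring.
  replace (1 - Cconj (- a) * z)%C with (1 + Cconj a * z)%C in B by (rewrite Copp_conj; ring). lra.
Qed.

Lemma holD_moebius a : Cmod a < 1 ->
  holD 1 (moebius a) (fun z => (1 - a * Cconj a) / ((1 + Cconj a * z) * (1 + Cconj a * z)))%C.
Proof.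
  intros Ha. unfold moebius.
  assert (H1 : holD 1 (fun z => 1 + Cconj a * z)%C (fun z => 0 + (0 * z + Cconj a * 1))%C).
  { apply (holD_plus 1 (fun _ => 1%C)); [apply holD_const|].
    apply (holD_mult 1 (fun _ => Cconj a) (fun z => z)); [apply holD_const|apply holD_id]. }
  assert (N : forall z, Cmod z < 1 -> (1 + Cconj a * z)%C <> 0%C) by (intros; now apply moebius_denom).
  eapply holD_ext; [reflexivity| |apply (holD_mult 1 (fun z => z + a)%C (fun z => / (1 + Cconj a * z))%C);
    [apply (holD_plus 1 (fun z => z) (fun _ => a)); [apply holD_id|apply holD_const]
    |apply (holD_inv 1 _ _ N H1)]].
  intros z Hz. simpl. specialize (N z Hz). field. auto.
Qed.

(** Automorphisms of the disc move [a] and [f a] to [0], where the Schwarz lemma applies. *)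
Theorem schwarz_pick f : hol 1 f -> (forall z, Cmod z < 1 -> Cmod (f z) < 1) ->
  forall a z, Cmod a < 1 -> Cmod z < 1 ->
  Cmod (f z - f a) * Cmod (1 - Cconj a * z) <= Cmod (1 - Cconj (f a) * f z) * Cmod (z - a).
Proof.
  intros Hf Hb a z Ha Hz.
  assert (HM : hol 1 (fun w => f (moebius a w))).
  { apply (hol_comp 1 1 f); auto; [intros; now apply moebius_disk|]. eexists; now apply holD_moebius. }
  assert (Hb' : forall w, Cmod w < 1 -> Cmod (f (moebius a w)) < 1) by (intros; apply Hb; now apply moebius_disk).
  assert (HF : hol 1 (fun w => (f (moebius a w) - f a) / (1 - Cconj (f a) * f (moebius a w)))%C).
  { hol_tac. intros w Hw. apply blaschke_denom; auto. apply Rlt_le; auto. }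
  assert (M0 : moebius a 0 = a) by (unfold moebius; field; intro K; ring_simplify (1 + Cconj a * 0)%C in K; apply RtoC_inj in K; lra).
  destruct HF as [dF HF].
  destruct (schwarz _ dF HF) as [S _].
  - rewrite M0. replace (f a - f a)%C with (RtoC 0) by ring. unfold Cdiv. ring.
  - intros w Hw. specialize (Hb' w Hw). specialize (Hb a Ha).
    pose proof (blaschke_denom (f a) (f (moebius a w)) Hb ltac:(lra)) as N.
    rewrite Cmod_div by auto. pose proof (blaschke_lt (f a) (f (moebius a w)) Hb Hb').
    apply Rmult_le_reg_r with (Cmod (1 - Cconj (f a) * f (moebius a w))); [now apply Cmod_gt_0|].
    unfold Rdiv. rewrite Rmult_assoc, Rinv_l; [lra|]. apply Rgt_not_eq. now apply Cmod_gt_0.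
  - set (w := ((z - a) / (1 - Cconj a * z))%C).
    assert (Nz : (1 - Cconj a * z)%C <> 0%C) by (apply blaschke_denom; auto; lra).
    assert (Pz : 0 < Cmod (1 - Cconj a * z)) by now apply Cmod_gt_0.
    assert (Hw : Cmod w < 1).
    { unfold w. rewrite Cmod_div by auto. apply Rmult_lt_reg_r with (Cmod (1 - Cconj a * z)); auto.
      unfold Rdiv. rewrite Rmult_assoc, Rinv_l by lra. pose proof (blaschke_lt a z Ha Hz). lra. }
    assert (Mw : moebius a w = z).
    { assert (Na : (1 - Cconj a * a)%C <> 0%C) by (apply blaschke_denom; auto; lra).
      unfold moebius, w. field. split; auto.
      replace (1 - Cconj a * z + Cconj a * (z - a))%C with (1 - Cconj a * a)%C by ring. auto. }
    specialize (S w Hw). simpl in S. rewrite Mw in S.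
    pose proof (blaschke_denom (f a) (f z) (Hb a Ha) ltac:(apply Rlt_le; auto)) as N.
    assert (PN : 0 < Cmod (1 - Cconj (f a) * f z)) by now apply Cmod_gt_0.
    unfold w in S. rewrite !Cmod_div in S by auto.
    apply (Rmult_le_compat_r (Cmod (1 - Cconj (f a) * f z) * Cmod (1 - Cconj a * z))) in S; [|nra].
    replace (Cmod (f z - f a) / Cmod (1 - Cconj (f a) * f z) * (Cmod (1 - Cconj (f a) * f z) * Cmod (1 - Cconj a * z)))
      with (Cmod (f z - f a) * Cmod (1 - Cconj a * z)) in S by (field; lra).
    replace (Cmod (z - a) / Cmod (1 - Cconj a * z) * (Cmod (1 - Cconj (f a) * f z) * Cmod (1 - Cconj a * z)))
      with (Cmod (1 - Cconj (f a) * f z) * Cmod (z - a)) in S by (field; lra).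
    exact S.
Qed.

(** The Schwarz-Pick inequality for maps into the right half plane, in infinitesimal form. *)
Theorem schwarz_pick_half_plane k dk : holD 1 k dk -> (forall z, Cmod z < 1 -> 0 < Re (k z)) ->
  forall z, Cmod z < 1 -> Cmod (dk z) * (1 - Cmod z ^ 2) <= 2 * Re (k z).
Proof.
  intros Hk Hp z Hz.
  assert (HM : holD 1 (fun w => k (moebius z w))
     (fun w => dk (moebius z w) * ((1 - z * Cconj z) / ((1 + Cconj z * w) * (1 + Cconj z * w))))%C).
  { apply (holD_comp 1 1 k (moebius z)); auto; [intros; now apply moebius_disk|now apply holD_moebius]. }
  assert (PM : forall w, Cmod w < 1 -> 0 < Re (k (moebius z w))) by (intros; apply Hp; now apply moebius_disk).
  set (b := k z) in *. assert (Pb : 0 < Re b) by (apply Hp; auto).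
  assert (N : forall w, Cmod w < 1 -> (k (moebius z w) + Cconj b)%C <> 0%C).
  { intros w Hw H. assert (Re (k (moebius z w) + Cconj b)%C = 0) by (rewrite H; reflexivity).
    rewrite re_plus, re_conj in H0. specialize (PM w Hw). lra. }
  assert (HN : holD 1 (fun w => k (moebius z w) + Cconj b)%C
     (fun w => dk (moebius z w) * ((1 - z * Cconj z) / ((1 + Cconj z * w) * (1 + Cconj z * w))) + 0)%C).
  { apply holD_plus; auto. apply holD_const. }
  assert (HF := holD_mult 1 _ _ _ _ (holD_minus 1 _ _ _ _ HM (holD_const 1 b)) (holD_inv 1 _ _ N HN)).
  assert (M0 : moebius z 0 = z) by (unfold moebius; field; intro K; ring_simplify (1 + Cconj z * 0)%C in K; apply RtoC_inj in K; lra).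
  destruct (schwarz _ _ HF) as [_ S].
  - rewrite M0. unfold b. ring.
  - intros w Hw. simpl. specialize (N w Hw). specialize (PM w Hw).
    rewrite Cmod_mult, Cmod_inv by auto.
    apply Rmult_le_reg_r with (Cmod (k (moebius z w) + Cconj b)); [now apply Cmod_gt_0|].
    rewrite Rmult_assoc, Rinv_l by (apply Rgt_not_eq; now apply Cmod_gt_0). rewrite Rmult_1_l, Rmult_1_r.
    apply sq_le_reg; [apply Cmod_ge_0|]. rewrite !Cmod2_alt.
    set (v := k (moebius z w)) in *. clearbody v b. destruct v, b. unfold Re, Im in *; simpl in *. nra.
  - simpl in S. rewrite M0 in S. fold b in S.
    assert (Nb : (b + Cconj b)%C = RtoC (2 * Re b)) by (destruct b; ceq).
    assert (NB : RtoC (2 * Re b) <> 0%C) by (intro K; apply RtoC_inj in K; lra).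
    match type of S with Cmod ?X <= 1 =>
      replace X with (dk z * RtoC (1 - Cmod z ^ 2) / RtoC (2 * Re b))%C in S end.
    2:{ rewrite Nb, (RtoC_minus 1), <- Cconj_mult_self.
        rewrite !Cmult_0_r, !Cplus_0_r. field. auto. }
    rewrite Cmod_div, Cmod_mult, !Cmod_R in S by auto.
    rewrite (Rabs_pos_eq (2 * Re b)) in S by lra.
    rewrite (Rabs_pos_eq (1 - Cmod z ^ 2)) in S by (pose proof (Cmod_ge_0 z); nra).
    apply (Rmult_le_compat_r (2 * Re b)) in S; [|lra].
    unfold Rdiv in S. rewrite Rmult_assoc, Rinv_l in S by lra. lra.
Qed.

(** * Convolution with functions starlike of order one half *)

Lemma polar_unit u : Cmod u = 1 -> exists s, 0 <= s < 2 * PI /\ u = cis s.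
Proof.
  intros H. pose proof (Cmod2_alt u) as K. rewrite H in K. destruct u as [x y]; unfold Re, Im in K; simpl in K.
  assert (X : -1 <= x <= 1) by nra. pose proof (acos_bound x) as B. pose proof PI_RGT_0.
  assert (S : sin (acos x) = sqrt (y ^ 2)).
  { rewrite sin_acos by auto. f_equal. unfold Rsqr. nra. }
  assert (S' : sqrt (y ^ 2) = Rabs y) by (rewrite <- Rsqr_pow2; apply sqrt_Rsqr_abs).
  destruct (Rle_or_lt 0 y) as [Y|Y].
  - exists (acos x). split; [lra|]. unfold cis. rewrite cos_acos, S, S', Rabs_pos_eq by auto. reflexivity.
  - exists (2 * PI - acos x). split.
    + assert (acos x <> 0); [|lra]. intros Z. rewrite Z, sin_0, S' in S.
      pose proof (Rabs_pos_lt y). lra.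
    + unfold cis. rewrite cos_minus, sin_minus, cos_2PI, sin_2PI, cos_acos, S, S', Rabs_left by auto.
      f_equal; ring.
Qed.

Lemma polar z r : Cmod z = r -> exists t, 0 <= t < 2 * PI /\ z = (RtoC r * cis t)%C.
Proof.
  intros <-. pose proof twoPI_pos. destruct (classic (z = 0%C)) as [->|N].
  - exists 0. split; [lra|]. rewrite Cmod_0. ring.
  - assert (P : 0 < Cmod z) by now apply Cmod_gt_0.
    assert (NR : RtoC (Cmod z) <> 0%C) by (apply Cneq_mod; rewrite Cmod_R, Rabs_pos_eq; lra).
    destruct (polar_unit (z / RtoC (Cmod z))) as [t [Ht Et]].
    { rewrite Cmod_div, Cmod_R, Rabs_pos_eq by (auto; lra). field. lra. }
    exists t. split; auto. rewrite <- Et. field. auto.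
Qed.

Lemma cis_neq_near s t : 0 < Rabs (s - t) < PI -> cis s <> cis t.
Proof.
  intros H E. assert (K : cis (s - t) = 1%C).
  { replace (s - t) with (s + - t) by ring. rewrite cis_plus, E, <- cis_plus.
    replace (t + - t) with 0 by ring. apply cis_0. }
  assert (C1 : cos (s - t) = 1) by (change (Re (cis (s - t)) = 1); now rewrite K).
  assert (C2 : cos (Rabs (s - t)) = 1).
  { unfold Rabs. destruct (Rcase_abs (s - t)); auto. now rewrite cos_neg. }
  pose proof (cos_decreasing_1 0 (Rabs (s - t))). rewrite cos_0 in H0. lra.
Qed.

Lemma hol_reflect r f : hol r f -> hol r (fun z => Cconj (f (Cconj z))).
Proof.
  intros [df H]. exists (fun z => Cconj (df (Cconj z))). intros z Hz.
  destruct (H (Cconj z)) as [H1 H2]; [now rewrite Cmod_conj|].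
  split.
  - intros e He. destruct (H1 e He) as [d [Hd K]]. exists d; split; auto. intros w Hw.
    rewrite <- Cmod_conj, Cminus_conj in Hw. specialize (K _ Hw).
    rewrite <- Cminus_conj, Cmod_conj in K.
    rewrite <- Cmod_conj, Cminus_conj, Cminus_conj, Cmult_conj, !Cconj_conj. exact K.
  - intros e He. destruct (H2 e He) as [d [Hd K]]. exists d; split; auto. intros w Hw.
    rewrite <- Cmod_conj, Cminus_conj in Hw. specialize (K _ Hw).
    now rewrite <- Cminus_conj, Cmod_conj.
Qed.

Lemma hol_rcont_cis r0 f : hol r0 f -> 1 < r0 -> rcont (fun t => f (cis t)).
Proof.
  intros H Hr. apply rcont_comp; [|apply rcont_cis]. intros t. eapply hol_cont; eauto.
  rewrite Cmod_cis; lra.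
Qed.

Lemma hol_rcont_cis_conj r0 f : hol r0 f -> 1 < r0 -> rcont (fun t => f (Cconj (cis t))).
Proof.
  intros H Hr. apply rcont_comp; [|apply rcont_conj, rcont_cis]. intros t. eapply hol_cont; eauto.
  rewrite Cmod_conj, Cmod_cis; lra.
Qed.

Lemma mean_value_cis r0 f : hol r0 f -> 1 < r0 -> cmean (fun t => f (cis t)) = f 0%C.
Proof.
  intros H Hr. rewrite <- (mean_value r0 1 f H) by lra. apply cmean_ext. intros t.
  unfold circ. f_equal. ring.
Qed.

(** ** The two-point inequality *)

Lemma exists_log_principal (c : C) : c <> 0%C -> exists l, cexp l = c /\ - PI < Im l <= PI.
Proof.
  intros H. assert (P : 0 < Cmod c) by now apply Cmod_gt_0.
  destruct (polar c _ eq_refl) as [s [Hs Es]].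
  assert (K : forall u, cis u = cis s -> cexp (ln (Cmod c), u) = c).
  { intros u Hu. rewrite cexp_polar. unfold Re, Im; simpl. now rewrite exp_ln, Hu. }
  destruct (Rle_or_lt s PI).
  - exists (ln (Cmod c), s). split; [now apply K|simpl; pose proof PI_RGT_0; lra].
  - exists (ln (Cmod c), s - 2 * PI). split; [|simpl; lra]. apply K.
    unfold Rminus. rewrite cis_plus, <- cis_conj', cis_2PI. ceq.
Qed.

Lemma exists_log (c : C) : c <> 0%C -> exists l, cexp l = c.
Proof. intros H. destruct (exists_log_principal c H) as [l [E _]]. now exists l. Qed.

(** [f / z] for a function [f] starlike of order one half on a disc larger than the unit disc:
    [Re (z f' / f) > 1/2] becomes [Re (z p' / p) > -1/2]. *)
Definition half_starlike (r0 : R) (p dp : C -> C) :=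
  holD r0 p dp /\ forall z, Cmod z < r0 -> p z <> 0%C /\ - (1/2) < Re (z * dp z / p z).

(** Along the unit circle the argument of [p (e^{it}) e^{it/2}] increases, by [PI] in one turn. *)
Lemma two_point r0 p dp w z : 1 < r0 -> half_starlike r0 p dp ->
  Cmod w = 1 -> Cmod z = 1 -> z <> w -> 0 < Re (Cconj (p w) * p z * (1 - Cconj w * z)).
Proof.
  intros Hr [Hp Hs] Hw Hz N.
  destruct (polar_unit w Hw) as [t0 [_ ->]].
  assert (HU : Cmod (Cconj (cis t0) * z) = 1) by (rewrite Cmod_mult, Cmod_conj, Cmod_cis, Hz; ring).
  destruct (polar_unit _ HU) as [s [Hs0 Es]].
  assert (Ez : z = cis (t0 + s)).
  { rewrite cis_plus, <- Es, Cmult_assoc, cis_conj_mul. ring. }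
  assert (Ps : 0 < s < 2 * PI).
  { split; [|lra]. destruct (Rle_lt_or_eq_dec 0 s ltac:(lra)) as [|<-]; auto.
    exfalso. apply N. now rewrite Ez, Rplus_0_r. }
  assert (N0 : p 0%C <> 0%C) by (apply Hs; rewrite Cmod_0; lra).
  destruct (exists_log _ N0) as [l0 Hl0].
  destruct (logarithm r0 p dp l0 ltac:(lra) Hp (fun z Hz => proj1 (Hs z Hz)) Hl0) as [l [Hl [_ El]]].
  set (k := fun x => Im (l (cis (t0 + x))) - Im (l (cis t0)) + x / 2).
  assert (Dk : forall x, is_derive k x (Re (cis (t0 + x) * (dp (cis (t0 + x)) / p (cis (t0 + x)))) + 1 / 2)).
  { intros x.
    assert (Rc : rder (fun y => cis (t0 + y)) x (Ci * cis (t0 + x))%C).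
    { eapply rder_eq.
      - assert (E : forall y, (cis t0 * cis y)%C = cis (t0 + y)) by (intros; now rewrite cis_plus).
        split; eapply is_derive_ext; try (intros y; rewrite <- E; reflexivity);
          apply (rder_mult (fun _ => cis t0) cis x 0 (Ci * cis x)); try apply rder_const; apply rder_cis.
      - rewrite cis_plus. ring. }
    assert (Rl := rder_comp l _ x _ _ (proj1 (Hl (cis (t0 + x)) ltac:(rewrite Cmod_cis; lra))) Rc).
    destruct Rl as [_ RI]. unfold k.
    evar_last.
    - apply (is_derive_plus (V := R_NormedModule)).
      + apply (is_derive_minus (V := R_NormedModule)); [exact RI|apply @is_derive_const].
      + apply (is_derive_ext (fun y => / 2 * y)); [intros; apply Rmult_comm|].
        apply is_derive_scal. apply @is_derive_id.
    - unfold minus, plus, opp, zero, one; simpl. unfold Re, Im; simpl. lra. }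
  assert (Dpos : forall x, 0 < Re (cis (t0 + x) * (dp (cis (t0 + x)) / p (cis (t0 + x)))) + 1 / 2).
  { intros x. destruct (Hs (cis (t0 + x)) ltac:(rewrite Cmod_cis; lra)) as [_ H].
    unfold Cdiv in *. rewrite Cmult_assoc. lra. }
  assert (Inc : forall x y, x < y -> k x < k y).
  { intros x y Hxy. exact (incr_function k m_infty p_infty _ (fun x _ _ => Dk x) (fun x _ _ => Dpos x) x y I Hxy I). }
  assert (K0 : k 0 = 0) by (unfold k; rewrite Rplus_0_r; lra).
  assert (K2 : k (2 * PI) = PI) by (unfold k; rewrite cis_plus, cis_2PI, Cmult_1_r; lra).
  pose proof (Inc 0 s ltac:(lra)) as I1. pose proof (Inc s (2 * PI) ltac:(lra)) as I2. rewrite K0 in I1. rewrite K2 in I2.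
  assert (Esz : (Cconj (cis t0) * z)%C = cis s) by auto.
  rewrite Esz, <- (El (cis t0)), <- (El z) by lra. rewrite Ez.
  set (L0 := l (cis t0)) in *. set (L := l (cis (t0 + s))) in *.
  replace (Cconj (cexp L0) * cexp L * (1 - cis s))%C
    with (RtoC (exp (Re L0) * exp (Re L)) * (cis (Im L - Im L0) * (1 - cis s)))%C.
  2:{ rewrite (cexp_polar L0), (cexp_polar L), Cmult_conj, cis_conj'.
      replace (Im L - Im L0) with (- Im L0 + Im L) by ring. rewrite cis_plus, RtoC_mult.
      replace (Cconj (RtoC (exp (Re L0)))) with (RtoC (exp (Re L0))) by ceq. ring. }
  rewrite re_scal_l. apply Rmult_lt_0_compat; [apply Rmult_lt_0_compat; apply exp_pos|].
  replace (cis (Im L - Im L0) * (1 - cis s))%C with (cis (Im L - Im L0) - cis (Im L - Im L0 + s))%C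
    by (rewrite (cis_plus (Im L - Im L0) s); ring).
  assert (E : Re (cis (Im L - Im L0) - cis (Im L - Im L0 + s))%C = 2 * sin (s / 2) * sin (k s)).
  { unfold k. fold L L0. set (al := Im L - Im L0).
    replace (Re (cis al - cis (al + s))%C) with (cos al - cos (al + s)) by (unfold Re; simpl; ring).
    set (be := al + s / 2).
    replace (cos al) with (cos (be - s / 2)) by (f_equal; unfold be; ring).
    replace (cos (al + s)) with (cos (be + s / 2)) by (f_equal; unfold be; field).
    rewrite cos_minus, cos_plus. ring. }
  rewrite E. apply Rmult_lt_0_compat; [apply Rmult_lt_0_compat; [lra|]|]; apply sin_gt_0; lra.
Qed.

Corollary two_point_le r0 p dp w z : 1 < r0 -> half_starlike r0 p dp ->
  Cmod w = 1 -> Cmod z = 1 -> 0 <= Re (Cconj (p w) * p z * (1 - Cconj w * z)).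
Proof.
  intros Hr Hs Hw Hz. destruct (classic (z = w)) as [->|N].
  - rewrite (Cmult_comm (Cconj w)), Cconj_mult_self, Hw.
    replace (Cconj (p w) * p w * (1 - RtoC (1 ^ 2)))%C with (RtoC 0); [simpl; lra|].
    rewrite pow1. ring.
  - apply Rlt_le. eapply two_point; eauto.
Qed.

(** ** Positivity of the convolution quotient *)

(** The difference quotient of [p] at [y], with its dependence on [y] explicit. *)
Definition dquot (r : R) (p : C -> C) (y a : C) : C :=
  cauchyK 1 r (fun t => p (circ r t) * / (circ r t - y))%C a.

Section DiffQuot.
Variables (r0 r : R) (p : C -> C).
Hypothesis (Hr : 1 < r < r0) (Hp : hol r0 p).

Lemma dquot_hol y : Cmod y < r -> hol r (dquot r p y).
Proof.
  intros Hy. eexists. apply cauchyK_hol1. apply rcont_mult; [|now apply rcont_kernel].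
  eapply hol_rcont_circ; eauto; lra.
Qed.

Lemma dquot_spec y a : Cmod y < r -> Cmod a < r -> (p a - p y = (a - y) * dquot r p y a)%C.
Proof.
  intros Hy Ha. pose proof (Cmod_ge_0 y).
  assert (RF : rcont (fun t => p (circ r t))) by (eapply hol_rcont_circ; eauto; lra).
  assert (RK : forall z, Cmod z < r -> rcont (fun t => / (circ r t - z))%C) by (intros; now apply rcont_kernel).
  rewrite (cauchyK_formula r0 r p a), (cauchyK_formula r0 r p y) by (auto; lra).
  unfold dquot, cauchyK. rewrite <- cmean_minus by (apply rcont_cauchyK; auto).
  rewrite <- cmean_scal by (apply rcont_cauchyK; auto; now apply rcont_mult; auto).
  apply cmean_ext. intros t.
  assert ((circ r t - a)%C <> 0%C) by (apply circ_neq; lra).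
  assert ((circ r t - y)%C <> 0%C) by (apply circ_neq; lra).
  simpl. field. auto.
Qed.

Lemma dquot_lip : exists B L, 0 <= B /\ 0 <= L /\
  (forall y a, Cmod y <= 1 -> Cmod a <= 1 -> Cmod (dquot r p y a) <= B) /\
  (forall y y' a, Cmod y <= 1 -> Cmod y' <= 1 -> Cmod a <= 1 ->
     Cmod (dquot r p y a - dquot r p y' a) <= L * Cmod (y - y')).
Proof.
  assert (RF : rcont (fun t => p (circ r t))) by (eapply hol_rcont_circ; eauto; lra).
  assert (RK : forall z, Cmod z < r -> rcont (fun t => / (circ r t - z))%C) by (intros; now apply rcont_kernel).
  destruct (rcont_bounded _ RF) as [M [HM BM]].
  set (b := / (r - 1)). assert (Hb : 0 < b) by (apply Rinv_0_lt_compat; lra).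
  assert (KB : forall z t, Cmod z <= 1 -> Cmod (/ (circ r t - z)) <= b) by (intros; apply kernel_bound; lra).
  exists (M * b * (r * b)), (M * b * b * (r * b)).
  assert (P0 : 0 <= M * b) by nra. assert (P1 : 0 <= r * b) by nra.
  split; [now apply Rmult_le_pos|split; [apply Rmult_le_pos; nra|split]].
  - intros y a Hy Ha. apply Cmod_cmean_le.
    + apply rcont_cauchyK; [|lra]. apply rcont_mult; auto. apply RK; lra.
    + intros t Ht. simpl. rewrite Cmult_1_r, !Cmod_mult, Cmod_circ, Rmult_assoc by lra.
      apply Rmult_le_compat; auto; try (apply Rmult_le_pos; auto; try lra; apply Cmod_ge_0).
      * apply Rmult_le_compat; auto; apply Cmod_ge_0.
      * apply Rmult_le_compat_l; auto; lra.
  - intros y y' a Hy Hy' Ha. unfold dquot, cauchyK.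
    assert (RC : forall y, Cmod y <= 1 -> rcont (fun t => p (circ r t) * / (circ r t - y))%C).
    { intros. apply rcont_mult; auto. apply RK; lra. }
    rewrite <- cmean_minus by (apply rcont_cauchyK; auto; lra).
    apply Cmod_cmean_le; [apply rcont_minus; apply rcont_cauchyK; auto; lra|].
    intros t Ht.
    assert ((circ r t - a)%C <> 0%C) by (apply circ_neq; lra).
    assert ((circ r t - y)%C <> 0%C) by (apply circ_neq; lra).
    assert ((circ r t - y')%C <> 0%C) by (apply circ_neq; lra).
    replace (p (circ r t) * / (circ r t - y) * circ r t * (/ (circ r t - a)) ^ 1 -
             p (circ r t) * / (circ r t - y') * circ r t * (/ (circ r t - a)) ^ 1)%C
      with ((p (circ r t) * / (circ r t - y) * / (circ r t - y')) * (circ r t * / (circ r t - a)) * (y - y'))%C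
      by (simpl; field; auto).
    rewrite !Cmod_mult, Cmod_circ by lra.
    pose proof (Cmod_ge_0 (p (circ r t))). pose proof (Cmod_ge_0 (/ (circ r t - y))).
    pose proof (Cmod_ge_0 (/ (circ r t - y'))). pose proof (Cmod_ge_0 (/ (circ r t - a))).
    apply Rmult_le_compat_r; [apply Cmod_ge_0|].
    apply Rmult_le_compat; try (repeat apply Rmult_le_pos; auto; lra).
    + apply Rmult_le_compat; auto; [now apply Rmult_le_pos|]. apply Rmult_le_compat; auto.
    + apply Rmult_le_compat_l; auto; lra.
Qed.
End DiffQuot.

Section Convolution.
Variables (r0 : R) (p dp q dq : C -> C).
Hypothesis Hr0 : 1 < r0.
Hypothesis Hp : half_starlike r0 p dp.
Hypothesis Hq : half_starlike r0 q dq.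

Let r := (1 + r0) / 2.
Let Hr : 1 < r < r0. Proof. unfold r; lra. Qed.
Let holp : hol r0 p. Proof. exists dp; apply Hp. Qed.
Let holq : hol r0 q. Proof. exists dq; apply Hq. Qed.
Let Rp : rcont (fun t => p (Cconj (cis t))). Proof. now apply (hol_rcont_cis_conj r0). Qed.
Let Rq : rcont (fun t => q (cis t)). Proof. now apply (hol_rcont_cis r0). Qed.
Let Rz : rcont cis := rcont_cis.
Let Rzb : rcont (fun t => Cconj (cis t)). Proof. apply rcont_conj, rcont_cis. Qed.

(** The convolution of [p] and [q z^n], evaluated at [1]. *)
Definition moment (n : nat) : C := cmean (fun t => p (Cconj (cis t)) * q (cis t) * cis t ^ n)%C.

(** The convolution of [p] and [q / (1 - y z)], evaluated at [1]; this form of it makes sense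
    for [|y| = 1] as well. *)
Definition psi (y : C) : C :=
  (p y * q 0 + cmean (fun t => q (cis t) * Cconj (cis t) * dquot r p y (Cconj (cis t))))%C.

Let Rd y : Cmod y <= 1 -> rcont (fun t => dquot r p y (Cconj (cis t))).
Proof. intros. apply (hol_rcont_cis_conj r); [|lra]. apply (dquot_hol r0); auto; lra. Qed.

Lemma psi_minus_moment y : Cmod y <= 1 ->
  (psi y - moment 0 = y * cmean (fun t => q (cis t) * dquot r p y (Cconj (cis t))))%C.
Proof.
  intros Hy. pose proof (Rd y Hy) as RD.
  unfold psi, moment. rewrite <- cmean_scal by now apply rcont_mult.
  rewrite <- (mean_value_cis r0 q holq Hr0), <- (cmean_scal (p y)) by auto.
  rewrite <- cmean_plus, <- cmean_minus.
  - apply cmean_ext. intros t.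
    pose proof (dquot_spec r0 r p Hr holp y (Cconj (cis t)) ltac:(lra) ltac:(rewrite Cmod_conj, Cmod_cis; lra)) as E.
    replace (p (Cconj (cis t))) with (p y + (Cconj (cis t) - y) * dquot r p y (Cconj (cis t)))%C
      by (rewrite <- E; ring).
    simpl. ring.
  - apply rcont_plus; [apply rcont_mult; auto; apply rcont_const|]. apply rcont_mult; auto. now apply rcont_mult.
  - apply rcont_mult; [now apply rcont_mult|]. now apply rcont_pow.
  - apply rcont_mult; auto. apply rcont_const.
  - apply rcont_mult; auto. now apply rcont_mult.
Qed.

Lemma psi_0 : psi 0 = moment 0.
Proof.
  pose proof (psi_minus_moment 0 ltac:(rewrite Cmod_0; lra)) as H. rewrite Cmult_0_l in H.
  replace (psi 0) with (psi 0 - moment 0 + moment 0)%C by ring. rewrite H. ring.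
Qed.

Lemma psi_lip : exists L, 0 <= L /\ forall y y', Cmod y <= 1 -> Cmod y' <= 1 ->
  Cmod (psi y - psi y') <= L * Cmod (y - y').
Proof.
  destruct (dquot_lip r0 r p Hr holp) as [B [L [HB [HL [KB KL]]]]].
  destruct (rcont_bounded _ Rq) as [Q [HQ BQ]].
  exists (B * Cmod (q 0%C) + Q * L). split.
  { pose proof (Cmod_ge_0 (q 0%C)). nra. }
  intros y y' Hy Hy'. unfold psi.
  pose proof (Rd y Hy) as R1. pose proof (Rd y' Hy') as R2.
  match goal with |- Cmod (?a * ?b + ?c - (?a' * ?b + ?c')) <= _ =>
    replace (a * b + c - (a' * b + c'))%C with ((a - a') * b + (c - c'))%C by ring end.
  rewrite <- cmean_minus by (apply rcont_mult; auto; now apply rcont_mult).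
  eapply Rle_trans; [apply Cmod_triangle|].
  replace ((B * Cmod (q 0%C) + Q * L) * Cmod (y - y'))
    with (B * Cmod (y - y') * Cmod (q 0%C) + Q * (L * Cmod (y - y'))) by ring.
  apply Rplus_le_compat.
  - rewrite Cmod_mult. apply Rmult_le_compat_r; [apply Cmod_ge_0|].
    rewrite (dquot_spec r0 r p Hr holp y' y) by lra. rewrite Cmod_mult, Rmult_comm.
    apply Rmult_le_compat_r; [apply Cmod_ge_0|]. auto.
  - apply Cmod_cmean_le.
    + apply rcont_minus; (apply rcont_mult; auto; now apply rcont_mult).
    + intros t Ht. match goal with |- Cmod (?a * ?d - ?a * ?d') <= _ =>
        replace (a * d - a * d')%C with (a * (d - d'))%C by ring end.
      rewrite !Cmod_mult, Cmod_conj, Cmod_cis, Rmult_1_r.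
      apply Rmult_le_compat; try apply Cmod_ge_0; auto. apply KL; auto.
      rewrite Cmod_conj, Cmod_cis; lra.
Qed.

Lemma geom_denom y t : Cmod y < 1 -> (1 - y * cis t)%C <> 0%C.
Proof.
  intros Hy. replace (1 - y * cis t)%C with (1 - Cconj (Cconj y) * cis t)%C by (now rewrite Cconj_conj).
  apply blaschke_denom; [now rewrite Cmod_conj|rewrite Cmod_cis; lra].
Qed.

Lemma geom_rcont y : Cmod y < 1 -> rcont (fun t => / (1 - y * cis t))%C.
Proof.
  intros Hy. apply rcont_inv; [intros; now apply geom_denom|].
  apply rcont_minus; [apply rcont_const|]. apply rcont_mult; auto. apply rcont_const.
Qed.

Lemma psi_inside y : Cmod y < 1 ->
  psi y = cmean (fun t => p (Cconj (cis t)) * q (cis t) * / (1 - y * cis t))%C.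
Proof.
  intros Hy. pose proof (Cmod_ge_0 y).
  pose proof (Rd y ltac:(lra)) as RD. pose proof (geom_rcont y Hy) as RG.
  set (s := Rmin r0 (2 / (1 + Cmod y))).
  assert (S1 : 1 < s).
  { apply Rmin_glb_lt; auto. apply Rmult_lt_reg_r with (1 + Cmod y); [lra|].
    unfold Rdiv; rewrite Rmult_assoc, Rinv_l; lra. }
  assert (S2 : s <= r0) by apply Rmin_l.
  assert (S3 : s * (1 + Cmod y) <= 2).
  { apply Rmult_le_reg_r with (/ (1 + Cmod y)); [apply Rinv_0_lt_compat; lra|].
    rewrite Rmult_assoc, Rinv_r, Rmult_1_r by lra. apply Rmin_r. }
  assert (HG : hol s (fun z => q z * / (1 - y * z))%C).
  { pose proof (hol_sub r0 s q S2 holq) as HS. hol_tac. intros z Hz. apply Cneq_mod.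
    pose proof (Cmod_rev_triangle 1 (y * z)). rewrite Cmod_1, Cmod_mult in H0.
    pose proof (Cmod_ge_0 z). nra. }
  pose proof (mean_value_cis s _ HG S1) as MV. simpl in MV.
  replace (q 0 * / (1 - y * 0))%C with (q 0%C) in MV.
  2:{ replace (1 - y * 0)%C with (RtoC 1) by ring. field. }
  unfold psi. rewrite <- MV.
  rewrite <- (cmean_scal (p y)) by (now apply rcont_mult).
  rewrite <- cmean_plus; [|apply rcont_mult; [apply rcont_const|now apply rcont_mult]
     |apply rcont_mult; auto; now apply rcont_mult].
  apply cmean_ext. intros t.
  pose proof (dquot_spec r0 r p Hr holp y (Cconj (cis t)) ltac:(lra) ltac:(rewrite Cmod_conj, Cmod_cis; lra)) as E.
  replace (p (Cconj (cis t))) with (p y + (Cconj (cis t) - y) * dquot r p y (Cconj (cis t)))%C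
    by (rewrite <- E; ring).
  pose proof (geom_denom y t Hy) as N.
  assert (E2 : (Cconj (cis t) - y = Cconj (cis t) * (1 - y * cis t))%C).
  { replace (Cconj (cis t) * (1 - y * cis t))%C with (Cconj (cis t) - y * (cis t * Cconj (cis t)))%C by ring.
    rewrite cis_conj_mul. ring. }
  rewrite E2. field. auto.
Qed.

Lemma rcont_moment n : rcont (fun t => p (Cconj (cis t)) * q (cis t) * cis t ^ n)%C.
Proof. apply rcont_mult; [now apply rcont_mult|now apply rcont_pow]. Qed.

Lemma psi_series : useries 1 moment psi.
Proof.
  apply plim_useries. intros y Hy. pose proof (Cmod_ge_0 y) as Py.
  pose proof (geom_rcont y Hy) as RG.
  set (T := fun n t => (p (Cconj (cis t)) * q (cis t) * (y * cis t) ^ n * / (1 - y * cis t))%C).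
  assert (RT : forall n, rcont (T n)).
  { intros n. unfold T. apply rcont_mult; auto. apply rcont_mult; [now apply rcont_mult|].
    apply rcont_pow, rcont_mult; auto. apply rcont_const. }
  assert (E : forall n, (psi y - psum moment n y)%C = cmean (T n)).
  { induction n.
    - simpl. rewrite psi_inside by auto. replace (_ - 0)%C with (cmean (fun t => p (Cconj (cis t)) * q (cis t) * / (1 - y * cis t)))%C by ring.
      apply cmean_ext; intros; unfold T; simpl; ring.
    - simpl psum. replace (psi y - (psum moment n y + moment n * y ^ n))%C with (psi y - psum moment n y - moment n * y ^ n)%C by ring.
      rewrite IHn. unfold moment. rewrite <- cmean_scal_r by apply rcont_moment.
      rewrite <- cmean_minus; auto; [|apply rcont_mult; [apply rcont_moment|apply rcont_const]].
      apply cmean_ext. intros t. unfold T. simpl. rewrite !Cpow_mult_l.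
      pose proof (geom_denom y t Hy). field. auto. }
  destruct (rcont_bounded (fun t => p (Cconj (cis t)) * q (cis t))%C) as [M [HM BM]]; [now apply rcont_mult|].
  intros e He. destruct (geom_small M (Cmod y) ltac:(lra) ltac:(lra) e He) as [N HN].
  exists N. intros n Hn. specialize (HN n Hn). rewrite Cmod_sub_sym, E.
  eapply Rle_trans; [|exact HN]. apply Cmod_cmean_le; auto. intros t Ht. unfold T.
  rewrite Cmod_mult, (Cmod_mult (p _ * q _)), Cmod_pow, (Cmod_mult y), Cmod_cis, Rmult_1_r.
  apply Rmult_le_compat; try apply Cmod_ge_0.
  - apply Rmult_le_pos; [apply Cmod_ge_0|apply pow_le; auto].
  - apply Rmult_le_compat_r; [now apply pow_le|auto].
  - rewrite Cmod_inv by now apply geom_denom. apply Rinv_le_contravar; [lra|].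
    pose proof (Cmod_rev_triangle 1 (y * cis t)). rewrite Cmod_1, Cmod_mult, Cmod_cis in H. lra.
Qed.

(** The convolution of [p] and [q (1 - conj w z) / (1 - conj v z)], evaluated at [1]. *)
Definition Xi (v w : C) : C :=
  (p (Cconj v) * q 0 + cmean (fun t => q (cis t) * (1 - Cconj w * cis t) *
     (Cconj (cis t) * dquot r p (Cconj v) (Cconj (cis t)))))%C.

Lemma Xi_psi v w : Cmod v = 1 ->
  (Xi v w = Cconj w * v * moment 0 + (1 - Cconj w * v) * psi (Cconj v))%C.
Proof.
  intros Hv. assert (Hv' : Cmod (Cconj v) <= 1) by (rewrite Cmod_conj; lra).
  pose proof (Rd _ Hv') as RD.
  assert (E : (Xi v w = psi (Cconj v) - Cconj w * cmean (fun t => q (cis t) * dquot r p (Cconj v) (Cconj (cis t))))%C).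
  { unfold Xi, psi. rewrite <- (cmean_scal (Cconj w)) by now apply rcont_mult.
    match goal with |- (?a + _ = ?a + ?b - ?c)%C => replace (a + b - c)%C with (a + (b - c))%C by ring end.
    f_equal. rewrite <- cmean_minus.
    - apply cmean_ext. intros t.
      set (d := dquot _ _ _ _). set (u := q (cis t)).
      transitivity (u * Cconj (cis t) * d - Cconj w * (u * d) * (cis t * Cconj (cis t)))%C; [ring|].
      rewrite cis_conj_mul. ring.
    - apply rcont_mult; auto. now apply rcont_mult.
    - apply rcont_mult; [apply rcont_const|]. now apply rcont_mult. }
  pose proof (psi_minus_moment (Cconj v) Hv') as K. rewrite E.
  assert (VV : (v * Cconj v)%C = 1%C) by (rewrite Cconj_mult_self, Hv; ceq).
  set (m := cmean _) in *.
  replace m with (v * (psi (Cconj v) - moment 0))%C.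
  2:{ rewrite K. replace (v * (Cconj v * m))%C with ((v * Cconj v) * m)%C by ring. rewrite VV. ring. }
  ring.
Qed.

(** On the circle [Re (1 / (1 - conj v zeta)) = 1/2], so the two-point inequality for [p]
    makes this real part positive. *)
Lemma kernel_re v t : Cmod v = 1 -> cis t <> v ->
  0 < Cmod (p (Cconj v)) ^ 2 / 2 +
      Re (Cconj (p (Cconj v)) * (Cconj (cis t) * dquot r p (Cconj v) (Cconj (cis t)))).
Proof.
  intros Hv N.
  pose proof (dquot_spec r0 r p Hr holp (Cconj v) (Cconj (cis t))
    ltac:(rewrite Cmod_conj; lra) ltac:(rewrite Cmod_conj, Cmod_cis; lra)) as E.
  assert (N2 : Cconj (cis t) <> Cconj v).
  { intros H. apply N. rewrite <- (Cconj_conj (cis t)), H. apply Cconj_conj. }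
  pose proof (two_point r0 p dp (Cconj v) (Cconj (cis t)) Hr0 Hp
    ltac:(rewrite Cmod_conj; lra) ltac:(rewrite Cmod_conj, Cmod_cis; lra) N2) as T.
  rewrite Cconj_conj in T.
  set (z := cis t) in *. set (pz := p (Cconj z)) in *. set (pv := p (Cconj v)) in *.
  set (d := dquot _ _ _ _) in *.
  assert (Z1 : (z * Cconj z)%C = 1%C) by apply cis_conj_mul.
  assert (V1 : (v * Cconj v)%C = 1%C) by (rewrite Cconj_mult_self, Hv; ceq).
  assert (N3 : (1 - v * Cconj z)%C <> 0%C).
  { intros K. apply N. replace z with (z * (v * Cconj z) + z * (1 - v * Cconj z))%C by ring.
    rewrite K. replace (z * (v * Cconj z))%C with (v * (z * Cconj z))%C by ring. rewrite Z1. ring. }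
  assert (S : 0 < Cmod (1 - v * Cconj z)) by now apply Cmod_gt_0.
  set (u := (1 - v * Cconj z)%C) in *.
  assert (UB : (u * Cconj u = 2 - v * Cconj z - Cconj v * z)%C).
  { unfold u. rewrite Cminus_conj, Cmult_conj, Cconj_conj. replace (Cconj 1) with (RtoC 1) by ceq.
    transitivity (1 - v * Cconj z - Cconj v * z + (v * Cconj v) * (z * Cconj z))%C; [ring|].
    rewrite V1, Z1. ring. }
  (* multiplying by [|u|^2] clears the denominator of the difference quotient [d] *)
  assert (K : (Cconj z * d * RtoC (Cmod u ^ 2) = (pz - pv) * u)%C).
  { rewrite <- Cconj_mult_self, UB.
    assert (A : ((2 - v * Cconj z - Cconj v * z) * Cconj z = (Cconj z - Cconj v) * u)%C).
    { unfold u. transitivity (2 * Cconj z - v * Cconj z * Cconj z - Cconj v * (z * Cconj z))%C; [ring|].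
      transitivity (Cconj z - v * Cconj z * Cconj z - Cconj v + (v * Cconj v) * Cconj z)%C; [rewrite V1, Z1; ring|ring]. }
    transitivity (d * ((2 - v * Cconj z - Cconj v * z) * Cconj z))%C; [ring|]. rewrite A, E. ring. }
  apply (Rmult_lt_reg_r (Cmod u ^ 2)); [nra|]. rewrite Rmult_0_l, Rmult_plus_distr_r.
  rewrite <- re_scal_r.
  replace (Cconj pv * (Cconj z * d) * RtoC (Cmod u ^ 2))%C with (Cconj pv * (Cconj z * d * RtoC (Cmod u ^ 2)))%C by ring.
  rewrite K.
  replace (Cconj pv * ((pz - pv) * u))%C with (Cconj pv * pz * u - (pv * Cconj pv) * u)%C by ring.
  rewrite Cconj_mult_self. unfold Cminus at 1. rewrite re_plus, re_opp, re_scal_l.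
  assert (RU : Re u = Cmod u ^ 2 / 2).
  { apply RtoC_inj. rewrite re_alt, RtoC_div, <- Cconj_mult_self, UB by lra. unfold Cdiv. f_equal. unfold u.
    rewrite Cminus_conj, Cmult_conj, Cconj_conj. replace (Cconj 1) with (RtoC 1) by ceq. ring. }
  rewrite RU. lra.
Qed.

Lemma continuous_ge_0_except (u : R -> R) t0 :
  continuous u t0 -> (forall s, 0 < Rabs (s - t0) < PI -> 0 <= u s) -> 0 <= u t0.
Proof.
  intros Hu H. destruct (Rle_or_lt 0 (u t0)) as [|N]; auto.
  assert (P : 0 < - u t0) by lra.
  destruct (proj1 (filterlim_locally _ _) Hu (mkposreal _ P)) as [d Hd]. pose proof PI_RGT_0.
  set (s := t0 + Rmin (d / 2) (PI / 2)). pose proof (cond_pos d).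
  assert (S : 0 < Rmin (d / 2) (PI / 2)) by (apply Rmin_glb_lt; lra).
  assert (A : Rabs (s - t0) = Rmin (d / 2) (PI / 2)).
  { unfold s. replace (t0 + _ - t0) with (Rmin (d / 2) (PI / 2)) by ring. apply Rabs_pos_eq; lra. }
  pose proof (Rmin_l (d / 2) (PI / 2)). pose proof (Rmin_r (d / 2) (PI / 2)).
  specialize (H s ltac:(lra)).
  assert (K : Rabs (u s - u t0) < - u t0) by (apply Hd; change (Rabs (s - t0) < d); lra).
  apply Rabs_def2 in K. lra.
Qed.

Lemma cis_avoid v w : exists t, 0 < t < 2 * PI /\ cis t <> v /\ cis t <> w.
Proof.
  pose proof PI_RGT_0.
  assert (A : cis (PI / 2) <> cis PI) by (apply cis_neq_near; rewrite Rabs_left; lra).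
  assert (B : cis PI <> cis (PI + PI / 2)) by (apply cis_neq_near; rewrite Rabs_left; lra).
  assert (D : cis (PI / 2) <> cis (PI + PI / 2)).
  { intros E. apply (f_equal Im) in E. unfold cis, Im in E; simpl in E.
    rewrite sin_plus, sin_PI, cos_PI, sin_PI2 in E. lra. }
  destruct (classic (cis PI = v \/ cis PI = w)) as [P|P].
  2:{ exists PI. split; [lra|tauto]. }
  destruct (classic (cis (PI / 2) = v \/ cis (PI / 2) = w)) as [Q|Q].
  2:{ exists (PI / 2). split; [lra|tauto]. }
  exists (PI + PI / 2). split; [lra|].
  destruct P, Q; subst; try congruence; split; congruence.
Qed.

(** The central positivity: after multiplication by suitable constants, [Xi v w] has real part
    the mean of a product of the two two-point expressions, one for [p] and one for [q].
    In the mean, [h] may be replaced by [2 Re h] in front of [k], because [k] has only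
    Fourier coefficients of negative index. *)
Lemma Xi_positive v w : Cmod v = 1 -> Cmod w = 1 ->
  0 < Re (Cconj (p (Cconj v)) * Cconj (q w) * Xi v w).
Proof.
  intros Hv Hw. assert (Hv' : Cmod (Cconj v) <= 1) by (rewrite Cmod_conj; lra).
  pose proof (Rd _ Hv') as RD.
  set (X0 := Cmod (p (Cconj v)) ^ 2).
  set (h := fun z => (Cconj (q w) * q z * (1 - Cconj w * z))%C).
  set (k := fun t => (Cconj (p (Cconj v)) * (Cconj (cis t) * dquot r p (Cconj v) (Cconj (cis t))))%C).
  assert (Hh : hol r0 h) by (unfold h; hol_tac).
  assert (Rh : rcont (fun t => h (cis t))) by now apply (hol_rcont_cis r0).
  assert (Rk : rcont k) by (unfold k; apply rcont_mult; [apply rcont_const|now apply rcont_mult]).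
  set (u := fun t => 2 * Re (h (cis t)) * (X0 / 2 + Re (k t))).
  assert (EZ : (Cconj (p (Cconj v)) * Cconj (q w) * Xi v w
                = RtoC X0 * h 0 + cmean (fun t => h (cis t) * k t))%C).
  { unfold Xi. rewrite Cmult_plus_distr_l. f_equal.
    - unfold h, X0. rewrite <- Cconj_mult_self. ring.
    - rewrite <- cmean_scal.
      + apply cmean_ext. intros t. unfold h, k. ring.
      + apply rcont_mult; [|now apply rcont_mult]. apply rcont_mult; auto.
        apply rcont_minus; [apply rcont_const|]. apply rcont_mult; auto. apply rcont_const. }
  assert (E0 : cmean (fun t => Cconj (h (cis t)) * k t)%C = 0%C).
  { set (g := fun z => (h z * (z * (p (Cconj v) * Cconj (dquot r p (Cconj v) (Cconj z)))))%C).
    assert (Hg : hol r g).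
    { assert (H1 : hol r h) by (apply hol_sub with r0; auto; lra).
      assert (H2 : hol r (fun z => Cconj (dquot r p (Cconj v) (Cconj z)))).
      { apply hol_reflect. apply (dquot_hol r0); auto; lra. }
      unfold g. hol_tac. }
    rewrite (cmean_ext _ (fun t => Cconj (g (cis t)))).
    - rewrite cmean_conj by (apply (hol_rcont_cis r); auto; lra).
      rewrite (mean_value_cis r g Hg) by lra. unfold g. rewrite Cmult_0_l, Cmult_0_r. ceq.
    - intros t. unfold g, k. rewrite !Cmult_conj, !Cconj_conj. ring. }
  assert (EU : rmean u = Re (Cconj (p (Cconj v)) * Cconj (q w) * Xi v w)).
  { rewrite EZ.
    transitivity (Re (cmean (fun t => RtoC X0 * h (cis t) + (h (cis t) * k t + Cconj (h (cis t)) * k t))%C)).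
    - rewrite Re_cmean. apply rmean_ext. intros t. unfold u.
      destruct (h (cis t)) as [a b], (k t) as [c d]. unfold Re; simpl; field.
    - rewrite cmean_plus, cmean_scal, (mean_value_cis r0 h Hh Hr0), cmean_plus, E0; auto.
      + f_equal. ring.
      + now apply rcont_mult.
      + apply rcont_mult; auto. now apply rcont_conj.
      + apply rcont_mult; auto. apply rcont_const.
      + apply rcont_plus; apply rcont_mult; auto. now apply rcont_conj. }
  rewrite <- EU.
  assert (Cu : forall t, continuous u t).
  { intros t. unfold u.
    apply (continuous_mult (K := R_AbsRing) (fun t => 2 * Re (h (cis t)))).
    - apply (continuous_scal_r (V := R_NormedModule)). now apply rcont_re.
    - apply (continuous_plus (V := R_NormedModule)); [apply continuous_const|now apply rcont_re]. }
  assert (A1 : forall t, 0 <= Re (h (cis t))).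
  { intros t. apply (two_point_le r0 q dq w (cis t) Hr0 Hq Hw). apply Cmod_cis. }
  assert (A2 : forall t, cis t <> v -> 0 <= u t).
  { intros t N. unfold u. pose proof (kernel_re v t Hv N). fold X0 in H. change (Re (_ * (_ * _))%C) with (Re (k t)) in H.
    specialize (A1 t). apply Rmult_le_pos; lra. }
  destruct (cis_avoid v w) as [t1 [T1 [T2 T3]]].
  apply (rmean_gt_0 u t1); auto.
  - intros t. destruct (classic (cis t = v)) as [E|]; auto.
    apply continuous_ge_0_except; auto. intros s Hs. apply A2. rewrite <- E. now apply cis_neq_near.
  - unfold u. pose proof (kernel_re v t1 Hv T2). fold X0 in H. change (Re (_ * (_ * _))%C) with (Re (k t1)) in H.
    pose proof (two_point r0 q dq w (cis t1) Hr0 Hq Hw (Cmod_cis _) T3) as H'.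
    change (0 < Re (h (cis t1))) in H'. apply Rmult_lt_0_compat; lra.
Qed.

Lemma moment_0_neq : moment 0 <> 0%C.
Proof.
  intros H. pose proof (Xi_positive 1 1 Cmod_1 Cmod_1) as K. rewrite Xi_psi in K by apply Cmod_1.
  rewrite H in K. replace (Cconj 1) with (RtoC 1) in K by ceq.
  match type of K with 0 < Re ?X => replace X with (RtoC 0) in K by ring end. simpl in K. lra.
Qed.

(** If [s = psi y / moment 0] had real part [1/2] then [s / (s - 1)] would be unimodular, and a
    suitable [w] would make [Xi (conj y) w] vanish, by [Xi_psi]. *)
Lemma psi_off_line y : Cmod y = 1 -> Re (psi y / moment 0) <> 1 / 2.
Proof.
  intros Hy E. pose proof moment_0_neq as M0.
  set (s := (psi y / moment 0)%C) in *.
  assert (Es : psi y = (s * moment 0)%C) by (unfold s; field; auto).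
  assert (N : (s - 1)%C <> 0%C).
  { intros K. apply (f_equal Re) in K. unfold Cminus in K. rewrite re_plus, re_opp, E in K. unfold Re in K; simpl in K. lra. }
  set (e := (s / (s - 1))%C).
  assert (He : Cmod e = 1).
  { unfold e. rewrite Cmod_div by auto.
    assert (Cmod (s - 1) = Cmod s).
    { apply (Rsqr_inj _ _ (Cmod_ge_0 _) (Cmod_ge_0 _)). rewrite !Rsqr_pow2, !Cmod2_alt.
      destruct s as [a b]; unfold Re, Im in *; simpl in *; nra. }
    rewrite H. field. intros Z. apply Cmod_eq_0 in Z. apply N. rewrite Z in E. simpl in E. lra. }
  assert (YY : (y * Cconj y)%C = 1%C) by (rewrite Cconj_mult_self, Hy; ceq).
  pose proof (Xi_positive (Cconj y) (Cconj (e * y)) ltac:(rewrite Cmod_conj; auto)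
    ltac:(rewrite Cmod_conj, Cmod_mult, He, Hy; ring)) as K.
  rewrite Xi_psi in K by (rewrite Cmod_conj; auto). rewrite !Cconj_conj in K.
  replace (e * y * Cconj y)%C with e in K by (rewrite <- Cmult_assoc, YY; ring).
  rewrite Es in K.
  replace (e * moment 0 + (1 - e) * (s * moment 0))%C with (RtoC 0) in K by (unfold e; field; auto).
  rewrite Cmult_0_r in K. simpl in K. lra.
Qed.

(** The boundary values avoid the line [Re = 1/2], hence stay on one side of it; this side is
    decided by the value [1] at the centre. *)
Lemma psi_half_plane y : Cmod y < 1 -> 1 / 2 <= Re (psi y / moment 0).
Proof.
  pose proof moment_0_neq as M0. set (m := moment 0) in *.
  assert (Pm : 0 < Cmod m) by now apply Cmod_gt_0.
  destruct psi_lip as [L0 [HL0 Lip0]].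
  set (s := fun y => (psi y / m)%C). set (L := L0 / Cmod m).
  assert (HL : 0 <= L) by (apply Rdiv_le_0_compat; auto).
  assert (Lip : forall y y', Cmod y <= 1 -> Cmod y' <= 1 -> Cmod (s y - s y') <= L * Cmod (y - y')).
  { intros a b Ha Hb. unfold s. replace (psi a / m - psi b / m)%C with ((psi a - psi b) / m)%C by (field; auto).
    rewrite Cmod_div by auto. unfold L, Rdiv. rewrite Rmult_assoc, (Rmult_comm (/ Cmod m)), <- Rmult_assoc.
    apply Rmult_le_compat_r; [apply Rlt_le, Rinv_0_lt_compat; auto|auto]. }
  assert (Hs : hol 1 s).
  { unfold s. pose proof (useries_hol _ _ _ psi_series) as H. hol_tac. auto. }
  assert (S0 : Re (s 0%C) = 1).
  { unfold s. rewrite psi_0. fold m. replace (m / m)%C with (RtoC 1) by (field; auto). reflexivity. }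
  assert (Rs : forall t, continuous (fun t => Re (s (cis t))) t).
  { intros t. apply clim_re; [typeclasses eauto|]. intros e He.
    destruct (rcont_cis t (e / (L + 1))) as [d Hd]; [apply Rdiv_lt_0_compat; lra|].
    exists d. intros x Hx. specialize (Hd x Hx).
    eapply Rle_lt_trans; [apply Lip; rewrite Cmod_cis; lra|].
    apply (Rmult_lt_compat_r (L + 1)) in Hd; [|lra].
    unfold Rdiv in Hd. rewrite Rmult_assoc, Rinv_l, Rmult_1_r in Hd by lra.
    pose proof (Cmod_ge_0 (cis x - cis t)). nra. }
  (* points of the circle of radius [a] are compared with their projections to the unit circle *)
  assert (Near : forall a z, 0 < a < 1 -> Cmod z = a ->
    exists t, Rabs (Re (s z) - Re (s (cis t))) <= L * (1 - a)).
  { intros a z Ha Hz. destruct (polar z a Hz) as [t [_ Ez]].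
    exists t. replace (Re (s z) - Re (s (cis t))) with (Re (s z - s (cis t))%C) by (unfold Re; simpl; ring).
    eapply Rle_trans; [apply re_le_Cmod|]. eapply Rle_trans; [apply Lip; rewrite ?Cmod_cis; lra|].
    apply Rmult_le_compat_l; auto. right.
    rewrite Ez. replace (RtoC a * cis t - cis t)%C with (- (RtoC (1 - a) * cis t))%C by (rewrite RtoC_minus; ring).
    rewrite Cmod_opp, Cmod_mult, Cmod_cis, Cmod_R, Rabs_pos_eq; lra. }
  assert (Sign : (forall t, 1 / 2 < Re (s (cis t))) \/ (forall t, Re (s (cis t)) < 1 / 2)).
  { assert (Ne : forall t, Re (s (cis t)) <> 1 / 2) by (intros; apply psi_off_line, Cmod_cis).
    assert (NoCross : forall x y, ~ (Re (s (cis x)) < 1 / 2 /\ 1 / 2 < Re (s (cis y)))).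
    { intros x z [H1 H2].
      destruct (IVT_gen (fun t => Re (s (cis t))) x z (1 / 2)) as [c [_ Hc]].
      - intros t. apply continuity_pt_filterlim. apply Rs.
      - rewrite Rmin_left, Rmax_right; lra.
      - apply (Ne c Hc). }
    destruct (Rlt_le_dec (1 / 2) (Re (s (cis 0)))) as [G|G].
    - left. intros t. specialize (Ne t). specialize (NoCross t 0).
      destruct (Rlt_le_dec (1 / 2) (Re (s (cis t)))); auto. exfalso. apply NoCross. split; auto; lra.
    - right. intros t. pose proof (Ne 0). specialize (Ne t). specialize (NoCross 0 t).
      destruct (Rlt_le_dec (Re (s (cis t))) (1 / 2)); auto. exfalso. apply NoCross. split; lra. }
  assert (Lim : forall x, (forall a, 1 / 2 <= a < 1 -> x <= L * (1 - a)) -> x <= 0).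
  { intros x Hx. apply le_epsilon. intros e He.
    assert (0 < e / (L + 1)) by (apply Rdiv_lt_0_compat; lra).
    pose proof (Rmin_l (1/2) (e / (L + 1))). pose proof (Rmin_r (1/2) (e / (L + 1))).
    assert (0 < Rmin (1/2) (e / (L + 1))) by (apply Rmin_glb_lt; lra).
    specialize (Hx (1 - Rmin (1/2) (e / (L + 1))) ltac:(lra)).
    assert ((L + 1) * (e / (L + 1)) = e) by (field; lra). nra. }
  intros Hy. change (1 / 2 <= Re (s y)).
  destruct Sign as [Up|Down].
  - assert (1 / 2 - Re (s y) <= 0); [|lra].
    assert (K : forall a, Cmod y < a < 1 -> 1 / 2 - L * (1 - a) <= Re (s y)).
    { intros a Ha. pose proof (Cmod_ge_0 y). apply (min_real_part 1 a s); auto; try lra.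
      intros z Hz. destruct (Near a z ltac:(lra) Hz) as [t Ht]. specialize (Up t).
      apply Rabs_le_between in Ht. lra. }
    apply le_epsilon. intros e He.
    set (a := 1 - Rmin ((1 - Cmod y) / 2) (e / (L + 1))).
    assert (0 < e / (L + 1)) by (apply Rdiv_lt_0_compat; lra).
    pose proof (Rmin_l ((1 - Cmod y) / 2) (e / (L + 1))). pose proof (Rmin_r ((1 - Cmod y) / 2) (e / (L + 1))).
    assert (0 < Rmin ((1 - Cmod y) / 2) (e / (L + 1))) by (apply Rmin_glb_lt; lra).
    specialize (K a ltac:(unfold a; lra)). unfold a in K.
    assert ((L + 1) * (e / (L + 1)) = e) by (field; lra). nra.
  - exfalso. assert (1 / 2 <= 0); [|lra]. apply Lim. intros a Ha.
    assert (K : - (1 / 2) - L * (1 - a) <= Re (- s 0)).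
    { apply (min_real_part 1 a (fun z => - s z)%C); try lra; [hol_tac| |rewrite Cmod_0; lra].
      intros z Hz. destruct (Near a z ltac:(lra) Hz) as [t Ht]. specialize (Down t).
      rewrite re_opp. apply Rabs_le_between in Ht. lra. }
    rewrite re_opp, S0 in K. lra.
Qed.
End Convolution.

Section Quotient.
Variables (r0 rho : R) (p dp q dq : C -> C).
Hypothesis Hr0 : 1 < r0.
Hypothesis Hp : half_starlike r0 p dp.
Hypothesis Hq : half_starlike r0 q dq.
Hypothesis Hrho : 0 < rho < 1.

Let m := moment p q.
Let g t := psi r0 p q (RtoC rho * Cconj (cis t)).
Let holp : hol r0 p. Proof. exists dp; apply Hp. Qed.
Let holq : hol r0 q. Proof. exists dq; apply Hq. Qed.
Let Rpq : rcont (fun t => p (Cconj (cis t)) * q (cis t))%C.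
Proof. apply rcont_mult; [now apply (hol_rcont_cis_conj r0)|now apply (hol_rcont_cis r0)]. Qed.
Let Ser : useries 1 m (psi r0 p q) := psi_series r0 p dp q dq Hr0 Hp Hq.

Let mod_rho t : Cmod (RtoC rho * Cconj (cis t)) = rho.
Proof. rewrite Cmod_mult, Cmod_conj, Cmod_cis, Cmod_R, Rabs_pos_eq; lra. Qed.
Let mod_rho' t : Cmod (RtoC rho * cis t) = rho.
Proof. rewrite Cmod_mult, Cmod_cis, Cmod_R, Rabs_pos_eq; lra. Qed.

Let Rrz : rcont (fun t => RtoC rho * Cconj (cis t))%C.
Proof. apply rcont_mult; [apply rcont_const|apply rcont_conj, rcont_cis]. Qed.
Let Rrz' : rcont (fun t => RtoC rho * cis t)%C.
Proof. apply rcont_mult; [apply rcont_const|apply rcont_cis]. Qed.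

Let Rg : rcont g.
Proof.
  apply (rcont_comp (psi r0 p q)); auto. intros t. eapply hol_cont; [exact (useries_hol _ _ _ Ser)|].
  rewrite mod_rho; lra.
Qed.

(** The convolution of [p] and [z -> q z * F (rho z)], evaluated at [1]. *)
Definition convolve (F : C -> C) : C :=
  cmean (fun t => p (Cconj (cis t)) * q (cis t) * F (RtoC rho * cis t))%C.

Lemma rcont_dilate F : hol r0 F -> rcont (fun t => F (RtoC rho * cis t)%C).
Proof.
  intros H. apply (rcont_comp F); auto. intros t. eapply hol_cont; eauto. rewrite mod_rho'; lra.
Qed.

(** Parseval: both means equal [sum_n a_n m_n rho^n], with [a_n] the coefficients of [F]. *)
Lemma convolve_parseval F : hol r0 F -> cmean (fun t => F (cis t) * g t)%C = convolve F.
Proof.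
  intros HF. destruct (taylor r0 F ltac:(lra) HF) as [a Ha].
  pose proof (hol_rcont_cis r0 F HF Hr0) as RF. pose proof (rcont_dilate F HF) as RFd.
  set (S := psum (fun k => a k * m k)%C).
  assert (RP : forall b n, rcont (fun t => psum b n (RtoC rho * Cconj (cis t)))%C).
  { intros b n. apply (rcont_comp (psum b n)); auto. intros t. eapply hol_cont; [apply (hol_psum 1)|].
    rewrite mod_rho; lra. }
  assert (RP' : forall b n, rcont (fun t => psum b n (RtoC rho * cis t))%C).
  { intros b n. apply (rcont_comp (psum b n)); auto. intros t. eapply hol_cont; [apply (hol_psum 1)|].
    rewrite mod_rho'; lra. }
  assert (E1 : forall n, cmean (fun t => F (cis t) * psum m n (RtoC rho * Cconj (cis t)))%C = S n (RtoC rho)).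
  { induction n.
    - rewrite (cmean_ext _ (fun _ => 0%C)); [apply cmean_const|]. intros; simpl; ring.
    - unfold S in *. simpl psum. rewrite <- IHn.
      pose proof (useries_coef r0 1 a F n Ha ltac:(lra)) as Co.
      rewrite Cpow_1_l, Cmult_1_r in Co.
      assert (RQ : rcont (fun t => F (circ 1 t) * Cconj (cis t) ^ n)%C).
      { apply rcont_mult; [eapply hol_rcont_circ; eauto; lra|]. apply rcont_pow, rcont_conj, rcont_cis. }
      rewrite <- Co, <- Cmult_assoc, <- cmean_scal_r by auto.
      rewrite <- cmean_plus; [|now apply rcont_mult|apply rcont_mult; auto; apply rcont_const].
      apply cmean_ext. intros t. unfold circ. rewrite Cpow_mult_l, Cmult_1_l. ring. }
  assert (E2 : forall n, cmean (fun t => p (Cconj (cis t)) * q (cis t) * psum a n (RtoC rho * cis t))%C = S n (RtoC rho)).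
  { induction n.
    - rewrite (cmean_ext _ (fun _ => 0%C)); [apply cmean_const|]. intros; simpl; ring.
    - unfold S in *. simpl psum. rewrite <- IHn.
      assert (RQ : rcont (fun t => p (Cconj (cis t)) * q (cis t) * cis t ^ n)%C).
      { apply rcont_mult; auto. apply rcont_pow, rcont_cis. }
      replace (a n * m n * RtoC rho ^ n)%C with (m n * (a n * RtoC rho ^ n))%C by ring.
      unfold m, moment. rewrite <- cmean_scal_r by auto.
      rewrite <- cmean_plus; [|now apply rcont_mult|apply rcont_mult; auto; apply rcont_const].
      apply cmean_ext. intros t. rewrite Cpow_mult_l. ring. }
  apply C_eq_of_small. intros e He.
  destruct (rcont_bounded _ RF) as [B1 [HB1 K1]]. destruct (rcont_bounded _ Rpq) as [B2 [HB2 K2]].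
  destruct (cmean_uniform_limit (fun n t => F (cis t) * psum m n (RtoC rho * Cconj (cis t)))%C
     (fun t => F (cis t) * g t)%C) with (eps := e / 4) as [N1 H1]; try lra.
  - intros n. now apply rcont_mult.
  - now apply rcont_mult.
  - intros d Hd. destruct (Ser rho ltac:(lra) (d / B1)) as [N HN]; [now apply Rdiv_lt_0_compat|].
    exists N. intros n Hn t Ht. specialize (HN n Hn (RtoC rho * Cconj (cis t))%C ltac:(rewrite mod_rho; lra)).
    unfold g. set (x := psi r0 p q (RtoC rho * Cconj (cis t))) in *. set (y := psum m n (RtoC rho * Cconj (cis t))) in *.
    replace (F (cis t) * y - F (cis t) * x)%C with (F (cis t) * (y - x))%C by ring.
    rewrite Cmod_mult. replace d with (B1 * (d / B1)) by (field; lra).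
    apply Rmult_le_compat; auto; apply Cmod_ge_0.
  - destruct (cmean_uniform_limit (fun n t => p (Cconj (cis t)) * q (cis t) * psum a n (RtoC rho * cis t))%C
     (fun t => p (Cconj (cis t)) * q (cis t) * F (RtoC rho * cis t))%C) with (eps := e / 4) as [N2 H2]; try lra.
    + intros n. now apply rcont_mult.
    + now apply rcont_mult.
    + intros d Hd. destruct (Ha rho ltac:(lra) (d / B2)) as [N HN]; [now apply Rdiv_lt_0_compat|].
      exists N. intros n Hn t Ht. specialize (HN n Hn (RtoC rho * cis t)%C ltac:(rewrite mod_rho'; lra)).
      set (x := F (RtoC rho * cis t)%C) in *. set (y := psum a n (RtoC rho * cis t)) in *.
      set (c := (p (Cconj (cis t)) * q (cis t))%C) in *.
      replace (c * y - c * x)%C with (c * (y - x))%C by ring.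
      rewrite Cmod_mult. replace d with (B2 * (d / B2)) by (field; lra).
      apply Rmult_le_compat; try apply Cmod_ge_0; auto. apply (K2 t Ht).
    + specialize (H1 (N1 + N2)%nat ltac:(lia)). specialize (H2 (N1 + N2)%nat ltac:(lia)).
      rewrite E1 in H1. rewrite E2 in H2. fold (convolve F) in H2.
      eapply Rle_lt_trans; [apply (Cmod_tri3 _ (S (N1 + N2)%nat (RtoC rho)))|].
      rewrite (Cmod_sub_sym _ (S _ _)). lra.
Qed.

(** Since [g] has only nonpositive frequencies and [F] only nonnegative ones, the conjugate of [g]
    contributes to the mean only its constant term, which the [- 1] compensates.  The resulting
    weight is nonnegative by [psi_half_plane]. *)
Lemma convolve_representation F : hol r0 F ->
  cmean (fun t => F (cis t) * RtoC (2 * Re (g t / m 0%nat) - 1))%C = (convolve F / m 0%nat)%C.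
Proof.
  intros HF. pose proof (moment_0_neq r0 p dp q dq Hr0 Hp Hq) as M0. fold m in M0.
  pose proof (hol_rcont_cis r0 F HF Hr0) as RF.
  assert (Rgc : rcont (fun t => Cconj (g t))) by now apply rcont_conj.
  assert (M0' : Cconj (m 0%nat) <> 0%C).
  { intros K. apply M0. rewrite <- (Cconj_conj (m 0%nat)), K. ceq. }
  (* [conj g] continues holomorphically to a disc of radius larger than 1 *)
  assert (E2 : cmean (fun t => F (cis t) * Cconj (g t))%C = (F 0 * Cconj (m 0%nat))%C).
  { set (s := Rmin r0 (/ rho)).
    assert (I : 1 < / rho) by (rewrite <- Rinv_1; apply Rinv_lt_contravar; lra).
    assert (S1 : 1 < s) by (now apply Rmin_glb_lt).
    assert (HG : hol s (fun z => F z * Cconj (psi r0 p q (Cconj (RtoC rho * z))))%C).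
    { apply hol_mult; [apply hol_sub with r0; auto; apply Rmin_l|].
      apply (hol_comp s 1 (fun z => Cconj (psi r0 p q (Cconj z)))).
      - intros z Hz. rewrite Cmod_mult, Cmod_R, Rabs_pos_eq by lra.
        assert (s <= / rho) by apply Rmin_r. apply Rmult_lt_reg_l with (/ rho); [lra|].
        rewrite <- Rmult_assoc, Rinv_l by lra. lra.
      - apply hol_reflect. exact (useries_hol _ _ _ Ser).
      - hol_tac. }
    pose proof (mean_value_cis s _ HG S1) as MV. cbv beta in MV.
    replace (Cconj (RtoC rho * 0))%C with (RtoC 0) in MV by ceq.
    rewrite (psi_0 r0 p dp q dq Hr0 Hp Hq) in MV. fold m in MV. rewrite <- MV.
    apply cmean_ext. intros t. unfold g. do 3 f_equal. rewrite Cmult_conj. f_equal. ceq. }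
  rewrite (cmean_ext _ (fun t => F (cis t) * g t * / m 0%nat + (F (cis t) * Cconj (g t) * / Cconj (m 0%nat) - F (cis t)))%C).
  2:{ intros t. replace (RtoC (2 * Re (g t / m 0%nat) - 1)) with (g t / m 0%nat + Cconj (g t / m 0%nat) - 1)%C.
      - rewrite Cdiv_conj by auto. unfold Cdiv. ring.
      - rewrite RtoC_minus, RtoC_mult, re_alt. field. auto. }
  assert (R1 : rcont (fun t => F (cis t) * g t * / m 0%nat)%C).
  { apply rcont_mult; [now apply rcont_mult|apply rcont_const]. }
  assert (R2 : rcont (fun t => F (cis t) * Cconj (g t) * / Cconj (m 0%nat))%C).
  { apply rcont_mult; [now apply rcont_mult|apply rcont_const]. }
  rewrite cmean_plus, cmean_minus, !cmean_scal_r; auto; try (now apply rcont_mult); [|now apply rcont_minus].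
  rewrite convolve_parseval, E2, (mean_value_cis r0 F) by auto. field. auto.
Qed.

(** The quotient [convolve F / convolve 1] is an average of the values of [F] on the circle. *)
Theorem convolve_nonzero F : hol r0 F -> (forall z, Cmod z = 1 -> 0 < Re (F z)) -> convolve F <> 0%C.
Proof.
  intros HF Pos E. pose proof (moment_0_neq r0 p dp q dq Hr0 Hp Hq) as M0. fold m in M0.
  pose proof (hol_rcont_cis r0 F HF Hr0) as RF.
  set (w := fun t => 2 * Re (g t / m 0%nat) - 1).
  assert (Rgm : rcont (fun t => g t / m 0%nat)%C) by (apply rcont_mult; auto; apply rcont_const).
  assert (Cw : forall t, continuous w t).
  { intros t. unfold w. apply (continuous_minus (V := R_NormedModule)); [|apply continuous_const].
    apply (continuous_scal_r (V := R_NormedModule)). now apply rcont_re. }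
  assert (W0 : forall t, 0 <= w t).
  { intros t. unfold w. pose proof (psi_half_plane r0 p dp q dq Hr0 Hp Hq (RtoC rho * Cconj (cis t))%C ltac:(rewrite mod_rho; lra)).
    fold m in H. fold (g t) in H. lra. }
  assert (W1 : rmean w = 1).
  { pose proof (convolve_representation (fun _ => 1%C) (hol_const _ _)) as K.
    assert (C1 : convolve (fun _ => 1%C) = m 0%nat) by reflexivity.
    rewrite C1 in K. apply (f_equal Re) in K. rewrite Re_cmean in K.
    replace (Re (m 0%nat / m 0%nat)) with 1 in K by (replace (m 0%nat / m 0%nat)%C with (RtoC 1) by (field; auto); reflexivity).
    rewrite <- K. apply rmean_ext. intros t. unfold w. rewrite Cmult_1_l, re_RtoC. reflexivity. }
  pose proof (convolve_representation F HF) as K. rewrite E in K.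
  apply (f_equal Re) in K. rewrite Re_cmean in K.
  replace (Re (0 / m 0%nat)) with 0 in K by (unfold Cdiv; rewrite Cmult_0_l; reflexivity).
  assert (Cf : forall t, continuous (fun t => Re (F (cis t))) t) by now apply rcont_re.
  destruct (continuity_ab_min (fun t => Re (F (cis t))) 0 (2 * PI)) as [x [Hx _]].
  { pose proof PI_RGT_0; lra. }
  { intros t _. apply continuity_pt_filterlim. apply Cf. }
  specialize (Pos (cis x) (Cmod_cis x)). set (mu := Re (F (cis x))) in *.
  assert (mu * rmean w <= 0); [|rewrite W1 in H; lra].
  rewrite <- K, <- rmean_scal by auto.
  apply rmean_le.
  - intros t. apply (continuous_scal_r (V := R_NormedModule)). auto.
  - intros t. apply continuous_ext with (fun t => Re (F (cis t)) * w t).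
    { intros s. rewrite re_scal_r. reflexivity. }
    apply (continuous_mult (K := R_AbsRing) (fun t => Re (F (cis t))) w); auto.
  - intros t Ht. rewrite re_scal_r. apply Rmult_le_compat_r; [apply W0|now apply Hx].
Qed.
End Quotient.

(** * The analytic criterion for convexity *)

(** Otherwise a step against the derivative would make the real part negative. *)
Lemma re_pos_of_local_min (g : C -> C) (z l : C) : l <> 0%C -> cder g z l ->
  nearC z (fun w => 0 <= Re (g w)) -> 0 < Re (g z).
Proof.
  intros Hl Hg Hn.
  assert (P : 0 < Cmod l) by now apply Cmod_gt_0.
  assert (G0 : 0 <= Re (g z)).
  { destruct Hn as [d [Hd H]]. apply H. replace (z - z)%C with (RtoC 0) by ring. now rewrite Cmod_0. }
  destruct (Rle_lt_or_eq_dec _ _ G0) as [|E]; auto. exfalso.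
  destruct (filter_and _ _ Hn (Hg (Cmod l / 2) ltac:(lra))) as [d [Hd H]].
  set (e := d / (2 * Cmod l)). assert (He : 0 < e) by (apply Rdiv_lt_0_compat; lra).
  set (w := (z - RtoC e * Cconj l)%C).
  assert (W : (w - z = - (RtoC e * Cconj l))%C) by (unfold w; ring).
  assert (M : Cmod (w - z) = e * Cmod l).
  { rewrite W, Cmod_opp, Cmod_mult, Cmod_conj, Cmod_R, Rabs_pos_eq; lra. }
  assert (Small : Cmod (w - z) < d).
  { rewrite M. unfold e. replace (d / (2 * Cmod l) * Cmod l) with (d / 2) by (field; lra). lra. }
  destruct (H w Small) as [H1 H2].
  pose proof (re_le (g w - g z - l * (w - z))) as K.
  assert (E2 : (l * (w - z))%C = RtoC (- (e * Cmod l ^ 2))).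
  { rewrite W. rewrite RtoC_opp, RtoC_mult, <- Cconj_mult_self. ring. }
  rewrite E2, M in H2. rewrite E2 in K.
  assert (ER : Re (g w - g z - RtoC (- (e * Cmod l ^ 2)))%C = Re (g w) - Re (g z) + e * Cmod l ^ 2)
    by (unfold Re; simpl; ring).
  rewrite ER, <- E in K. assert (0 < e * Cmod l ^ 2) by (apply Rmult_lt_0_compat; [lra|now apply pow_lt]).
  assert (Cmod l / 2 * (e * Cmod l) = e * Cmod l ^ 2 / 2) by field. lra.
Qed.

Section Convexity.
Variables (R0 : R) (h dh ddh : C -> C).
Hypothesis Hh : holD R0 h dh.
Hypothesis Hdh : holD R0 dh ddh.
Hypothesis Nz : forall z, Cmod z < R0 -> dh z <> 0%C.
Hypothesis Hc : forall z, Cmod z < R0 -> 0 < Re (1 + z * ddh z / dh z).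

(** The tangent to the curve [t -> h (r e^{it})] turns monotonically, by [2 PI] in one turn;
    hence the curve stays on one side of each of its tangents. *)
Lemma support_on_circle w z : 0 < Cmod w < R0 -> Cmod z = Cmod w -> z <> w ->
  0 < Re (Cconj (w * dh w) * (h w - h z)).
Proof.
  intros Hw Hz N. set (r := Cmod w) in *.
  assert (N0 : dh 0%C <> 0%C) by (apply Nz; rewrite Cmod_0; lra).
  destruct (exists_log _ N0) as [l0 Hl0].
  destruct (logarithm R0 dh ddh l0 ltac:(lra) Hdh Nz Hl0) as [l [Hl [_ El]]].
  assert (Nw : w <> 0%C) by (apply Cneq_mod; unfold r in Hw; lra).
  destruct (polar_unit (z / w)) as [s [Hs Es]].
  { rewrite Cmod_div, Hz by auto. unfold r. field. unfold r in Hw; lra. }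
  assert (Ez : z = (w * cis s)%C) by (rewrite <- Es; field; auto).
  assert (Ps : 0 < s < 2 * PI).
  { split; [|lra]. destruct (Rle_lt_or_eq_dec 0 s ltac:(lra)) as [|<-]; auto.
    exfalso. apply N. rewrite Ez, cis_0. ring. }
  set (c := fun x => (w * cis x)%C).
  assert (Mc : forall x, Cmod (c x) < R0).
  { intros x. unfold c. rewrite Cmod_mult, Cmod_cis. unfold r in Hw; lra. }
  assert (Rc : forall x, rder c x (Ci * c x)%C).
  { intros x. eapply rder_eq; [apply (rder_mult (fun _ => w) cis x 0 (Ci * cis x)); [apply rder_const|apply rder_cis]|].
    unfold c. ring. }
  set (k := fun x => Im (l (c x)) - Im (l w) + x).
  assert (Dk : forall x, is_derive k x (Re (1 + c x * ddh (c x) / dh (c x)))).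
  { intros x. pose proof (rder_comp l c x _ _ (proj1 (Hl (c x) (Mc x))) (Rc x)) as [_ RI].
    unfold k. evar_last.
    - apply (is_derive_plus (V := R_NormedModule)); [|apply @is_derive_id].
      apply (is_derive_minus (V := R_NormedModule)); [exact RI|apply @is_derive_const].
    - replace (ddh (c x) / dh (c x) * (Ci * c x))%C with (Ci * (c x * ddh (c x) / dh (c x)))%C by (unfold Cdiv; ring).
      set (X := (c x * ddh (c x) / dh (c x))%C). unfold minus, plus, opp, zero, one; simpl. unfold Re, Im; simpl. lra. }
  assert (Inc : forall x y, x < y -> k x < k y).
  { intros x y Hxy. exact (incr_function k m_infty p_infty _ (fun x _ _ => Dk x) (fun x _ _ => Hc _ (Mc x)) x y I Hxy I). }
  assert (c0 : c 0 = w) by (unfold c; rewrite cis_0; ring).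
  assert (c2 : c (2 * PI) = w) by (unfold c; rewrite cis_2PI; ring).
  assert (K0 : k 0 = 0) by (unfold k; rewrite c0; lra).
  assert (K2 : k (2 * PI) = 2 * PI) by (unfold k; rewrite c2; lra).
  set (d := fun x => Re (Cconj (w * dh w) * (h w - h (c x)))%C).
  assert (Dd : forall x, is_derive d x (Cmod w ^ 2 * (exp (Re (l w)) * exp (Re (l (c x)))) * sin (k x))).
  { intros x. pose proof (rder_comp h c x _ _ (proj1 (Hh (c x) (Mc x))) (Rc x)) as Rh.
    pose proof (rder_mult (fun _ => - Cconj (w * dh w))%C _ x 0 _ (rder_const _ x) Rh) as Rm.
    pose proof (rder_plus (fun _ => Cconj (w * dh w) * h w)%C _ x 0 _ (rder_const _ x) Rm) as [RR _].
    apply is_derive_ext with (fun s => Re (Cconj (w * dh w) * h w + - Cconj (w * dh w) * h (c s))%C).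
    { intros y. unfold d. f_equal. ring. }
    match goal with |- is_derive _ _ ?v => match type of RR with is_derive _ _ ?v' => replace v with v'; [exact RR|] end end.
    rewrite <- (El (c x) (Mc x)), <- (El w) by (unfold r in Hw; lra).
    rewrite (cexp_polar (l w)), (cexp_polar (l (c x))).
    replace (0 + (0 * h (c x) + - Cconj (w * (RtoC (exp (Re (l w))) * cis (Im (l w)))) *
         (RtoC (exp (Re (l (c x)))) * cis (Im (l (c x))) * (Ci * c x))))%C
      with (RtoC (Cmod w ^ 2 * (exp (Re (l w)) * exp (Re (l (c x))))) * (- Ci * cis (k x)))%C.
    - rewrite re_scal_l. f_equal. unfold cis, Re; simpl. ring.
    - rewrite !RtoC_mult, <- Cconj_mult_self, !Cmult_conj, cis_conj'.
      replace (k x) with (- Im (l w) + (Im (l (c x)) + x)) by (unfold k; ring).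
      rewrite !cis_plus. replace (Cconj (RtoC (exp (Re (l w))))) with (RtoC (exp (Re (l w)))) by ceq.
      unfold c. ring. }
  assert (Pos : forall x, 0 < Cmod w ^ 2 * (exp (Re (l w)) * exp (Re (l (c x))))).
  { intros x. apply Rmult_lt_0_compat; [unfold r in Hw; nra|]. apply Rmult_lt_0_compat; apply exp_pos. }
  change (0 < Re (Cconj (w * dh w) * (h w - h z))). rewrite Ez. change (0 < d s).
  assert (d0 : d 0 = 0).
  { unfold d. rewrite c0. replace (_ * _)%C with (RtoC 0) by ring. reflexivity. }
  assert (d2 : d (2 * PI) = 0).
  { unfold d. rewrite c2. replace (_ * _)%C with (RtoC 0) by ring. reflexivity. }
  assert (Dd' : forall x, derivable_pt_lim d x (Cmod w ^ 2 * (exp (Re (l w)) * exp (Re (l (c x)))) * sin (k x)))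
    by (intros; apply is_derive_Reals; apply Dd).
  destruct (Rle_or_lt (k s) PI) as [L|L].
  - destruct (MVT_cor2 d _ 0 s ltac:(lra) (fun x _ => Dd' x)) as [x [Ex Hx]].
    rewrite d0, !Rminus_0_r in Ex. rewrite Ex.
    pose proof (Inc 0 x ltac:(lra)). pose proof (Inc x s ltac:(lra)).
    apply Rmult_lt_0_compat; [|lra]. apply Rmult_lt_0_compat; auto. apply sin_gt_0; lra.
  - destruct (MVT_cor2 d _ s (2 * PI) ltac:(lra) (fun x _ => Dd' x)) as [x [Ex Hx]].
    rewrite d2 in Ex.
    pose proof (Inc s x ltac:(lra)). pose proof (Inc x (2 * PI) ltac:(lra)).
    assert (sin (k x) < 0) by (apply sin_lt_0; lra). specialize (Pos x).
    set (A := Cmod w ^ 2 * (exp (Re (l w)) * exp (Re (l (c x))))) in *.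
    assert (0 < (A * - sin (k x)) * (2 * PI - s)); [|lra].
    apply Rmult_lt_0_compat; [|lra]. apply Rmult_lt_0_compat; lra.
Qed.

(** The left-hand side is a harmonic function of [z], so the inequality passes from the circle
    to its interior. *)
Lemma support_in_disk w z : 0 < Cmod w < R0 -> Cmod z <= Cmod w -> z <> w ->
  0 < Re (Cconj (w * dh w) * (h w - h z)).
Proof.
  intros Hw Hz N. destruct (Rle_lt_or_eq_dec _ _ Hz) as [L|E]; [|now apply support_on_circle].
  set (g := fun x => (Cconj (w * dh w) * (h w - h x))%C).
  assert (Hg : holD R0 g (fun x => 0 * (h w - h x) + Cconj (w * dh w) * (0 - dh x))%C).
  { apply (holD_mult R0 (fun _ => Cconj (w * dh w)) (fun x => h w - h x)%C); [apply holD_const|].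
    apply (holD_minus R0 (fun _ => h w) h); auto. apply holD_const. }
  apply (re_pos_of_local_min g z (0 * (h w - h z) + Cconj (w * dh w) * (0 - dh z))%C).
  - replace (0 * (h w - h z) + Cconj (w * dh w) * (0 - dh z))%C with (- (Cconj (w * dh w) * dh z))%C by ring.
    apply Cneq_mod. rewrite Cmod_opp, !Cmod_mult, Cmod_conj, Cmod_mult.
    assert (0 < Cmod (dh w)) by (apply Cmod_gt_0, Nz; lra).
    assert (0 < Cmod (dh z)) by (apply Cmod_gt_0, Nz; lra).
    repeat apply Rmult_lt_0_compat; lra.
  - apply Hg. lra.
  - generalize (disk_open (Cmod w) z L). apply filter_imp. intros x Hx.
    apply (min_real_part R0 (Cmod w) g 0); try lra; [eexists; exact Hg|].
    intros y Hy. destruct (classic (y = w)) as [->|M].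
    + unfold g. replace (_ * _)%C with (RtoC 0) by ring. simpl; lra.
    + apply Rlt_le. now apply support_on_circle.
Qed.

Lemma convex_injective : injective_on (disk R0) h.
Proof.
  assert (K : forall z1 z2, disk R0 z1 -> disk R0 z2 -> Cmod z1 <= Cmod z2 -> h z1 = h z2 -> z1 = z2).
  { intros z1 z2 H1 H2 L E. unfold disk in *. destruct (classic (z1 = z2)) as [|N]; auto. exfalso.
    assert (0 < Cmod z2).
    { destruct (Rle_lt_or_eq_dec _ _ (Cmod_ge_0 z2)) as [|Z]; auto. exfalso. apply N.
      assert (Cmod z1 = 0) by (pose proof (Cmod_ge_0 z1); lra).
      rewrite (Cmod_eq_0 z1), (Cmod_eq_0 z2); auto. }
    pose proof (support_in_disk z2 z1 ltac:(lra) L N) as P. rewrite E in P.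
    replace (_ * _)%C with (RtoC 0) in P by ring. simpl in P; lra. }
  intros z1 z2 H1 H2 E. destruct (Rle_or_lt (Cmod z1) (Cmod z2)); [now apply K|].
  symmetry. apply K; auto. lra.
Qed.

(** If [u] were omitted, [z h' / (h - u)] would be holomorphic, vanish at [0] and have positive
    real part on the circle of radius [r], against the minimum principle. *)
Lemma inner_side_value r u : 0 < r < R0 ->
  (forall w, Cmod w = r -> 0 < Re (Cconj (w * dh w) * (h w - u))) -> image_of h (disk R0) u.
Proof.
  intros Hr H. apply NNPP. intros NI.
  assert (D : forall z, Cmod z < R0 -> (h z - u)%C <> 0%C).
  { intros z Hz E. apply NI. exists z. split; auto. replace (h z) with (h z - u + u)%C by ring. rewrite E; ring. }
  set (k := fun z => (z * dh z / (h z - u))%C).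
  assert (Hk : hol R0 k).
  { assert (hol R0 h) by (eexists; exact Hh). assert (hol R0 dh) by (eexists; exact Hdh).
    unfold k. hol_tac. exact D. }
  pose proof (mean_value R0 r k Hk Hr) as MV. apply (f_equal Re) in MV. rewrite Re_cmean in MV.
  replace (Re (k 0%C)) with 0 in MV.
  2:{ unfold k. replace (0 * dh 0 / (h 0 - u))%C with (RtoC 0) by (unfold Cdiv; ring). reflexivity. }
  assert (P : forall t, 0 < Re (k (circ r t))).
  { intros t. assert (M : Cmod (circ r t) = r) by (apply Cmod_circ; lra).
    specialize (H _ M). specialize (D (circ r t) ltac:(lra)). unfold k.
    set (w := circ r t) in *. set (X := (h w - u)%C) in *.
    assert (PX : 0 < Cmod X) by now apply Cmod_gt_0.
    replace (w * dh w / X)%C with (RtoC (/ Cmod X ^ 2) * Cconj (Cconj (w * dh w) * X))%C.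
    - rewrite re_scal_l, re_conj. apply Rmult_lt_0_compat; auto. apply Rinv_0_lt_compat. nra.
    - rewrite RtoC_inv, <- Cconj_mult_self by nra. rewrite Cmult_conj, Cconj_conj. field.
      split; auto. intros Z. apply D. rewrite <- (Cconj_conj X), Z. ceq. }
  assert (0 < rmean (fun t => Re (k (circ r t)))); [|lra].
  pose proof PI_RGT_0. apply (rmean_gt_0 _ PI); auto; try lra.
  - apply rcont_re. eapply hol_rcont_circ; eauto. lra.
  - intros t. now apply Rlt_le.
Qed.

(** The inner sides of the tangents are half-planes, so they contain convex combinations. *)
Theorem convex_image : convex_set (image_of h (disk R0)).
Proof.
  intros u1 u2 t [z1 [H1 E1]] [z2 [H2 E2]] Ht. unfold disk in H1, H2.
  set (r := (Rmax (Cmod z1) (Cmod z2) + R0) / 2).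
  assert (Hr : Cmod z1 < r /\ Cmod z2 < r /\ r < R0).
  { unfold r. pose proof (Rmax_l (Cmod z1) (Cmod z2)). pose proof (Rmax_r (Cmod z1) (Cmod z2)).
    assert (Rmax (Cmod z1) (Cmod z2) < R0) by now apply Rmax_lub_lt. lra. }
  pose proof (Cmod_ge_0 z1).
  apply inner_side_value with r; [lra|]. intros w Hw.
  assert (P1 : 0 < Re (Cconj (w * dh w) * (h w - u1))).
  { rewrite <- E1. apply support_in_disk; try lra. intros ->; lra. }
  assert (P2 : 0 < Re (Cconj (w * dh w) * (h w - u2))).
  { rewrite <- E2. apply support_in_disk; try lra. intros ->; lra. }
  replace (Cconj (w * dh w) * (h w - (RtoC (1 - t) * u1 + RtoC t * u2)))%C
    with (RtoC (1 - t) * (Cconj (w * dh w) * (h w - u1)) + RtoC t * (Cconj (w * dh w) * (h w - u2)))%C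
    by (rewrite RtoC_minus; ring).
  rewrite re_plus, !re_scal_l. destruct (Req_dec t 0) as [->|]; [lra|].
  assert (0 < t * Re (Cconj (w * dh w) * (h w - u2))) by (apply Rmult_lt_0_compat; lra).
  assert (0 <= (1 - t) * Re (Cconj (w * dh w) * (h w - u1))) by (apply Rmult_le_pos; lra). lra.
Qed.
End Convexity.

(** * Univalent functions *)

Lemma cder_of_slope (g k : C -> C) z :
  ccont k z -> nearC z (fun w => (g w - g z = k w * (w - z))%C) -> cder g z (k z).
Proof.
  intros Hk H e He. generalize (filter_and _ _ H (Hk e He)). apply filter_imp.
  intros w [E K]. rewrite E. replace (k w * (w - z) - k z * (w - z))%C with ((k w - k z) * (w - z))%C by ring.
  rewrite Cmod_mult. pose proof (Cmod_ge_0 (w - z)). nra.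
Qed.

Lemma circle_min r0 r f : hol r0 f -> 0 <= r < r0 -> (forall z, Cmod z = r -> f z <> 0%C) ->
  exists m, 0 < m /\ forall z, Cmod z = r -> m <= Cmod (f z).
Proof.
  intros Hf Hr Hz. pose proof twoPI_pos.
  destruct (continuity_ab_min (fun t => Cmod (f (circ r t))) 0 (2 * PI)) as [x [Hx _]]; [lra| |].
  - intros t _. apply continuity_pt_filterlim.
    apply (rcont_cmod (fun t => f (circ r t))). eapply hol_rcont_circ; eauto.
  - exists (Cmod (f (circ r x))). split.
    + apply Cmod_gt_0, Hz. apply Cmod_circ; lra.
    + intros z Mz. destruct (polar z r Mz) as [t [Ht ->]]. apply Hx; lra.
Qed.

Lemma hol_translate f df z0 r : holD 1 f df -> Cmod z0 + r <= 1 ->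
  holD r (fun z => f (z0 + z)%C) (fun z => df (z0 + z)%C).
Proof.
  intros Hf Hr. apply holD_ext with (fun z => f (z0 + z)%C) (fun z => df (z0 + z) * (0 + 1))%C.
  - reflexivity.
  - intros; ring.
  - apply (holD_comp r 1 f (fun z => z0 + z)%C df (fun _ => 0 + 1)%C); auto.
    + intros z Hz. eapply Rle_lt_trans; [apply Cmod_triangle|lra].
    + apply (holD_plus r (fun _ => z0) (fun z => z)); [apply holD_const|apply holD_id].
Qed.

Section Univalent.
Variables (f df : C -> C).
Hypothesis Hf : holD 1 f df.
Hypothesis Inj : injective_on (disk 1) f.

(** If [w] near [f z0] were omitted close to [z0], the reciprocal of [f - w] would violate the
    maximum principle on a small circle, where [f - f z0] is bounded away from [0]. *)
Lemma open_mapping z0 e : Cmod z0 < 1 -> 0 < e ->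
  exists d, 0 < d /\ forall w, Cmod (w - f z0) < d ->
  exists z, Cmod z < 1 /\ Cmod (z - z0) < e /\ f z = w.
Proof.
  intros Hz He. set (r1 := Rmin e (1 - Cmod z0)).
  assert (H1 : 0 < r1) by (apply Rmin_glb_lt; lra).
  assert (H2 : r1 <= e) by apply Rmin_l. assert (H3 : r1 <= 1 - Cmod z0) by apply Rmin_r.
  assert (InD : forall u, Cmod u < r1 -> Cmod (z0 + u) < 1).
  { intros u Hu. eapply Rle_lt_trans; [apply Cmod_triangle|lra]. }
  assert (HF : hol r1 (fun u => f (z0 + u)%C)) by (eexists; apply (hol_translate f df); auto; lra).
  destruct (circle_min r1 (r1 / 2) (fun u => f (z0 + u) - f z0)%C) as [m [Hm Km]].
  - hol_tac.
  - lra.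
  - intros u Hu E. assert (u = 0%C).
    { assert (z0 + u = z0)%C.
      { apply Inj; [apply InD; lra|exact Hz|]. replace (f (z0 + u)%C) with (f (z0 + u) - f z0 + f z0)%C by ring.
        rewrite E; ring. }
      replace u with (z0 + u - z0)%C by ring. rewrite H; ring. }
    rewrite H, Cmod_0 in Hu. lra.
  - exists (m / 2). split; [lra|]. intros w Hw. apply NNPP. intros N.
    assert (D : forall u, Cmod u < r1 -> (f (z0 + u) - w)%C <> 0%C).
    { intros u Hu E. apply N. exists (z0 + u)%C. split; [auto|split].
      - replace (z0 + u - z0)%C with u by ring. lra.
      - replace (f (z0 + u)%C) with (f (z0 + u) - w + w)%C by ring. rewrite E; ring. }
    assert (K : Cmod (/ (f (z0 + 0) - w)) <= / (m / 2)).
    { apply (max_modulus r1 (r1 / 2) (fun u => / (f (z0 + u) - w))%C); try lra.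
      - hol_tac. exact D.
      - intros u Hu. rewrite Cmod_inv by (apply D; lra). apply Rinv_le_contravar; [lra|].
        specialize (Km u Hu). pose proof (Cmod_tri3 (f (z0 + u)%C) w (f z0)). lra.
      - rewrite Cmod_0; lra. }
    assert (D0 : (f (z0 + 0) - w)%C <> 0%C) by (apply D; rewrite Cmod_0; lra).
    rewrite Cmod_inv in K by auto.
    replace (z0 + 0)%C with z0 in * by ring. rewrite Cmod_sub_sym in Hw.
    apply Rinv_lt_contravar in Hw; [lra|].
    apply Rmult_lt_0_compat; [now apply Cmod_gt_0|lra].
Qed.

(** Where [f'] vanishes, nearby difference quotients [(f z - f w) / (z - w)] with [f' w <> 0]
    have no zeros, hence by the maximum principle cannot be small. *)
Lemma univalent_derivative z0 : Cmod z0 < 1 -> df z0 <> 0%C.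
Proof.
  intros Hz E0. pose proof (Cmod_ge_0 z0).
  set (r := (1 + Cmod z0) / 2). assert (Hr : Cmod z0 < r < 1) by (unfold r; lra).
  assert (holf : hol 1 f) by (exists df; auto).
  destruct (circle_min 1 r (fun z => f z - f z0)%C) as [m [Hm Km]].
  - hol_tac.
  - lra.
  - intros z Mz E. assert (z = z0).
    { apply Inj; unfold disk; try lra. replace (f z) with (f z - f z0 + f z0)%C by ring. rewrite E; ring. }
    subst; lra.
  - destruct (difference_quotient 1 f df z0 Hf Hz) as [D [HD [D0 DE]]].
    set (c := m / 4).
    assert (Low : forall w, Cmod w < r -> w <> z0 -> df w <> 0%C -> Cmod (f w - f z0) <= m / 2 -> c <= Cmod (D w)).
    { intros w Hw Nw Dw Sw.
      destruct (difference_quotient 1 f df w Hf) as [k [Hk [k0 kE]]]; [lra|].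
      assert (Nk : forall z, Cmod z < 1 -> k z <> 0%C).
      { intros z Mz Z. destruct (classic (z = w)) as [->|N]; [congruence|]. apply N.
        apply Inj; unfold disk; auto; try lra.
        replace (f z) with (f z - f w + f w)%C by ring. rewrite kE, Z by auto. ring. }
      assert (K : Cmod (/ k z0) <= / c).
      { apply (max_modulus 1 r (fun z => / k z)%C); try lra.
        - hol_tac. exact Nk.
        - intros z Mz. rewrite Cmod_inv by (apply Nk; lra). apply Rinv_le_contravar; [unfold c; lra|].
          specialize (Km z Mz). pose proof (Cmod_tri3 (f z) (f w) (f z0)).
          specialize (kE z ltac:(lra)).
          assert (M1 : Cmod (f z - f w) = Cmod (z - w) * Cmod (k z)) by (rewrite kE; apply Cmod_mult).
          assert (M2 : Cmod (z - w) <= 2).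
          { replace (z - w)%C with (z + - w)%C by ring. eapply Rle_trans; [apply Cmod_triangle|]. rewrite Cmod_opp; lra. }
          pose proof (Cmod_ge_0 (k z)). unfold c. nra. }
      assert (KE : k z0 = D w).
      { assert (N' : (w - z0)%C <> 0%C).
        { intro X. apply Nw. replace w with (w - z0 + z0)%C by ring. rewrite X; ring. }
        pose proof (kE z0 Hz) as A. pose proof (DE w ltac:(lra)) as B.
        replace (k z0) with (- (f z0 - f w) / (w - z0))%C by (rewrite A; field; auto).
        replace (D w) with ((f w - f z0) / (w - z0))%C by (rewrite B; field; auto). field; auto. }
      rewrite KE in K. assert (P : D w <> 0%C) by (rewrite <- KE; apply Nk; lra).
      rewrite Cmod_inv in K by auto.
      destruct (Rle_or_lt c (Cmod (D w))) as [|L]; auto.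
      apply Rinv_lt_contravar in L; [lra|]. apply Rmult_lt_0_compat; [now apply Cmod_gt_0|unfold c; lra]. }
    pose proof (hol_cont 1 D z0 HD Hz c ltac:(unfold c; lra)) as C1.
    pose proof (hol_cont 1 f z0 holf Hz (m / 2) ltac:(lra)) as C2.
    destruct (filter_and _ _ (filter_and _ _ C1 C2) (disk_open r z0 ltac:(lra))) as [d [Hd K]].
    assert (Z : forall u, Cmod u < Rmin d (1 - Cmod z0) -> df (z0 + u)%C = 0%C).
    { intros u Hu. apply NNPP. intros N.
      assert (Cmod u < d) by (eapply Rlt_le_trans; [exact Hu|apply Rmin_l]).
      destruct (K (z0 + u)%C) as [[K1 K2] K3]; [replace (z0 + u - z0)%C with u by ring; auto|].
      assert (z0 + u <> z0)%C by (intros X; rewrite X in N; auto).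
      specialize (Low _ K3 H1 N ltac:(lra)).
      rewrite D0, E0 in K1. replace (D (z0 + u)%C - 0)%C with (D (z0 + u)%C) in K1 by ring. lra. }
    set (s := Rmin d (1 - Cmod z0)) in *. assert (S : 0 < s) by (apply Rmin_glb_lt; lra).
    assert (s <= 1 - Cmod z0) by apply Rmin_r.
    assert (HC : holD s (fun u => f (z0 + u)%C) (fun _ => 0%C)).
    { apply holD_ext with (fun u => f (z0 + u)%C) (fun u => df (z0 + u)%C); auto. apply hol_translate; auto; lra. }
    assert (M : Cmod (RtoC (s / 2)) = s / 2) by (rewrite Cmod_R, Rabs_pos_eq; lra).
    pose proof (hol_constant s _ HC (RtoC (s / 2)) ltac:(lra)) as EC. cbv beta in EC.
    assert (X : (z0 + RtoC (s / 2) = z0 + 0)%C).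
    { apply Inj; unfold disk; auto.
      - eapply Rle_lt_trans; [apply Cmod_triangle|lra].
      - replace (z0 + 0)%C with z0 by ring; auto. }
    assert (ZZ : RtoC (s / 2) = 0%C).
    { replace (RtoC (s / 2)) with (z0 + RtoC (s / 2) - z0)%C by ring. rewrite X; ring. }
    apply RtoC_inj in ZZ. lra.
Qed.

(** A lift of a translation through [f] is continuous because [f] is open and injective, and then
    differentiable because [f'] does not vanish. *)
Lemma lift_hol (x : C) (g : C -> C) :
  (forall z, Cmod z < 1 -> Cmod (g z) < 1 /\ f (g z) = (f z - x)%C) ->
  holD 1 g (fun z => df z / df (g z))%C.
Proof.
  intros Hg.
  assert (Cg : forall z, Cmod z < 1 -> ccont g z).
  { intros z Hz e He. destruct (Hg z Hz) as [G1 G2].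
    destruct (open_mapping (g z) e G1 He) as [d [Hd K]].
    pose proof (holD_cont 1 f df z Hf Hz d Hd) as Cf.
    generalize (filter_and _ _ Cf (disk_open 1 z Hz)). apply filter_imp. intros w [W1 W2].
    destruct (Hg w W2) as [G3 G4].
    destruct (K (f (g w))) as [z' [Z1 [Z2 Z3]]].
    { rewrite G2, G4. replace (f w - x - (f z - x))%C with (f w - f z)%C by ring. auto. }
    rewrite (Inj z' (g w)) in Z2; auto. }
  intros z Hz. destruct (Hg z Hz) as [G1 G2].
  assert (N : df (g z) <> 0%C) by now apply univalent_derivative.
  assert (CD : ccont (fun z => df z / df (g z))%C z).
  { unfold ccont. apply clim_div; [typeclasses eauto|auto|now apply Hf|].
    apply (clim_comp_cont (nearC z) g df (g z)); [now apply Cg|now apply Hf]. }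
  split; auto.
  destruct (proj1 (cder_slope f (g z) _) (proj1 (Hf (g z) G1))) as [k [Ck [Ek K]]].
  destruct (proj1 (cder_slope f z _) (proj1 (Hf z Hz))) as [m [Cm [Em M]]].
  assert (Ck' : clim (nearC z) (fun w => k (g w)) (k (g z))).
  { apply (clim_comp_cont (nearC z) g k (g z)); auto. now apply Cg. }
  rewrite <- Em, <- Ek.
  apply (cder_of_slope g (fun w => m w / k (g w))%C).
  - unfold ccont. apply clim_div; [typeclasses eauto|now rewrite Ek|exact Cm|exact Ck'].
  - assert (P : 0 < Cmod (k (g z))) by (rewrite Ek; now apply Cmod_gt_0).
    generalize (filter_and _ _ (Ck' _ P) (disk_open 1 z Hz)). apply filter_imp. intros w [W1 W2].
    assert (Nk : k (g w) <> 0%C).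
    { intros Z. rewrite Z in W1. replace (0 - k (g z))%C with (- k (g z))%C in W1 by ring. rewrite Cmod_opp in W1. lra. }
    destruct (Hg w W2) as [G3 G4].
    assert (E : (k (g w) * (g w - g z) = m w * (w - z))%C).
    { rewrite <- K, <- M, G2, G4. ring. }
    replace (g w - g z)%C with (/ k (g w) * (k (g w) * (g w - g z)))%C by (field; auto).
    rewrite E. field; auto.
Qed.
End Univalent.

(** * Translations of the image and their common boundary fixed point *)

(** Bolzano-Weierstrass on the unit circle, with angles. *)
Lemma angle_cluster (P : nat -> R -> Prop) :
  (forall n, exists t, 0 <= t <= 2 * PI /\ P n t) ->
  exists t0, forall e N, 0 < e -> exists n t, (N <= n)%nat /\ P n t /\ Cmod (cis t - cis t0) < e.
Proof.
  intros H. pose proof twoPI_pos as TP.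
  set (u := fun n => proj1_sig (constructive_indefinite_description _ (H n))).
  assert (Hu : forall n, 0 <= u n <= 2 * PI /\ P n (u n)).
  { intros n. unfold u. destruct (constructive_indefinite_description _ (H n)); auto. }
  destruct (Bolzano_Weierstrass u (fun c => 0 <= c <= 2 * PI)) as [t0 Ht0].
  - apply compact_P3.
  - intros n. apply Hu.
  - exists t0. intros e N He. destruct (rcont_cis t0 e He) as [d Hd].
    destruct (Ht0 (disc t0 d) N) as [n [Hn Dn]].
    { exists d. intros y Hy. exact Hy. }
    exists n, (u n). split; auto. split; [apply Hu|]. apply Hd. exact Dn.
Qed.

Lemma continuity_ge_0 (f : R -> R) e0 : continuity_pt f 0 -> 0 < e0 ->
  (forall e, 0 < e < e0 -> 0 <= f e) -> 0 <= f 0.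
Proof.
  intros Hc He0 H. destruct (Rle_or_lt 0 (f 0)) as [|N]; auto.
  destruct (Hc (- f 0)) as [d [Hd K]]; [lra|].
  pose proof (Rmin_l (d / 2) (e0 / 2)). pose proof (Rmin_r (d / 2) (e0 / 2)).
  assert (M : 0 < Rmin (d / 2) (e0 / 2)) by (apply Rmin_glb_lt; lra).
  specialize (H (Rmin (d / 2) (e0 / 2)) ltac:(lra)).
  specialize (K (Rmin (d / 2) (e0 / 2))). simpl in K. unfold Rdist in K.
  assert (Rabs (f (Rmin (d / 2) (e0 / 2)) - f 0) < - f 0).
  { apply K. split; [split; [exact I|lra]|]. rewrite Rminus_0_r, Rabs_pos_eq; lra. }
  apply Rabs_def2 in H2. lra.
Qed.

Section Translations.
Variables (f df : C -> C) (v1 v2 e0 : C).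
Hypothesis Hf : holD 1 f df.
Hypothesis Inj : injective_on (disk 1) f.
Hypothesis Abs : forall a b z, 0 <= a -> 0 <= b -> Cmod z < 1 ->
  exists z', Cmod z' < 1 /\ f z' = (f z - (RtoC a * v1 + RtoC b * v2))%C.
Hypothesis He0 : Cmod e0 = 1.
Hypothesis Hv1 : 0 < Re (Cconj e0 * v1).
Hypothesis Hv2 : 0 < Re (Cconj e0 * v2).

Let G (a b : R) (z : C) : C :=
  epsilon (inhabits (0%C : C)) (fun z' => Cmod z' < 1 /\ f z' = (f z - (RtoC a * v1 + RtoC b * v2))%C).

Let G_spec a b z : 0 <= a -> 0 <= b -> Cmod z < 1 ->
  Cmod (G a b z) < 1 /\ f (G a b z) = (f z - (RtoC a * v1 + RtoC b * v2))%C.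
Proof. intros. unfold G. apply epsilon_spec. now apply Abs. Qed.

Let G_hol a b : 0 <= a -> 0 <= b -> hol 1 (G a b).
Proof.
  intros Ha Hb. eexists. apply (lift_hol f df Hf Inj (RtoC a * v1 + RtoC b * v2)%C).
  intros z Hz. now apply G_spec.
Qed.

Let G_comp a b a' b' z : 0 <= a -> 0 <= b -> 0 <= a' -> 0 <= b' -> Cmod z < 1 ->
  G a b (G a' b' z) = G (a + a') (b + b') z.
Proof.
  intros. destruct (G_spec a' b' z) as [H4 H5]; auto.
  destruct (G_spec a b (G a' b' z)) as [H6 H7]; auto.
  destruct (G_spec (a + a') (b + b') z) as [H8 H9]; auto; try lra.
  apply Inj; auto. rewrite H7, H5, H9, !RtoC_plus. ring.
Qed.

Let zero_disk : Cmod 0 < 1. Proof. rewrite Cmod_0; lra. Qed.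

Let gap a b := 1 - Cmod (G a b 0).

(** Far translations move the values of [f] without bound along [- e0], while [f] is bounded on
    smaller discs. *)
Let gap_small d : 0 < d -> exists K, 0 <= K /\ forall a b, 0 <= a -> 0 <= b -> K <= a + b -> gap a b < d.
Proof.
  intros Hd. set (r := Rmax (1 / 2) (1 - d / 2)).
  assert (Hr : 1 / 2 <= r < 1) by (split; [apply Rmax_l|apply Rmax_lub_lt; lra]).
  assert (Hr' : 1 - d / 2 <= r) by apply Rmax_r.
  assert (holf : hol 1 f) by (exists df; auto).
  assert (RF : rcont (fun t => f (circ r t))) by (eapply hol_rcont_circ; eauto; lra).
  destruct (rcont_bounded _ RF) as [M [HM BM]].
  assert (B : forall z, Cmod z < r -> Cmod (f z) <= M).
  { apply (max_modulus 1 r f M); auto; [lra|]. intros z Mz.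
    destruct (polar z r Mz) as [t [Ht ->]]. apply BM; lra. }
  set (c := Rmin (Re (Cconj e0 * v1)) (Re (Cconj e0 * v2))).
  assert (Hc : 0 < c) by (now apply Rmin_glb_lt).
  assert (c1 : c <= Re (Cconj e0 * v1)) by apply Rmin_l. assert (c2 : c <= Re (Cconj e0 * v2)) by apply Rmin_r.
  exists ((2 * M + 1) / c). split; [apply Rdiv_le_0_compat; lra|].
  intros a b Ha Hb Hab. destruct (G_spec a b 0 Ha Hb zero_disk) as [H1 H2].
  unfold gap. destruct (Rlt_le_dec (Cmod (G a b 0)) r) as [L|L]; [|lra]. exfalso.
  apply B in L. rewrite H2 in L.
  assert (F0 : Cmod (f 0%C) <= M) by (apply B; rewrite Cmod_0; lra).
  set (x := (RtoC a * v1 + RtoC b * v2)%C) in *.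
  assert (X : c * (a + b) <= Cmod x).
  { apply Rle_trans with (Re (Cconj e0 * x)).
    - unfold x. replace (Cconj e0 * (RtoC a * v1 + RtoC b * v2))%C
        with (RtoC a * (Cconj e0 * v1) + RtoC b * (Cconj e0 * v2))%C by ring.
      rewrite re_plus, !re_scal_l.
      assert (a * c <= a * Re (Cconj e0 * v1)) by now apply Rmult_le_compat_l.
      assert (b * c <= b * Re (Cconj e0 * v2)) by now apply Rmult_le_compat_l. lra.
    - eapply Rle_trans; [apply re_le|]. rewrite Cmod_mult, Cmod_conj, He0; lra. }
  apply (Rmult_le_compat_l c) in Hab; [|lra].
  replace (c * ((2 * M + 1) / c)) with (2 * M + 1) in Hab by (field; lra).
  pose proof (Cmod_rev_triangle x (f 0%C)). rewrite Cmod_sub_sym in H. lra.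
Qed.

(** A walk on the lattice that always took a step increasing the gap by a factor [1 + e]
    would make the gap unbounded; so at some far lattice point both steps are good. *)
Let good_point s e d : 0 < s -> 0 < e -> 0 < d -> exists a b, 0 <= a /\ 0 <= b /\ gap a b < d /\
  gap (a + s) b <= (1 + e) * gap a b /\ gap a (b + s) <= (1 + e) * gap a b.
Proof.
  intros Hs He Hd. destruct (gap_small d Hd) as [K [HK0 HK]]. apply NNPP. intros N.
  set (u0 := gap K 0).
  assert (U0 : 0 < u0). { unfold u0, gap. destruct (G_spec K 0 0); auto; lra. }
  assert (W : forall k, exists a b, 0 <= a /\ 0 <= b /\ K <= a + b /\ (1 + e) ^ k * u0 <= gap a b).
  { induction k.
    - exists K, 0. unfold u0. simpl. repeat split; lra.
    - destruct IHk as [a [b [Ha [Hb [Hab Hg]]]]].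
      destruct (Rle_or_lt (gap (a + s) b) ((1 + e) * gap a b)) as [L1|L1].
      + destruct (Rle_or_lt (gap a (b + s)) ((1 + e) * gap a b)) as [L2|L2].
        * exfalso. apply N. exists a, b. repeat split; auto.
        * exists a, (b + s). simpl. repeat split; try lra.
          apply Rle_trans with ((1 + e) * gap a b); [|lra]. rewrite Rmult_assoc. apply Rmult_le_compat_l; lra.
      + exists (a + s), b. simpl. repeat split; try lra.
        apply Rle_trans with ((1 + e) * gap a b); [|lra]. rewrite Rmult_assoc. apply Rmult_le_compat_l; lra. }
  destruct (Pow_x_infinity (1 + e)) with (b := 2 / u0) as [n Hn]; [rewrite Rabs_pos_eq; lra|].
  specialize (Hn n (Nat.le_refl _)). rewrite Rabs_pos_eq in Hn by (apply pow_le; lra).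
  destruct (W n) as [a [b [Ha [Hb [_ Hg]]]]].
  assert (gap a b <= 1). { unfold gap. pose proof (Cmod_ge_0 (G a b 0)). lra. }
  assert (2 / u0 * u0 <= (1 + e) ^ n * u0) by (apply Rmult_le_compat_r; lra).
  replace (2 / u0 * u0) with 2 in H0 by (field; lra). lra.
Qed.

(** Neighbouring lattice points lie at bounded hyperbolic distance. *)
Let step_close a b a' b' : 0 <= a -> 0 <= b -> 0 <= a' -> 0 <= b' ->
  Cmod (G (a + a') (b + b') 0 - G a b 0) * (1 - Cmod (G a' b' 0)) <= 2 * gap a b.
Proof.
  intros Ha Hb Ha' Hb'. destruct (G_spec a' b' 0) as [B1 _]; auto.
  rewrite <- (G_comp a b a' b' 0) by auto.
  set (p := G a' b' 0) in *. set (A := G a b 0) in *. set (B := G a b p).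
  assert (HA : Cmod A < 1) by (apply (G_spec a b 0); auto).
  pose proof (schwarz_pick (G a b) (G_hol a b Ha Hb) (fun z Hz => proj1 (G_spec a b z Ha Hb Hz)) 0%C p zero_disk B1) as S.
  fold A in S. fold B in S.
  replace (1 - Cconj 0 * p)%C with (RtoC 1) in S by ceq. replace (p - 0)%C with p in S by ring.
  rewrite Cmod_1, Rmult_1_r in S.
  assert (T : Cmod (1 - Cconj A * B) <= (1 - Cmod A ^ 2) + Cmod A * Cmod (B - A)).
  { replace (1 - Cconj A * B)%C with ((1 - A * Cconj A) - Cconj A * (B - A))%C by ring.
    eapply Rle_trans; [apply Cmod_triangle|]. rewrite Cmod_opp, Cmod_mult, Cmod_conj, Cconj_mult_self.
    apply Rplus_le_compat_r. replace (1 - RtoC (Cmod A ^ 2))%C with (RtoC (1 - Cmod A ^ 2)) by (rewrite RtoC_minus; ring).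
    pose proof (Cmod_ge_0 A). rewrite Cmod_R, Rabs_pos_eq; nra. }
  unfold gap. fold A. pose proof (Cmod_ge_0 A). pose proof (Cmod_ge_0 p). pose proof (Cmod_ge_0 (B - A)).
  assert (Cmod (B - A) <= ((1 - Cmod A ^ 2) + Cmod (B - A)) * Cmod p).
  { eapply Rle_trans; [exact S|]. apply Rmult_le_compat_r; auto. eapply Rle_trans; [exact T|]. nra. }
  assert (A2 : 0 <= 1 - Cmod A ^ 2 <= 2 * (1 - Cmod A)) by nra.
  assert ((1 - Cmod A ^ 2) * Cmod p <= 1 - Cmod A ^ 2) by nra. lra.
Qed.

(** Julia's lemma for one translation step [g], with approach points supplied by the lattice. *)
Let julia_step a' b' t0 : 0 <= a' -> 0 <= b' ->
  (forall e, 0 < e -> exists a b, 0 <= a /\ 0 <= b /\ Cmod (G a b 0 - cis t0) < e /\ gap a b < e /\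
     gap (a + a') (b + b') <= (1 + e) * gap a b) ->
  forall z, Cmod z < 1 ->
  (1 - Cmod z ^ 2) * Cmod (1 - Cconj (cis t0) * G a' b' z) ^ 2 <=
  (1 - Cmod (G a' b' z) ^ 2) * Cmod (1 - Cconj (cis t0) * z) ^ 2.
Proof.
  intros Ha' Hb' H z Hz. set (tau := cis t0) in *.
  destruct (G_spec a' b' z Ha' Hb' Hz) as [W1 _]. destruct (G_spec a' b' 0 Ha' Hb' zero_disk) as [P1 _].
  set (w := G a' b' z) in *. set (p := G a' b' 0) in *.
  set (c := 1 + 2 / (1 - Cmod p)).
  assert (Hp : 0 < 1 - Cmod p) by lra.
  assert (Hc : 1 < c). { unfold c. assert (0 < 2 / (1 - Cmod p)) by (apply Rdiv_lt_0_compat; lra). lra. }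
  set (X := Cmod (1 - Cconj tau * z)). set (Y := Cmod (1 - Cconj tau * w)).
  assert (Y0 : 0 < Y).
  { unfold Y. pose proof (Cmod_rev_triangle 1 (Cconj tau * w)). rewrite Cmod_mult, Cmod_conj, Cmod_1 in H0.
    unfold tau in H0 at 1. rewrite Cmod_cis in H0. lra. }
  pose proof (Cmod_ge_0 z) as Pz. pose proof (Cmod_ge_0 w) as Pw.
  assert (X0 : 0 <= X) by apply Cmod_ge_0.
  assert (Z2 : 0 < 1 - Cmod z ^ 2) by nra. assert (W2 : 0 < 1 - Cmod w ^ 2) by nra.
  set (F := fun e => (1 + e) * 2 * (1 - Cmod w ^ 2) * (X + e) ^ 2 - (2 - e) * (1 - Cmod z ^ 2) * (Y - c * e) ^ 2).
  assert (0 <= F 0).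
  { apply (continuity_ge_0 F (Rmin 1 (Y / c))).
    - unfold F. reg.
    - apply Rmin_glb_lt; [lra|]. apply Rdiv_lt_0_compat; lra.
    - intros e [E1 E2].
      assert (E3 : e < 1) by (eapply Rlt_le_trans; [exact E2|apply Rmin_l]).
      assert (E4 : e < Y / c) by (eapply Rlt_le_trans; [exact E2|apply Rmin_r]).
      apply (Rmult_lt_compat_r c) in E4; [|lra]. replace (Y / c * c) with Y in E4 by (field; lra).
      destruct (H e E1) as [a [b [Ha [Hb [N1 [N2 N3]]]]]].
      set (A := G a b 0) in *.
      assert (HA : Cmod A < 1) by (apply (G_spec a b 0); auto).
      assert (EB : G (a + a') (b + b') 0 = G a' b' A).
      { unfold A. rewrite G_comp by auto. f_equal; ring. }
      pose proof (step_close a b a' b' Ha Hb Ha' Hb') as SC. fold A p in SC.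
      unfold gap in N2, N3, SC. fold A in N2, N3, SC. rewrite EB in N3, SC.
      set (B := G a' b' A) in *.
      assert (HB : Cmod B < 1) by (apply (G_spec a' b' A); auto).
      pose proof (Cmod_ge_0 A) as PA. pose proof (Cmod_ge_0 B) as PB.
      pose proof (schwarz_pick (G a' b') (G_hol a' b' Ha' Hb') (fun z Hz => proj1 (G_spec a' b' z Ha' Hb' Hz)) A z HA Hz) as S.
      fold w B in S.
      set (XA := Cmod (1 - Cconj A * z)) in *. set (YB := Cmod (1 - Cconj B * w)) in *.
      pose proof (blaschke_identity A z) as I1. pose proof (blaschke_identity B w) as I2. fold XA in I1. fold YB in I2.
      assert (S2 : (1 - Cmod A ^ 2) * (1 - Cmod z ^ 2) * YB ^ 2 <= (1 - Cmod B ^ 2) * (1 - Cmod w ^ 2) * XA ^ 2).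
      { rewrite <- I1, <- I2.
        assert (Cmod (w - B) ^ 2 * XA ^ 2 <= YB ^ 2 * Cmod (z - A) ^ 2); [|lra].
        rewrite <- !Rpow_mult_distr. apply pow_incr. split; [|exact S].
        apply Rmult_le_pos; apply Cmod_ge_0. }
      assert (XA1 : XA <= X + e).
      { unfold XA, X. replace (1 - Cconj A * z)%C with ((1 - Cconj tau * z) + - (Cconj (A - tau) * z))%C by (rewrite Cminus_conj; ring).
        eapply Rle_trans; [apply Cmod_triangle|]. rewrite Cmod_opp, Cmod_mult, Cmod_conj.
        pose proof (Cmod_ge_0 (A - tau)). nra. }
      assert (BT : Cmod (B - tau) <= c * e).
      { eapply Rle_trans; [apply (Cmod_tri3 _ A)|].
        assert (Cmod (B - A) <= 2 / (1 - Cmod p) * e).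
        { apply (Rmult_le_reg_r (1 - Cmod p)); auto.
          replace (2 / (1 - Cmod p) * e * (1 - Cmod p)) with (2 * e) by (field; lra). lra. }
        unfold c. lra. }
      assert (YB1 : Y - c * e <= YB).
      { unfold YB, Y. replace (1 - Cconj B * w)%C with ((1 - Cconj tau * w) - (Cconj (B - tau) * w))%C by (rewrite Cminus_conj; ring).
        pose proof (Cmod_plus_ge (1 - Cconj tau * w) (- (Cconj (B - tau) * w))) as Q.
        rewrite Cmod_opp, Cmod_mult, Cmod_conj in Q. pose proof (Cmod_ge_0 (B - tau)).
        assert (Cmod (B - tau) * Cmod w <= c * e * 1) by (apply Rmult_le_compat; auto; lra).
        eapply Rle_trans; [|exact Q]. lra. }
      assert (XA0 : 0 <= XA) by apply Cmod_ge_0.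
      assert (Q1 : (Y - c * e) ^ 2 <= YB ^ 2) by (apply pow_incr; lra).
      assert (Q2 : XA ^ 2 <= (X + e) ^ 2) by (apply pow_incr; lra).
      assert (Q3 : (2 - e) * (1 - Cmod B ^ 2) <= (1 + e) * 2 * (1 - Cmod A ^ 2)).
      { replace (1 - Cmod B ^ 2) with ((1 - Cmod B) * (1 + Cmod B)) by ring.
        replace (1 - Cmod A ^ 2) with ((1 - Cmod A) * (1 + Cmod A)) by ring.
        apply Rle_trans with ((1 + Cmod A) * (((1 + e) * (1 - Cmod A)) * 2)); [|lra].
        apply Rmult_le_compat; try lra; [apply Rmult_le_pos; lra|]. apply Rmult_le_compat; lra. }
      assert (GA : 0 < 1 - Cmod A ^ 2) by nra.
      unfold F. apply Rmult_le_reg_l with (1 - Cmod A ^ 2); auto. rewrite Rmult_0_r.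
      assert (T1 : (1 - Cmod A ^ 2) * (1 - Cmod z ^ 2) * (Y - c * e) ^ 2 <= (1 - Cmod A ^ 2) * (1 - Cmod z ^ 2) * YB ^ 2).
      { apply Rmult_le_compat_l; auto. apply Rmult_le_pos; lra. }
      assert (T2 : (2 - e) * ((1 - Cmod B ^ 2) * (1 - Cmod w ^ 2) * XA ^ 2) <= (1 + e) * 2 * (1 - Cmod A ^ 2) * ((1 - Cmod w ^ 2) * (X + e) ^ 2)).
      { replace ((2 - e) * ((1 - Cmod B ^ 2) * (1 - Cmod w ^ 2) * XA ^ 2))
          with ((2 - e) * (1 - Cmod B ^ 2) * ((1 - Cmod w ^ 2) * XA ^ 2)) by ring.
        assert (0 <= 1 - Cmod B ^ 2) by nra.
        apply Rmult_le_compat; auto.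
        - apply Rmult_le_pos; lra.
        - apply Rmult_le_pos; [lra|]. nra.
        - apply Rmult_le_compat_l; lra. }
      assert (T3 : (2 - e) * ((1 - Cmod A ^ 2) * (1 - Cmod z ^ 2) * (Y - c * e) ^ 2)
                <= (2 - e) * ((1 - Cmod B ^ 2) * (1 - Cmod w ^ 2) * XA ^ 2)) by (apply Rmult_le_compat_l; lra).
      lra. }
  unfold F in H0. rewrite Rmult_0_r, Rminus_0_r, !Rplus_0_r, Rminus_0_r in H0. fold X Y. nra.
Qed.

Let julia s : 0 < s -> exists t, 0 <= t <= 2 * PI /\ forall z, Cmod z < 1 ->
  ((1 - Cmod z ^ 2) * Cmod (1 - Cconj (cis t) * G s 0 z) ^ 2 <=
   (1 - Cmod (G s 0 z) ^ 2) * Cmod (1 - Cconj (cis t) * z) ^ 2) /\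
  ((1 - Cmod z ^ 2) * Cmod (1 - Cconj (cis t) * G 0 s z) ^ 2 <=
   (1 - Cmod (G 0 s z) ^ 2) * Cmod (1 - Cconj (cis t) * z) ^ 2).
Proof.
  intros Hs.
  destruct (angle_cluster (fun n t => exists a b, 0 <= a /\ 0 <= b /\
     G a b 0 = (RtoC (Cmod (G a b 0)) * cis t)%C /\ gap a b < / INR (S n) /\
     gap (a + s) b <= (1 + / INR (S n)) * gap a b /\ gap a (b + s) <= (1 + / INR (S n)) * gap a b)) as [t0 H0].
  { intros n. assert (P : 0 < / INR (S n)) by (apply Rinv_0_lt_compat, lt_0_INR; lia).
    destruct (good_point s (/ INR (S n)) (/ INR (S n)) Hs P P) as [a [b [Ha [Hb [A1 [A2 A3]]]]]].
    destruct (polar (G a b 0) _ eq_refl) as [t [Ht Et]]. exists t. split; [lra|]. exists a, b. repeat split; auto. }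
  assert (HH : forall e, 0 < e -> exists a b, 0 <= a /\ 0 <= b /\ Cmod (G a b 0 - cis t0) < e /\ gap a b < e /\
     gap (a + s) b <= (1 + e) * gap a b /\ gap a (b + s) <= (1 + e) * gap a b).
  { intros e He. destruct (archimed_cor1 (e / 2) ltac:(lra)) as [N [HN HN0]].
    destruct (H0 (e / 2) N ltac:(lra)) as [n [t [Hn [[a [b [Ha [Hb [B1 [B2 [B3 B4]]]]]]] Ct]]]].
    assert (Le : / INR (S n) < e / 2).
    { eapply Rle_lt_trans; [|exact HN]. apply Rinv_le_contravar; [now apply lt_0_INR|]. apply le_INR. lia. }
    assert (Gp : 0 <= gap a b). { unfold gap. destruct (G_spec a b 0); auto; lra. }
    exists a, b. repeat split; auto; try lra.
    - eapply Rle_lt_trans; [apply (Cmod_tri3 _ (cis t))|].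
      assert (Cmod (G a b 0 - cis t) = gap a b); [|lra].
      rewrite B1 at 1. replace (RtoC (Cmod (G a b 0)) * cis t - cis t)%C with (- (RtoC (gap a b) * cis t))%C
        by (unfold gap; rewrite RtoC_minus; ring).
      rewrite Cmod_opp, Cmod_mult, Cmod_cis, Cmod_R, Rabs_pos_eq; lra.
    - eapply Rle_trans; [exact B3|]. apply Rmult_le_compat_r; lra.
    - eapply Rle_trans; [exact B4|]. apply Rmult_le_compat_r; lra. }
  destruct (polar_unit (cis t0) (Cmod_cis t0)) as [t1 [Ht1 E1]].
  exists t1. split; [lra|]. rewrite <- E1. intros z Hz. split.
  - apply julia_step; auto; try lra. intros e He. destruct (HH e He) as [a [b [Ha [Hb [C1 [C2 [C3 C4]]]]]]].
    exists a, b. rewrite Rplus_0_r. auto.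
  - apply julia_step; auto; try lra. intros e He. destruct (HH e He) as [a [b [Ha [Hb [C1 [C2 [C3 C4]]]]]]].
    exists a, b. rewrite Rplus_0_r. auto.
Qed.

Let herglotz_re (sg w : C) : Cmod sg = 1 -> Cmod w < 1 ->
  Re ((1 + Cconj sg * w) / (1 - Cconj sg * w)) = (1 - Cmod w ^ 2) / Cmod (1 - Cconj sg * w) ^ 2.
Proof.
  intros Hs Hw.
  assert (N : 0 < Cmod (1 - Cconj sg * w)).
  { pose proof (Cmod_rev_triangle 1 (Cconj sg * w)). rewrite Cmod_1, Cmod_mult, Cmod_conj, Hs in H. lra. }
  set (D := (1 - Cconj sg * w)%C) in *.
  assert (ND : D <> 0%C) by now apply Cneq_mod.
  assert (NC : Cconj D <> 0%C) by (intros Z; apply ND; rewrite <- (Cconj_conj D), Z; ceq).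
  replace ((1 + Cconj sg * w) / D)%C with (RtoC (/ Cmod D ^ 2) * ((1 + Cconj sg * w) * Cconj D))%C.
  2:{ rewrite RtoC_inv, <- Cconj_mult_self by nra. field. auto. }
  rewrite re_scal_l. unfold Rdiv. rewrite Rmult_comm. f_equal.
  pose proof (Cmod2_alt sg) as S2. rewrite Hs in S2. rewrite Cmod2_alt. unfold D.
  destruct sg as [a b], w as [x y]. unfold Re, Im in *; simpl in *. nra.
Qed.

(** Letting the length [s] of the translation tend to zero. *)
Let julia_limit t0 v z : Cmod z < 1 ->
  (forall e, 0 < e -> exists s t w, 0 < s < e /\ Cmod (cis t - cis t0) < e /\ Cmod w < 1 /\
     f w = (f z - RtoC s * v)%C /\
     (1 - Cmod z ^ 2) * Cmod (1 - Cconj (cis t) * w) ^ 2 <=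
     (1 - Cmod w ^ 2) * Cmod (1 - Cconj (cis t) * z) ^ 2) ->
  0 <= Re (- (Cconj (cis t0) * v) / (df z * (1 - Cconj (cis t0) * z) ^ 2)).
Proof.
  intros Hz H.
  assert (Nd : df z <> 0%C) by (apply (univalent_derivative f df Hf Inj); auto).
  destruct (proj1 (cder_slope f z _) (proj1 (Hf z Hz))) as [k [Ck [Ek K]]].
  assert (Ns : forall sg x, Cmod sg = 1 -> Cmod x < 1 -> (1 - Cconj sg * x)%C <> 0%C).
  { intros sg x Hs Hx. apply Cneq_mod. pose proof (Cmod_rev_triangle 1 (Cconj sg * x)).
    rewrite Cmod_1, Cmod_mult, Cmod_conj, Hs in H0. lra. }
  set (E := fun q : C * C => (- (Cconj (fst q) * v) / (k (snd q) * ((1 - Cconj (fst q) * snd q) * (1 - Cconj (fst q) * z))))%C).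
  set (tau := cis t0).
  assert (Mt : Cmod tau = 1) by apply Cmod_cis.
  replace (- (Cconj tau * v) / (df z * (1 - Cconj tau * z) ^ 2))%C with (E (tau, z)).
  2:{ unfold E; simpl. rewrite Ek. field. auto. }
  destruct (Rle_or_lt 0 (Re (E (tau, z)))) as [|Neg]; auto. exfalso.
  assert (FF : Filter (filter_prod (nearC tau) (nearC z))) by (apply filter_prod_filter; typeclasses eauto).
  assert (C1 : clim (filter_prod (nearC tau) (nearC z)) fst tau).
  { intros e He. exists (fun x => Cmod (x - tau) < e) (fun _ => True); auto.
    - exists e; auto. - apply filter_true. }
  assert (C2 : clim (filter_prod (nearC tau) (nearC z)) snd z).
  { intros e He. exists (fun _ => True) (fun x => Cmod (x - z) < e); auto.
    - apply filter_true. - exists e; auto. }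
  assert (C3 : clim (filter_prod (nearC tau) (nearC z)) (fun q => k (snd q)) (k z)).
  { now apply (clim_comp_cont _ snd k z). }
  assert (CE : clim (filter_prod (nearC tau) (nearC z)) E (E (tau, z))).
  { unfold E; simpl. apply clim_div; auto.
    - rewrite Ek. repeat apply Cmult_neq_0; auto.
    - apply clim_opp; auto. apply clim_mult; auto; [apply clim_conj; auto|apply clim_const; auto].
    - apply clim_mult; auto. apply clim_mult; auto; apply clim_minus; auto; try (apply clim_const; auto);
        apply clim_mult; auto; try (apply clim_conj; auto); apply clim_const; auto. }
  assert (Pn : 0 < - Re (E (tau, z))) by lra.
  assert (Pk : 0 < Cmod (k z)) by (rewrite Ek; now apply Cmod_gt_0).
  destruct (filter_and _ _ (CE _ Pn) (C3 _ Pk)) as [Q R' [d1 [Hd1 HQ]] [d2 [Hd2 HR]] HQR].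
  destruct (open_mapping f df Hf Inj z d2 Hz Hd2) as [d3 [Hd3 HO]].
  set (e := Rmin d1 (d3 / (Cmod v + 1))).
  pose proof (Cmod_ge_0 v) as Pv.
  assert (He : 0 < e) by (apply Rmin_glb_lt; auto; apply Rdiv_lt_0_compat; lra).
  destruct (H e He) as [s [t [w [[Hs1 Hs2] [Ht [Hw [Ew Ju]]]]]]].
  assert (B1 : Cmod (cis t - tau) < d1) by (eapply Rlt_le_trans; [exact Ht|apply Rmin_l]).
  assert (B2 : s * Cmod v < d3).
  { assert (S3 : s < d3 / (Cmod v + 1)) by (eapply Rlt_le_trans; [exact Hs2|apply Rmin_r]).
    apply (Rmult_lt_compat_r (Cmod v + 1)) in S3; [|lra].
    replace (d3 / (Cmod v + 1) * (Cmod v + 1)) with d3 in S3 by (field; lra). lra. }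
  assert (B3 : Cmod (w - z) < d2).
  { destruct (HO (f w)) as [z' [Z1 [Z2 Z3]]].
    - rewrite Ew. replace (f z - RtoC s * v - f z)%C with (- (RtoC s * v))%C by ring.
      rewrite Cmod_opp, Cmod_mult, Cmod_R, Rabs_pos_eq; lra.
    - rewrite <- (Inj z' w); auto. }
  set (sg := cis t) in *. assert (Ms : Cmod sg = 1) by apply Cmod_cis.
  assert (KK : Cmod (E (sg, w) - E (tau, z)) < - Re (E (tau, z)) /\ Cmod (k w - k z) < Cmod (k z))
    by exact (HQR sg w (HQ _ B1) (HR _ B3)).
  destruct KK as [K1 K2].
  assert (Nk : k w <> 0%C).
  { intros Z. rewrite Z in K2. replace (0 - k z)%C with (- k z)%C in K2 by ring. rewrite Cmod_opp in K2. lra. }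
  assert (ReE : Re (E (sg, w)) < 0).
  { pose proof (re_le (E (sg, w) - E (tau, z))).
    replace (Re (E (sg, w) - E (tau, z))%C) with (Re (E (sg, w)) - Re (E (tau, z))) in H0 by (unfold Re; simpl; ring).
    lra. }
  pose proof (Ns sg w Ms Hw) as N1. pose proof (Ns sg z Ms Hz) as N2.
  assert (EE : ((1 + Cconj sg * w) / (1 - Cconj sg * w) - (1 + Cconj sg * z) / (1 - Cconj sg * z)
               = RtoC (2 * s) * E (sg, w))%C).
  { assert (WZ : (w - z = - (RtoC s * v) / k w)%C).
    { replace (- (RtoC s * v))%C with (f w - f z)%C by (rewrite Ew; ring). rewrite K. field; auto. }
    transitivity (2 * Cconj sg * (w - z) / ((1 - Cconj sg * w) * (1 - Cconj sg * z)))%C; [field; auto|].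
    rewrite WZ. unfold E; simpl. rewrite RtoC_mult. field. auto. }
  apply (f_equal Re) in EE. rewrite re_scal_l in EE. unfold Cminus at 1 in EE. rewrite re_plus, re_opp in EE.
  rewrite !herglotz_re in EE by auto.
  set (X := Cmod (1 - Cconj sg * z)) in *. set (Y := Cmod (1 - Cconj sg * w)) in *.
  assert (0 < X) by now apply Cmod_gt_0. assert (0 < Y) by now apply Cmod_gt_0.
  assert (0 <= (1 - Cmod w ^ 2) / Y ^ 2 + - ((1 - Cmod z ^ 2) / X ^ 2)); [|nra].
  replace ((1 - Cmod w ^ 2) / Y ^ 2 + - ((1 - Cmod z ^ 2) / X ^ 2))
    with (((1 - Cmod w ^ 2) * X ^ 2 - (1 - Cmod z ^ 2) * Y ^ 2) / (X ^ 2 * Y ^ 2)) by (field; lra).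
  apply Rdiv_le_0_compat; [lra|]. apply Rmult_lt_0_compat; nra.
Qed.

(** The lifted translations commute and push the base point to the circle.  Julia's lemma, applied
    along a lattice walk on which both elementary steps are asymptotically non-expanding, gives one
    horocycle centre for both directions; as the step length tends to [0], subsequences of these
    centres converge to [tau], and invariance of the horodiscs becomes the stated inequality on
    the infinitesimal generators [- v / f'] of the two translation semigroups. *)
Theorem boundary_fixed_point : exists tau, Cmod tau = 1 /\ forall z, Cmod z < 1 ->
  0 <= Re (- (Cconj tau * v1) / (df z * (1 - Cconj tau * z) ^ 2)) /\
  0 <= Re (- (Cconj tau * v2) / (df z * (1 - Cconj tau * z) ^ 2)).
Proof.
  assert (Pn : forall n, 0 < / INR (S n)) by (intros; apply Rinv_0_lt_compat, lt_0_INR; lia).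
  destruct (angle_cluster (fun n t => forall z, Cmod z < 1 ->
  ((1 - Cmod z ^ 2) * Cmod (1 - Cconj (cis t) * G (/ INR (S n)) 0 z) ^ 2 <=
   (1 - Cmod (G (/ INR (S n)) 0 z) ^ 2) * Cmod (1 - Cconj (cis t) * z) ^ 2) /\
  ((1 - Cmod z ^ 2) * Cmod (1 - Cconj (cis t) * G 0 (/ INR (S n)) z) ^ 2 <=
   (1 - Cmod (G 0 (/ INR (S n)) z) ^ 2) * Cmod (1 - Cconj (cis t) * z) ^ 2))) as [t0 H0].
  { intros n. apply julia. auto. }
  exists (cis t0). split; [apply Cmod_cis|]. intros z Hz.
  assert (App : forall e, 0 < e -> exists n t, 0 < / INR (S n) < e /\ Cmod (cis t - cis t0) < e /\ forall z, Cmod z < 1 ->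
  ((1 - Cmod z ^ 2) * Cmod (1 - Cconj (cis t) * G (/ INR (S n)) 0 z) ^ 2 <=
   (1 - Cmod (G (/ INR (S n)) 0 z) ^ 2) * Cmod (1 - Cconj (cis t) * z) ^ 2) /\
  ((1 - Cmod z ^ 2) * Cmod (1 - Cconj (cis t) * G 0 (/ INR (S n)) z) ^ 2 <=
   (1 - Cmod (G 0 (/ INR (S n)) z) ^ 2) * Cmod (1 - Cconj (cis t) * z) ^ 2)).
  { intros e He. destruct (archimed_cor1 e He) as [N [HN HN0]].
    destruct (H0 e N He) as [n [t [Hn [Ht Ct]]]]. exists n, t. repeat split; auto; try (apply Ht; auto).
    eapply Rle_lt_trans; [|exact HN]. apply Rinv_le_contravar; [now apply lt_0_INR|]. apply le_INR. lia. }
  split; apply julia_limit; auto; intros e He; destruct (App e He) as [n [t [Hn [Ct Ht]]]];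
    exists (/ INR (S n)), t; destruct (Ht z Hz) as [J1 J2].
  - exists (G (/ INR (S n)) 0 z). destruct (G_spec (/ INR (S n)) 0 z) as [A1 A2]; try lra.
    split; [lra|split; [auto|split; [auto|split; [|auto]]]]. rewrite A2. ring.
  - exists (G 0 (/ INR (S n)) z). destruct (G_spec 0 (/ INR (S n)) z) as [A1 A2]; try lra.
    split; [lra|split; [auto|split; [auto|split; [|auto]]]]. rewrite A2. ring.
Qed.
End Translations.

(** * From an invariant sector of directions to the pre-Schwarzian bound *)

Lemma Re_cexp_cis l u : Re (cis u * cexp l) = exp (Re l) * cos (Im l + u).
Proof. rewrite cexp_polar. unfold cis, Re, Im; simpl. rewrite cos_plus. ring. Qed.

Lemma cos_nonneg_principal x : - (3 * (PI / 2)) < x < 3 * (PI / 2) -> 0 <= cos x -> - (PI / 2) <= x <= PI / 2.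
Proof.
  intros H Hc. split.
  - destruct (Rle_or_lt (- (PI / 2)) x) as [|L]; auto. exfalso.
    rewrite <- cos_neg in Hc. pose proof (cos_lt_0 (- x)). lra.
  - destruct (Rle_or_lt x (PI / 2)) as [|L]; auto. exfalso. pose proof (cos_lt_0 x). lra.
Qed.

(** A holomorphic logarithm whose exponential stays in the closed sector of half angle
    [b PI / 2] grows at most like the logarithm of the conformal map onto that sector. *)
Lemma sector_log_derivative l dl b :
  0 < b -> holD 1 l dl -> (forall z, Cmod z < 1 -> Rabs (Im (l z)) <= b * (PI / 2)) ->
  forall z, Cmod z < 1 -> Cmod (dl z) * (1 - Cmod z ^ 2) <= 2 * b.
Proof.
  intros Hb Hl HI z Hz.
  set (k := fun w => cexp (RtoC (/ b) * l w)).
  assert (Hk : holD 1 k (fun w => k w * (RtoC (/ b) * dl w))%C).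
  { eapply holD_ext; [reflexivity| |apply holD_cexp, (holD_mult 1 (fun _ => RtoC (/ b)) l);
      [apply holD_const|exact Hl]]. intros w _. unfold k. simpl. ring. }
  assert (Rk : forall w, Cmod w < 1 -> 0 <= Re (k w)).
  { intros w Hw. unfold k. rewrite Re_cexp. apply Rmult_le_pos; [apply Rlt_le, exp_pos|].
    specialize (HI w Hw). replace (Im (RtoC (/ b) * l w)%C) with (/ b * Im (l w)) by (unfold Im; simpl; ring).
    apply Rabs_le_between in HI.
    assert (- (PI / 2) <= / b * Im (l w) <= PI / 2).
    { split; apply (Rmult_le_reg_l b); auto; rewrite <- Rmult_assoc, Rinv_r by lra; lra. }
    apply cos_ge_0; lra. }
  assert (K : forall e, 0 < e -> Cmod (k z * (RtoC (/ b) * dl z)) * (1 - Cmod z ^ 2) <= 2 * Cmod (k z) + 2 * e).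
  { intros e He.
    assert (HK := holD_plus 1 k (fun _ => RtoC e) _ _ Hk (holD_const 1 (RtoC e))).
    pose proof (schwarz_pick_half_plane _ _ HK) as S. cbv beta in S.
    assert (P : forall w, Cmod w < 1 -> 0 < Re (k w + RtoC e)).
    { intros w Hw. rewrite re_plus, re_RtoC. specialize (Rk w Hw). lra. }
    specialize (S P z Hz). rewrite Cplus_0_r, re_plus, re_RtoC in S. pose proof (re_le (k z)). lra. }
  assert (K0 : Cmod (k z * (RtoC (/ b) * dl z)) * (1 - Cmod z ^ 2) <= 2 * Cmod (k z)).
  { apply le_epsilon. intros e He. specialize (K (e / 2) ltac:(lra)). lra. }
  assert (Pk : 0 < Cmod (k z)) by (unfold k; rewrite Cmod_cexp; apply exp_pos).
  rewrite !Cmod_mult, Cmod_R, Rabs_pos_eq in K0 by (apply Rlt_le, Rinv_0_lt_compat; auto).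
  apply (Rmult_le_reg_l (Cmod (k z) * / b)); [apply Rmult_lt_0_compat; auto; now apply Rinv_0_lt_compat|].
  replace (Cmod (k z) * / b * (2 * b)) with (2 * Cmod (k z)) by (field; lra).
  eapply Rle_trans; [|exact K0]. right; ring.
Qed.

(** The two inequalities confine [- conj tau e / (f' (1 - conj tau z)^2)] to a sector of opening
    [PI - del].  The logarithm of this function has derivative
    [- f'' / f' + 2 conj tau / (1 - conj tau z)], and the second term accounts exactly for
    [2 conj z] up to a number of modulus [2]. *)
Lemma sector_bound f df ddf tau e del :
  holD 1 f df -> holD 1 df ddf -> (forall z, Cmod z < 1 -> df z <> 0%C) ->
  Cmod tau = 1 -> Cmod e = 1 -> 0 <= del < PI ->
  (forall z, Cmod z < 1 ->
    0 <= Re (- (Cconj tau * (e * cis (- (del / 2)))) / (df z * (1 - Cconj tau * z) ^ 2)) /\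
    0 <= Re (- (Cconj tau * (e * cis (del / 2))) / (df z * (1 - Cconj tau * z) ^ 2))) ->
  forall z, Cmod z < 1 ->
  Cmod (RtoC (1 - Cmod z ^ 2) * (ddf z / df z) - 2 * Cconj z) <= 2 + 2 * ((PI - del) / PI).
Proof.
  intros Hf Hdf Nd Mt Me Hdel HR z Hz. pose proof PI_RGT_0 as PI0.
  set (D := fun z => (1 - Cconj tau * z)%C).
  assert (ND : forall z, Cmod z < 1 -> D z <> 0%C).
  { intros w Hw. apply Cneq_mod. pose proof (Cmod_rev_triangle 1 (Cconj tau * w)).
    rewrite Cmod_1, Cmod_mult, Cmod_conj, Mt in H. unfold D. lra. }
  assert (HD : holD 1 D (fun _ => - Cconj tau)%C).
  { eapply holD_ext; [reflexivity| |apply (holD_minus 1 (fun _ => 1%C) (fun z => Cconj tau * z)%C);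
      [apply holD_const|apply (holD_mult 1 (fun _ => Cconj tau) (fun z => z)); [apply holD_const|apply holD_id]]].
    intros; simpl; ring. }
  assert (Z0 : Cmod 0 < 1) by (rewrite Cmod_0; lra).
  assert (D0 : D 0%C = 1%C) by (unfold D; ring).
  destruct (exists_log (df 0%C) (Nd _ Z0)) as [a0 Ha0].
  destruct (logarithm 1 df ddf a0 Rlt_0_1 Hdf Nd Ha0) as [l1 [Hl1 [L10 E1]]].
  destruct (logarithm 1 D _ 0%C Rlt_0_1 HD ND) as [l2 [Hl2 [L20 E2]]]; [now rewrite cexp_0|].
  assert (Nte : (Cconj tau * e)%C <> 0%C) by (apply Cneq_mod; rewrite Cmod_mult, Cmod_conj, Mt, Me; lra).
  destruct (exists_log_principal (- (Cconj tau * e) / df 0%C)%C) as [b0 [Hb0 Ib0]].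
  { intros K. apply Nte. specialize (Nd _ Z0).
    transitivity (- ((- (Cconj tau * e) / df 0%C) * df 0%C))%C; [field; auto|rewrite K; ring]. }
  set (L := fun z => (b0 + a0 - l1 z - (l2 z + l2 z))%C).
  assert (HL : holD 1 L (fun z => 0 - ddf z / df z - (- Cconj tau / D z + - Cconj tau / D z))%C).
  { apply holD_minus; [apply holD_minus; [apply holD_const|auto]|]. now apply holD_plus. }
  assert (EL : forall w, Cmod w < 1 -> cexp (L w) = (- (Cconj tau * e) / (df w * D w ^ 2))%C).
  { intros w Hw.
    assert (X : (cexp (L w) * (df w * D w ^ 2) = - (Cconj tau * e))%C).
    { rewrite <- E1, <- E2 by auto. simpl. rewrite Cmult_1_r, <- !cexp_plus.
      unfold L. replace (b0 + a0 - l1 w - (l2 w + l2 w) + (l1 w + (l2 w + l2 w)))%C with (b0 + a0)%C by ring.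
      rewrite cexp_plus, Hb0, Ha0. field. auto. }
    rewrite <- X. field. split; auto. }
  assert (L0 : L 0%C = b0) by (unfold L; rewrite L10, L20; ring).
  assert (HC : forall w, Cmod w < 1 -> 0 <= cos (Im (L w) - del / 2) /\ 0 <= cos (Im (L w) + del / 2)).
  { intros w Hw. destruct (HR w Hw) as [A B]. specialize (EL w Hw). fold (D w) in A, B.
    assert (Tr : forall u, (- (Cconj tau * (e * cis u)) / (df w * D w ^ 2) = cis u * cexp (L w))%C).
    { intros u. rewrite EL. unfold Cdiv. ring. }
    rewrite Tr, Re_cexp_cis in A, B. pose proof (exp_pos (Re (L w))).
    split.
    - destruct (Rle_or_lt 0 (cos (Im (L w) - del / 2))); auto. unfold Rminus in *. nra.
    - destruct (Rle_or_lt 0 (cos (Im (L w) + del / 2))); auto. nra. }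
  set (y := PI / 2 - del / 2).
  assert (Y0 : - y <= Im (L 0%C) <= y).
  { destruct (HC 0%C Z0) as [A B]. rewrite L0 in *. unfold y.
    destruct (Rle_or_lt (Im b0) 0).
    - apply cos_nonneg_principal in A; [|lra]. lra.
    - apply cos_nonneg_principal in B; [|lra]. lra. }
  (* leaving the sector continuously would mean crossing directions where one of the cosines is negative *)
  assert (HI : forall w, Cmod w < 1 -> Rabs (Im (L w)) <= (PI - del) / PI * (PI / 2)).
  { intros w Hw. replace ((PI - del) / PI * (PI / 2)) with y by (unfold y; field; lra).
    set (g := fun s => Im (L (RtoC s * w)%C)).
    assert (Cg : forall s, 0 <= s <= 1 -> continuity_pt g s).
    { intros s Hs. apply continuity_pt_filterlim. apply (ex_derive_continuous (V := R_NormedModule)).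
      pose proof (rder_ray L _ 1 w s HL (ray_in_disk 1 w s Hs Hw)) as [_ R2]. eexists; exact R2. }
    assert (g0 : g 0 = Im (L 0%C)) by (unfold g; do 2 f_equal; ring).
    assert (g1 : g 1 = Im (L w)) by (unfold g; do 2 f_equal; ring).
    assert (IV : forall c, g 0 < c < g 1 \/ g 1 < c < g 0 -> exists s, 0 <= s <= 1 /\ g s = c).
    { intros c Hc.
      destruct Hc as [Hc|Hc].
      - destruct (Ranalysis5.IVT_interv (fun x => g x - c) 0 1) as [s [Hs Es]]; try lra.
        + intros s Hs. apply continuity_pt_minus; [now apply Cg|apply continuity_pt_const; intros ? ?; auto].
        + exists s. split; auto; lra.
      - destruct (Ranalysis5.IVT_interv (fun x => c - g x) 0 1) as [s [Hs Es]]; try lra.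
        + intros s Hs. apply continuity_pt_minus; [apply continuity_pt_const; intros ? ?; auto|now apply Cg].
        + exists s. split; auto; lra. }
    rewrite <- g1. rewrite <- g0 in Y0. apply Rabs_le. split.
    - destruct (Rle_or_lt (- y) (g 1)) as [|N]; auto. exfalso.
      set (c := Rmax ((g 1 - y) / 2) (- y - 1)).
      assert (Hc : c < - y /\ g 1 < c /\ - y - 1 <= c).
      { unfold c. pose proof (Rmax_l ((g 1 - y) / 2) (- y - 1)). pose proof (Rmax_r ((g 1 - y) / 2) (- y - 1)).
        assert (Rmax ((g 1 - y) / 2) (- y - 1) < - y) by (apply Rmax_lub_lt; lra). lra. }
      destruct (IV c) as [s [Hs Es]]; [right; lra|].
      destruct (HC _ (ray_in_disk 1 w s Hs Hw)) as [A _]. fold (g s) in A. rewrite Es in A.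
      rewrite <- cos_neg in A. pose proof (cos_lt_0 (- (c - del / 2))). pose proof PI2_3_2. unfold y in *. lra.
    - destruct (Rle_or_lt (g 1) y) as [|N]; auto. exfalso.
      set (c := Rmin ((g 1 + y) / 2) (y + 1)).
      assert (Hc : y < c /\ c < g 1 /\ c <= y + 1).
      { unfold c. pose proof (Rmin_l ((g 1 + y) / 2) (y + 1)). pose proof (Rmin_r ((g 1 + y) / 2) (y + 1)).
        assert (y < Rmin ((g 1 + y) / 2) (y + 1)) by (apply Rmin_glb_lt; lra). lra. }
      destruct (IV c) as [s [Hs Es]]; [left; lra|].
      destruct (HC _ (ray_in_disk 1 w s Hs Hw)) as [_ B]. fold (g s) in B. rewrite Es in B.
      pose proof (cos_lt_0 (c + del / 2)). pose proof PI2_3_2. unfold y in *. lra. }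
  assert (Bp : 0 < (PI - del) / PI) by (apply Rdiv_lt_0_compat; lra).
  pose proof (sector_log_derivative L _ _ Bp HL HI z Hz) as S. cbv beta in S.
  set (q := (0 - ddf z / df z - (- Cconj tau / D z + - Cconj tau / D z))%C) in *.
  assert (Pz : 0 < 1 - Cmod z ^ 2) by (pose proof (Cmod_ge_0 z); nra).
  assert (ZZ : (z * Cconj z)%C = RtoC (Cmod z ^ 2)) by apply Cconj_mult_self.
  assert (TT : (tau * Cconj tau)%C = 1%C) by (rewrite Cconj_mult_self, Mt; ceq).
  assert (E : (RtoC (1 - Cmod z ^ 2) * (ddf z / df z) - 2 * Cconj z
               = - (RtoC (1 - Cmod z ^ 2) * q) + 2 * ((Cconj tau - Cconj z) / D z))%C).
  { unfold q. assert (KD : ((Cconj tau - Cconj z) / D z = RtoC (1 - Cmod z ^ 2) * Cconj tau / D z - Cconj z)%C).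
    { transitivity (((1 - z * Cconj z) * Cconj tau - Cconj z * D z) / D z)%C.
      - f_equal. unfold D. ring.
      - rewrite RtoC_minus, <- ZZ. specialize (ND z Hz). field; auto. }
    rewrite KD. unfold Cdiv. ring. }
  rewrite E. eapply Rle_trans; [apply Cmod_triangle|].
  rewrite Cmod_opp, !Cmod_mult, !Cmod_R, (Rabs_pos_eq (1 - Cmod z ^ 2)), (Rabs_pos_eq 2) by lra.
  assert (M1 : Cmod ((Cconj tau - Cconj z) / D z) = 1).
  { rewrite Cmod_div by auto.
    assert (MD : Cmod (D z) = Cmod (Cconj tau - Cconj z)).
    { rewrite <- Cminus_conj, Cmod_conj. replace (D z) with (Cconj tau * (tau - z))%C.
      - rewrite Cmod_mult, Cmod_conj, Mt; ring.
      - unfold D. replace (Cconj tau * (tau - z))%C with (tau * Cconj tau - Cconj tau * z)%C by ring. rewrite TT. ring. }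
    rewrite MD. field. rewrite <- MD. apply Rgt_not_eq. now apply Cmod_gt_0, ND. }
  rewrite M1. lra.
Qed.

(** * Recession directions of the complement *)

Section Recession.
Variable Omega : C -> Prop.
Hypothesis Conv : convex_set (fun w => ~ Omega w).
Hypothesis Open : forall w, Omega w -> nearC w Omega.

Definition recession (v : C) := forall w s, ~ Omega w -> 0 <= s -> ~ Omega (w + RtoC s * v)%C.

Lemma complement_closed (w : C) : (forall d, 0 < d -> exists u, ~ Omega u /\ Cmod (u - w) < d) -> ~ Omega w.
Proof.
  intros H K. destruct (Open w K) as [d [Hd Kd]]. destruct (H d Hd) as [u [Hu Du]]. apply Hu, Kd, Du.
Qed.

(** The segments from [w] to far points [x] of the complement tend to the ray from [w] along [u]. *)
Lemma recession_limit u : Cmod u = 1 ->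
  (forall e M, 0 < e -> exists x, ~ Omega x /\ M <= Cmod x /\ Cmod (x - RtoC (Cmod x) * u) <= e * Cmod x) ->
  recession u.
Proof.
  intros Mu H w s Hw Hs. apply complement_closed. intros d Hd.
  pose proof (Cmod_ge_0 w) as Pw.
  assert (Hsd : 0 <= 2 * s * Cmod w / d) by (apply Rmult_le_pos; [nra|apply Rlt_le, Rinv_0_lt_compat; auto]).
  destruct (H (d / (2 * (s + 1))) (2 * s * Cmod w / d + s + 1)) as [x [Hx [Mx Dx]]].
  { apply Rdiv_lt_0_compat; lra. }
  assert (Px : 0 < Cmod x) by lra.
  set (th := s / Cmod x).
  assert (Hth : 0 <= th <= 1).
  { unfold th. split; [apply Rmult_le_pos; auto; apply Rlt_le, Rinv_0_lt_compat; auto|].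
    apply (Rmult_le_reg_r (Cmod x)); auto. unfold Rdiv. rewrite Rmult_assoc, Rinv_l by lra. lra. }
  assert (Ths : th * Cmod x = s) by (unfold th; field; lra).
  exists ((1 - th)%R * w + th * x)%C. split; [now apply Conv|].
  replace ((1 - th)%R * w + th * x - (w + s * u))%C with (RtoC th * (x - RtoC (Cmod x) * u) - RtoC th * w)%C.
  2:{ rewrite <- Ths, RtoC_mult, RtoC_minus. ring. }
  eapply Rle_lt_trans; [apply Cmod_triangle|]. rewrite Cmod_opp, !Cmod_mult, !Cmod_R, Rabs_pos_eq by lra.
  assert (th * Cmod (x - RtoC (Cmod x) * u) <= s * (d / (2 * (s + 1)))).
  { replace (s * (d / (2 * (s + 1)))) with (th * (d / (2 * (s + 1)) * Cmod x)).
    - apply Rmult_le_compat_l; lra.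
    - transitivity (th * Cmod x * (d / (2 * (s + 1)))); [ring|now rewrite Ths]. }
  assert (s * (d / (2 * (s + 1))) < d / 2).
  { apply (Rmult_lt_reg_r (2 * (s + 1))); [lra|]. replace (s * (d / (2 * (s + 1))) * (2 * (s + 1))) with (s * d) by (field; lra). nra. }
  assert (th * Cmod w <= d / 2).
  { apply (Rmult_le_reg_r (Cmod x)); auto. replace (th * Cmod w * Cmod x) with (s * Cmod w) by (rewrite <- Ths; ring).
    replace (s * Cmod w) with (d / 2 * (2 * s * Cmod w / d)) by (field; lra). apply Rmult_le_compat_l; lra. }
  lra.
Qed.

(** A ray that does not eventually stay in [Omega] meets the complement arbitrarily far out. *)
Lemma not_reaching_recession theta : ~ reaches_infinity Omega theta -> recession (cis theta).
Proof.
  intros H. apply recession_limit; [apply Cmod_cis|]. intros e M He.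
  destruct (not_all_not_ex _ (fun t => Rmax M 0 <= t /\ ~ Omega (t * (cos theta, sin theta))%C)) as [t [Ht Et]].
  { intros K. apply H. exists (Rmax M 0). intros t Ht. apply NNPP. intros L. now apply (K t). }
  pose proof (Rmax_l M 0). pose proof (Rmax_r M 0).
  exists (RtoC t * cis theta)%C. rewrite Cmod_mult, Cmod_R, Cmod_cis, Rabs_pos_eq, Rmult_1_r by lra.
  split; [exact Et|split; [lra|]].
  replace (t * cis theta - t * cis theta)%C with (RtoC 0) by ring. rewrite Cmod_0. nra.
Qed.

Lemma unbounded_recession : (forall M, exists x, ~ Omega x /\ M <= Cmod x) -> exists theta, recession (cis theta).
Proof.
  intros H.
  destruct (angle_cluster (fun n t => exists x, ~ Omega x /\ INR n <= Cmod x /\ x = (RtoC (Cmod x) * cis t)%C)) as [t0 Ht0].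
  { intros n. destruct (H (INR n + 1)) as [x [Hx Mx]]. pose proof (pos_INR n).
    destruct (polar x _ eq_refl) as [t [Ht Et]].
    exists t. split; [lra|]. exists x. repeat split; auto. lra. }
  exists t0. apply recession_limit; [apply Cmod_cis|]. intros e M He.
  destruct (INR_unbounded M) as [N HN].
  destruct (Ht0 e N He) as [n [t [Hn [[x [Hx [Mx Ex]]] Dt]]]]. apply le_INR in Hn.
  exists x. split; [auto|split; [lra|]]. rewrite Ex at 1.
  replace (Cmod x * cis t - Cmod x * cis t0)%C with (RtoC (Cmod x) * (cis t - cis t0))%C by ring.
  rewrite Cmod_mult, Cmod_R, Rabs_pos_eq by apply Cmod_ge_0. rewrite Rmult_comm.
  apply Rmult_le_compat_r; [apply Cmod_ge_0|lra].
Qed.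

Lemma recession_closed v :
  (forall e, 0 < e -> exists v', recession v' /\ Cmod (v' - v) < e) -> recession v.
Proof.
  intros H w s Hw Hs. apply complement_closed. intros d Hd.
  destruct (H (d / (s + 1))) as [v' [Hv' D]]; [apply Rdiv_lt_0_compat; lra|].
  exists (w + RtoC s * v')%C. split; [now apply Hv'|].
  replace (w + s * v' - (w + s * v))%C with (RtoC s * (v' - v))%C by ring.
  rewrite Cmod_mult, Cmod_R, Rabs_pos_eq by auto. pose proof (Cmod_ge_0 (v' - v)).
  apply Rle_lt_trans with (s * (d / (s + 1))); [apply Rmult_le_compat_l; lra|].
  apply (Rmult_lt_reg_r (s + 1)); [lra|]. replace (s * (d / (s + 1)) * (s + 1)) with (s * d) by (field; lra). nra.
Qed.

Lemma recession_conic v1 v2 a b : recession v1 -> recession v2 -> 0 <= a -> 0 <= b ->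
  recession (RtoC a * v1 + RtoC b * v2)%C.
Proof.
  intros H1 H2 Ha Hb w s Hw Hs.
  replace (w + s * (a * v1 + b * v2))%C with (w + RtoC (s * a) * v1 + RtoC (s * b) * v2)%C by (rewrite !RtoC_mult; ring).
  apply H2; [apply H1|]; auto; nra.
Qed.

Lemma recession_between t a s : 0 < a < PI -> 0 <= s <= a ->
  recession (cis t) -> recession (cis (t + a)) -> recession (cis (t + s)).
Proof.
  intros Ha Hs H1 H2. assert (Sa : 0 < sin a) by (apply sin_gt_0; lra).
  assert (Q : forall x, 0 <= x <= a -> 0 <= sin x / sin a).
  { intros x Hx. apply Rmult_le_pos; [apply sin_ge_0; lra|apply Rlt_le, Rinv_0_lt_compat; auto]. }
  replace (cis (t + s)) with (RtoC (sin (a - s) / sin a) * cis t + RtoC (sin s / sin a) * cis (t + a))%C.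
  - apply recession_conic; auto; apply Q; lra.
  - assert (E : sin (a - s) / sin a = cos s - cos a * (sin s / sin a)) by (rewrite sin_minus; field; lra).
    rewrite E. apply C_ext; unfold Re, Im; simpl; rewrite ?cos_plus, ?sin_plus; field; lra.
Qed.

(** The supremum is attained because limits of recession directions are recession directions. *)
Lemma recession_extreme t0 sg : recession (cis t0) ->
  exists a, 0 <= a <= PI /\ recession (cis (t0 + sg * a)) /\
  forall s, 0 <= s <= PI -> recession (cis (t0 + sg * s)) -> s <= a.
Proof.
  intros H0.
  destruct (completeness (fun s => 0 <= s <= PI /\ recession (cis (t0 + sg * s)))) as [a [Ub Lb]].
  - exists PI. intros s [Hs _]. lra.
  - exists 0. split; [pose proof PI_RGT_0; lra|]. now replace (t0 + sg * 0) with t0 by ring.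
  - assert (A0 : 0 <= a).
    { apply Ub. split; [pose proof PI_RGT_0; lra|]. now replace (t0 + sg * 0) with t0 by ring. }
    assert (AP : a <= PI) by (apply Lb; intros s [Hs _]; lra).
    exists a. split; [lra|split].
    + apply recession_closed. intros e He.
      assert (Cc : clim (locally a) (fun s => cis (t0 + sg * s)) (cis (t0 + sg * a))).
      { apply (rder_rcont_at (fun s => cis (t0 + sg * s)) a (RtoC sg * (Ci * cis (t0 + sg * a)))%C).
        split; unfold cis, Re, Im in *; simpl in *.
        - auto_derive; [auto|ring].
        - auto_derive; [auto|ring]. }
      destruct (Cc e He) as [d Hd].
      destruct (not_all_not_ex _ (fun s => a - d < s /\ 0 <= s <= PI /\ recession (cis (t0 + sg * s)))) as [s [Hs1 [Hs2 Hs3]]].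
      { intros K. assert (a <= a - d); [|pose proof (cond_pos d); lra].
        apply Lb. intros s Hs. destruct (Rle_or_lt s (a - d)); auto. exfalso. apply (K s). tauto. }
      assert (s <= a) by (apply Ub; auto).
      exists (cis (t0 + sg * s)). split; auto. apply Hd.
      change (Rabs (s - a) < d). rewrite Rabs_left1; lra.
    + intros s Hs Hr. apply Ub. auto.
Qed.

Hypothesis Sided : forall w0 theta, (forall t : R, ~ Omega (w0 + RtoC t * cis theta)%C) ->
  (forall w, Omega w -> 0 < Im ((w - w0) * Cconj (cis theta))) \/
  (forall w, Omega w -> Im ((w - w0) * Cconj (cis theta)) < 0).

(** If [Omega] lies on one side of a line, the directions pointing to the other side cannot reach
    infinity inside [Omega]. *)
Lemma half_plane_recession w0 theta s sg : (sg = 1 \/ sg = -1) -> 0 <= s < PI -> recession (cis theta) ->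
  (forall w, Omega w -> 0 < sg * Im ((w - w0) * Cconj (cis theta))) -> recession (cis (theta - sg * s)).
Proof.
  intros Hsg Hs H0 H. destruct (Rle_lt_or_eq_dec 0 s) as [Ps| <-]; [lra| |now replace (theta - sg * 0) with theta by ring].
  apply not_reaching_recession. intros [T HT].
  assert (Ss : 0 < sin s) by (apply sin_gt_0; lra).
  set (c := Im (w0 * Cconj (cis theta))).
  set (t := Rmax T (- sg * c / sin s)).
  specialize (HT t (Rmax_l _ _)). specialize (H _ HT).
  assert (E : sg * Im ((t * (cos (theta - sg * s), sin (theta - sg * s)) - w0) * Cconj (cis theta)) = - (t * sin s) - sg * c).
  { change (cos (theta - sg * s), sin (theta - sg * s)) with (cis (theta - sg * s)).
    replace ((t * cis (theta - sg * s) - w0) * Cconj (cis theta))%C with (RtoC t * cis (- (sg * s)) - w0 * Cconj (cis theta))%C.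
    2:{ unfold Rminus. rewrite (cis_plus theta), cis_conj. field. apply cis_neq_0. }
    replace (Im (t * cis (- (sg * s)) - w0 * Cconj (cis theta))%C) with (t * sin (- (sg * s)) - c) by (unfold c, cis, Re, Im; simpl; ring).
    rewrite sin_neg. destruct Hsg as [-> | ->]; [rewrite !Rmult_1_l; ring|].
    replace (-1 * s) with (- s) by ring. rewrite sin_neg. ring. }
  rewrite E in H. pose proof (Rmax_r T (- sg * c / sin s)). fold t in H1.
  apply (Rmult_le_compat_r (sin s)) in H1; [|lra].
  replace (- sg * c / sin s * sin s) with (- sg * c) in H1 by (field; lra). lra.
Qed.

(** Either the recession directions fill less than a half-turn and then the remaining
    directions all reach infinity inside [Omega], so the opening angle bounds their
    spread from below, or the complement contains a half-plane. *)
Theorem recession_sector A : 1 < A <= 2 ->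
  Rbar_le (opening_angle_at_infinity Omega) (PI * A) ->
  (forall M, exists x, ~ Omega x /\ M <= Cmod x) ->
  exists t, recession (cis t) /\ recession (cis (t + (2 - A) * PI)).
Proof.
  intros HA HO HU. pose proof PI_RGT_0 as P0.
  set (del := (2 - A) * PI). assert (Hdel : 0 <= del < PI) by (unfold del; nra).
  destruct (unbounded_recession HU) as [t0 H0].
  assert (Line : forall t, recession (cis t) -> recession (cis (t + PI)) -> exists u, recession (cis u) /\ recession (cis (u + del))).
  { intros t H1 H2. destruct (HU 0) as [w0 [Hw0 _]].
    destruct (Sided w0 t) as [S|S].
    - intros x. destruct (Rle_or_lt 0 x); [now apply H1|].
      replace (w0 + x * cis t)%C with (w0 + RtoC (- x) * cis (t + PI))%C; [apply H2; auto; lra|].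
      rewrite cis_plus. replace (cis PI) with (- (1))%C; [rewrite RtoC_opp; ring|].
      apply C_ext; unfold Re, Im; simpl; rewrite ?cos_PI, ?sin_PI; ring.
    - exists (t - 1 * del). split; [|now replace (t - 1 * del + del) with t by ring].
      apply (half_plane_recession w0); auto. intros w Hw. specialize (S w Hw). lra.
    - exists t. split; auto. replace (t + del) with (t - -1 * del) by ring.
      apply (half_plane_recession w0); auto. intros w Hw. specialize (S w Hw). lra. }
  destruct (recession_extreme t0 1 H0) as [a [Ha [Ra Ma]]].
  destruct (recession_extreme t0 (-1) H0) as [b [Hb [Rb Mb]]].
  replace (t0 + 1 * a) with (t0 + a) in Ra by ring. replace (t0 + -1 * b) with (t0 - b) in Rb by ring.
  destruct (Req_dec a PI) as [->|Na]; [now apply (Line t0)|].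
  destruct (Req_dec b PI) as [->|Nb].
  { apply (Line (t0 - PI)); auto. now replace (t0 - PI + PI) with t0 by ring. }
  assert (Hab : del <= a + b).
  { assert (L : 2 * PI - a - b <= PI * A); [|unfold del; lra].
    change (Rbar_le (Finite (2 * PI - a - b)) (PI * A)).
    eapply Rbar_le_trans; [|exact HO]. unfold opening_angle_at_infinity.
    match goal with |- Rbar_le _ (Lub_Rbar ?S) => destruct (Lub_Rbar_correct S) as [U _]; apply U end.
    split; [lra|]. exists (t0 + a). intros th Hth. apply NNPP. intros K.
    apply not_reaching_recession in K.
    destruct (Rle_or_lt th (t0 + PI)).
    - assert (th - t0 <= a); [|lra]. apply Ma; [lra|]. now replace (t0 + 1 * (th - t0)) with th by ring.
    - assert (t0 + 2 * PI - th <= b); [|lra]. apply Mb; [lra|].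
      replace (t0 + -1 * (t0 + 2 * PI - th)) with (th + - (2 * PI)) by ring.
      rewrite cis_plus, <- cis_conj', cis_2PI. replace (cis th * Cconj 1)%C with (cis th) by ceq. auto. }
  set (s2 := Rmin a del).
  assert (Hs2 : 0 <= s2 <= a /\ 0 <= del - s2 <= b).
  { unfold s2, Rmin. destruct (Rle_dec a del); lra. }
  exists (t0 - (del - s2)). split.
  - destruct (Rle_lt_or_eq_dec 0 b) as [Pb|Zb]; [lra| |].
    + replace (t0 - (del - s2)) with (t0 - b + (b - (del - s2))) by ring.
      apply recession_between with b; try lra; auto. now replace (t0 - b + b) with t0 by ring.
    + now replace (t0 - (del - s2)) with t0 by lra.
  - replace (t0 - (del - s2) + del) with (t0 + s2) by ring.
    destruct (Rle_lt_or_eq_dec 0 a) as [Pa|Za]; [lra| |].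
    + apply recession_between with a; try lra; auto.
    + now replace (t0 + s2) with t0 by lra.
Qed.
End Recession.

(** * Concave functions *)

Lemma path_IVT (g : R -> R) : (forall s, 0 <= s <= 1 -> continuity_pt g s) ->
  (forall s, 0 <= s <= 1 -> g s <> 0) -> 0 < g 0 -> 0 < g 1.
Proof.
  intros Hc Hn H0. destruct (Rle_or_lt (g 1) 0) as [L|]; auto. exfalso.
  assert (g 1 <> 0) by (apply Hn; lra).
  destruct (Ranalysis5.IVT_interv (fun x => - g x) 0 1) as [s [Hs Es]]; try lra.
  - intros s Hs. apply continuity_pt_opp. now apply Hc.
  - apply (Hn s); lra.
Qed.

Section Concave.
Variables (f df ddf : C -> C).
Hypothesis Hf : holD 1 f df.
Hypothesis Hdf : holD 1 df ddf.
Hypothesis Inj : injective_on (disk 1) f.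
Hypothesis F0 : f 0%C = 0%C.
Hypothesis DF0 : df 0%C = 1%C.

Lemma image_open w : image_of f (disk 1) w -> nearC w (image_of f (disk 1)).
Proof.
  intros [z [Hz <-]]. destruct (open_mapping f df Hf Inj z 1 Hz Rlt_0_1) as [d [Hd H]].
  exists d. split; auto. intros u Hu. destruct (H u Hu) as [y [Hy [_ Ey]]]. now exists y.
Qed.

(** Preimages of points of the circle cannot approach the unit circle: at a limit point of their
    values, injectivity and openness force them to stay near an interior point. *)
Lemma circle_preimage_compact r : 0 < r -> (forall w, Cmod w = r -> image_of f (disk 1) w) ->
  exists q, 0 <= q < 1 /\ forall z, Cmod z < 1 -> Cmod (f z) = r -> Cmod z <= q.
Proof.
  intros Hr Hc. apply NNPP. intros N.
  destruct (angle_cluster (fun n t => exists z, Cmod z < 1 /\ 1 - / (INR n + 1) < Cmod z /\ f z = (RtoC r * cis t)%C)) as [t0 Ht0].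
  { intros n. apply NNPP. intros K. apply N. exists (1 - / (INR n + 1)).
    pose proof (pos_INR n).
    assert (0 < / (INR n + 1) <= 1).
    { split; [apply Rinv_0_lt_compat; lra|]. rewrite <- Rinv_1. apply Rinv_le_contravar; lra. }
    split; [lra|]. intros z Hz Mz. destruct (Rle_or_lt (Cmod z) (1 - / (INR n + 1))) as [|L]; auto. exfalso. apply K.
    destruct (polar (f z) r Mz) as [t [Ht Et]].
    exists t. split; [lra|]. exists z. repeat split; auto. }
  destruct (Hc (RtoC r * cis t0)%C) as [z0 [Hz0 E0]].
  { rewrite Cmod_mult, Cmod_cis, Cmod_R, Rabs_pos_eq; lra. }
  unfold disk in Hz0.
  destruct (open_mapping f df Hf Inj z0 ((1 - Cmod z0) / 2) Hz0) as [d [Hd Hop]]; [lra|].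
  destruct (INR_unbounded (2 / (1 - Cmod z0))) as [n0 Hn0].
  destruct (Ht0 (d / r) n0) as [n [t [Hn [[z [Hz [Lz Ez]]] Dt]]]]; [now apply Rdiv_lt_0_compat|].
  destruct (Hop (f z)) as [z' [Hz' [Dz' Ez']]].
  { rewrite Ez, E0. replace (r * cis t - r * cis t0)%C with (RtoC r * (cis t - cis t0))%C by ring.
    rewrite Cmod_mult, Cmod_R, Rabs_pos_eq by lra. apply (Rmult_lt_compat_l r) in Dt; auto.
    replace (r * (d / r)) with d in Dt by (field; lra). auto. }
  apply Inj in Ez'; auto. subst z'. apply le_INR in Hn.
  assert (B : / (INR n + 1) <= (1 - Cmod z0) / 2).
  { replace ((1 - Cmod z0) / 2) with (/ (2 / (1 - Cmod z0))) by (field; lra).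
    apply Rinv_le_contravar; [apply Rdiv_lt_0_compat|]; lra. }
  pose proof (Cmod_rev_triangle z z0). lra.
Qed.

(** Otherwise the image contains all points of modulus at least some [r >= 2].  Then [|f| > r] on
    an annulus [q < |z| < 1], because [|f|] takes large values near [1] and cannot equal [r] there.
    The maximum principle for [z / f z] contradicts its value [1] at the centre. *)
Lemma complement_unbounded : infinite_at_one f ->
  forall M, exists x, ~ image_of f (disk 1) x /\ M <= Cmod x.
Proof.
  intros Hi M. apply NNPP. intros N.
  set (r := Rmax M 2). pose proof (Rmax_l M 2). pose proof (Rmax_r M 2). fold r in H, H0.
  assert (Far : forall x, r <= Cmod x -> image_of f (disk 1) x).
  { intros x Hx. apply NNPP. intros K. apply N. exists x. split; auto. lra. }
  destruct (circle_preimage_compact r) as [q [Hq Kq]]; [lra| |].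
  { intros w Hw. apply Far. lra. }
  assert (X1 : exists x1, q < x1 < 1 /\ r < Cmod (f (RtoC x1))).
  { assert (P : Rbar_locally p_infty (fun y => r < y)) by (exists r; auto).
    specialize (Hi _ P). destruct Hi as [d Hd].
    pose proof (cond_pos d) as Dp.
    set (x1 := Rmax ((1 + q) / 2) (1 - d / 2)).
    assert (x1 < 1) by (apply Rmax_lub_lt; lra).
    pose proof (Rmax_l ((1 + q) / 2) (1 - d / 2)). pose proof (Rmax_r ((1 + q) / 2) (1 - d / 2)). fold x1 in H2, H3.
    exists x1. split; [lra|]. apply Hd.
    - split; [change (Rabs (x1 - 1) < d); apply Rabs_def1; lra|change (Rabs (0 - 0) < d); rewrite Rminus_0_r, Rabs_R0; auto].
    - unfold disk. rewrite Cmod_R, Rabs_pos_eq; lra. }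
  destruct X1 as [x1 [Hx1 Fx1]].
  (* the annulus is path connected and [|f| = r] is excluded there *)
  assert (Big : forall z, Cmod z = (1 + q) / 2 -> r < Cmod (f z)).
  { intros z Hz.
    destruct (polar z _ Hz) as [t [_ Et]].
    set (gam := fun s : R => (RtoC (x1 + s * ((1 + q) / 2 - x1)) * cis (s * t))%C).
    assert (Mg : forall s, 0 <= s <= 1 -> q < Cmod (gam s) < 1).
    { intros s Hs. unfold gam. assert (q < x1 + s * ((1 + q) / 2 - x1) < 1) by nra.
      rewrite Cmod_mult, Cmod_cis, Cmod_R, Rabs_pos_eq; lra. }
    assert (G0 : gam 0 = RtoC x1). { unfold gam. rewrite !Rmult_0_l, cis_0, Rplus_0_r. ring. }
    assert (G1 : gam 1 = z).
    { unfold gam. rewrite !Rmult_1_l, Et. do 2 f_equal. ring. }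
    assert (PI' := path_IVT (fun s => Cmod (f (gam s)) - r)). cbv beta in PI'.
    rewrite G0, G1 in PI'. enough (0 < Cmod (f z) - r) by lra. apply PI'; [| |lra].
    - intros s Hs. apply continuity_pt_minus; [|apply continuity_pt_const; intros ? ?; auto].
      apply continuity_pt_filterlim. apply (clim_cmod (locally s) (fun s => f (gam s))), (clim_comp_cont (locally s) gam f).
      + unfold gam. apply clim_mult; [typeclasses eauto| |].
        * apply (rder_rcont_at (fun s => RtoC (x1 + s * ((1 + q) / 2 - x1))) s (RtoC ((1 + q) / 2 - x1))).
          apply (rder_RtoC (fun s => x1 + s * ((1 + q) / 2 - x1))). auto_derive; [auto|ring].
        * apply (rder_rcont_at (fun s => cis (s * t)) s (RtoC t * (Ci * cis (s * t)))%C).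
          split; unfold cis, Re, Im in *; simpl in *; (auto_derive; [auto|ring]).
      + eapply holD_cont; [exact Hf|apply Mg; auto].
    - intros s Hs K. specialize (Kq (gam s) (proj2 (Mg s Hs))). pose proof (Mg s Hs). lra. }
  destruct (difference_quotient 1 f df 0%C Hf) as [k [Hk [K0 Ek]]]; [rewrite Cmod_0; lra|].
  assert (Ek' : forall a, Cmod a < 1 -> f a = (a * k a)%C).
  { intros a Ha. specialize (Ek a Ha). rewrite F0 in Ek.
    transitivity (f a - 0)%C; [ring|]. rewrite Ek. ring. }
  assert (Nk : forall z, Cmod z < 1 -> k z <> 0%C).
  { intros z Hz K. destruct (classic (z = 0%C)) as [->|Nz].
    - rewrite K0, DF0 in K. apply RtoC_inj in K. lra.
    - apply Nz. apply Inj; auto; [unfold disk; rewrite Cmod_0; lra|]. rewrite F0, Ek', K by auto. ring. }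
  assert (Z : Cmod (/ k 0%C) <= / 2).
  { apply (max_modulus 1 ((1 + q) / 2) (fun z => / k z)%C); [now apply hol_inv|lra| |rewrite Cmod_0; lra].
    intros z Hz. assert (Hz1 : Cmod z < 1) by lra. rewrite Cmod_inv by auto.
    apply Rinv_le_contravar; [lra|]. specialize (Big z Hz). rewrite Ek', Cmod_mult in Big by auto.
    pose proof (Cmod_ge_0 (k z)). nra. }
  rewrite K0, DF0, Cmod_inv, Cmod_1 in Z; [lra|]. intros K. apply RtoC_inj in K; lra.
Qed.

(** The image is connected, so it lies on one side of a line that it does not meet. *)
Lemma omitted_line_sides w0 theta : (forall t : R, ~ image_of f (disk 1) (w0 + RtoC t * cis theta)%C) ->
  (forall w, image_of f (disk 1) w -> 0 < Im ((w - w0) * Cconj (cis theta))) \/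
  (forall w, image_of f (disk 1) w -> Im ((w - w0) * Cconj (cis theta)) < 0).
Proof.
  intros H.
  assert (N : forall z, Cmod z < 1 -> Im ((f z - w0) * Cconj (cis theta)) <> 0).
  { intros z Hz K. apply (H (Re ((f z - w0) * Cconj (cis theta)))). exists z. split; [exact Hz|].
    assert (E : ((f z - w0) * Cconj (cis theta) = RtoC (Re ((f z - w0) * Cconj (cis theta))))%C).
    { apply C_ext; [now rewrite re_RtoC|rewrite K; reflexivity]. }
    rewrite <- E, cis_conj. field. apply cis_neq_0. }
  assert (S : forall sg z, Cmod z < 1 -> 0 < sg * Im ((f 0%C - w0) * Cconj (cis theta)) ->
    0 < sg * Im ((f z - w0) * Cconj (cis theta))).
  { intros sg z Hz Hs.
    assert (PI' := path_IVT (fun s => sg * Im ((f (RtoC s * z)%C - w0) * Cconj (cis theta)))). cbv beta in PI'.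
    rewrite Cmult_0_l, Cmult_1_l in PI'.
    apply PI'; auto.
    - intros s Hs1. apply continuity_pt_mult; [apply continuity_pt_const; intros ? ?; auto|].
      apply continuity_pt_filterlim. apply (clim_im (locally s) (fun s => ((f (RtoC s * z) - w0) * Cconj (cis theta))%C)).
      apply clim_mult; [typeclasses eauto| |apply clim_const; typeclasses eauto].
      apply clim_minus; [typeclasses eauto| |apply clim_const; typeclasses eauto].
      apply (rder_rcont_at (fun s => f (RtoC s * z)%C) s (df (RtoC s * z) * z)%C).
      apply (rder_ray f df 1); auto. now apply ray_in_disk.
    - intros s Hs1 K. apply Rmult_integral in K as [K|K]; [rewrite K in Hs; lra|].
      now apply (N (RtoC s * z)%C); [apply ray_in_disk|]. }
  assert (Z0 : Cmod 0 < 1) by (rewrite Cmod_0; lra).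
  destruct (Rdichotomy _ _ (N _ Z0)) as [L|L].
  - right. intros w [z [Hz <-]]. specialize (S (-1) z Hz). lra.
  - left. intros w [z [Hz <-]]. specialize (S 1 z Hz). lra.
Qed.

(** The recession directions of the complement are directions [v] such that the image absorbs
    translations by [- v], and by the opening angle two of them span an angle [(2 - A) PI]. *)
Theorem concave_pre_schwarzian A : 1 < A <= 2 -> infinite_at_one f ->
  convex_set (fun w => ~ image_of f (disk 1) w) ->
  Rbar_le (opening_angle_at_infinity (image_of f (disk 1))) (PI * A) ->
  forall z, Cmod z < 1 -> Cmod (RtoC (1 - Cmod z ^ 2) * (ddf z / df z) - 2 * Cconj z) <= 2 * A.
Proof.
  intros HA Hi Hc HO z Hz. pose proof PI_RGT_0 as P0.
  destruct (recession_sector _ Hc image_open omitted_line_sides A HA HO (complement_unbounded Hi)) as [t [R1 R2]].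
  set (del := (2 - A) * PI) in *. assert (Hdel : 0 <= del < PI) by (unfold del; nra).
  set (e := cis (t + del / 2)).
  assert (V1 : (e * cis (- (del / 2)))%C = cis t) by (unfold e; rewrite <- cis_plus; f_equal; ring).
  assert (V2 : (e * cis (del / 2))%C = cis (t + del)) by (unfold e; rewrite <- cis_plus; f_equal; field).
  rewrite <- V1 in R1. rewrite <- V2 in R2.
  assert (Rv : forall x, - (PI / 2) < x < PI / 2 -> 0 < Re (Cconj e * (e * cis x))).
  { intros x Hx. replace (Cconj e * (e * cis x))%C with ((e * Cconj e) * cis x)%C by ring.
    unfold e. rewrite cis_conj_mul, Cmult_1_l. unfold cis, Re; simpl. apply cos_gt_0; lra. }
  destruct (boundary_fixed_point f df (e * cis (- (del / 2)))%C (e * cis (del / 2))%C e Hf Inj) as [tau [Mt Ht]].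
  - intros a b u Ha Hb Hu.
    destruct (classic (image_of f (disk 1) (f u - (a * (e * cis (- (del / 2))) + b * (e * cis (del / 2)))))%C) as [[u' [Hu' Eu']]|N].
    + exists u'. split; auto.
    + exfalso. refine (recession_conic _ _ _ a b R1 R2 Ha Hb _ 1 N _ _); [lra|].
      exists u. split; [exact Hu|]. ring.
  - unfold e; apply Cmod_cis.
  - apply Rv; lra.
  - apply Rv; lra.
  - replace (2 * A) with (2 + 2 * ((PI - del) / PI)) by (unfold del; field; lra).
    apply (sector_bound f df ddf tau e del); auto.
    + intros w Hw. now apply (univalent_derivative f df Hf Inj).
    + unfold e; apply Cmod_cis.
Qed.
End Concave.

(** * The inequality behind the radius *)

Definition artanh (r : R) : R := (ln (1 + r) - ln (1 - r)) / 2.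

Lemma is_derive_artanh r : -1 < r < 1 -> is_derive artanh r (/ (1 - r ^ 2)).
Proof.
  intros Hr. unfold artanh. auto_derive; [lra|]. field. repeat split; nra.
Qed.

Lemma monotone_of_derivative (g dg : R -> R) b : 0 <= b ->
  (forall x, 0 <= x <= b -> is_derive g x (dg x)) -> (forall x, 0 <= x <= b -> 0 <= dg x) -> g 0 <= g b.
Proof.
  intros Hb Hg Hd.
  destruct (MVT_gen g 0 b dg) as [c [Hc Ec]].
  - intros x Hx. rewrite Rmin_left, Rmax_right in Hx by auto. apply Hg; lra.
  - intros x Hx. rewrite Rmin_left, Rmax_right in Hx by auto. apply continuity_pt_filterlim.
    apply (ex_derive_continuous (V := R_NormedModule)). eexists. now apply Hg.
  - rewrite Rmin_left, Rmax_right in Hc by auto. specialize (Hd c Hc). nra.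
Qed.

Lemma artanh_0 : artanh 0 = 0.
Proof. unfold artanh. rewrite Rplus_0_r, Rminus_0_r. lra. Qed.

Lemma artanh_le x : 0 <= x <= 52/100 -> artanh x <= 1124/1000 * x.
Proof.
  intros Hx.
  assert (0 + 457/1000 * 0 ^ 3 - artanh 0 <= x + 457/1000 * x ^ 3 - artanh x).
  { apply (monotone_of_derivative (fun t => t + 457/1000 * t ^ 3 - artanh t)
      (fun t => 1 + 457/1000 * (3 * t ^ 2) - / (1 - t ^ 2))); [lra| |].
    - intros t Ht. assert (D : -1 < t < 1) by lra. apply is_derive_artanh in D.
      apply (is_derive_minus (V := R_NormedModule) (fun t => t + 457/1000 * t ^ 3) artanh); auto. auto_derive; auto. ring.
    - intros t Ht. assert (P : 0 < 1 - t ^ 2) by nra.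
      apply (Rmult_le_reg_r (1 - t ^ 2)); auto. rewrite Rmult_0_l, Rmult_minus_distr_r, Rinv_l by lra.
      assert (0 <= t ^ 2 <= 2704/10000) by nra. simpl in *. nra. }
  rewrite artanh_0 in H. assert (x ^ 2 <= 2704 / 10000) by nra. nra.
Qed.

Lemma artanh_ge_0 x : 0 <= x < 1 -> 0 <= artanh x.
Proof.
  intros Hx. rewrite <- artanh_0 at 1. apply (monotone_of_derivative artanh (fun t => / (1 - t ^ 2))); [lra| |].
  - intros t Ht. apply is_derive_artanh. lra.
  - intros t Ht. apply Rlt_le, Rinv_0_lt_compat. nra.
Qed.

Lemma cos_taylor x : 0 <= x <= 2 -> 1 - x ^ 2 / 2 <= cos x <= 1 - x ^ 2 / 2 + x ^ 4 / 24.
Proof.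
  intros Hx. destruct (pre_cos_bound x 0) as [L U]; [lra|lra|].
  unfold cos_approx, cos_term in L, U. simpl in L, U. split; simpl; lra.
Qed.

(** On [[a, b]] the constraint bounds [w] by [cos a / a], hence [s^2 (w - w^2)] from below. *)
Lemma key_piece a b s w : 0 < a <= s -> s <= b -> b <= 11/10 -> 1/2 <= w <= 1 -> s * w <= cos s ->
  let wa := (1 - a ^ 2 / 2 + a ^ 4 / 24) / a in
  0 <= wa - wa ^ 2 -> b < (1 + a ^ 2 * (wa - wa ^ 2)) * (1 - 158/1000 * b ^ 2) ->
  s < (1 + s ^ 2 * (w - w ^ 2)) * (1 - 158/1000 * s ^ 2).
Proof.
  intros Ha Hb Hb' Hw Hc wa Hwa HB.
  assert (cos s <= cos a) by (pose proof PI2_3_2; apply cos_decr_1; lra).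
  assert (cos a <= 1 - a ^ 2 / 2 + a ^ 4 / 24) by (apply cos_taylor; lra).
  assert (W : w <= wa).
  { apply (Rmult_le_reg_l a); [lra|]. unfold wa. replace (a * ((1 - a ^ 2 / 2 + a ^ 4 / 24) / a)) with (1 - a ^ 2 / 2 + a ^ 4 / 24) by (field; lra). nra. }
  assert (W2 : wa - wa ^ 2 <= w - w ^ 2) by nra.
  assert (S1 : a ^ 2 <= s ^ 2) by nra. assert (S2 : s ^ 2 <= b ^ 2) by nra.
  assert (U : a ^ 2 * (wa - wa ^ 2) <= s ^ 2 * (w - w ^ 2)) by (apply Rmult_le_compat; auto; nra).
  assert (V : 0 < 1 - 158/1000 * b ^ 2) by nra.
  assert (0 <= a ^ 2 * (wa - wa ^ 2)) by (apply Rmult_le_pos; nra).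
  apply Rle_lt_trans with b; auto. eapply Rlt_le_trans; [exact HB|]. apply Rmult_le_compat; lra.
Qed.

(** Here [s = 2 A r], [w = 1 / (1 + rad0 A ^ 2)] and [s^2 (w - w^2) = r^2]; the case division is a
    numerical check of [s / (1 + r^2) < 1 - 0.158 s^2]. *)
Lemma key_inequality s w : 0 <= s <= PI / 2 -> 1/2 <= w <= 1 -> s * w <= cos s ->
  s < 104/100 /\ s < (1 + s ^ 2 * (w - w ^ 2)) * (1 - 158/1000 * s ^ 2).
Proof.
  intros Hs Hw Hc. pose proof PI2_3_2.
  assert (S : s < 104/100).
  { destruct (Rle_or_lt (104/100) s) as [L|]; auto. exfalso.
    assert (cos s <= cos (104/100)) by (apply cos_decr_1; lra).
    pose proof (cos_taylor (104/100)). nra. }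
  split; auto.
  destruct (Rle_or_lt s (8/10)) as [S0|S0].
  { assert (0 <= s ^ 2 * (w - w ^ 2)) by (apply Rmult_le_pos; nra).
    assert (s < 1 - 158/1000 * s ^ 2) by nra. nra. }
  destruct (Rle_or_lt s (9/10)); [apply (key_piece (8/10) (9/10)); try lra; auto|].
  destruct (Rle_or_lt s (97/100)); [apply (key_piece (9/10) (97/100)); try lra; auto|].
  destruct (Rle_or_lt s 1); [apply (key_piece (97/100) 1); try lra; auto|].
  destruct (Rle_or_lt s (102/100)); [apply (key_piece 1 (102/100)); try lra; auto|].
  apply (key_piece (102/100) (104/100)); try lra; auto.
Qed.

Lemma rad0_eq A : 1 < A -> 0 < rad0 A < 1 /\ rad0 A ^ 2 + 1 = 2 * A * rad0 A.
Proof.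
  intros HA. unfold rad0. assert (P : 0 < A ^ 2 - 1) by nra.
  pose proof (sqrt_sqrt (A ^ 2 - 1)) as S. specialize (S (Rlt_le _ _ P)).
  pose proof (sqrt_lt_R0 _ P). set (q := sqrt (A ^ 2 - 1)) in *.
  assert (q < A) by nra. assert (A - 1 < q) by nra. split; [lra|nra].
Qed.

Lemma asin_gt_0 x : 0 < x <= 1 -> 0 < asin x.
Proof.
  intros Hx. destruct (Rle_or_lt (asin x) 0) as [L|]; auto. exfalso.
  pose proof (asin_bound x). assert (0 <= sin (- asin x)) by (apply sin_ge_0; pose proof PI_RGT_0; lra).
  rewrite sin_neg, sin_asin in H0; lra.
Qed.

(** The equation [xi A R2 = 0] says [R2 / rad0 A = cos (2 A asin R2)], which is at most
    [cos (2 A R2)]; this forces [2 A R2 < 1.04] and leaves room to replace [asin] by [artanh]. *)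
Theorem radius_inequality A R2 r : 1 < A <= 2 -> 0 < R2 < rad0 A -> xi A R2 = 0 -> 0 <= r <= R2 ->
  2 * A * r / (1 + r ^ 2) < cos (A * artanh r) /\ 0 <= A * artanh r <= 1.
Proof.
  intros HA HR Hxi Hr. destruct (rad0_eq A) as [H0 E0]; [lra|]. set (R0 := rad0 A) in *.
  unfold xi in Hxi. fold R0 in Hxi. pose proof PI2_3_2 as P0.
  assert (Q : 0 < R2 / R0 < 1).
  { split; [apply Rdiv_lt_0_compat; lra|]. apply (Rmult_lt_reg_r R0); [lra|]. unfold Rdiv. rewrite Rmult_assoc, Rinv_l; lra. }
  assert (A1 : 0 < asin (R2 / R0)) by (apply asin_gt_0; lra).
  assert (A2 : R2 <= asin R2).
  { rewrite <- (sin_asin R2) at 1 by lra. apply Rlt_le, sin_lt_x, asin_gt_0. lra. }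
  assert (A3 : cos (2 * A * asin R2) = R2 / R0).
  { replace (2 * A * asin R2) with (PI / 2 - asin (R2 / R0)) by lra. rewrite cos_shift. apply sin_asin. lra. }
  set (s := 2 * A * r). set (w := / (1 + R0 ^ 2)).
  assert (S1 : 0 <= s <= 2 * A * R2) by (unfold s; nra).
  assert (S2 : 2 * A * R2 <= 2 * A * asin R2) by nra.
  assert (Sw : s * w = r / R0).
  { unfold s, w. replace (2 * A) with ((R0 ^ 2 + 1) / R0) by (rewrite E0; field; lra).
    field. split; apply Rgt_not_eq; nra. }
  assert (C1 : s * w <= cos s).
  { rewrite Sw. apply Rle_trans with (R2 / R0); [apply Rmult_le_compat_r; [apply Rlt_le, Rinv_0_lt_compat|]; lra|].
    rewrite <- A3. apply cos_decr_1; lra. }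
  assert (Hw : 1/2 <= w <= 1).
  { unfold w. replace (1/2) with (/ 2) by lra. split; [apply Rinv_le_contravar; nra|].
    rewrite <- Rinv_1 at 2. apply Rinv_le_contravar; nra. }
  destruct (key_inequality s w) as [K1 K2]; auto; [lra|].
  assert (U : s ^ 2 * (w - w ^ 2) = r ^ 2).
  { replace (s ^ 2 * (w - w ^ 2)) with ((s * w) ^ 2 * (1 / w - 1)) by (field; lra).
    rewrite Sw. unfold w. field. repeat split; apply Rgt_not_eq; nra. }
  rewrite U in K2.
  assert (r < 52/100) by (unfold s in K1; nra).
  assert (T1 : artanh r <= 1124/1000 * r) by (apply artanh_le; lra).
  assert (T0 : 0 <= artanh r) by (apply artanh_ge_0; lra).
  set (y := A * artanh r). assert (Hy : 0 <= y <= 562/1000 * s) by (unfold y, s; nra).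
  split; [|lra]. pose proof (cos_taylor y).
  assert (1 - 158/1000 * s ^ 2 <= cos y) by nra.
  assert (P1 : 0 < 1 + r ^ 2) by nra.
  apply (Rmult_lt_reg_r (1 + r ^ 2)); auto. unfold Rdiv. rewrite Rmult_assoc, Rinv_l, Rmult_1_r by lra. fold s.
  nra.
Qed.

(** * Consequences of the pre-Schwarzian bound *)

Section PreSchwarzian.
Variables (A : R) (df ddf : C -> C).
Hypothesis HA : 0 < A.
Hypothesis Bd : forall z, Cmod z < 1 -> Cmod (RtoC (1 - Cmod z ^ 2) * (ddf z / df z) - 2 * Cconj z) <= 2 * A.

(** Multiplied by [z], the bound reads as membership in a disc for [1 + z f'' / f']. *)
Lemma curvature_disc z : Cmod z < 1 ->
  Cmod ((1 + z * ddf z / df z) - RtoC ((1 + Cmod z ^ 2) / (1 - Cmod z ^ 2))) <= 2 * A * Cmod z / (1 - Cmod z ^ 2).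
Proof.
  intros Hz. pose proof (Cmod_ge_0 z). assert (P : 0 < 1 - Cmod z ^ 2) by nra.
  apply (Rmult_le_reg_l (1 - Cmod z ^ 2)); auto.
  replace ((1 - Cmod z ^ 2) * (2 * A * Cmod z / (1 - Cmod z ^ 2))) with (Cmod z * (2 * A)) by (field; lra).
  rewrite <- (Rabs_pos_eq (1 - Cmod z ^ 2)) at 1 by lra. rewrite <- Cmod_R, <- Cmod_mult.
  replace (RtoC (1 - Cmod z ^ 2) * (1 + z * ddf z / df z - RtoC ((1 + Cmod z ^ 2) / (1 - Cmod z ^ 2))))%C
    with (z * (RtoC (1 - Cmod z ^ 2) * (ddf z / df z) - 2 * Cconj z))%C.
  - rewrite Cmod_mult. apply Rmult_le_compat_l; auto.
  - assert (ZZ : (z * Cconj z)%C = RtoC (Cmod z ^ 2)) by apply Cconj_mult_self.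
    replace (RtoC (1 - Cmod z ^ 2) * (1 + z * ddf z / df z - RtoC ((1 + Cmod z ^ 2) / (1 - Cmod z ^ 2))))%C
      with (RtoC (1 - Cmod z ^ 2) * (1 + z * ddf z / df z) - RtoC ((1 - Cmod z ^ 2) * ((1 + Cmod z ^ 2) / (1 - Cmod z ^ 2))))%C
      by (rewrite RtoC_mult; ring).
    replace ((1 - Cmod z ^ 2) * ((1 + Cmod z ^ 2) / (1 - Cmod z ^ 2))) with (1 + Cmod z ^ 2) by (field; lra).
    rewrite RtoC_plus, RtoC_minus, <- ZZ. unfold Cdiv. ring.
Qed.

Lemma curvature_re_pos z : Cmod z < 1 -> 2 * A * Cmod z < 1 + Cmod z ^ 2 -> 0 < Re (1 + z * ddf z / df z).
Proof.
  intros Hz H. pose proof (Cmod_ge_0 z). assert (P : 0 < 1 - Cmod z ^ 2) by nra.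
  pose proof (curvature_disc z Hz) as D.
  set (c := (1 + Cmod z ^ 2) / (1 - Cmod z ^ 2)) in *. set (p := (1 + z * ddf z / df z)%C) in *.
  assert (2 * A * Cmod z / (1 - Cmod z ^ 2) < c).
  { unfold c. apply Rmult_lt_compat_r; auto. now apply Rinv_0_lt_compat. }
  pose proof (re_le (RtoC c - p)). rewrite Cmod_sub_sym in H2.
  replace (Re (c - p)%C) with (c - Re p) in H2 by (unfold Re; simpl; ring). lra.
Qed.

(** Along a ray, [Im (z f'' / f')] is bounded because the correction [2 conj z] turns into a real number. *)
Lemma log_im_bound l : holD 1 l (fun z => ddf z / df z)%C -> l 0%C = 0%C ->
  forall z, Cmod z < 1 -> Rabs (Im (l z)) <= 2 * A * artanh (Cmod z).
Proof.
  intros Hl L0 z Hz. pose proof (Cmod_ge_0 z) as Pz. set (r := Cmod z) in *.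
  assert (K : forall sg, Rabs sg = 1 -> sg * Im (l z) <= 2 * A * artanh r).
  { intros sg Hsg.
    set (g := fun s => 2 * A * artanh (s * r) - sg * Im (l (RtoC s * z)%C)).
    assert (G : g 0 <= g 1).
    { apply (monotone_of_derivative g (fun s => 2 * A * (r * / (1 - (s * r) ^ 2)) - sg * Im (ddf (RtoC s * z) / df (RtoC s * z) * z)%C)); [lra| |].
      - intros s Hs.
        apply (is_derive_minus (V := R_NormedModule) (fun s => 2 * A * artanh (s * r)) (fun s => sg * Im (l (RtoC s * z)%C))).
        + apply (is_derive_scal (fun s => artanh (s * r)) s (2 * A)).
          apply (is_derive_comp artanh (fun s => s * r)); [apply is_derive_artanh; nra|]. auto_derive; auto; ring.
        + apply (is_derive_scal (fun s => Im (l (RtoC s * z)%C)) s sg).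
          apply (rder_ray l _ 1 z s Hl (ray_in_disk 1 z s Hs Hz)).
      - intros s Hs. set (w := (RtoC s * z)%C).
        assert (Mw : Cmod w = s * r) by (unfold w; rewrite Cmod_mult, Cmod_R, Rabs_pos_eq; auto; lra).
        assert (Hw : Cmod w < 1) by (rewrite Mw; nra). pose proof (Bd w Hw) as B. rewrite Mw in B.
        assert (Sr : 0 <= s * r < 1) by nra. assert (P : 0 < 1 - (s * r) ^ 2) by nra.
        set (q := (ddf w / df w)%C) in *.
        assert (E : (1 - (s * r) ^ 2) * Im (q * z)%C = Im (z * (RtoC (1 - (s * r) ^ 2) * q - 2 * Cconj w))%C).
        { replace (z * (RtoC (1 - (s * r) ^ 2) * q - 2 * Cconj w))%C with (RtoC (1 - (s * r) ^ 2) * (q * z) - RtoC (2 * s * Cmod z ^ 2))%C.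
          - unfold Im; simpl; ring.
          - rewrite 2!RtoC_mult, <- Cconj_mult_self. unfold w. rewrite Cmult_conj.
            replace (Cconj (RtoC s)) with (RtoC s) by ceq. ring. }
        assert (Hm : sg * Im (q * z)%C * (1 - (s * r) ^ 2) <= 2 * A * r).
        { replace (sg * Im (q * z)%C * (1 - (s * r) ^ 2)) with (sg * ((1 - (s * r) ^ 2) * Im (q * z)%C)) by ring. rewrite E.
          eapply Rle_trans; [apply Rle_abs|]. rewrite Rabs_mult, Hsg, Rmult_1_l.
          eapply Rle_trans; [apply im_le_Cmod|]. rewrite Cmod_mult. fold r. rewrite Rmult_comm. apply Rmult_le_compat_r; auto. }
        apply (Rmult_le_reg_r (1 - (s * r) ^ 2)); auto. rewrite Rmult_0_l, Rmult_minus_distr_r.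
        replace (2 * A * (r * / (1 - (s * r) ^ 2)) * (1 - (s * r) ^ 2)) with (2 * A * r) by (field; lra). lra. }
    unfold g in G. rewrite Rmult_0_l, Rmult_1_l, artanh_0, Cmult_0_l, Cmult_1_l, L0 in G.
    replace (Im 0) with 0 in G by reflexivity. lra. }
  apply Rabs_le. split.
  - assert (K1 : Rabs (-1) = 1) by (rewrite Rabs_left; lra). apply K in K1. lra.
  - pose proof (K 1 Rabs_R1). lra.
Qed.
End PreSchwarzian.

(** * Hadamard products as means *)

Lemma is_pseries_plim a z l : is_pseries (K := C_AbsRing) (V := C_NormedModule) a z l -> plim a z l.
Proof.
  intros H e He. unfold is_pseries, is_series in H.
  apply (proj1 (filterlim_locally_ball_norm _ _)) with (eps := mkposreal e He) in H.
  destruct H as [N HN]. exists (S N). intros n Hn. destruct n as [|n]; [lia|].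
  specialize (HN n ltac:(lia)).
  assert (E : forall m, sum_n (fun k => scal (pow_n (K := C_AbsRing) z k) (a k) : C_NormedModule) m = psum a (S m) z).
  { assert (P : forall k, pow_n (K := C_AbsRing) z k = (z ^ k)%C).
    { induction k; [reflexivity|]. simpl. rewrite IHk. reflexivity. }
    induction m.
    - rewrite sum_O, P. change (1 * a O = 0 + a O * 1)%C. ring.
    - rewrite sum_Sn, IHm, P. change (psum a (S m) z + (z ^ S m * a (S m)) = psum a (S (S m)) z)%C.
      simpl. ring. }
  rewrite E in HN. apply Rlt_le. exact HN.
Qed.

Lemma psum_shift a n z : psum a (S n) z = (a O + z * psum (fun k => a (S k)) n z)%C.
Proof.
  induction n; [simpl; ring|]. change (psum a (S (S n)) z) with (psum a (S n) z + a (S n) * z ^ S n)%C.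
  rewrite IHn. simpl. ring.
Qed.

Lemma psum_0 a n : psum a (S n) 0 = a O.
Proof. rewrite psum_shift. ring. Qed.

Lemma plim_0 a l : plim a 0 l -> l = a O.
Proof.
  intros H. apply (plim_unique a (RtoC 0)); auto. intros e He. exists 1%nat. intros n Hn.
  destruct n; [lia|]. rewrite psum_0. replace (a O - a O)%C with (RtoC 0) by ring. rewrite Cmod_0. lra.
Qed.

Lemma plim_shift a z l : plim (fun k => a (S k)) z l -> plim a z (a O + z * l)%C.
Proof.
  intros H e He. pose proof (Cmod_ge_0 z). destruct (H (e / (Cmod z + 1))) as [N HN]; [apply Rdiv_lt_0_compat; lra|].
  exists (S N). intros n Hn. destruct n; [lia|]. rewrite psum_shift.
  replace (a O + z * psum (fun k => a (S k)) n z - (a O + z * l))%C with (z * (psum (fun k => a (S k)) n z - l))%C by ring.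
  rewrite Cmod_mult. specialize (HN n ltac:(lia)). pose proof (Cmod_ge_0 (psum (fun k => a (S k)) n z - l)).
  apply Rle_trans with ((Cmod z + 1) * (e / (Cmod z + 1))); [apply Rmult_le_compat; lra|]. right; field; lra.
Qed.

Lemma plim_unshift a (z l : C) : z <> 0%C -> plim a z (a O + z * l)%C -> plim (fun k => a (S k)) z l.
Proof.
  intros Hz H e He. assert (P : 0 < Cmod z) by now apply Cmod_gt_0.
  destruct (H (e * Cmod z)) as [N HN]; [nra|]. exists N. intros n Hn. specialize (HN (S n) ltac:(lia)).
  rewrite psum_shift in HN.
  replace (a O + z * psum (fun k => a (S k)) n z - (a O + z * l))%C with (z * (psum (fun k => a (S k)) n z - l))%C in HN by ring.
  rewrite Cmod_mult in HN. apply (Rmult_le_reg_l (Cmod z)); auto. lra.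
Qed.

Lemma plim_ext a b z l : (forall k, a k = b k) -> plim a z l -> plim b z l.
Proof.
  intros H Ha e He. destruct (Ha e He) as [N HN]. exists N. intros n Hn.
  replace (psum b n z) with (psum a n z); auto. clear - H. induction n; simpl; congruence.
Qed.

Lemma useries_divide_z b phi dphi : useries 1 b phi -> holD 1 phi dphi -> phi 0%C = 0%C ->
  exists p dp, holD 1 p dp /\ useries 1 (fun k => b (S k)) p /\ p 0%C = dphi 0%C /\
  forall z, Cmod z < 1 -> phi z = (z * p z)%C.
Proof.
  intros Hb Hphi Z. assert (Z0 : Cmod 0 < 1) by (rewrite Cmod_0; lra).
  destruct (difference_quotient 1 phi dphi 0%C Hphi Z0) as [p [[dp Hp] [P0 Ep]]].
  assert (E : forall z, Cmod z < 1 -> phi z = (z * p z)%C).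
  { intros z Hz. specialize (Ep z Hz). rewrite Z in Ep. transitivity (phi z - 0)%C; [ring|]. rewrite Ep. ring. }
  assert (B0 : b O = 0%C). { rewrite <- Z. symmetry. apply plim_0. now apply (useries_plim 1). }
  exists p, dp. split; [|split; [|split]]; auto.
  apply plim_useries. intros z Hz. destruct (classic (z = 0%C)) as [->|Nz].
  - rewrite P0. pose proof (useries_derivative _ _ _ _ Hb Hphi) as D.
    rewrite (plim_0 _ _ (useries_plim _ _ _ _ D Z0)).
    intros e He. exists 1%nat. intros n Hn. destruct n; [lia|]. rewrite psum_0. unfold pder.
    replace (b 1%nat - RtoC (INR 1) * b 1%nat)%C with (RtoC 0) by (simpl; ring). rewrite Cmod_0. lra.
  - apply plim_unshift; auto. rewrite B0, Cplus_0_l, <- E by auto. now apply (useries_plim 1).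
Qed.

Lemma useries_euler c G dG : useries 1 c G -> holD 1 G dG ->
  useries 1 (fun k => RtoC (INR k) * c k)%C (fun z => z * dG z)%C.
Proof.
  intros Hc HG. apply plim_useries. intros z Hz.
  pose proof (plim_shift (fun k => RtoC (INR k) * c k)%C z (dG z)) as S. cbv beta in S.
  replace (RtoC (INR 0) * c O + z * dG z)%C with (z * dG z)%C in S by (simpl; ring).
  apply S. apply (useries_plim 1); auto. apply (useries_derivative 1 c G); auto.
Qed.

(** Termwise integration: the factor [conj zeta ^ k] of the [k]-th term of [p] picks the [k]-th
    coefficient of [G]. *)
Lemma hadamard_mean b c p G r s al : useries 1 b p -> useries 1 c G -> 0 <= r < 1 -> 0 <= s < 1 ->
  plim (fun k => b k * c k)%C (RtoC (s * r) * cis al)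
    (cmean (fun t => p (RtoC s * cis al * Cconj (cis t)) * G (circ r t))%C).
Proof.
  intros Hb Hc Hr Hs. set (u := fun t => (RtoC s * cis al * Cconj (cis t))%C).
  assert (Mu : forall t, Cmod (u t) = s).
  { intros t. unfold u. rewrite !Cmod_mult, Cmod_conj, !Cmod_cis, Cmod_R, Rabs_pos_eq; lra. }
  assert (Ru : rcont u) by (apply rcont_mult; [apply rcont_const|apply rcont_conj, rcont_cis]).
  assert (RG : rcont (fun t => G (circ r t))) by now apply (useries_rcont 1 r c).
  assert (Rp : rcont (fun t => p (u t))).
  { apply (rcont_comp p); auto. intros t. apply (useries_ccont 1 b); auto. rewrite Mu; lra. }
  assert (Rs : forall n, rcont (fun t => psum b n (u t))).
  { intros n. apply (rcont_comp (psum b n)); auto. intros t. apply (hol_cont 1); [apply hol_psum|rewrite Mu; lra]. }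
  assert (E : forall n, psum (fun k => b k * c k)%C n (RtoC (s * r) * cis al) =
    cmean (fun t => psum b n (u t) * G (circ r t))%C).
  { induction n.
    - simpl. symmetry. rewrite (cmean_ext _ (fun _ => 0%C)); [apply cmean_const|intros; ring].
    - simpl psum. rewrite IHn.
      rewrite (cmean_ext (fun t => (psum b n (u t) + b n * u t ^ n) * G (circ r t))%C
        (fun t => psum b n (u t) * G (circ r t) + (b n * (RtoC s * cis al) ^ n) * (G (circ r t) * Cconj (cis t) ^ n))%C).
      2:{ intros t. unfold u. rewrite (Cpow_mult_l (RtoC s * cis al)). ring. }
      assert (Rk : rcont (fun t => G (circ r t) * Cconj (cis t) ^ n)%C).
      { apply rcont_mult; auto. apply rcont_pow, rcont_conj, rcont_cis. }
      rewrite cmean_plus, cmean_scal; auto; [|now apply rcont_mult|apply rcont_mult; [apply rcont_const|auto]].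
      rewrite (useries_coef 1 r c G n Hc Hr), RtoC_mult. f_equal.
      rewrite !Cpow_mult_l. ring. }
  destruct (rcont_bounded _ RG) as [M [HM BM]].
  intros e He. destruct (Hb s (proj2 Hs) (e / M)) as [N HN]; [now apply Rdiv_lt_0_compat|].
  exists N. intros n Hn. rewrite E, <- cmean_minus; [|now apply rcont_mult|now apply rcont_mult].
  apply Cmod_cmean_le; [apply rcont_minus; now apply rcont_mult|]. intros t Ht. fold (u t).
  replace (psum b n (u t) * G (circ r t) - p (u t) * G (circ r t))%C with ((psum b n (u t) - p (u t)) * G (circ r t))%C by ring.
  rewrite Cmod_mult. apply Rle_trans with (e / M * M); [|right; field; lra].
  apply Rmult_le_compat; try apply Cmod_ge_0; auto. apply HN; auto. rewrite Mu; lra.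
Qed.

(** * Curvature of the Hadamard product *)

Lemma half_starlike_dilate r1 r0 p dp (u : C) : half_starlike r1 p dp -> 0 < r0 -> Cmod u * r0 <= r1 -> u <> 0%C ->
  half_starlike r0 (fun z => p (u * z)%C) (fun z => dp (u * z) * u)%C.
Proof.
  intros [Hp Hs] H0 Hu Nu. assert (Pu : 0 < Cmod u) by now apply Cmod_gt_0.
  assert (D : forall z, Cmod z < r0 -> Cmod (u * z) < r1).
  { intros z Hz. rewrite Cmod_mult. apply (Rmult_lt_compat_l (Cmod u)) in Hz; auto. lra. }
  split.
  - eapply holD_ext; [reflexivity| |apply (holD_comp r0 r1 p (fun z => u * z)%C dp (fun _ => u)); auto].
    + reflexivity.
    + eapply holD_ext; [reflexivity| |apply (holD_mult r0 (fun _ => u) (fun z => z)); [apply holD_const|apply holD_id]].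
      intros; simpl; ring.
  - intros z Hz. destruct (Hs _ (D z Hz)) as [N P]. split; auto.
    replace (z * (dp (u * z) * u) / p (u * z))%C with (u * z * dp (u * z) / p (u * z))%C; auto. unfold Cdiv; ring.
Qed.

Section HadamardProduct.
Variables (A R2 : R) (df ddf p dp dh ddh : C -> C) (b c : nat -> C).
Hypothesis HA : 1 < A <= 2.
Hypothesis HR : 0 < R2 < rad0 A.
Hypothesis Hxi : xi A R2 = 0.
Hypothesis Hdf : holD 1 df ddf.
Hypothesis Nd : forall z, Cmod z < 1 -> df z <> 0%C.
Hypothesis D0 : df 0%C = 1%C.
Hypothesis Bd : forall z, Cmod z < 1 -> Cmod (RtoC (1 - Cmod z ^ 2) * (ddf z / df z) - 2 * Cconj z) <= 2 * A.
Hypothesis Hc : useries 1 c df.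
Hypothesis Hp : half_starlike 1 p dp.
Hypothesis Hb : useries 1 b p.
Hypothesis Hdh : holD 1 dh ddh.
Hypothesis Hbc : useries 1 (fun k => b k * c k)%C dh.

Let R2_lt_1 : R2 < 1.
Proof. destruct (rad0_eq A) as [K _]; lra. Qed.

(** For [Q = sqrt f'] one has [z Q' / Q = z f'' / (2 f')], so [Re (1 + z f'' / f') > 0] is precisely
    the condition of order one half for [Q]. *)
Lemma sqrt_derivative : exists Q dQ : C -> C, half_starlike R2 Q dQ /\ hol 1 Q /\
  (forall z, Cmod z < 1 -> (Q z * Q z)%C = df z) /\
  (forall z, Cmod z < R2 -> Cmod (Q z) * cos (A * artanh (Cmod z)) <= Re (Q z)).
Proof.
  destruct (logarithm 1 df ddf 0%C Rlt_0_1 Hdf Nd) as [l [Hl [L0 El]]]; [now rewrite cexp_0, D0|].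
  set (Q := fun z => cexp (RtoC (1/2) * l z)).
  assert (HQ : holD 1 Q (fun z => Q z * (RtoC (1/2) * (ddf z / df z)))%C).
  { eapply holD_ext; [reflexivity| |apply holD_cexp, (holD_mult 1 (fun _ => RtoC (1/2)) l); [apply holD_const|exact Hl]].
    intros z _. unfold Q. simpl. ring. }
  exists Q, (fun z => Q z * (RtoC (1/2) * (ddf z / df z)))%C.
  destruct (rad0_eq A) as [K0 K1]; [lra|].
  split; [split; [apply holD_sub with 1; auto; lra|]|split; [now eexists; exact HQ|split]].
  - intros z Hz. assert (NQ : Q z <> 0%C) by apply cexp_neq_0. split; auto.
    replace (z * (Q z * (RtoC (1/2) * (ddf z / df z))) / Q z)%C with (RtoC (1/2) * (1 + z * ddf z / df z) - RtoC (1/2))%C.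
    2:{ assert (df z <> 0%C) by (apply Nd; lra). field. auto. }
    pose proof (Cmod_ge_0 z).
    pose proof (curvature_re_pos A df ddf Bd z) as C0.
    replace (Re (RtoC (1/2) * (1 + z * ddf z / df z) - RtoC (1/2))%C) with (1/2 * Re (1 + z * ddf z / df z)%C - 1/2).
    + assert (0 < Re (1 + z * ddf z / df z)); [|lra]. apply C0; [lra|].
      assert (0 < (1 - rad0 A * Cmod z) * (rad0 A - Cmod z)) by (apply Rmult_lt_0_compat; nra). nra.
    + set (w := (1 + z * ddf z / df z)%C). unfold Re; simpl; ring.
  - intros z Hz. unfold Q. rewrite <- cexp_plus, <- El by auto. f_equal.
    replace (RtoC (1/2) * l z + RtoC (1/2) * l z)%C with (RtoC (1/2 + 1/2) * l z)%C by (rewrite RtoC_plus; ring).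
    replace (1/2 + 1/2) with 1 by lra. ring.
  - intros z Hz. unfold Q. rewrite Re_cexp, Cmod_cexp. apply Rmult_le_compat_l; [apply Rlt_le, exp_pos|].
    replace (Im (RtoC (1/2) * l z)%C) with (1/2 * Im (l z)) by (unfold Im; simpl; ring).
    pose proof (log_im_bound A df ddf Bd l Hl L0 z ltac:(lra)) as I.
    pose proof (Cmod_ge_0 z).
    destruct (radius_inequality A R2 (Cmod z) HA HR Hxi) as [_ Y]; [lra|].
    assert (V : cos (Rabs (1/2 * Im (l z))) = cos (1/2 * Im (l z))).
    { unfold Rabs. destruct Rcase_abs; auto. apply cos_neg. }
    rewrite <- V. rewrite Rabs_mult, (Rabs_pos_eq (1/2)) by lra. pose proof (Rabs_pos (Im (l z))).
    pose proof PI2_3_2. apply cos_decr_1; lra.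
Qed.

(** For [x = 1 + w ddf w / df w] in the disc of centre [m = (1 + r^2)/(1 - r^2)] and radius
    [2 A r / (1 - r^2)], the number [(m - i tau) (x + i tau)] is within
    [|m - i tau| 2 A r / (1 - r^2)] of the positive number [|m + i tau|^2]. *)
Lemma tilted_curvature_re_pos (Q : C -> C) w (tau : R) : Cmod w < R2 -> Q w <> 0%C ->
  Cmod (Q w) * cos (A * artanh (Cmod w)) <= Re (Q w) ->
  let m := (1 + Cmod w ^ 2) / (1 - Cmod w ^ 2) in
  0 < Re ((m, - tau) * (Q w * (1 + w * ddf w / df w + (0, tau)))).
Proof.
  intros Hw NQ HQ m. pose proof (Cmod_ge_0 w) as Pw. set (r := Cmod w) in *.
  assert (PQ : 0 < Cmod (Q w)) by now apply Cmod_gt_0.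
  assert (P1 : 0 < 1 - r ^ 2) by nra.
  destruct (radius_inequality A R2 r HA HR Hxi) as [I _]; [lra|].
  pose proof (curvature_disc A df ddf Bd w ltac:(fold r; lra)) as D. fold r in D. fold m in D.
  set (x := (1 + w * ddf w / df w)%C) in *. set (k := ((m, - tau) : C)).
  assert (Mk : m <= Cmod k) by (eapply Rle_trans; [apply (re_le k)|lra]).
  assert (Pm : 0 < m) by (apply Rdiv_lt_0_compat; nra).
  set (co := cos (A * artanh r)) in *.
  assert (Rad : 2 * A * r / (1 - r ^ 2) < m * co).
  { apply (Rmult_lt_compat_l m) in I; auto. unfold m in *.
    replace ((1 + r ^ 2) / (1 - r ^ 2) * (2 * A * r / (1 + r ^ 2))) with (2 * A * r / (1 - r ^ 2)) in I; auto.
    field. split; apply Rgt_not_eq; nra. }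
  assert (E : (k * (Q w * (x + (0, tau))) = RtoC (Cmod k ^ 2) * Q w + Q w * k * (x - RtoC m))%C).
  { rewrite <- Cconj_mult_self. unfold k. replace (Cconj (m, - tau)) with (RtoC m + (0, tau))%C by ceq. ring. }
  rewrite E, re_plus. replace (Re (RtoC (Cmod k ^ 2) * Q w)%C) with (Cmod k ^ 2 * Re (Q w)) by (unfold Re; simpl; ring).
  pose proof (re_le (- (Q w * k * (x - RtoC m)))) as L. rewrite Cmod_opp, !Cmod_mult in L.
  replace (Re (- (Q w * k * (x - m)))%C) with (- Re (Q w * k * (x - m))%C) in L by reflexivity.
  assert (Pk : 0 < Cmod k) by lra.
  assert (Cmod (Q w) * Cmod k * Cmod (x - m) < Cmod k ^ 2 * Re (Q w)); [|lra].
  apply Rlt_le_trans with (Cmod k ^ 2 * (Cmod (Q w) * co)); [|apply Rmult_le_compat_l; [nra|lra]].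
  replace (Cmod k ^ 2 * (Cmod (Q w) * co)) with (Cmod (Q w) * Cmod k * (Cmod k * co)) by ring.
  apply Rmult_lt_compat_l; [nra|].
  assert (0 < co) by (destruct (Rle_or_lt co 0); auto; assert (0 <= 2 * A * r / (1 + r ^ 2)) by (apply Rmult_le_pos; [nra|apply Rlt_le, Rinv_0_lt_compat; nra]); lra).
  nra.
Qed.

(** Writing [f' = Q Q] turns [h'] and [(1 + i tau) h' + z h''] at [z0] into convolutions of [p] and
    [Q] with weights of positive real part, to which [convolve_nonzero] applies.  The radii satisfy
    [|z0| < rho0 < rho1 < R2], so that all factors are holomorphic beyond the unit circle after
    rescaling. *)
Theorem hadamard_curvature_avoids_axis z0 : 0 < Cmod z0 < R2 ->
  dh z0 <> 0%C /\ forall tau : R, ((1 + (0, tau)) * dh z0 + z0 * ddh z0)%C <> 0%C.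
Proof.
  intros Hz0. destruct sqrt_derivative as [Q [dQ [SQ [hQ [EQ RQ]]]]].
  set (rho0 := (2 * Cmod z0 + R2) / 3). set (rho1 := (Cmod z0 + 2 * R2) / 3).
  assert (H01 : Cmod z0 < rho0 < rho1 /\ rho1 < R2) by (unfold rho0, rho1; lra).
  set (s := Cmod z0 / rho0).
  assert (Hs : 0 < s < 1).
  { unfold s. split; [apply Rdiv_lt_0_compat; lra|]. apply (Rmult_lt_reg_r rho0); [lra|].
    unfold Rdiv. rewrite Rmult_assoc, Rinv_l; lra. }
  assert (Es : s * rho0 = Cmod z0) by (unfold s; field; lra).
  destruct (polar z0 _ eq_refl) as [al [_ Eal]].
  assert (Ez : (RtoC (s * rho0) * cis al)%C = z0) by now rewrite Es.
  set (u := (RtoC s * cis al)%C).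
  assert (Mu : Cmod u = s) by (unfold u; rewrite Cmod_mult, Cmod_cis, Cmod_R, Rabs_pos_eq; lra).
  set (mean := fun G : C -> C => cmean (fun t => p (u * Cconj (cis t)) * G (circ rho0 t))%C).
  assert (Hrho0 : 0 <= rho0 < 1) by (unfold rho0; lra).
  assert (M1 : mean df = dh z0).
  { apply (plim_unique (fun k => b k * c k)%C z0); [|now apply (useries_plim 1); [|lra]].
    rewrite <- Ez at 1. apply (hadamard_mean b c p df); auto; lra. }
  assert (M2 : mean (fun w => w * ddf w)%C = (z0 * ddh z0)%C).
  { apply (plim_unique (fun k => b k * (RtoC (INR k) * c k))%C z0).
    - rewrite <- Ez at 1. apply (hadamard_mean b _ p (fun w => w * ddf w)%C); auto; [|lra].
      now apply useries_euler with df.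
    - apply plim_ext with (fun k => RtoC (INR k) * (b k * c k))%C; [intros; ring|].
      apply (useries_plim 1 _ (fun z => z * ddh z)%C); [|lra]. now apply useries_euler with dh. }
  set (r0 := Rmin (/ s) (R2 / rho1)).
  assert (Hr0 : 1 < r0 /\ s * r0 <= 1 /\ rho1 * r0 <= R2).
  { unfold r0. pose proof (Rmin_l (/ s) (R2 / rho1)) as L. pose proof (Rmin_r (/ s) (R2 / rho1)) as L'.
    split; [apply Rmin_glb_lt|split].
    - rewrite <- Rinv_1. apply Rinv_lt_contravar; lra.
    - apply (Rmult_lt_reg_r rho1); [lra|]. replace (R2 / rho1 * rho1) with R2 by (field; lra). lra.
    - replace 1 with (s * / s) by (field; lra). apply Rmult_le_compat_l; lra.
    - replace R2 with (rho1 * (R2 / rho1)) at 2 by (field; lra). apply Rmult_le_compat_l; lra. }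
  assert (Main : forall F, hol 1 F -> (forall w, Cmod w = rho1 -> 0 < Re (F w)) -> mean (fun w => Q w * F w)%C <> 0%C).
  { intros F hF RF.
    pose proof (half_starlike_dilate 1 r0 p dp u Hp ltac:(lra)) as Sp.
    rewrite Mu in Sp. specialize (Sp (proj1 (proj2 Hr0))).
    assert (Nu : u <> 0%C) by (apply Cneq_mod; lra). specialize (Sp Nu).
    assert (Mr : Cmod (RtoC rho0) = rho0) by (rewrite Cmod_R, Rabs_pos_eq; lra).
    pose proof (half_starlike_dilate R2 r0 Q dQ (RtoC rho0) SQ ltac:(lra)) as Sq.
    rewrite Mr in Sq. specialize (Sq ltac:(nra)).
    assert (Nr : RtoC rho0 <> 0%C) by (apply Cneq_mod; lra). specialize (Sq Nr).
    assert (Hq : 0 < rho0 / rho1 < 1).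
    { split; [apply Rdiv_lt_0_compat; lra|]. apply (Rmult_lt_reg_r rho1); [lra|]. unfold Rdiv. rewrite Rmult_assoc, Rinv_l; lra. }
    assert (Mr1 : forall z, Cmod (RtoC rho1 * z) = rho1 * Cmod z) by (intros z; rewrite Cmod_mult, Cmod_R, Rabs_pos_eq; lra).
    pose proof (convolve_nonzero r0 (rho0 / rho1) _ _ _ _ (proj1 Hr0) Sp Sq Hq (fun z => F (RtoC rho1 * z)%C)) as N.
    intros Z. apply N.
    - apply (hol_comp r0 1 F (fun z => RtoC rho1 * z)%C); auto.
      + intros z Hz. rewrite Mr1. apply (Rmult_lt_compat_l rho1) in Hz; lra.
      + apply hol_mult; [apply hol_const|apply hol_id].
    - intros z Hz. apply RF. rewrite Mr1, Hz. ring.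
    - rewrite <- Z. unfold convolve, mean. apply cmean_ext. intros t. unfold circ.
      replace (RtoC rho1 * (RtoC (rho0 / rho1) * cis t))%C with (RtoC rho0 * cis t)%C; [ring|].
      replace rho0 with (rho1 * (rho0 / rho1)) at 1 by (field; lra). rewrite RtoC_mult. ring. }
  assert (CI : forall t, Cmod (circ rho0 t) < 1) by (intros t; rewrite Cmod_circ; lra).
  assert (Wr : forall w, Cmod w = rho1 -> 0 < Cmod (Q w) /\ Q w <> 0%C /\ Cmod w < R2).
  { intros w Hw. destruct (proj2 SQ w) as [N _]; [lra|]. repeat split; auto; [now apply Cmod_gt_0|lra]. }
  split.
  - rewrite <- M1. intros Z. apply (Main Q hQ).
    + intros w Hw. destruct (Wr w Hw) as [P [N L]]. specialize (RQ w L).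
      destruct (radius_inequality A R2 (Cmod w) HA HR Hxi) as [_ Y]; [lra|].
      pose proof PI2_3_2. assert (0 < cos (A * artanh (Cmod w))) by (apply cos_gt_0; lra). nra.
    + rewrite <- Z. apply cmean_ext. intros t. now rewrite EQ.
  - intros tau Z.
    set (m := (1 + rho1 ^ 2) / (1 - rho1 ^ 2)). set (k := ((m, - tau) : C)).
    assert (hddf : hol 1 ddf) by now apply hol_derivative with df.
    assert (hdf : hol 1 df) by now exists ddf.
    apply (Main (fun w => k * (Q w * (1 + w * ddf w / df w + (0, tau))))%C).
    + apply hol_mult; [apply hol_const|]. apply hol_mult; auto. apply hol_plus; [|apply hol_const].
      apply hol_plus; [apply hol_const|]. apply hol_div; auto. apply hol_mult; auto. apply hol_id.
    + intros w Hw. destruct (Wr w Hw) as [P [N L]].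
      pose proof (tilted_curvature_re_pos Q w tau L N (RQ w L)) as T. cbv zeta in T. now rewrite Hw in T.
    + assert (Rp : rcont (fun t => p (u * Cconj (cis t)))%C).
      { apply (rcont_comp p (fun t => u * Cconj (cis t))%C).
        - intros t. apply (holD_cont 1 p dp); [apply Hp|]. rewrite Cmod_mult, Cmod_conj, Cmod_cis, Mu; lra.
        - apply rcont_mult; [apply rcont_const|apply rcont_conj, rcont_cis]. }
      assert (Rm : forall G, hol 1 G -> rcont (fun t => p (u * Cconj (cis t)) * G (circ rho0 t))%C).
      { intros G hG. apply rcont_mult; auto. now apply (hol_rcont_circ 1). }
      assert (hz : hol 1 (fun w => w * ddf w)%C) by (apply hol_mult; auto; apply hol_id).
      transitivity (k * ((1 + (0, tau)) * mean df + mean (fun w => w * ddf w)))%C.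
      * unfold mean. rewrite <- (cmean_scal (1 + (0, tau))%C) by (apply Rm; auto).
        rewrite <- cmean_plus; [|apply rcont_mult; [apply rcont_const|exact (Rm _ hdf)]|exact (Rm _ hz)].
        rewrite <- cmean_scal.
        2:{ apply rcont_plus; [apply rcont_mult; [apply rcont_const|exact (Rm _ hdf)]|exact (Rm _ hz)]. }
        apply cmean_ext. intros t. set (w := circ rho0 t). set (pt := p (u * Cconj (cis t))).
        assert (N : df w <> 0%C) by (apply Nd, CI).
        replace (Q w * (k * (Q w * (1 + w * ddf w / df w + (0, tau)))))%C with (k * ((Q w * Q w) * (1 + w * ddf w / df w + (0, tau))))%C by ring.
        rewrite EQ by apply CI. field. exact N.
      * rewrite M1, M2, Z. ring.
Qed.

(** The curvature is [1] at the centre and continuous along rays, so it cannot leave the right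
    half-plane without meeting the imaginary axis. *)
Theorem hadamard_curvature : b O = 1%C -> forall z, Cmod z < R2 ->
  dh z <> 0%C /\ 0 < Re (1 + z * ddh z / dh z).
Proof.
  intros B0. assert (Z0 : Cmod 0 < 1) by (rewrite Cmod_0; lra).
  assert (C0 : c O = 1%C) by (rewrite <- D0; symmetry; apply plim_0; now apply (useries_plim 1)).
  assert (N : forall z, Cmod z < R2 -> dh z <> 0%C).
  { intros z Hz. destruct (classic (z = 0%C)) as [->|Nz].
    - rewrite (plim_0 _ _ (useries_plim _ _ _ _ Hbc Z0)), B0, C0. intros K.
      replace (1 * 1)%C with (RtoC 1) in K by ring. apply RtoC_inj in K. lra.
    - apply hadamard_curvature_avoids_axis. split; auto. now apply Cmod_gt_0. }
  intros z Hz. split; [now apply N|].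
  set (P := fun w => (1 + w * ddh w / dh w)%C).
  assert (hP : hol R2 P).
  { assert (hol 1 dh) by (now exists ddh). assert (hol 1 ddh) by now apply hol_derivative with dh.
    unfold P. apply hol_plus; [apply hol_const|]. apply hol_div; auto.
    - apply hol_mult; [apply hol_id|]. apply hol_sub with 1; auto; lra.
    - apply hol_sub with 1; auto; lra. }
  destruct hP as [dP hP].
  pose proof (path_IVT (fun s => Re (P (RtoC s * z)%C))) as V. cbv beta in V.
  rewrite Cmult_0_l, Cmult_1_l in V. apply V.
  - intros s Hs. apply continuity_pt_filterlim. apply (clim_re (locally s) (fun s => P (RtoC s * z)%C)).
    apply (rder_rcont_at (fun s => P (RtoC s * z)%C) s (dP (RtoC s * z) * z)%C).
    apply (rder_ray P dP R2); auto. now apply ray_in_disk.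
  - intros s Hs K. set (w := (RtoC s * z)%C) in *.
    assert (Hw : Cmod w < R2) by now apply ray_in_disk.
    destruct (classic (w = 0%C)) as [E|Nw].
    + rewrite E in K. unfold P in K. replace (1 + 0 * ddh 0%C / dh 0%C)%C with (RtoC 1) in K by (unfold Cdiv; ring).
      rewrite re_RtoC in K. lra.
    + destruct (hadamard_curvature_avoids_axis w) as [_ T]; [split; auto; now apply Cmod_gt_0|].
      apply (T (- Im (P w))).
      assert (E : (P w + (0, (- Im (P w))%R))%C = 0%C).
      { apply C_ext; [rewrite re_plus, K|]; unfold Re, Im; simpl; ring. }
      transitivity (dh w * (P w + (0, (- Im (P w))%R)))%C; [|rewrite E; ring].
      set (y := ((0, (- Im (P w))%R) : C)). unfold P. field. now apply N.
  - unfold P. replace (1 + 0 * ddh 0%C / dh 0%C)%C with (RtoC 1) by (unfold Cdiv; ring). rewrite re_RtoC. lra.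
Qed.
End HadamardProduct.

(** * The radius of convexity *)

Lemma power_series_useries a f : power_series_on_disk a f -> useries 1 a f.
Proof. intros H. apply plim_useries. intros z Hz. apply is_pseries_plim, H, Hz. Qed.

(** With [phi = z p], [z phi' / phi = 1 + z p' / p]. *)
Lemma starlike_half_quotient b phi : useries 1 b phi -> starlike_half phi ->
  exists p dp, half_starlike 1 p dp /\ useries 1 (fun k => b (S k)) p /\ b 1%nat = 1%C.
Proof.
  intros Hb [[_ [P0 D0]] Hs]. destruct (useries_hol _ _ _ Hb) as [dphi Hphi].
  assert (Z0 : Cmod 0 < 1) by (rewrite Cmod_0; lra).
  assert (D0' : dphi 0%C = 1%C) by (rewrite <- D0; symmetry; apply C_derive_cder, Hphi, Z0).
  destruct (useries_divide_z b phi dphi Hb Hphi P0) as [p [dp [Hp [Hbp [p0 E]]]]].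
  exists p, dp. split; [split; auto|split; auto].
  - intros z Hz. destruct (classic (z = 0%C)) as [->|Nz].
    + rewrite p0, D0'. split; [intros K; apply RtoC_inj in K; lra|].
      replace (0 * dp 0%C / 1)%C with (RtoC 0) by (unfold Cdiv; ring). rewrite re_RtoC. lra.
    + destruct (Hs z Hz Nz) as [N P]. rewrite E in N by auto.
      assert (Np : p z <> 0%C) by (intros K; apply N; rewrite K; ring). split; auto.
      assert (Dz : C_derive phi z = (1 * p z + z * dp z)%C).
      { apply C_derive_cder. apply cder_ext_loc with (fun w => w * p w)%C.
        - destruct (disk_open 1 z Hz) as [d [Hd K]]. exists d. split; auto. intros w Hw. symmetry. apply E, K, Hw.
        - apply (cder_mult (fun w => w) p); [apply cder_id|now apply Hp]. }
      rewrite Dz, E in P by auto.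
      replace (z * (1 * p z + z * dp z) / (z * p z))%C with (RtoC 1 + z * dp z / p z)%C in P by (field; auto).
      rewrite re_plus, re_RtoC in P. lra.
  - rewrite <- D0', <- p0. symmetry. apply (plim_0 (fun k => b (S k))). now apply (useries_plim 1).
Qed.

Theorem convolution_convex A R2 h : 1 < A <= 2 -> 0 < R2 < rad0 A -> xi A R2 = 0 ->
  convolution_class (concave_class A) starlike_half h -> convex_in_disk R2 h.
Proof.
  intros HA HR Hxi [f [phi [[[[_ [F0 DF0]] Inj] [Hi [Hcv HO]]] [Hphi [a [b [Ha [Hb Hab]]]]]]]].
  apply power_series_useries in Ha, Hb, Hab.
  assert (Z0 : Cmod 0 < 1) by (rewrite Cmod_0; lra).
  destruct (useries_hol _ _ _ Ha) as [df Hf]. destruct (hol_derivative _ _ _ Hf) as [ddf Hdf].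
  assert (D0 : df 0%C = 1%C) by (rewrite <- DF0; symmetry; apply C_derive_cder, Hf, Z0).
  assert (Bd := concave_pre_schwarzian f df ddf Hf Hdf Inj F0 D0 A HA Hi Hcv HO).
  assert (Nd : forall z, Cmod z < 1 -> df z <> 0%C) by (intros z Hz; now apply (univalent_derivative f df Hf Inj)).
  destruct (starlike_half_quotient b phi Hb Hphi) as [p [dp [Hp [Hbp B1]]]].
  destruct (useries_hol _ _ _ Hab) as [dh Hh]. destruct (hol_derivative _ _ _ Hh) as [ddh Hdh].
  assert (Hpd : useries 1 (fun k => b (S k) * pder a k)%C dh).
  { apply plim_useries. intros z Hz. apply plim_ext with (pder (fun k => a k * b k)%C).
    - intros k. unfold pder. ring.
    - apply (useries_plim 1); auto. now apply (useries_derivative 1 _ h). }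
  assert (Cv := hadamard_curvature A R2 df ddf p dp dh ddh (fun k => b (S k)) (pder a) HA HR Hxi Hdf Nd D0 Bd
    (useries_derivative _ _ _ _ Ha Hf) Hp Hbp Hdh Hpd B1).
  assert (R1 : R2 <= 1) by (destruct (rad0_eq A) as [K _]; lra).
  apply (holD_sub 1 R2) in Hh, Hdh; auto.
  split; [|split].
  - intros z Hz. exists (dh z). apply is_derive_cder, Hh, Hz.
  - apply (convex_injective R2 h dh ddh); auto; intros z Hz; now apply Cv.
  - apply (convex_image R2 h dh ddh); auto; intros z Hz; now apply Cv.
Qed.

(** Convexity passes to increasing unions of discs, so the supremum of the admissible radii is
    itself admissible. *)
Lemma radius_of_convexity_exists F r0 : convexity_holds_at F r0 ->
  exists rho, is_radius_of_convexity F rho /\ r0 <= rho.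
Proof.
  intros H0. destruct (completeness (convexity_holds_at F)) as [rho [Ub Lb]].
  - exists 1. intros r [Hr _]. lra.
  - now exists r0.
  - assert (L0 : r0 <= rho) by now apply Ub.
    assert (App : forall x, x < rho -> exists r, x < r /\ r <= rho /\ convexity_holds_at F r).
    { intros x Hx. apply NNPP. intros N. assert (rho <= x); [|lra]. apply Lb. intros r Hr.
      destruct (Rle_or_lt r x); auto. exfalso. apply N. exists r. split; [auto|split; [now apply Ub|auto]]. }
    exists rho. split; auto. split; [|intros r Hr; now apply Ub]. split.
    + split; [destruct H0; lra|]. apply Lb. intros r [Hr _]. lra.
    + intros f Hf. split; [|split].
      * intros z Hz. destruct (App _ Hz) as [r [Hr [_ [_ Cr]]]]. now apply (Cr f Hf).
      * intros z1 z2 H1 H2 E. destruct (App (Rmax (Cmod z1) (Cmod z2))) as [r [Hr [_ [_ Cr]]]]; [now apply Rmax_lub_lt|].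
        pose proof (Rmax_l (Cmod z1) (Cmod z2)). pose proof (Rmax_r (Cmod z1) (Cmod z2)).
        apply (Cr f Hf); auto; unfold disk; lra.
      * intros w1 w2 t [z1 [H1 E1]] [z2 [H2 E2]] Ht.
        destruct (App (Rmax (Cmod z1) (Cmod z2))) as [r [Hr [Hr' [_ Cr]]]]; [now apply Rmax_lub_lt|].
        pose proof (Rmax_l (Cmod z1) (Cmod z2)). pose proof (Rmax_r (Cmod z1) (Cmod z2)).
        destruct (Cr f Hf) as [_ [_ K]]. destruct (K w1 w2 t) as [z [Hz Ez]]; auto.
        -- exists z1. split; auto. unfold disk; lra.
        -- exists z2. split; auto. unfold disk; lra.
        -- exists z. split; auto. unfold disk in *; lra.
Qed.

Theorem theorem1 (A : R) (hA : 1 < A <= 2) (R2 : R)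
  (hR2 : 0 < R2 < rad0 A)
  (hroot : xi A R2 = 0)
  (hleast : forall r : R, 0 < r < rad0 A -> xi A r = 0 -> R2 <= r) :
  exists rho : R,
    is_radius_of_convexity
      (convolution_class (concave_class A) starlike_half) rho /\
    R2 <= rho.
Proof.
  apply radius_of_convexity_exists. split.
  - destruct (rad0_eq A) as [K _]; lra.
  - intros h Hh. now apply (convolution_convex A).
Qed.
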